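(* Let $M$ be a Riemann surface, let $\varphi:M\to\mathrm U(n)$ be a harmonic map, and let $\Pi:\widetilde M\to M$ be a simply connected covering space of $M$ (with holomorphic projection $\Pi$). Then the following are equivalent: (i) $\varphi$ is of finite uniton number; (ii) $\varphi|_U$ is of finite uniton number for some open set $U$ of $M$; (iii) $\varphi\circ\Pi:\widetilde M\to\mathrm U(n)$ is of finite uniton number.
   Context: Riemann surfaces are connected, as usual, and open sets $U$ are understood to be non-empty; $z$ is a local complex coordinate. A smooth map $\varphi:M\to\mathrm U(n)$ is harmonic iff, with $A^\varphi_z=\frac12\varphi^{-1}\partial_z\varphi$, $A^\varphi_{\bar z}=\frac12\varphi^{-1}\partial_{\bar z}\varphi$, one has $\partial_{\bar z}A^\varphi_z+\partial_zA^\varphi_{\bar z}=0$. An extended solution associated to $\varphi$ is a smooth $\Phi:S^1\times M\to\mathrm U(n)$ with $\Phi(1,\cdot)=I$ and $\Phi^{-1}d\Phi=(1-\lambda^{-1})A^\varphi_z\,dz+(1-\lambda)A^\varphi_{\bar z}\,d\bar z$. A harmonic map $\varphi:M\to\mathrm U(n)$ is of finite uniton number if there exists an extended solution associated to $\varphi$ which is defined on the whole of its domain $M$ and is a trigonometric polynomial in $\lambda\in S^1$: $\Phi_0(\lambda,z)=\sum_{k=-r}^sC_k(z)\lambda^k$ with $r,s\in\mathbb N$ and $C_k:M\to\mathfrak{gl}(n,\mathbb C)$ smooth. *)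

(* Defs.v *)
From mathcomp Require Import all_boot all_order all_algebra.
From mathcomp Require Import all_classical all_reals all_analysis.
From mathcomp Require Import complex.

Set Implicit Arguments.
Unset Strict Implicit.
Unset Printing Implicit Defensive.

Import Order.TTheory GRing.Theory Num.Theory numFieldNormedType.Exports.

Local Open Scope classical_set_scope.
Local Open Scope ring_scope.
Local Open Scope complex_scope.

(* R[i] with the topology of its norm; over itself it is a normed module, so
   [derivable f w 1] for f : Cplane R -> Cplane R is complex
   differentiability of f at w. *)
Notation Cplane R := (R[i]^o).

(** * Calculus in the plane *)

(* R[i] is not a normed module over R in the library: real derivatives are
   taken through the identification R * R = R[i]. *)
Definition of_plane {R : realType} (p : R * R) : Cplane R := p.1 +i* p.2.
Definition to_plane {R : realType} (w : Cplane R) : R * R :=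
  (complex.Re w, complex.Im w).

(* C^oo on an open set A of a finite-dimensional space V: all iterated
   directional derivatives exist and are continuous on A.  ['D_v] is total,
   and its value at a point of A depends only on the function near that point,
   so the values outside A are irrelevant. *)
Definition smooth_on {R : realType} {V : normedModType R}
    (A : set V) (f : V -> R) : Prop :=
  forall (vs : seq V) (x : V), A x ->
    let g := foldr (fun v (h : V -> R) => (fun y : V => 'D_v h y)) f vs in
    {for x, continuous g} /\ forall v : V, derivable g x v.

Definition smooth_mx_on {R : realType} {V : normedModType R} {n : nat}
    (A : set V) (f : V -> 'M[R[i]]_n) : Prop :=
  forall i j : 'I_n,
    smooth_on A (fun x => complex.Re (f x i j)) /\
    smooth_on A (fun x => complex.Im (f x i j)).

Definition partial_v {R : realType} (v : R * R) (f : Cplane R -> R[i])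
    (w : Cplane R) : R[i] :=
  'D_v (fun p : R * R => complex.Re (f (of_plane p))) (to_plane w) +i*
  'D_v (fun p : R * R => complex.Im (f (of_plane p))) (to_plane w).

(* Entrywise d/dz = (d/dx - i d/dy)/2 and d/dzbar = (d/dx + i d/dy)/2. *)
Definition dz {R : realType} {n : nat} (f : Cplane R -> 'M[R[i]]_n)
    (w : Cplane R) : 'M[R[i]]_n :=
  \matrix_(i, j) (2^-1 * (
    partial_v (1, 0) (fun w' => f w' i j) w
    - (0 +i* 1) * partial_v (0, 1) (fun w' => f w' i j) w)).
Definition dzbar {R : realType} {n : nat} (f : Cplane R -> 'M[R[i]]_n)
    (w : Cplane R) : 'M[R[i]]_n :=
  \matrix_(i, j) (2^-1 * (
    partial_v (1, 0) (fun w' => f w' i j) w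
    + (0 +i* 1) * partial_v (0, 1) (fun w' => f w' i j) w)).

(** * Riemann surfaces *)

(* [chart_param] is the inverse of [chart_coord] on the image of [chart_dom];
   outside these sets both functions are arbitrary. *)
Record chart (R : realType) (M : topologicalType) := Chart {
  chart_dom : set M ;
  chart_coord : M -> Cplane R ;
  chart_param : Cplane R -> M ;
  chart_dom_open : open chart_dom ;
  chart_codom_open : open (chart_coord @` chart_dom) ;
  chart_coordK : forall x, chart_dom x -> chart_param (chart_coord x) = x ;
  chart_coord_continuous : {within chart_dom, continuous chart_coord} ;
  chart_param_continuous :
    {within chart_coord @` chart_dom, continuous chart_param}
}.

(* Second countability is not required: it is automatic (Rado). *)
Record riemannSurface (R : realType) := RiemannSurface {
  carrier :> topologicalType ;
  surface_hausdorff : hausdorff_space carrier ;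
  surface_nonempty : [set: carrier] !=set0 ;
  surface_connected : connected [set: carrier] ;
  atlas : set (chart R carrier) ;
  atlas_cover : forall x : carrier, exists2 c, atlas c & chart_dom c x ;
  atlas_holomorphic : forall c d, atlas c -> atlas d ->
    forall x, chart_dom c x -> chart_dom d x ->
      derivable (chart_coord d \o chart_param c : Cplane R -> Cplane R)
        (chart_coord c x) 1
}.

Definition holomorphic_map {R : realType} {M N : riemannSurface R}
    (f : M -> N) : Prop :=
  continuous f /\
  forall (c : chart R M) (d : chart R N), atlas c -> atlas d ->
    forall x : M, chart_dom c x -> chart_dom d (f x) ->
      derivable (chart_coord d \o f \o chart_param c : Cplane R -> Cplane R)
        (chart_coord c x) 1.

(** * Coverings and simple connectedness *)

Definition evenly_covered {E B : topologicalType} (p : E -> B) (V : set B)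
    : Prop :=
  exists sheets : set (set E),
    [/\ forall S, sheets S -> open S,
        trivIset sheets id,
        p @^-1` V = \bigcup_(S in sheets) S
      & forall S, sheets S -> exists s : B -> E,
          [/\ {within V, continuous s},
              forall b, V b -> S (s b) /\ p (s b) = b
            & forall e, S e -> s (p e) = e]].

Definition covering_map {E B : topologicalType} (p : E -> B) : Prop :=
  [/\ continuous p,
      forall b, exists e, p e = b
    & forall b, exists V : set B, [/\ open V, V b & evenly_covered p V]].

Definition path_connected (R : realType) (T : topologicalType) : Prop :=
  forall x y : T, exists g : R -> T,
    [/\ {within `[0, 1]%classic, continuous g}, g 0 = x & g 1 = y].

Definition simply_connected (R : realType) (T : topologicalType) : Prop :=
  path_connected R T /\
  forall g : R -> T, {within `[0, 1]%classic, continuous g} -> g 0 = g 1 ->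
    exists H : R * R -> T,
      [/\ {within `[0, 1]%classic `*` `[0, 1]%classic, continuous H},
          forall t, `[0, 1]%classic t -> H (0, t) = g t,
          forall t, `[0, 1]%classic t -> H (1, t) = g 0
        & forall s, `[0, 1]%classic s -> H (s, 0) = g 0 /\ H (s, 1) = g 0].

(** * Harmonic maps, extended solutions and finite uniton number *)

(* Everything is stated over an open subset U of M; only the values of the
   maps on U matter.  U = setT gives the notions on M itself, and the notion
   over U for a map on M is the notion for its restriction to U.  The charts
   of the atlas are used as local coordinates z. *)

Definition smooth_map_on {R : realType} {M : riemannSurface R} {n : nat}
    (U : set M) (f : M -> 'M[R[i]]_n) : Prop :=
  forall c : chart R M, atlas c ->
    smooth_mx_on
      [set p : R * R | (chart_coord c @` (chart_dom c `&` U)) (of_plane p)]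
      (fun p => f (chart_param c (of_plane p))).

Definition Az {R : realType} {n : nat} (f : Cplane R -> 'M[R[i]]_n)
    (w : Cplane R) : 'M[R[i]]_n := 2^-1 *: (invmx (f w) *m dz f w).
Definition Azbar {R : realType} {n : nat} (f : Cplane R -> 'M[R[i]]_n)
    (w : Cplane R) : 'M[R[i]]_n := 2^-1 *: (invmx (f w) *m dzbar f w).

Definition harmonic_on {R : realType} {M : riemannSurface R} {n : nat}
    (U : set M) (phi : M -> 'M[R[i]]_n) : Prop :=
  [/\ forall x, U x -> phi x \is unitarymx,
      smooth_map_on U phi
    & forall (c : chart R M) (x : M), atlas c -> chart_dom c x -> U x ->
        dzbar (Az (phi \o chart_param c)) (chart_coord c x)
        + dz (Azbar (phi \o chart_param c)) (chart_coord c x) = 0].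

Definition circle (R : realType) : set R[i] := [set l | `|l| = 1].

(* The first argument of Phi is the parameter on the circle.  Smoothness on
   circle x U is tested in the coordinates (t, z) with lambda = exp (i t), and
   the equation
     Phi^-1 dPhi = (1 - lambda^-1) A_z dz + (1 - lambda) A_zbar dzbar
   is written on the components along dz and dzbar. *)
Definition extended_solution_on {R : realType} {M : riemannSurface R} {n : nat}
    (U : set M) (phi : M -> 'M[R[i]]_n) (Phi : R[i] -> M -> 'M[R[i]]_n)
    : Prop :=
  [/\ forall l x, circle l -> U x -> Phi l x \is unitarymx,
      forall c : chart R M, atlas c ->
        smooth_mx_on
          [set q : R * (R * R) |
             (chart_coord c @` (chart_dom c `&` U)) (of_plane q.2)]
          (fun q => Phi (cos q.1 +i* sin q.1) (chart_param c (of_plane q.2))),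
      forall x, U x -> Phi 1 x = 1%:M
    & forall (c : chart R M) (l : R[i]) (x : M),
        atlas c -> circle l -> chart_dom c x -> U x ->
        let F := Phi l \o chart_param c in
        let f := phi \o chart_param c in
        let w := chart_coord c x in
        invmx (F w) *m dz F w = (1 - l^-1) *: Az f w /\
        invmx (F w) *m dzbar F w = (1 - l) *: Azbar f w].

(* The summation index k < r + s + 1 stands for the exponent k - r. *)
Definition finite_uniton_number_on {R : realType} {M : riemannSurface R}
    {n : nat} (U : set M) (phi : M -> 'M[R[i]]_n) : Prop :=
  harmonic_on U phi /\
  exists2 Phi : R[i] -> M -> 'M[R[i]]_n, extended_solution_on U phi Phi &
  exists (r s : nat) (C : int -> M -> 'M[R[i]]_n),
    (forall k : int, - r%:Z <= k <= s%:Z -> smooth_map_on U (C k)) /\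
    forall l x, circle l -> U x ->
      Phi l x = \sum_(k < (r + s).+1) l ^ (k%:Z - r%:Z) *: C (k%:Z - r%:Z) x.

(* Main.v *)
From HB Require Import structures.
Require Import Defs.
From mathcomp Require Import all_boot all_order all_algebra.
From mathcomp Require Import all_classical all_reals all_analysis.
From mathcomp Require Import complex ring lra.

Set Implicit Arguments.
Unset Strict Implicit.
Unset Printing Implicit Defensive.

Import Order.TTheory GRing.Theory Num.Theory numFieldNormedType.Exports.

Local Open Scope classical_set_scope.
Local Open Scope ring_scope.
Local Open Scope complex_scope.

(** Let [A] and [B] be the components of [phi^-1 dphi / 2] along [dz] and [dzbar].
    After multiplication by a power of lambda, a polynomial extended solution is
    [sum_(k <= d) lambda^k C_k], and comparing coefficients of lambda turns its
    equation into
      [dz C_k = (C_k - C_(k+1)) A],   [dzbar C_k = (C_k - C_(k-1)) B],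
    where [C_(-1) = C_(d+1) = 0] ([psol]; [finite_uniton_wsol] and
    [wsol_finite_uniton] go back and forth).  Solutions can be pulled back along
    holomorphic maps, because [A dz] and [B dzbar] are.

    The heart of the matter is that the existence of a solution near one point
    implies existence everywhere ([finite_uniton_global]).  Two things are needed.

    Extension ([psol_extend]): a solution on a small disc extends to every
    concentric disc inside a chart.  Along the radii the equations are linear
    ordinary differential equations for [C_0, ..., C_d], which can be solved up
    to the boundary ([radial_transport]).  That the result solves the full system
    is not automatic, since the truncated connection has curvature; but the
    curvature only involves [C_0 A] and [C_d B].  These two functions satisfy a
    perturbed dbar-equation and its conjugate, the remaining errors satisfy a
    radial equation, and all of them vanish on the small disc.  A Carleman
    estimate ([strip_unique_continuation]) shows that they vanish on the large
    one.  Consequently the set of points near which a solution of degree [d]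
    exists is open and closed.

    Uniqueness: a solution is determined up to a loop that is constant on the
    surface, so local solutions need not fit together around closed paths.  They
    do once they are normalized so that no constant row annihilates [C_0]: such
    solutions exist ([type_one_exists]) by splitting off lines, which lowers the
    weighted sum of the squares of the coefficients by one each time, and they
    are unique ([type_one_unique]).  Picking the normalized solution at each
    point gives a global one ([wsol_global]).

    It remains to compare a surface with its covering.  Upwards one pulls back
    along the projection ([finite_uniton_pull]).  Downwards one pulls back along
    a local section, near a point where the derivative of the projection is not
    zero ([finite_uniton_push]), which gives a solution on an open set.  Since
    holomorphic maps are only assumed to be complex differentiable at each point,
    their smoothness is derived from Goursat's theorem and Cauchy's formula
    ([holomorphic_smooth]). *)

(** * Smooth real functions *)

(** Finite-order smoothness: [smooth_on] quantifies over lists of directions,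
    whereas closure properties are proved by induction on the order. *)
Fixpoint Ck {R : realType} {V : normedModType R} (k : nat) (A : set V)
    (f : V -> R) : Prop :=
  match k with
  | 0%N => forall x, A x -> {for x, continuous f}
  | k'.+1 => (forall x, A x ->
                {for x, continuous f} /\ forall v, derivable f x v) /\
             forall v, Ck k' A ('D_v f)
  end.

Section Smooth.
Context {R : realType} {V : normedModType R}.
Implicit Types (A B : set V) (f g : V -> R).

Lemma smooth_onP A f : smooth_on A f <-> forall k, Ck k A f.
Proof.
split=> [sf k|Cf vs x Ax].
  rewrite -[f]/(foldr (fun v (h : V -> R) => (fun y : V => 'D_v h y)) f [::]).
  elim: k [::] => [|k IH] vs /=; first by move=> x /(sf vs)[].
  by split=> [x /(sf vs)//|v]; have := IH (v :: vs).
have H : forall vs k, Ck (k + size vs) A f ->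
    Ck k A (foldr (fun v (h : V -> R) => (fun y : V => 'D_v h y)) f vs).
  elim=> [|v ws IH] k /=; first by rewrite addn0.
  by rewrite addnS -addSn => /IH[_ /(_ v)].
by have /(_ (Cf _))[/(_ x Ax)] := H vs 1%N.
Qed.

Lemma CkS k A f : Ck k.+1 A f -> Ck k A f.
Proof.
elim: k f => [|k IH] f /=; first by move=> [H _] x /H[].
by move=> [H1 H2]; split=> // v; apply: IH; exact: H2.
Qed.

Lemma Ck_cont k A f x : Ck k A f -> A x -> {for x, continuous f}.
Proof. by elim: k f => [|k IH] f /=; [move=> H /H | move=> [H _] /H[]]. Qed.

Lemma open_near A x : open A -> A x -> \forall y \near x, A y.
Proof. by move=> oA Ax; exact: open_nbhs_nbhs. Qed.

Lemma near_continuous f g x :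
  (\near x, f x = g x) -> {for x, continuous f} -> {for x, continuous g}.
Proof.
move=> fg cf; have H : g @ x --> f x.
  by apply: cvg_trans cf; apply: near_eq_cvg; apply: filterS fg.
by have e : f x = g x := nbhs_singleton fg; rewrite e in H.
Qed.

Lemma Ck_ext k A f g : open A -> (forall x, A x -> f x = g x) ->
  Ck k A f -> Ck k A g.
Proof.
move=> oA; elim: k f g => [|k IH] f g fg /=.
  move=> cf x Ax; apply: near_continuous (cf x Ax).
  by apply: filterS (open_near oA Ax) => y /fg.
have nfg x : A x -> \near x, f x = g x.
  by move=> Ax; apply: filterS (open_near oA Ax) => y /fg.
move=> [H1 H2]; split=> [x Ax|v].
  have [cf df] := H1 x Ax; split; first exact: (near_continuous (nfg x Ax) cf).
  by move=> v; exact: (near_eq_derivable (nfg x Ax) (df v)).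
apply: IH (H2 v) => x Ax; exact: (near_eq_derive _ (nfg x Ax)).
Qed.

Lemma Ck_cst k A (c : R) : Ck k A (fun=> c).
Proof.
elim: k c => [|k IH] c /=; first by move=> x _; exact: cvg_cst.
split=> [x _|v]; first by split=> [|v]; [exact: cvg_cst|exact: derivable_cst].
rewrite (_ : 'D_v _ = fun=> 0); first exact: IH.
by apply/funext => x; exact: derive_cst.
Qed.

Lemma CkD k A f g : open A -> Ck k A f -> Ck k A g ->
  Ck k A (fun x => f x + g x).
Proof.
move=> oA; elim: k f g => [|k IH] f g /=.
  by move=> cf cg x Ax; apply: continuousD; [exact: cf|exact: cg].
move=> [f1 f2] [g1 g2]; split=> [x Ax|v].
  have [cf df] := f1 x Ax; have [cg dg] := g1 x Ax; split.
    exact: continuousD.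
  by move=> v; exact: derivableD.
apply: Ck_ext (IH _ _ (f2 v) (g2 v)) => // x Ax.
have [_ /(_ v) df] := f1 x Ax; have [_ /(_ v) dg] := g1 x Ax.
by rewrite -(deriveD df dg).
Qed.

Lemma CkM k A f g : open A -> Ck k A f -> Ck k A g ->
  Ck k A (fun x => f x * g x).
Proof.
move=> oA; elim: k f g => [|k IH] f g.
  by move=> cf cg x Ax; apply: continuousM; [exact: cf|exact: cg].
move=> Cf Cg; have [f1 f2] := Cf; have [g1 g2] := Cg; split=> [x Ax|v].
  have [cf df] := f1 x Ax; have [cg dg] := g1 x Ax; split.
    exact: continuousM.
  by move=> v; exact: derivableM.
apply: Ck_ext (CkD oA (IH _ _ (CkS Cf) (g2 v)) (IH _ _ (CkS Cg) (f2 v))) => //.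
move=> x Ax.
have [_ /(_ v) df] := f1 x Ax; have [_ /(_ v) dg] := g1 x Ax.
by rewrite -/((f * g)) (deriveM df dg).
Qed.

Lemma smooth_on_ext A f g : open A -> (forall x, A x -> f x = g x) ->
  smooth_on A f -> smooth_on A g.
Proof. by move=> oA fg /smooth_onP H; apply/smooth_onP => k; exact: (Ck_ext oA fg (H k)). Qed.

Lemma smooth_on_sub A B f : B `<=` A -> smooth_on A f -> smooth_on B f.
Proof. by move=> BA H vs x /BA; exact: H. Qed.

Lemma smooth_on_local A f :
  (forall x, A x -> exists2 B, B x & smooth_on B f) -> smooth_on A f.
Proof. by move=> H vs x /H[B Bx]; exact. Qed.

Lemma smooth_on_cont A f x : smooth_on A f -> A x -> {for x, continuous f}.
Proof. by move=> H Ax; have [] := H [::] x Ax. Qed.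

Lemma smooth_on_derivable A f x v : smooth_on A f -> A x -> derivable f x v.
Proof. by move=> H Ax; have [] := H [::] x Ax. Qed.

Lemma smooth_on_derive A f v : smooth_on A f -> smooth_on A ('D_v f).
Proof. by move=> /smooth_onP H; apply/smooth_onP => k; have [_] := H k.+1; apply. Qed.

Lemma smooth_on_cst A (c : R) : smooth_on A (fun=> c).
Proof. by apply/smooth_onP => k; exact: Ck_cst. Qed.
Arguments smooth_on_cst : clear implicits.

Lemma smooth_onD A f g : open A -> smooth_on A f -> smooth_on A g ->
  smooth_on A (fun x => f x + g x).
Proof.
by move=> oA /smooth_onP F /smooth_onP G; apply/smooth_onP => k; exact: CkD.
Qed.

Lemma smooth_onM A f g : open A -> smooth_on A f -> smooth_on A g ->
  smooth_on A (fun x => f x * g x).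
Proof.
by move=> oA /smooth_onP F /smooth_onP G; apply/smooth_onP => k; exact: CkM.
Qed.

Lemma smooth_onN A f : open A -> smooth_on A f -> smooth_on A (fun x => - f x).
Proof.
move=> oA F; apply: (smooth_on_ext oA _ (smooth_onM oA (smooth_on_cst A (-1)) F)).
by move=> x _; rewrite mulN1r.
Qed.

Lemma smooth_onB A f g : open A -> smooth_on A f -> smooth_on A g ->
  smooth_on A (fun x => f x - g x).
Proof. by move=> oA F G; apply: smooth_onD => //; exact: smooth_onN. Qed.

Lemma smooth_on_sum I (r : seq I) (P : pred I) A (F : I -> V -> R) : open A ->
  (forall i, P i -> smooth_on A (F i)) ->
  smooth_on A (fun x => \sum_(i <- r | P i) F i x).
Proof.
move=> oA H; elim: r => [|i r IH].
  by apply: (smooth_on_ext oA _ (smooth_on_cst A 0)) => x _; rewrite big_nil.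
have [Pi|nPi] := boolP (P i).
  apply: (smooth_on_ext oA _ (smooth_onD oA (H i Pi) IH)) => x _.
  by rewrite big_cons Pi.
by apply: (smooth_on_ext oA _ IH) => x _; rewrite big_cons (negbTE nPi).
Qed.

End Smooth.
Arguments smooth_on_cst {R V} A c.

Lemma continuous_at_comp {T U W : topologicalType} (f : T -> U) (g : U -> W) x :
  {for x, continuous f} -> {for f x, continuous g} -> {for x, continuous (g \o f)}.
Proof. by move=> cf cg; exact: continuous_comp. Qed.

Section SmoothComp.
Context {R : realType} {V W : normedModType R}.

(** Affine changes of variables need no chain rule: a directional derivative
    of the composite is literally one of the outer function. *)
Lemma derive_affine (f : W -> R) (L : {linear V -> W}) (c : W) x v :
  'D_v (fun y => f (L y + c)) x = 'D_(L v) f (L x + c).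
Proof. by rewrite /derive /=; under eq_fun do rewrite linearP -addrA. Qed.

Lemma derivable_affine (f : W -> R) (L : {linear V -> W}) (c : W) x v :
  derivable (fun y => f (L y + c)) x v <-> derivable f (L x + c) (L v).
Proof. by rewrite /derivable /=; under eq_fun do rewrite linearP -addrA. Qed.

Lemma smooth_on_affine A B (f : W -> R) (L : {linear V -> W}) (c : W) :
  continuous L -> (forall x, A x -> B (L x + c)) ->
  smooth_on B f -> smooth_on A (fun x => f (L x + c)).
Proof.
move=> cL AB /smooth_onP H; apply/smooth_onP => k; move: (H k) => {H}.
elim: k f => [|k IH] f /=.
  move=> cf x Ax; apply: (@continuous_at_comp _ _ _ (fun y => L y + c) f).
    by apply: continuousD; [exact: cL|exact: cvg_cst].
  exact/cf/AB.
move=> [H1 H2]; split=> [x Ax|v].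
  have [cf df] := H1 _ (AB x Ax); split; last by move=> v; apply/(derivable_affine f L c x v); exact: df.
  apply: (@continuous_at_comp _ _ _ (fun y => L y + c) f) => //.
  by apply: continuousD; [exact: cL|exact: cvg_cst].
rewrite (_ : 'D_v _ = fun x => 'D_(L v) f (L x + c)).
  exact: (IH ('D_(L v) f) (H2 (L v))).
by apply/funext => x; exact: derive_affine.
Qed.

End SmoothComp.

(** * Calculus in the plane *)

Section Lines.
Context {R : realType} {V : normedModType R}.
Implicit Types f : V -> R.

Lemma is_derive_line f (x v : V) (s : R) :
  derivable f (s *: v + x) v ->
  is_derive s 1 (fun h : R => f (h *: v + x)) ('D_v f (s *: v + x)).
Proof.
have e : (fun h : R => h^-1 *: (f ((h *: (1 : R) + s) *: v + x) - f (s *: v + x)))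
       = (fun h : R => h^-1 *: (f (h *: v + (s *: v + x)) - f (s *: v + x))).
  by apply/funext => h; rewrite /= [_ *: (1:R)]mulr1 scalerDl addrA.
by move=> df; apply: DeriveDef; rewrite /derivable /derive /= e.
Qed.

Lemma mvt_dir f (x v : V) (t : R) :
  (forall s : R, `|s| <= `|t| -> derivable f (s *: v + x) v) ->
  exists2 s : R, `|s| <= `|t| & f (t *: v + x) - f x = t * 'D_v f (s *: v + x).
Proof.
move=> H; pose g := fun h : R => f (h *: v + x).
pose dg := fun s : R => 'D_v f (s *: v + x).
have dgP (s : R) : `|s| <= `|t| -> is_derive s (1 : R) g (dg s).
  by move=> /H; exact: is_derive_line.
have g0 : g 0 = f x by rewrite /g scale0r add0r.
have cg (s : R) : `|s| <= `|t| -> {for s, continuous g}.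
  by move=> /dgP[dgs _]; apply/differentiable_continuous/derivable1_diffP.
have [t0|t0] := leP 0 t.
  have bd s : s \in `[0, t] -> `|s| <= `|t|.
    by rewrite in_itv /= => /andP[s0 st]; rewrite !ger0_norm.
  have [] := @MVT_segment R g dg 0 t t0.
  - by move=> s st; apply/dgP/bd/subset_itv_oo_cc.
  - apply: continuous_in_subspaceT => s; rewrite inE => st; exact/cg/bd.
  - by move=> c /bd ct; rewrite g0 subr0 mulrC => e; exists c.
have bd s : s \in `[t, 0] -> `|s| <= `|t|.
  by rewrite in_itv /= => /andP[s0 st]; rewrite !ler0_norm ?lerN2 // ltW.
have [] := @MVT_segment R g dg t 0 (ltW t0).
- by move=> s st; apply/dgP/bd/subset_itv_oo_cc.
- apply: continuous_in_subspaceT => s; rewrite inE => st; exact/cg/bd.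
- move=> c /bd ct; rewrite g0 sub0r => e; exists c => //.
  by rewrite -opprB e mulrN opprK mulrC.
Qed.

Lemma differentiableI f (x : V) (df : {linear V -> R}) : continuous df ->
  (forall e : R, 0 < e -> \forall h \near (0 : V),
     `|f (h + x) - f x - df h| <= e * `|h|) ->
  differentiable f x /\ 'd f x = df :> (V -> R).
Proof.
move=> cdf H.
have E : f \o shift x = cst (f x) + df +o_ 0 id.
  apply/eqaddoP => e e0; apply: filterS (H e e0) => h.
  by rewrite /= !fctE opprD addrA.
have dE := diff_unique cdf E.
by split=> //; apply/diff_locallyP; rewrite dE.
Qed.

Lemma differentiableE f (x : V) : differentiable f x ->
  forall e : R, 0 < e -> \forall h \near (0 : V),
     `|f (h + x) - f x - 'd f x h| <= e * `|h|.
Proof.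
move=> /diff_locallyP[_ /eqaddoP H] e e0; apply: filterS (H e e0) => h.
by rewrite /= !fctE opprD addrA.
Qed.

End Lines.

(* Unification must not unfold a derivative into its defining limit. *)
#[global] Opaque derive.

Section Gradient.
Context {R : realType}.
Local Notation P := (R * R)%type.

Definition e1 : P := (1, 0).
Definition e2 : P := (0, 1).

Implicit Types (A B : set P) (f : P -> R) (p q v : P).

Definition lin2 (a b : R) (h : P) : R := a * h.1 + b * h.2.

Fact lin2_linear a b : linear (lin2 a b).
Proof. by move=> k u v; rewrite /lin2 /= /GRing.scale /=; ring. Qed.
HB.instance Definition _ a b :=
  GRing.isLinear.Build R P R _ (lin2 a b) (lin2_linear a b).

Lemma lin2_continuous a b : continuous (lin2 a b).
Proof.
move=> p; apply: (@cvgD _ _ _ _ _ (fun h : P => a * h.1) (fun h : P => b * h.2)).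
  by apply: cvgMr; exact: cvg_fst.
by apply: cvgMr; exact: cvg_snd.
Qed.

Lemma norm1_le p : `|p.1| <= `|p|.
Proof. by rewrite prod_normE le_max lexx. Qed.

Lemma norm2_le p : `|p.2| <= `|p|.
Proof. by rewrite prod_normE le_max lexx orbT. Qed.

Lemma scale_e12 (s t : R) : s *: e1 + t *: e2 = (s, t) :> P.
Proof.
by congr (_, _); rewrite /= /GRing.scale /= ?mulr0 ?mulr1 ?addr0 ?add0r.
Qed.

Lemma norm_pair (s t d : R) : `|s| < d -> `|t| < d -> `|(s, t) : P| < d.
Proof. by move=> sd td; rewrite prod_normE gt_max sd td. Qed.

(** The increment is split into a horizontal and a vertical one, and the mean
    value theorem is applied to each. *)
Lemma C1_differentiable A f (a b : P -> R) p : open A -> A p ->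
  (forall q, A q -> is_derive q e1 f (a q) /\ is_derive q e2 f (b q)) ->
  {for p, continuous a} -> {for p, continuous b} ->
  differentiable f p /\ 'd f p = lin2 (a p) (b p) :> (P -> R).
Proof.
move=> oA Ap dfA c1 c2; apply: differentiableI; first exact: lin2_continuous.
move=> e e0; have e20 : 0 < e / 2 by rewrite divr_gt0.
have : \forall q \near p, [/\ A q, `|a p - a q| < e / 2
    & `|b p - b q| < e / 2].
  move/cvgrPdist_lt : c1 => /(_ _ e20) c1; move/cvgrPdist_lt : c2 => /(_ _ e20) c2.
  apply: filterS (filterI (open_near oA Ap) (filterI c1 c2)).
  by move=> q [Aq [h1 h2]]; split.
move=> /nbhs_ballP[d /= d0 H].
apply/nbhs_ballP; exists d => //= h; rewrite -ball_normE /= sub0r normrN => hd.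
have inb q : `|q - p| < d -> ball p d q.
  by rewrite -ball_normE /= distrC.
have in1 (s : R) : `|s| <= `|h.1| -> `|s *: e1 + (h.2 *: e2 + p) - p| < d.
  move=> sh; rewrite addrA addrK scale_e12 norm_pair //.
    by rewrite (le_lt_trans sh) ?(le_lt_trans (norm1_le _)).
  by rewrite (le_lt_trans (norm2_le _)).
have in2 (s : R) : `|s| <= `|h.2| -> `|s *: e2 + p - p| < d.
  move=> sh; rewrite addrK -[_ *: _]add0r -(scale0r e1) scale_e12.
  by rewrite norm_pair ?normr0 // (le_lt_trans sh) // (le_lt_trans (norm2_le _)).
have {}H q : `|q - p| < d -> [/\ A q, `|a q - a p| < e / 2 & `|b q - b p| < e / 2].
  by move=> /inb/H[H1 H2 H3]; split; rewrite // distrC.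
have [s /in1/H[Aq aq _] fa] : exists2 s : R, `|s| <= `|h.1| &
    f (h.1 *: e1 + (h.2 *: e2 + p)) - f (h.2 *: e2 + p)
    = h.1 * a (s *: e1 + (h.2 *: e2 + p)).
  have [u /in1/H[As _ _]|s0 sh ->] := @mvt_dir R _ f (h.2 *: e2 + p) e1 h.1.
    by have [[]] := dfA _ As.
  exists s0 => //; congr (_ * _).
  by have /in1/H[As _ _] := sh; have [[_ ->]] := dfA _ As.
have [t /in2/H[Ar _ bq] fb] : exists2 s : R, `|s| <= `|h.2| &
    f (h.2 *: e2 + p) - f p = h.2 * b (s *: e2 + p).
  have [u /in2/H[As _ _]|s0 sh ->] := @mvt_dir R _ f p e2 h.2.
    by have [_ []] := dfA _ As.
  exists s0 => //; congr (_ * _).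
  by have /in2/H[As _ _] := sh; have [_ [_ ->]] := dfA _ As.
have -> : h + p = h.1 *: e1 + (h.2 *: e2 + p).
  by rewrite addrA scale_e12 -surjective_pairing.
move: fa fb aq bq; set x1 := f (h.1 *: e1 + _); set x2 := f (h.2 *: e2 + p).
set y1 := a (s *: _ + _); set y2 := b (t *: _ + _) => fa fb aq bq.
rewrite /lin2 (_ : x1 - f p - _ = h.1 * (y1 - a p) + h.2 * (y2 - b p)); last first.
  rewrite (_ : x1 - f p = (x1 - x2) + (x2 - f p)); last by ring.
  by rewrite fa fb; ring.
rewrite (splitr e) mulrDl (le_trans (ler_normD _ _)) // lerD // normrM mulrC.
  by rewrite ler_pM ?norm1_le // ltW.
by rewrite ler_pM ?norm2_le // ltW.
Qed.

Lemma smooth_differentiable A f p : open A -> smooth_on A f -> A p ->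
  differentiable f p.
Proof.
move=> oA sf Ap; have [] // := @C1_differentiable A f ('D_e1 f) ('D_e2 f) p oA Ap.
- by move=> q Aq; split; apply: derivableP; exact: (smooth_on_derivable sf Aq).
- by apply: smooth_on_cont Ap; exact: smooth_on_derive.
- by apply: smooth_on_cont Ap; exact: smooth_on_derive.
Qed.

Lemma differentiable_dir f p v : differentiable f p ->
  'D_v f p = v.1 * 'D_e1 f p + v.2 * 'D_e2 f p.
Proof.
move=> df; rewrite !deriveE // {1}(surjective_pairing v) -scale_e12.
by rewrite linearD !linearZ.
Qed.

Section Comp.
Context {V : normedModType R}.
Implicit Types (g : V -> P).

Lemma derive_comp2 f g (x v : V) : differentiable f (g x) ->
  derivable (fun y => (g y).1) x v -> derivable (fun y => (g y).2) x v ->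
  derivable (f \o g) x v /\
  'D_v (f \o g) x = 'D_v (fun y => (g y).1) x * 'D_e1 f (g x)
                  + 'D_v (fun y => (g y).2) x * 'D_e2 f (g x).
Proof.
move=> df d1 d2.
pose k h := g (h *: v + x).
have k0 : k 0 = g x by rewrite /k scale0r add0r.
have dk1 : is_derive (0 : R) (1 : R) (fun h => (k h).1) ('D_v (fun y => (g y).1) x).
  have := @is_derive_line R V (fun y => (g y).1) x v 0.
  by rewrite scale0r add0r => /(_ d1).
have dk2 : is_derive (0 : R) (1 : R) (fun h => (k h).2) ('D_v (fun y => (g y).2) x).
  have := @is_derive_line R V (fun y => (g y).2) x v 0.
  by rewrite scale0r add0r => /(_ d2).
have fk1 : differentiable (fun h => (k h).1) (0:R) by apply/derivable1_diffP; case: dk1.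
have fk2 : differentiable (fun h => (k h).2) (0:R) by apply/derivable1_diffP; case: dk2.
have kE : k = fun h => ((k h).1, (k h).2).
  by apply/funext => h; rewrite -surjective_pairing.
have fk : differentiable k (0:R).
  by rewrite kE; exact: differentiable_pair.
have dfk : differentiable f (k 0) by rewrite k0.
have fgk : differentiable (f \o k) (0:R) by exact: differentiable_comp.
have dfg : derivable (f \o g) x v.
  by apply/derivable1P; apply/derivable1_diffP.
split => //.
have -> : 'D_v (f \o g) x = 'D_1 (f \o k) 0.
  have := @is_derive_line R V (f \o g) x v 0.
  by rewrite scale0r add0r => /(_ dfg)[_ <-].
rewrite deriveE // diff_comp //=.
have -> : 'd k (0 : R) 1 = ('d (fun h => (k h).1) (0:R) 1, 'd (fun h => (k h).2) (0:R) 1).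
  by rewrite [in LHS]kE diff_pair.
have -> : 'd (fun h => (k h).1) (0:R) 1 = 'D_v (fun y => (g y).1) x.
  by case: dk1 => _ <-; rewrite deriveE.
have -> : 'd (fun h => (k h).2) (0:R) 1 = 'D_v (fun y => (g y).2) x.
  by case: dk2 => _ <-; rewrite deriveE.
by rewrite -deriveE // k0 differentiable_dir.
Qed.

(** By induction on the order: the partial derivatives of the composite are sums
    of products of lower-order data with composites of the same kind. *)
Lemma smooth_on_comp2 (A : set V) B f g : open A -> open B ->
  (forall x, A x -> B (g x)) ->
  smooth_on A (fun y => (g y).1) -> smooth_on A (fun y => (g y).2) ->
  smooth_on B f -> smooth_on A (f \o g).
Proof.
move=> oA oB AB s1 s2 sf; apply/smooth_onP => k.
elim: k f sf => [|k IH] f sf.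
  move=> x Ax; apply: continuous_comp; last exact: (smooth_on_cont sf (AB x Ax)).
  rewrite (_ : g = fun y => ((g y).1, (g y).2)).
    exact: (cvg_pair (smooth_on_cont s1 Ax) (smooth_on_cont s2 Ax)).
  by apply/funext => h; rewrite -surjective_pairing.
have D x (v : V) : A x -> derivable (f \o g) x v /\
  'D_v (f \o g) x = 'D_v (fun y => (g y).1) x * 'D_e1 f (g x)
                  + 'D_v (fun y => (g y).2) x * 'D_e2 f (g x).
  move=> Ax; apply: derive_comp2.
  - exact: (smooth_differentiable oB sf (AB x Ax)).
  - exact: (smooth_on_derivable s1 Ax).
  - exact: (smooth_on_derivable s2 Ax).
split=> [x Ax|v].
  split; last by move=> v; exact: (D x v Ax).1.
  exact: (Ck_cont (IH _ sf) Ax).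
apply: (Ck_ext oA (fun x Ax => esym (D x v Ax).2)).
apply: CkD => //; apply: CkM => //.
- by have /smooth_onP := smooth_on_derive v s1; apply.
- exact: (IH _ (smooth_on_derive _ sf)).
- by have /smooth_onP := smooth_on_derive v s2; apply.
- exact: (IH _ (smooth_on_derive _ sf)).
Qed.

End Comp.
End Gradient.

(** Both mixed derivatives are values, at points close to [p], of the second
    difference quotient of [f] along [v] and [w]. *)
Lemma Schwarz {R : realType} {V : normedModType R} (A : set V) (f : V -> R)
    (p v w : V) : open A -> smooth_on A f -> A p ->
  'D_v ('D_w f) p = 'D_w ('D_v f) p.
Proof.
move=> oA sf Ap.
have sv := smooth_on_derive v sf; have sw := smooth_on_derive w sf.
have [a aE] : exists a : V -> R, a = 'D_w ('D_v f).
  exact: (ex_intro _ _ erefl).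
have [b bE] : exists b : V -> R, b = 'D_v ('D_w f).
  exact: (ex_intro _ _ erefl).
have ca : {for p, continuous a}.
  by rewrite aE; exact: (smooth_on_cont (smooth_on_derive w sv) Ap).
have cb : {for p, continuous b}.
  by rewrite bE; exact: (smooth_on_cont (smooth_on_derive v sw) Ap).
suff : b p = a p by rewrite aE bE.
apply/eqP; rewrite -subr_eq0 -normr_eq0; apply: contraT => ab.
have e0 : 0 < `|b p - a p| / 2 by rewrite divr_gt0 // lt_neqAle eq_sym ab /=.
set e := _ / 2 in e0.
move/cvgrPdist_lt : ca => /(_ _ e0) ca; move/cvgrPdist_lt : cb => /(_ _ e0) cb.
have : \forall x \near p, [/\ A x, `|a p - a x| < e & `|b p - b x| < e].
  apply: filterS (filterI (open_near oA Ap) (filterI ca cb)).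
  by move=> q [Aq [h1 h2]]; split.
move=> /nbhs_ballP[d /= d0 H].
have [t t0 tN] : exists2 t, 0 < t & t * (`|v| + `|w| + 1) < d.
  have N0 : 0 < `|v| + `|w| + 1 by rewrite ltr_wpDl // addr_ge0.
  exists (d / 2 / (`|v| + `|w| + 1)); first by rewrite !divr_gt0.
  by rewrite mulfVK ?gt_eqF // ltr_pdivrMr // ltr_pMr // ltr1n.
have {}H (s s' : R) : `|s| <= t -> `|s'| <= t -> [/\ A (s *: v + (s' *: w + p)),
    `|a p - a (s *: v + (s' *: w + p))| < e & `|b p - b (s *: v + (s' *: w + p))| < e].
  move=> st s't; suff : `|s *: v + s' *: w| < d.
    rewrite addrA => sd.
    suff /H[Aq ? ?] : ball p d (s *: v + s' *: w + p) by split.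
    by rewrite -ball_normE /= opprD addrCA subrr addr0 normrN.
  rewrite (le_lt_trans (ler_normD _ _)) // !normrZ.
  apply: le_lt_trans tN.
    rewrite !mulrDr; apply: ler_wpDr; first by rewrite mulr1 ltW.
    by apply: lerD; apply: ler_wpM2r.
have tt : `|t| = t by rewrite gtr0_norm.
have sh (u : V) (c : R) : c *: u = c *: u + 0 by rewrite addr0.
pose idl : {linear V -> V} := idfun.
have dsh (h : V -> R) (c x u : V) : derivable h (c + x) u ->
    derivable (fun y => h (c + y)) x u /\ 'D_u (fun y => h (c + y)) x = 'D_u h (c + x).
  have -> : (fun y => h (c + y)) = (fun y => h (idl y + c)).
    by apply/funext => y; rewrite /idl /= addrC.
  move=> dh; rewrite derive_affine /idl /= (addrC x); split=> //.
  by apply/(derivable_affine h idl); rewrite /idl /= addrC.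
have quot (u1 u2 : V) (c : V -> R) : (forall x, 'D_u2 ('D_u1 f) x = c x) -> (forall s s' : R, `|s| <= t -> `|s'| <= t ->
       A (s *: u1 + (s' *: u2 + p))) -> exists s s' : R, [/\ `|s| <= t, `|s'| <= t &
    f (t *: u2 + (t *: u1 + p)) - f (t *: u1 + p) - (f (t *: u2 + p) - f p)
    = t * (t * c (s' *: u2 + (s *: u1 + p)))].
  move=> cE HA.
  have HA0 s : `|s| <= t -> A (s *: u1 + p).
    by move=> st; have := HA s 0 st; rewrite normr0 scale0r add0r; apply; exact: ltW.
  have dg (s : R) : `|s| <= `|t| ->
      derivable (fun x => f (t *: u2 + x) - f x) (s *: u1 + p) u1 /\
      'D_u1 (fun x => f (t *: u2 + x) - f x) (s *: u1 + p) =
      'D_u1 f (t *: u2 + (s *: u1 + p)) - 'D_u1 f (s *: u1 + p).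
    rewrite tt => st.
    have [|d1 E1] := dsh f (t *: u2) (s *: u1 + p) u1.
      apply: (smooth_on_derivable sf); rewrite addrCA; apply: HA => //.
      by rewrite tt.
    have d2 : derivable f (s *: u1 + p) u1.
      by apply: (smooth_on_derivable sf); exact: HA0.
    split; first exact: derivableB.
    by rewrite -E1 -deriveB.
  have [|s st E] := @mvt_dir R V (fun x => f (t *: u2 + x) - f x) p u1 t.
    by move=> s /dg[].
  rewrite (dg s st).2 in E; rewrite tt in st.
  have [|s' st' E'] := @mvt_dir R V ('D_u1 f) (s *: u1 + p) u2 t.
    move=> s' st'; rewrite tt in st'.
    apply: (smooth_on_derivable (smooth_on_derive u1 sf)).
    by rewrite addrCA; apply: HA.
  by rewrite tt in st'; exists s, s'; rewrite E E' cE.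
have [||s1 [s2 [h1 h2 E1]]] := quot v w a.
- by move=> x; rewrite aE.
- by move=> s s' st s't; have [] := H s s' st s't.
have [||s3 [s4 [h3 h4 E2]]] := quot w v b.
- by move=> x; rewrite bE.
- by move=> s s' st s't; rewrite addrCA; have [] := H s' s s't st.
have EE : a (s1 *: v + (s2 *: w + p)) = b (s4 *: v + (s3 *: w + p)).
  have t2 : t * t != 0 by rewrite mulf_neq0 // gt_eqF.
  apply: (mulfI t2); rewrite -!mulrA [in LHS]addrCA -E1 -E2.
  by rewrite [t *: w + (t *: v + p)]addrCA; ring.
have [_ a1 _] := H _ _ h1 h2; have [_ _ b1] := H _ _ h4 h3.
suff : `|b p - a p| < `|b p - a p| by rewrite ltxx.
rewrite [X in _ < X]splitr -/e.
rewrite EE in a1; set z := b (_ + _) in a1 b1.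
rewrite (_ : b p - a p = (b p - z) - (a p - z)); last by ring.
by rewrite (le_lt_trans (ler_normB _ _)) // ltrD.
Qed.

(** * Complex and matrix-valued functions on a real normed space *)

Notation Re := complex.Re.
Notation Im := complex.Im.

Section ReIm.
Context {R : realType}.
Implicit Types x y : R[i].

Lemma complex_ext x y : Re x = Re y -> Im x = Im y -> x = y.
Proof. by case: x y => [a b] [c d] /= -> ->. Qed.
Lemma ReD x y : Re (x + y) = Re x + Re y. Proof. by case: x y => [a b] [c d]. Qed.
Lemma ImD x y : Im (x + y) = Im x + Im y. Proof. by case: x y => [a b] [c d]. Qed.
Lemma ReN x : Re (- x) = - Re x. Proof. by case: x. Qed.
Lemma ImN x : Im (- x) = - Im x. Proof. by case: x. Qed.
Lemma ReM x y : Re (x * y) = Re x * Re y - Im x * Im y.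
Proof. by case: x y => [a b] [c d]. Qed.
Lemma ImM x y : Im (x * y) = Re x * Im y + Im x * Re y.
Proof. by case: x y => [a b] [c d]. Qed.
Lemma ReJ x : Re (Num.conj x) = Re x. Proof. by case: x. Qed.
Lemma ImJ x : Im (Num.conj x) = - Im x. Proof. by case: x. Qed.
Lemma Re0 : Re (0 : R[i]) = 0. Proof. by []. Qed.
Lemma Im0 : Im (0 : R[i]) = 0. Proof. by []. Qed.
Lemma Re_sum I (r : seq I) (P : pred I) (F : I -> R[i]) :
  Re (\sum_(i <- r | P i) F i) = \sum_(i <- r | P i) Re (F i).
Proof. exact: (big_morph _ ReD Re0). Qed.
Lemma Im_sum I (r : seq I) (P : pred I) (F : I -> R[i]) :
  Im (\sum_(i <- r | P i) F i) = \sum_(i <- r | P i) Im (F i).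
Proof. exact: (big_morph _ ImD Im0). Qed.

End ReIm.

Lemma derive_MBM {R : realType} {V : normedModType R} (a b c d : V -> R) (v x : V) :
  derivable a x v -> derivable b x v -> derivable c x v -> derivable d x v ->
  'D_v (fun y => a y * c y - b y * d y) x =
  ('D_v a x * c x + a x * 'D_v c x) - ('D_v b x * d x + b x * 'D_v d x).
Proof.
move=> da db dc dd.
have /= -> := deriveB (derivableM da dc) (derivableM db dd).
by rewrite (deriveM da dc) (deriveM db dd) /GRing.scale /=; ring.
Qed.

Lemma derive_MDM {R : realType} {V : normedModType R} (a b c d : V -> R) (v x : V) :
  derivable a x v -> derivable b x v -> derivable c x v -> derivable d x v ->
  'D_v (fun y => a y * c y + b y * d y) x =
  ('D_v a x * c x + a x * 'D_v c x) + ('D_v b x * d x + b x * 'D_v d x).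
Proof.
move=> da db dc dd.
have /= -> := deriveD (derivableM da dc) (derivableM db dd).
by rewrite (deriveM da dc) (deriveM db dd) /GRing.scale /=; ring.
Qed.

Section ComplexCalculus.
Context {R : realType} {V : normedModType R}.
Implicit Types (A : set V) (f g : V -> R[i]) (v x : V).

Definition csmooth_on A f :=
  smooth_on A (fun y => Re (f y)) /\ smooth_on A (fun y => Im (f y)).

Definition cderive v f x : R[i] :=
  'D_v (fun y => Re (f y)) x +i* 'D_v (fun y => Im (f y)) x.

Lemma csmooth_on_ext A f g : open A -> (forall x, A x -> f x = g x) ->
  csmooth_on A f -> csmooth_on A g.
Proof.
move=> oA fg [f1 f2]; split.
  by apply: (smooth_on_ext oA _ f1) => x /fg ->.
by apply: (smooth_on_ext oA _ f2) => x /fg ->.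
Qed.

Lemma cderive_near v f g x : (\forall y \near x, f y = g y) ->
  cderive v f x = cderive v g x.
Proof.
move=> fg; rewrite /cderive.
rewrite (@near_eq_derive _ _ _ (fun y => Re (f y)) (fun y => Re (g y))); last first.
  by apply: filterS fg => y ->.
rewrite (@near_eq_derive _ _ _ (fun y => Im (f y)) (fun y => Im (g y))) //.
by apply: filterS fg => y ->.
Qed.

Lemma csmooth_on_cst A (c : R[i]) : csmooth_on A (fun=> c).
Proof. by split; exact: smooth_on_cst. Qed.

Lemma csmooth_onD A f g : open A -> csmooth_on A f -> csmooth_on A g ->
  csmooth_on A (fun x => f x + g x).
Proof.
move=> oA [f1 f2] [g1 g2]; split.
  by apply: (smooth_on_ext oA _ (smooth_onD oA f1 g1)) => x _; rewrite ReD.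
by apply: (smooth_on_ext oA _ (smooth_onD oA f2 g2)) => x _; rewrite ImD.
Qed.

Lemma csmooth_onM A f g : open A -> csmooth_on A f -> csmooth_on A g ->
  csmooth_on A (fun x => f x * g x).
Proof.
move=> oA [f1 f2] [g1 g2]; split.
  apply: (smooth_on_ext oA _
    (smooth_onB oA (smooth_onM oA f1 g1) (smooth_onM oA f2 g2))).
  by move=> x _; rewrite ReM.
apply: (smooth_on_ext oA _
    (smooth_onD oA (smooth_onM oA f1 g2) (smooth_onM oA f2 g1))).
by move=> x _; rewrite ImM.
Qed.

Lemma csmooth_onJ A f : open A -> csmooth_on A f ->
  csmooth_on A (fun x => Num.conj (f x)).
Proof.
move=> oA [f1 f2]; split.
  by apply: (smooth_on_ext oA _ f1) => x _; rewrite ReJ.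
by apply: (smooth_on_ext oA _ (smooth_onN oA f2)) => x _; rewrite ImJ.
Qed.

Lemma csmooth_on_sum I (r : seq I) (P : pred I) A (F : I -> V -> R[i]) : open A ->
  (forall i, P i -> csmooth_on A (F i)) ->
  csmooth_on A (fun x => \sum_(i <- r | P i) F i x).
Proof.
move=> oA H; split.
  apply: (smooth_on_ext oA _ (smooth_on_sum r oA (fun i Pi => (H i Pi).1))).
  by move=> x _; rewrite Re_sum.
apply: (smooth_on_ext oA _ (smooth_on_sum r oA (fun i Pi => (H i Pi).2))).
by move=> x _; rewrite Im_sum.
Qed.

Lemma csmooth_on_cderive A f v : csmooth_on A f -> csmooth_on A (cderive v f).
Proof. by move=> [f1 f2]; split; [exact: (smooth_on_derive v f1)|exact: (smooth_on_derive v f2)]. Qed.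

Lemma cderive_cst v (c : R[i]) x : cderive v (fun=> c) x = 0.
Proof. by rewrite /cderive !derive_cst. Qed.

Section At.
Variables (A : set V) (x : V).
Hypothesis Ax : A x.

Lemma cderiveD v f g : csmooth_on A f -> csmooth_on A g ->
  cderive v (fun y => f y + g y) x = cderive v f x + cderive v g x.
Proof.
move=> [f1 f2] [g1 g2]; rewrite /cderive; apply: complex_ext => /=.
  rewrite -(@deriveD _ _ _ (fun y => Re (f y)) (fun y => Re (g y))).
  - by congr ('D_v _ x); apply/funext => y; rewrite ReD.
  - exact: (smooth_on_derivable f1).
  - exact: (smooth_on_derivable g1).
rewrite -(@deriveD _ _ _ (fun y => Im (f y)) (fun y => Im (g y))).
- by congr ('D_v _ x); apply/funext => y; rewrite ImD.
- exact: (smooth_on_derivable f2).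
- exact: (smooth_on_derivable g2).
Qed.

Lemma cderiveM v f g : csmooth_on A f -> csmooth_on A g ->
  cderive v (fun y => f y * g y) x = cderive v f x * g x + f x * cderive v g x.
Proof.
move=> [f1 f2] [g1 g2].
have df1 : derivable (fun y => Re (f y)) x v by exact: (smooth_on_derivable f1).
have df2 : derivable (fun y => Im (f y)) x v by exact: (smooth_on_derivable f2).
have dg1 : derivable (fun y => Re (g y)) x v by exact: (smooth_on_derivable g1).
have dg2 : derivable (fun y => Im (g y)) x v by exact: (smooth_on_derivable g2).
rewrite /cderive; apply: complex_ext => /=.
  have -> : (fun y => Re (f y * g y)) =
      (fun y => Re (f y) * Re (g y) - Im (f y) * Im (g y)).
    by apply/funext => y; rewrite ReM.
  rewrite (derive_MBM df1 df2 dg1 dg2) ReD !ReM /=.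
  move: ('D_v _ x) ('D_v _ x) ('D_v _ x) ('D_v _ x) => a b c d; ring.
have -> : (fun y => Im (f y * g y)) =
    (fun y => Re (f y) * Im (g y) + Im (f y) * Re (g y)).
  by apply/funext => y; rewrite ImM.
rewrite (derive_MDM df1 df2 dg2 dg1) ImD !ImM /=.
move: ('D_v _ x) ('D_v _ x) ('D_v _ x) ('D_v _ x) => a b c d; ring.
Qed.

Lemma cderiveJ v f : csmooth_on A f ->
  cderive v (fun y => Num.conj (f y)) x = Num.conj (cderive v f x).
Proof.
move=> [f1 f2]; rewrite /cderive; apply: complex_ext => /=.
  by congr ('D_v _ x); apply/funext => y; rewrite ReJ.
rewrite -deriveN; last exact: (smooth_on_derivable f2).
by congr ('D_v _ x); apply/funext => y; rewrite ImJ.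
Qed.

Lemma cderive_sum v (I : Type) (r : seq I) (P : pred I) (F : I -> V -> R[i]) :
  open A -> (forall i, P i -> csmooth_on A (F i)) ->
  cderive v (fun y => \sum_(i <- r | P i) F i y) x
  = \sum_(i <- r | P i) cderive v (F i) x.
Proof.
move=> oA H; elim: r => [|i r IH].
  rewrite big_nil (_ : (fun=> _) = fun=> 0); first exact: cderive_cst.
  by apply/funext => y; rewrite big_nil.
rewrite big_cons -IH; case Pi: (P i).
  rewrite -(cderiveD v (H i Pi) (csmooth_on_sum r oA H)).
  by apply: (congr1 (fun h => cderive v h x)); apply/funext => y; rewrite big_cons Pi.
by apply: (congr1 (fun h => cderive v h x)); apply/funext => y; rewrite big_cons Pi.
Qed.

Lemma cderive_sym v w f : open A -> csmooth_on A f ->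
  cderive v (cderive w f) x = cderive w (cderive v f) x.
Proof.
move=> oA [f1 f2].
apply: complex_ext.
  change ('D_v ('D_w (fun y => Re (f y))) x = 'D_w ('D_v (fun y => Re (f y))) x).
  exact: (Schwarz v w oA f1 Ax).
change ('D_v ('D_w (fun y => Im (f y))) x = 'D_w ('D_v (fun y => Im (f y))) x).
exact: (Schwarz v w oA f2 Ax).
Qed.

End At.
End ComplexCalculus.

Section MatrixCalculus.
Context {R : realType} {V : normedModType R} {n : nat}.
Local Notation M := 'M[R[i]]_n.
Implicit Types (A : set V) (F G : V -> M) (v x : V).

Definition mderive v F x : M := \matrix_(i, j) cderive v (fun y => F y i j) x.

Lemma smooth_mx_on_ext A F G : open A -> (forall x, A x -> F x = G x) ->
  smooth_mx_on A F -> smooth_mx_on A G.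
Proof.
move=> oA FG sF i j; apply: (csmooth_on_ext oA _ (sF i j)).
by move=> x /FG ->.
Qed.

Lemma smooth_mx_on_sub A (B : set V) F : B `<=` A ->
  smooth_mx_on A F -> smooth_mx_on B F.
Proof.
by move=> BA sF i j; have [? ?] := sF i j; split; exact: (smooth_on_sub BA).
Qed.

Lemma smooth_mx_on_local A F :
  (forall x, A x -> exists2 B, B x & smooth_mx_on B F) -> smooth_mx_on A F.
Proof.
move=> H i j; split; apply: smooth_on_local => x /H[B Bx sF]; exists B => //.
  exact: (sF i j).1.
exact: (sF i j).2.
Qed.

Lemma mderive_near v F G x : (\forall y \near x, F y = G y) ->
  mderive v F x = mderive v G x.
Proof.
move=> FG; apply/matrixP => i j; rewrite !mxE; apply: cderive_near.
by apply: filterS FG => y ->.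
Qed.

Lemma smooth_mx_on_cst A (C : M) : smooth_mx_on A (fun=> C).
Proof. by move=> i j; exact: csmooth_on_cst. Qed.

Lemma smooth_mx_onD A F G : open A -> smooth_mx_on A F -> smooth_mx_on A G ->
  smooth_mx_on A (fun x => F x + G x).
Proof.
move=> oA sF sG i j.
by apply: (csmooth_on_ext oA _ (csmooth_onD oA (sF i j) (sG i j))) => x _; rewrite mxE.
Qed.

Lemma smooth_mx_onM A F G : open A -> smooth_mx_on A F -> smooth_mx_on A G ->
  smooth_mx_on A (fun x => F x *m G x).
Proof.
move=> oA sF sG i j.
apply: (csmooth_on_ext oA _ (csmooth_on_sum (index_enum _) oA
  (fun (k : 'I_n) (_ : true) => csmooth_onM oA (sF i k) (sG k j)))) => x _.
by rewrite mxE.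
Qed.

Lemma smooth_mx_on_scalar A (h : V -> R[i]) : open A -> csmooth_on A h ->
  smooth_mx_on A (fun x => (h x)%:M : M).
Proof.
move=> oA sh i j; have [ij|ij] := eqVneq i j.
  by apply: (csmooth_on_ext oA _ sh) => x _; rewrite mxE ij eqxx mulr1n.
by apply: (csmooth_on_ext oA _ (csmooth_on_cst A 0)) => x _; rewrite mxE (negbTE ij).
Qed.

Lemma smooth_mx_onZf A (h : V -> R[i]) F : open A -> csmooth_on A h ->
  smooth_mx_on A F -> smooth_mx_on A (fun x => h x *: F x).
Proof.
move=> oA sh sF.
apply: (smooth_mx_on_ext oA _ (smooth_mx_onM oA (smooth_mx_on_scalar oA sh) sF)).
by move=> x _; rewrite mul_scalar_mx.
Qed.

Lemma smooth_mx_onZ A (c : R[i]) F : open A -> smooth_mx_on A F ->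
  smooth_mx_on A (fun x => c *: F x).
Proof. by move=> oA; apply: smooth_mx_onZf => //; exact: csmooth_on_cst. Qed.

Lemma smooth_mx_onB A F G : open A -> smooth_mx_on A F -> smooth_mx_on A G ->
  smooth_mx_on A (fun x => F x - G x).
Proof.
move=> oA sF sG.
apply: (smooth_mx_on_ext oA _ (smooth_mx_onD oA sF (smooth_mx_onZ (-1) oA sG))).
by move=> x _; rewrite scaleN1r.
Qed.

Lemma smooth_mx_on_sum I (r : seq I) (P : pred I) A (F : I -> V -> M) : open A ->
  (forall i, P i -> smooth_mx_on A (F i)) ->
  smooth_mx_on A (fun x => \sum_(i <- r | P i) F i x).
Proof.
move=> oA H; elim: r => [|i r IH].
  by apply: (smooth_mx_on_ext oA _ (smooth_mx_on_cst A 0)) => x _; rewrite big_nil.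
case Pi: (P i).
  apply: (smooth_mx_on_ext oA _ (smooth_mx_onD oA (H i Pi) IH)) => x _.
  by rewrite big_cons Pi.
by apply: (smooth_mx_on_ext oA _ IH) => x _; rewrite big_cons Pi.
Qed.

Definition adjm (F : M) : M := \matrix_(i, j) Num.conj (F j i).

Lemma adjmE (F : M) : adjm F = (F ^t*)%sesqui.
Proof. by apply/matrixP => i j; rewrite !mxE. Qed.

Lemma adjmK : involutive adjm.
Proof. by move=> F; apply/matrixP => i j; rewrite !mxE conjCK. Qed.

Lemma adjmM (F G : M) : adjm (F *m G) = adjm G *m adjm F.
Proof.
apply/matrixP => i j; rewrite !mxE rmorph_sum; apply: eq_bigr => k _.
by rewrite !mxE rmorphM mulrC.
Qed.

Lemma adjmD (F G : M) : adjm (F + G) = adjm F + adjm G.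
Proof. by apply/matrixP => i j; rewrite !mxE rmorphD. Qed.

Lemma adjmN (F : M) : adjm (- F) = - adjm F.
Proof. by apply/matrixP => i j; rewrite !mxE rmorphN. Qed.

Lemma adjmZ (c : R[i]) (F : M) : adjm (c *: F) = Num.conj c *: adjm F.
Proof. by apply/matrixP => i j; rewrite !mxE rmorphM. Qed.

Lemma adjm0 : adjm 0 = 0.
Proof. by apply/matrixP => i j; rewrite !mxE rmorph0. Qed.

Lemma adjm1 : adjm 1%:M = 1%:M.
Proof. by apply/matrixP => i j; rewrite !mxE eq_sym; case: eqP; rewrite ?rmorph1 ?rmorph0. Qed.

Lemma adjm_sum I (r : seq I) (P : pred I) (F : I -> M) :
  adjm (\sum_(i <- r | P i) F i) = \sum_(i <- r | P i) adjm (F i).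
Proof. exact: (big_morph _ adjmD adjm0). Qed.

Lemma smooth_mx_on_adj A F : open A -> smooth_mx_on A F ->
  smooth_mx_on A (fun x => adjm (F x)).
Proof.
move=> oA sF i j.
by apply: (csmooth_on_ext oA _ (csmooth_onJ oA (sF j i))) => x _; rewrite mxE.
Qed.

Lemma smooth_mx_on_mderive A F v : open A -> smooth_mx_on A F ->
  smooth_mx_on A (mderive v F).
Proof.
move=> oA sF i j.
by apply: (csmooth_on_ext oA _ (csmooth_on_cderive v (sF i j))) => x _; rewrite mxE.
Qed.

Lemma mderive_cst v (C : M) x : mderive v (fun=> C) x = 0.
Proof. by apply/matrixP => i j; rewrite !mxE cderive_cst. Qed.

Section At.
Variables (A : set V) (x : V).
Hypotheses (oA : open A) (Ax : A x).

Lemma mderiveD v F G : smooth_mx_on A F -> smooth_mx_on A G ->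
  mderive v (fun y => F y + G y) x = mderive v F x + mderive v G x.
Proof.
move=> sF sG; apply/matrixP => i j; rewrite !mxE -(cderiveD Ax v (sF i j) (sG i j)).
by apply: (congr1 (fun h => cderive v h x)); apply/funext => y; rewrite mxE.
Qed.

Lemma mderiveM v F G : smooth_mx_on A F -> smooth_mx_on A G ->
  mderive v (fun y => F y *m G y) x = mderive v F x *m G x + F x *m mderive v G x.
Proof.
move=> sF sG; apply/matrixP => i j; rewrite !mxE -big_split /=.
transitivity (cderive v (fun y => \sum_k F y i k * G y k j) x).
  by apply: (congr1 (fun h => cderive v h x)); apply/funext => y; rewrite mxE.
rewrite (cderive_sum Ax) //; last by move=> k _; exact: csmooth_onM.
by apply: eq_bigr => k _; rewrite !mxE (cderiveM Ax).
Qed.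

Lemma mderive_adj v F : smooth_mx_on A F ->
  mderive v (fun y => adjm (F y)) x = adjm (mderive v F x).
Proof.
move=> sF; apply/matrixP => i j; rewrite !mxE -(cderiveJ Ax v (sF j i)).
by apply: (congr1 (fun h => cderive v h x)); apply/funext => y; rewrite mxE.
Qed.

Lemma mderive_sym v w F : smooth_mx_on A F ->
  mderive v (mderive w F) x = mderive w (mderive v F) x.
Proof.
move=> sF; apply/matrixP => i j; rewrite [LHS]mxE [RHS]mxE.
have -> : (fun y => mderive w F y i j) = cderive w (fun z => F z i j).
  by apply/funext => y; rewrite mxE.
have -> : (fun y => mderive v F y i j) = cderive v (fun z => F z i j).
  by apply/funext => y; rewrite mxE.
exact: (cderive_sym Ax v w oA (sF i j)).
Qed.

Lemma mderiveZf v (h : V -> R[i]) F : csmooth_on A h -> smooth_mx_on A F ->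
  mderive v (fun y => h y *: F y) x = cderive v h x *: F x + h x *: mderive v F x.
Proof.
move=> sh sF; apply/matrixP => i j; rewrite !mxE -(cderiveM Ax v sh (sF i j)).
by apply: (congr1 (fun h => cderive v h x)); apply/funext => y; rewrite mxE.
Qed.

Lemma mderiveZ v c F : smooth_mx_on A F ->
  mderive v (fun y => c *: F y) x = c *: mderive v F x.
Proof.
move=> sF; rewrite mderiveZf ?cderive_cst ?scale0r ?add0r //.
exact: csmooth_on_cst.
Qed.

Lemma mderiveB v F G : smooth_mx_on A F -> smooth_mx_on A G ->
  mderive v (fun y => F y - G y) x = mderive v F x - mderive v G x.
Proof.
move=> sF sG; rewrite -[- mderive _ _ _]scaleN1r -mderiveZ // -mderiveD //; last first.
  exact: smooth_mx_onZ.
by apply: (congr1 (fun h => mderive v h x)); apply/funext => y; rewrite scaleN1r.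
Qed.

Lemma mderive_sum v I (r : seq I) (P : pred I) (F : I -> V -> M) :
  (forall i, P i -> smooth_mx_on A (F i)) ->
  mderive v (fun y => \sum_(i <- r | P i) F i y) x
  = \sum_(i <- r | P i) mderive v (F i) x.
Proof.
move=> H; elim: r => [|i r IH].
  rewrite big_nil (_ : (fun=> _) = fun=> 0); first exact: mderive_cst.
  by apply/funext => y; rewrite big_nil.
rewrite big_cons -IH; case Pi: (P i).
  rewrite -(mderiveD v (H i Pi) (smooth_mx_on_sum r oA H)).
  by apply: (congr1 (fun h => mderive v h x)); apply/funext => y; rewrite big_cons Pi.
by apply: (congr1 (fun h => mderive v h x)); apply/funext => y; rewrite big_cons Pi.
Qed.

End At.
End MatrixCalculus.

(** * Integrals of continuous functions *)

Section Intervals.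
Context {R : realType}.
Implicit Types (a b : R) (f g F : R -> R).
Local Notation mu := (@lebesgue_measure R).

Definition cont_on a b f := forall x, a <= x <= b -> {for x, continuous f}.

Definition intg a b f : R := \int[mu]_(x in `[a, b]) f x.

Lemma cont_on_within a b f : cont_on a b f -> {within `[a, b], continuous f}.
Proof.
move=> cf; apply: continuous_in_subspaceT => x; rewrite inE /= in_itv /=.
exact: cf.
Qed.

Lemma cont_on_integrable a b f : cont_on a b f ->
  mu.-integrable `[a, b] (EFin \o f).
Proof.
move=> cf; apply: continuous_compact_integrable; first exact: segment_compact.
exact: cont_on_within.
Qed.

Lemma cont_onD a b f g : cont_on a b f -> cont_on a b g ->
  cont_on a b (fun x => f x + g x).
Proof. by move=> cf cg x xab; exact: (continuousD (cf x xab) (cg x xab)). Qed.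

Lemma cont_onM a b f g : cont_on a b f -> cont_on a b g ->
  cont_on a b (fun x => f x * g x).
Proof. by move=> cf cg x xab; exact: (continuousM (cf x xab) (cg x xab)). Qed.

Lemma cont_on_cst a b (c : R) : cont_on a b (fun=> c).
Proof. by move=> x _; exact: cvg_cst. Qed.

Lemma intgD a b f g : cont_on a b f -> cont_on a b g ->
  intg a b (fun x => f x + g x) = intg a b f + intg a b g.
Proof. by move=> /cont_on_integrable ? /cont_on_integrable ?; exact: RintegralD. Qed.

Lemma intgZ a b f (c : R) : cont_on a b f ->
  intg a b (fun x => c * f x) = c * intg a b f.
Proof. by move=> /cont_on_integrable ?; exact: RintegralZl. Qed.

Lemma intgB a b f g : cont_on a b f -> cont_on a b g ->
  intg a b (fun x => f x - g x) = intg a b f - intg a b g.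
Proof. by move=> /cont_on_integrable ? /cont_on_integrable ?; exact: RintegralB. Qed.

Lemma eq_intg a b f g : (forall x, a <= x <= b -> f x = g x) ->
  intg a b f = intg a b g.
Proof.
by move=> fg; apply: eq_Rintegral => x; rewrite inE /= in_itv /=; exact: fg.
Qed.

Lemma le_intg a b f g : cont_on a b f -> cont_on a b g ->
  (forall x, a <= x <= b -> f x <= g x) -> intg a b f <= intg a b g.
Proof.
move=> /cont_on_integrable ? /cont_on_integrable ? fg; apply: le_Rintegral => //.
Qed.

Lemma intg_cst a b (c : R) : a <= b -> intg a b (fun=> c) = c * (b - a).
Proof.
move=> ab; rewrite /intg Rintegral_cst //= lebesgue_measure_itv /= lte_fin.
by move: ab; rewrite le_eqVlt => /predU1P[->|->]//; rewrite ltxx subrr.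
Qed.

Lemma norm_intg_le a b f (M : R) : a <= b -> cont_on a b f ->
  (forall x, a <= x <= b -> `|f x| <= M) -> `|intg a b f| <= M * (b - a).
Proof.
move=> ab cf fM; rewrite ler_norml; apply/andP; split.
  rewrite -mulNr -intg_cst //; apply: le_intg => //; first exact: cont_on_cst.
  by move=> x /fM; rewrite ler_norml => /andP[].
rewrite -intg_cst //; apply: le_intg => //; first exact: cont_on_cst.
by move=> x /fM; rewrite ler_norml => /andP[].
Qed.

Lemma FTC2 a b f F : a < b -> cont_on a b f ->
  (forall x, a <= x <= b -> is_derive x (1 : R) F (f x)) ->
  intg a b f = F b - F a.
Proof.
move=> ab cf dF; have cF x : a <= x <= b -> {for x, continuous F}.
  by move=> /dF[dFx _]; apply/differentiable_continuous/derivable1_diffP.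
rewrite /intg /Rintegral (@continuous_FTC2 _ f F) //.
- exact: cont_on_within.
- split.
  + by move=> x /subset_itv_oo_cc; rewrite in_itv /= => /dF[].
  + by apply/cvg_at_right_filter/cF; rewrite lexx ltW.
  + by apply/cvg_at_left_filter/cF; rewrite lexx ltW.
- move=> x /subset_itv_oo_cc; rewrite in_itv /= => /dF[dFx <-].
  by rewrite derive1E.
Qed.

Lemma intg_split a b c f : a <= b -> b <= c -> cont_on a c f ->
  intg a c f = intg a b f + intg b c f.
Proof.
move=> ab bc cf; have := @Rintegral_itvB R f (BLeft a) (BRight c) b.
rewrite !bnd_simp => /(_ (cont_on_integrable cf) ab bc) E.
apply/eqP; rewrite addrC -subr_eq; apply/eqP; rewrite /intg E.
apply: Rintegral_itv_obnd_cbnd.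
apply: (@integrableS _ _ _ mu _ _ _ _ _ _ (cont_on_integrable cf)) => //.
by move=> x /=; rewrite !in_itv /= => /andP[/ltW bx ->]; rewrite (le_trans ab bx).
Qed.

Lemma intg_gt0 a b f : a < b -> cont_on a b f ->
  (forall x, a <= x <= b -> 0 <= f x) -> (exists2 x, a <= x <= b & 0 < f x) ->
  0 < intg a b f.
Proof.
move=> ab cf f0 [c /andP[ac cb] fc].
have fc2 : 0 < f c / 2 by rewrite divr_gt0.
have /cf/cvgrPdist_lt/(_ _ fc2)/nbhs_ballP[d /= d0 H] : a <= c <= b by rewrite ac cb.
have hf x : `|c - x| < d -> f c / 2 <= f x.
  move=> xd; have := H x; rewrite -ball_normE /= => /(_ xd).
  by rewrite ltr_norml => /andP[_]; lra.
pose u := Num.max a (c - d / 2); pose v := Num.min b (c + d / 2).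
have uc : u <= c by rewrite ge_max ac /=; lra.
have cv : c <= v by rewrite le_min cb /=; lra.
have uv : u < v.
  by rewrite lt_min !gt_max ab /=; apply/and3P; split; lra.
have au : a <= u by rewrite le_max lexx.
have vb : v <= b by rewrite ge_min lexx.
have cfs x y : a <= x -> y <= b -> cont_on x y f.
  by move=> ax yb z /andP[xz zy]; apply: cf; rewrite (le_trans ax) // (le_trans zy).
have ge0 x y : a <= x -> y <= b -> 0 <= intg x y f.
  move=> ax yb.
  apply: Rintegral_ge0 => z /=; rewrite in_itv /= => /andP[xz zy].
  by apply: f0; rewrite (le_trans ax) // (le_trans zy).
rewrite (@intg_split a u b) ?(ltW (lt_le_trans uv vb)) //.
rewrite (@intg_split u v b) ?(ltW uv) //; last exact: cfs.
apply: ltr_wpDl; first by apply: ge0 => //; rewrite ltW // (lt_le_trans uv vb).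
apply: ltr_wpDr; first by apply: ge0 => //; rewrite ltW // (le_lt_trans au uv).
apply: (@lt_le_trans _ _ (intg u v (fun=> f c / 2))).
  by rewrite intg_cst ?ltW // mulr_gt0 // subr_gt0.
apply: le_intg; [exact: cont_on_cst|exact: cfs|].
move=> x /andP[ux xv]; apply: hf.
have : c - d / 2 <= u by rewrite le_max lexx orbT.
have : v <= c + d / 2 by rewrite ge_min lexx orbT.
rewrite ltr_norml => *; apply/andP; split; lra.
Qed.

Lemma intg_eq0 a b f : a < b -> cont_on a b f ->
  (forall x, a <= x <= b -> 0 <= f x) -> intg a b f <= 0 ->
  forall x, a <= x <= b -> f x = 0.
Proof.
move=> ab cf f0 fI x xab; apply/eqP; rewrite eq_le f0 // andbT leNgt.
apply/negP => fx; move: fI; rewrite leNgt => /negP; apply.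
by apply: intg_gt0 => //; exists x.
Qed.

End Intervals.

Section Param.
Context {R : realType}.
Local Notation P := (R * R)%type.

Lemma continuous_section (h : P -> R) (t x : R) :
  {for (t, x), continuous h} -> {for x, continuous (fun y => h (t, y))}.
Proof.
move=> ch; apply: (@continuous_at_comp _ _ _ (fun y => (t, y)) h) => //.
exact: (cvg_pair (@cvg_cst _ t _ (nbhs x) _) (@cvg_id _ (nbhs x))).
Qed.

(** Monotonicity of a parameter-dependent integral, up to a divergence term
    that integrates to zero. *)
Lemma intg_param_mono (kap r : P -> R) (T0 t0 t1 L : R) :
  t0 < t1 -> t1 < T0 -> 0 < L ->
  smooth_on [set u : P | u.1 < T0] kap -> smooth_on [set u : P | u.1 < T0] r ->
  (forall t, t < T0 -> r (t, L) = r (t, 0)) ->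
  (forall t x, t0 <= t <= t1 -> 0 <= x <= L ->
    'D_e2 r (t, x) <= 'D_e1 kap (t, x)) ->
  intg 0 L (fun x => kap (t0, x)) <= intg 0 L (fun x => kap (t1, x)).
Proof.
move=> t01 t1T L0 sk sr rper Hd.
have cs (h : P -> R) t : smooth_on [set u : P | u.1 < T0] h -> t < T0 ->
    cont_on 0 L (fun x => h (t, x)).
  by move=> sh tT x _; apply: continuous_section; exact: (@smooth_on_cont R P _ h (t, x) sh tT).
have sdk := smooth_on_derive e1 sk; have sdr := smooth_on_derive e2 sr.
pose Q t := intg 0 L (fun x => kap (t, x)).
pose u0 := t0 - 1; pose v0 := (t1 + T0) / 2.
have v0T : v0 < T0 by rewrite /v0; lra.
have t1v : t1 < v0 by rewrite /v0; lra.
have dline t x : t < T0 -> is_derive t (1 : R) (fun s => kap (s, x)) ('D_e1 kap (t, x)).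
  move=> tT; have := @is_derive_line R P kap (0, x) e1 t.
  have E s : s *: e1 + (0, x) = (s, x) :> P.
    by congr (_, _); rewrite /= /GRing.scale /= ?mulr1 ?mulr0 ?addr0 ?add0r.
  rewrite E => /(_ (@smooth_on_derivable R P _ kap (t, x) e1 sk tT)).
  rewrite (_ : (fun h => kap (h *: e1 + (0, x))) = (fun s => kap (s, x))) //.
  by apply/funext => s; rewrite E.
have [K K0 HK] : exists2 K, 0 <= K & forall t x, t \in `]u0, v0[ -> x \in `[0, L] ->
    `|'D_e1 kap (t, x)| <= K.
  have cpt : compact (`[u0, v0] `*` `[0, L] : set P).
    by apply: compact_setX; exact: segment_compact.
  have cont : {within (`[u0, v0] `*` `[0, L] : set P), continuous ('D_e1 kap)}.
    apply: continuous_in_subspaceT => p; rewrite inE /= => -[].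
    rewrite !in_itv /= => /andP[_ pv] _.
    by apply: (smooth_on_cont sdk); exact: le_lt_trans v0T.
  have [M [Mr HM]] := compact_bounded (continuous_compact cont cpt).
  exists (`|M| + 1); first by rewrite addr_ge0.
  move=> t x tuv xL; apply: (HM (`|M| + 1)).
    by rewrite (le_lt_trans (ler_norm M)) // ltrDl.
  by exists (t, x) => //; split => //=; exact: subset_itv_oo_cc tuv.
have dQ t : t0 <= t <= t1 -> is_derive t (1 : R) Q (intg 0 L (fun x => 'D_e1 kap (t, x))).
  move=> /andP[tt0 tt1].
  have tI : [set` `]u0, v0[] t by rewrite /= in_itv /= (lt_le_trans _ tt0) ?(le_lt_trans tt1) // /u0; lra.
  have int s : [set` `]u0, v0[] s ->
      lebesgue_measure.-integrable `[0, L] (EFin \o (fun x => kap (s, x))).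
    rewrite /= in_itv /= => /andP[_ sv].
    by apply: cont_on_integrable; apply: cs => //; exact: lt_trans v0T.
  have der s x : [set` `]u0, v0[] s -> [set` `[0, L]] x ->
      derivable ((fun s x => kap (s, x)) ^~ x) s 1.
    by rewrite /= in_itv /= => /andP[_ sv] _; case: (dline s x (lt_trans sv v0T)).
  have E s x : s < T0 -> partial1of2 (fun s x => kap (s, x)) s x = 'D_e1 kap (s, x).
    by move=> sT; rewrite partial1of2E; case: (dline s x sT).
  have Gub s x : [set` `]u0, v0[] s -> [set` `[0, L]] x ->
      `|partial1of2 (fun s x => kap (s, x)) s x| <= (fun=> K) x.
    move=> sI xL; rewrite E; first exact: HK.
    by move: sI; rewrite /= in_itv /= => /andP[_ /lt_trans]; apply.
  have intK : lebesgue_measure.-integrable `[0, L] (EFin \o (fun=> K : R)).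
    by apply: cont_on_integrable; exact: cont_on_cst.
  apply: DeriveDef.
    exact: (@derivable_under_integral R _ _ lebesgue_measure _ _ _ _ _ _ tI int der _ (fun=> K0) intK Gub).
  rewrite -derive1E.
  have mI : measurable (`[0, L] : set R) by exact: measurable_itv.
  have H := @differentiation_under_integral R _ _ lebesgue_measure
    _ _ mI _ _ _ tI int der _ (fun=> K0) intK Gub.
  apply: (etrans H); apply: eq_intg => x _.
  by rewrite /= E // (le_lt_trans tt1).
have dQ0 t : t0 <= t <= t1 -> 0 <= intg 0 L (fun x => 'D_e1 kap (t, x)).
  move=> tt; have tT : t < T0 by case/andP: tt => _ /le_lt_trans; apply.
  have r0 : intg 0 L (fun x => 'D_e2 r (t, x)) = 0.
    suff dr x : 0 <= x <= L -> is_derive x (1 : R) (fun x => r (t, x)) ('D_e2 r (t, x)).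
      by rewrite (FTC2 L0 (cs _ _ sdr tT) dr) rper ?subrr.
    move=> _; have := @is_derive_line R P r (t, 0) e2 x.
    have E s : s *: e2 + (t, 0) = (t, s) :> P.
      by congr (_, _); rewrite /= /GRing.scale /= ?mulr1 ?mulr0 ?addr0 ?add0r.
    rewrite E => /(_ (@smooth_on_derivable R P _ r (t, x) e2 sr tT)).
    rewrite (_ : (fun h => r (h *: e2 + (t, 0))) = (fun s => r (t, s))) //.
    by apply/funext => s; rewrite E.
  rewrite -[X in X <= _]r0.
  exact: (le_intg (cs _ _ sdr tT) (cs _ _ sdk tT) (fun x => Hd t x tt)).
have [] := @MVT_segment R Q (fun t => intg 0 L (fun x => 'D_e1 kap (t, x))) t0 t1 (ltW t01).
- by move=> t /subset_itv_oo_cc; rewrite in_itv /=; exact: dQ.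
- apply: continuous_in_subspaceT => t; rewrite inE /= in_itv /= => /dQ[dQt _].
  by apply/differentiable_continuous/derivable1_diffP.
- move=> c; rewrite in_itv /= => cI E; rewrite -subr_ge0 -/(Q t1) -/(Q t0) E.
  by rewrite mulr_ge0 ?dQ0 // subr_ge0 ltW.
Qed.

End Param.

(** * Elementary smooth functions *)

Section Elementary.
Context {R : realType}.
Local Notation P := (R * R)%type.

Lemma derive_R (f : R -> R) (x v : R) : derivable f x 1 ->
  derivable f x v /\ 'D_v f x = v * 'D_1 f x.
Proof.
move=> /derivable1_diffP df; split; first exact: diff_derivable.
by rewrite !deriveE // -[v in LHS]mulr1 -[v * 1]/(v *: (1 : R)) linearZ.
Qed.

Lemma smooth_closed (S : set (R -> R)) :
  (forall f, S f -> (forall x : R, derivable f x (1 : R)) /\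
     forall v : R, S (fun x => v * 'D_1 f x)) ->
  forall f, S f -> smooth_on [set: R] f.
Proof.
move=> HS f Sf; apply/smooth_onP => k; elim: k f Sf => [|k IH] f Sf.
  move=> x _; have [/(_ x) df _] := HS f Sf.
  exact/differentiable_continuous/derivable1_diffP.
have [df Sd] := HS f Sf; split=> [x _|v].
  split; first exact/differentiable_continuous/derivable1_diffP.
  by move=> v; have [] := derive_R v (df x).
apply: (Ck_ext openT _ (IH _ (Sd v))) => x _.
by have [_ ->] := derive_R v (df x).
Qed.

Lemma smooth_expR : smooth_on [set: R] (@expR R).
Proof.
apply: (@smooth_closed [set f | exists c, f = fun x => c * expR x]); last first.
  by exists 1; apply/funext => x; rewrite mul1r.
move=> f [c ->].
have D (x : R) : is_derive x (1 : R) (fun x => c * expR x) (c * expR x).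
  exact: is_deriveZ.
split=> [x|v]; first by case: (D x).
by exists (v * c); apply/funext => x; case: (D x) => _ ->; rewrite mulrA.
Qed.

Lemma smooth_trig (a b : R) : smooth_on [set: R] (fun x => a * sin x + b * cos x).
Proof.
apply: (@smooth_closed [set f | exists a b, f = fun x => a * sin x + b * cos x]); last first.
  by exists a, b.
move=> f [{}a [{}b ->]].
have D (x : R) : is_derive x (1 : R) (fun x => a * sin x + b * cos x)
    (a * cos x + b * - sin x).
  by apply: is_deriveD; exact: is_deriveZ.
split=> [x|v]; first by case: (D x).
by exists (- v * b), (v * a); apply/funext => x; case: (D x) => _ ->; ring.
Qed.

Lemma smooth_sin : smooth_on [set: R] (@sin R).
Proof.
apply: (smooth_on_ext openT _ (smooth_trig 1 0)) => x _.
by rewrite mul1r mul0r addr0.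
Qed.

Lemma smooth_cos : smooth_on [set: R] (@cos R).
Proof.
apply: (smooth_on_ext openT _ (smooth_trig 0 1)) => x _.
by rewrite mul1r mul0r add0r.
Qed.

Lemma smooth_lin {V : normedModType R} (A : set V) (L : {linear V -> R}) :
  continuous L -> smooth_on A L.
Proof.
move=> cL; apply: (smooth_on_sub (@subsetT _ A)); apply/smooth_onP => k.
case: k => [|k]; first by move=> x _; exact: cL.
have D x v : derivable L x v /\ 'D_v L x = L v.
  have dL : differentiable L x by exact: linear_differentiable.
  by split; [exact: diff_derivable|rewrite deriveE // diff_lin].
split=> [x _|v]; first by split; [exact: cL|move=> v; case: (D x v)].
apply: (Ck_ext openT _ (Ck_cst k setT (L v))) => x _.
by case: (D x v).
Qed.

Lemma smooth_fst (A : set P) : smooth_on A (fun p : P => p.1).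
Proof.
apply: (smooth_on_sub (@subsetT _ A)).
apply: (smooth_on_ext openT _ (smooth_lin (@lin2_continuous R 1 0))) => p _.
by rewrite /= /lin2 mul1r mul0r addr0.
Qed.

Lemma smooth_snd (A : set P) : smooth_on A (fun p : P => p.2).
Proof.
apply: (smooth_on_sub (@subsetT _ A)).
apply: (smooth_on_ext openT _ (smooth_lin (@lin2_continuous R 0 1))) => p _.
by rewrite /= /lin2 mul1r mul0r add0r.
Qed.

Lemma smooth_on_comp1 {V : normedModType R} (A : set V) (g : R -> R) (h : V -> R) :
  open A -> smooth_on [set: R] g -> smooth_on A h -> smooth_on A (fun x => g (h x)).
Proof.
move=> oA sg sh.
have s1 : smooth_on [set: P] (fun p => g (lin2 1 0 p + 0)).
  by apply: (smooth_on_affine _ _ sg) => //; exact: lin2_continuous.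
apply: (smooth_on_ext oA _ (smooth_on_comp2 (g := fun y => (h y, 0)) oA openT _ sh (smooth_on_cst A 0) s1)) => //.
by move=> x _ /=; rewrite /lin2 /= mul1r mul0r !addr0.
Qed.

Lemma is_derive_comp1 {V : normedModType R} (g : R -> R) (h : V -> R) (x v : V) (dg dh : R) :
  is_derive (h x) (1 : R) g dg -> is_derive x v h dh ->
  is_derive x v (fun y => g (h y)) (dg * dh).
Proof.
move=> Hg [dh1 dh2]; pose k (s : R) := h (s *: v + x).
have Hk : is_derive (0 : R) (1 : R) k dh.
  by have := @is_derive_line R V h x v 0; rewrite scale0r add0r dh2 => /(_ dh1).
have k0 : k 0 = h x by rewrite /k scale0r add0r.
have Hg' : is_derive (k 0) (1 : R) g dg by rewrite k0.
have Hgk : is_derive (0 : R) (1 : R) (g \o k) (dg * dh).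
  by have := @is_derive1_comp R g k 0 dg dh Hg' Hk.
have dgh : derivable (fun y => g (h y)) x v by apply/derivable1P; case: Hgk.
apply: DeriveDef => //.
have [] := @is_derive_line R V (fun y => g (h y)) x v 0.
  by rewrite scale0r add0r.
by rewrite scale0r add0r => _ <-; case: Hgk.
Qed.

Lemma derive_sum_smooth {V : normedModType R} (A : set V) (x v : V) (I : Type)
    (r : seq I) (F : I -> V -> R) : open A -> A x ->
  (forall i, smooth_on A (F i)) ->
  'D_v (fun y => \sum_(i <- r) F i y) x = \sum_(i <- r) 'D_v (F i) x.
Proof.
move=> oA Ax H; elim: r => [|i r IH].
  rewrite big_nil (_ : (fun=> _) = fun=> 0); first exact: derive_cst.
  by apply/funext => y; rewrite big_nil.
have d1 : derivable (F i) x v by exact: (smooth_on_derivable (H i) Ax).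
have d2 : derivable (fun y => \sum_(j <- r) F j y) x v.
  by apply: (smooth_on_derivable _ Ax); exact: (smooth_on_sum r oA (fun i (_ : true) => H i)).
rewrite big_cons -IH -(deriveD d1 d2).
by apply: (congr1 (fun h => 'D_v h x)); apply/funext => y; rewrite big_cons.
Qed.

Lemma is_derive_lin2 (a b : R) (u v : P) : is_derive u v (lin2 a b) (lin2 a b v).
Proof.
have dL : differentiable (lin2 a b) u by exact: linear_differentiable (@lin2_continuous R a b).
apply: DeriveDef; first exact: diff_derivable.
by rewrite deriveE // diff_lin //; exact: lin2_continuous.
Qed.

Lemma is_derive_fst (u v : P) : is_derive u v (fun u : P => u.1) v.1.
Proof.
have := is_derive_lin2 1 0 u v; rewrite {2}/lin2 mul1r mul0r addr0.
by congr (is_derive _ _ _ _); apply/funext => y; rewrite /lin2 mul1r mul0r addr0.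
Qed.

Lemma is_derive_snd (u v : P) : is_derive u v (fun u : P => u.2) v.2.
Proof.
have := is_derive_lin2 0 1 u v; rewrite {2}/lin2 mul1r mul0r add0r.
by congr (is_derive _ _ _ _); apply/funext => y; rewrite /lin2 mul1r mul0r add0r.
Qed.

End Elementary.
Arguments smooth_fst {R} A.
Arguments smooth_snd {R} A.

(** * Unique continuation for first-order elliptic systems *)

Section Carleman.
Context {R : realType}.
Local Notation P := (R * R)%type.

Lemma derive_elliptic_energy {V : normedModType R} (E be p q p2 q2 : V -> R) (x v : V)
    (E' be' p' q' p2' q2' : R) :
  is_derive x v E E' -> is_derive x v be be' -> is_derive x v p p' ->
  is_derive x v q q' -> is_derive x v p2 p2' -> is_derive x v q2 q2' ->
  'D_v (fun y => E y * (q2 y * p y - p2 y * q y + be y * (p y * p y + q y * q y))) x =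
  E' * (q2 x * p x - p2 x * q x + be x * (p x * p x + q x * q x))
  + E x * (q2' * p x + q2 x * p' - p2' * q x - p2 x * q' + be' * (p x * p x + q x * q x)
      + 2 * be x * (p x * p' + q x * q')).
Proof.
move=> HE Hb Hp Hq Hp2 Hq2.
have := is_deriveM HE (is_deriveD (is_deriveB (is_deriveM Hq2 Hp) (is_deriveM Hp2 Hq))
  (is_deriveM Hb (is_deriveD (is_deriveM Hp Hp) (is_deriveM Hq Hq)))).
by case=> _; rewrite /GRing.scale /= !fctE => ->; ring.
Qed.

Lemma derive_divergence {V : normedModType R} (E p q p1 q1 : V -> R) (x v : V)
    (p' q' p1' q1' : R) :
  is_derive x v E 0 -> is_derive x v p p' ->
  is_derive x v q q' -> is_derive x v p1 p1' -> is_derive x v q1 q1' ->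
  'D_v (fun y => E y * (q1 y * p y - p1 y * q y)) x =
  E x * (q1' * p x + q1 x * p' - p1' * q x - p1 x * q').
Proof.
move=> HE Hp Hq Hp1 Hq1.
have := is_deriveM HE (is_deriveB (is_deriveM Hq1 Hp) (is_deriveM Hp1 Hq)).
by case=> _; rewrite /GRing.scale /= !fctE => ->; ring.
Qed.

Lemma derive_weighted_square {V : normedModType R} (E w : V -> R) (x v : V) (E' w' : R) :
  is_derive x v E E' -> is_derive x v w w' ->
  'D_v (fun y => E y * (w y * w y)) x = E' * (w x * w x) + E x * (2 * (w x * w')).
Proof.
move=> HE Hw; have := is_deriveM HE (is_deriveM Hw Hw).
by case=> _; rewrite /GRing.scale /= !fctE => ->; ring.
Qed.

(** After completing squares, the difference of the two sides is a sum of
    squares: this is what makes the weighted energy monotone. *)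
Lemma carleman_elliptic (E be tau p q p1 q1 p2 q2 p12 q12 : R) : 0 <= E ->
  E * (tau * (p * p + q * q) - ((p1 - q2) ^+ 2 + (q1 + p2) ^+ 2) / 2) <=
  2 * be * E * (q2 * p - p2 * q + be * (p * p + q * q))
  + E * (q12 * p + q2 * p1 - p12 * q - p2 * q1 + tau * (p * p + q * q)
      + 2 * be * (p * p1 + q * q1))
  - E * (q12 * p + q1 * p2 - p12 * q - p1 * q2).
Proof.
move=> E0; rewrite -subr_ge0 (_ : _ - _ = E * (2 * (q2 + be * p + (p1 - q2) / 2) ^+ 2
  + 2 * (- p2 + be * q + (q1 + p2) / 2) ^+ 2)); last by field.
by rewrite mulr_ge0 // addr_ge0 // mulr_ge0 // sqr_ge0.
Qed.

Lemma carleman_transport (E be w w1 : R) : 0 <= E ->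
  E * ((- (2 * be) - 1) * (w * w) - w1 ^+ 2) <=
  - (2 * be * E * (w * w) + E * (2 * (w * w1))).
Proof.
move=> E0; rewrite -subr_ge0 (_ : _ - _ = E * (w - w1) ^+ 2); last by ring.
by rewrite mulr_ge0 // sqr_ge0.
Qed.

(** The weight [exp (tau (t - T)^2)] is decreasing in [t] before [T] with a
    convex exponent: convexity controls the elliptic components and the decay
    controls the transported ones.  The weighted energy is monotone, vanishes
    at [t0], and would be negative at [t1] for large [tau]. *)
Lemma strip_unique_continuation (I J : finType) (p q : I -> P -> R) (w : J -> P -> R)
    (T0 t0 t1 K L : R) : t0 < t1 -> t1 < T0 -> 0 < L -> 0 <= K ->
  let A := [set u : P | u.1 < T0] in
  (forall i, smooth_on A (p i)) -> (forall i, smooth_on A (q i)) ->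
  (forall j, smooth_on A (w j)) ->
  (forall i t x, p i (t, x + L) = p i (t, x)) ->
  (forall i t x, q i (t, x + L) = q i (t, x)) ->
  (forall x, (forall i, p i (t0, x) = 0 /\ q i (t0, x) = 0) /\
     forall j, w j (t0, x) = 0) ->
  let S u := \sum_i (p i u * p i u + q i u * q i u) + \sum_j w j u * w j u in
  (forall t x, t0 <= t <= t1 -> 0 <= x <= L ->
     (forall i, ('D_e1 (p i) (t, x) - 'D_e2 (q i) (t, x)) ^+ 2
         + ('D_e1 (q i) (t, x) + 'D_e2 (p i) (t, x)) ^+ 2 <= K * S (t, x)) /\
     forall j, ('D_e1 (w j) (t, x)) ^+ 2 <= K * S (t, x)) ->
  forall x, 0 <= x <= L ->
    (forall i, p i (t1, x) = 0 /\ q i (t1, x) = 0) /\ forall j, w j (t1, x) = 0.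
Proof.
move=> t01 t1T L0 K0 A sp sq sw pper qper z0 S HK.
have oA : open A.
  rewrite (_ : A = fst @^-1` [set t | t < T0]) //.
  by apply: open_comp; [move=> u _; exact: cvg_fst|exact: open_lt].
pose T := t1 + 1.
pose m t x := \sum_i (p i (t, x) * p i (t, x) + q i (t, x) * q i (t, x)).
pose l t x := \sum_i ('D_e2 (q i) (t, x) * p i (t, x) - 'D_e2 (p i) (t, x) * q i (t, x)).
pose W t x := \sum_j w j (t, x) * w j (t, x).
have cs (h : P -> R) t : smooth_on A h -> t < T0 -> cont_on 0 L (fun x => h (t, x)).
  by move=> sh tT x _; apply: continuous_section; exact: (@smooth_on_cont R P _ h (t, x) sh tT).
have sM (f g : P -> R) : smooth_on A f -> smooth_on A g -> smooth_on A (fun u => f u * g u).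
  exact: smooth_onM.
have sm : smooth_on A (fun u => m u.1 u.2).
  apply: (smooth_on_ext oA _ (smooth_on_sum (index_enum I) oA (fun i (_ : true) =>
    smooth_onD oA (sM _ _ (sp i) (sp i)) (sM _ _ (sq i) (sq i))))).
  by move=> [t x] _.
have sl : smooth_on A (fun u => l u.1 u.2).
  apply: (smooth_on_ext oA _ (smooth_on_sum (index_enum I) oA (fun i (_ : true) =>
    smooth_onB oA (sM _ _ (smooth_on_derive e2 (sq i)) (sp i))
      (sM _ _ (smooth_on_derive e2 (sp i)) (sq i))))).
  by move=> [t x] _.
have sW : smooth_on A (fun u => W u.1 u.2).
  apply: (smooth_on_ext oA _ (smooth_on_sum (index_enum J) oA (fun j (_ : true) =>
    sM _ _ (sw j) (sw j)))).
  by move=> [t x] _.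
have cm := cs _ _ sm t1T; have cl := cs _ _ sl t1T; have cW := cs _ _ sW t1T.
rewrite /= in cm cl cW.
pose tau0 : R := (#|I|%:R + #|J|%:R) * K + 1.
have tau01 : 1 <= tau0 by rewrite lerDr mulr_ge0 // addr_ge0.
have key tau : tau0 <= tau ->
    tau * intg 0 L (m t1) + intg 0 L (W t1) <= intg 0 L (l t1).
  move=> tautau; have tau1 : 1 <= tau by rewrite (le_trans tau01).
  pose be (u : P) := tau * (u.1 - T).
  pose E (u : P) := expR (tau * ((u.1 - T) * (u.1 - T))).
  have s1 : smooth_on A (fun u : P => u.1 - T).
    exact: (smooth_onB oA (smooth_fst A) (smooth_on_cst A T)).
  have sbe : smooth_on A be by exact: (sM _ _ (smooth_on_cst A tau) s1).
  have sE : smooth_on A E.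
    apply: (smooth_on_comp1 oA smooth_expR).
    exact: (sM _ _ (smooth_on_cst A tau) (sM _ _ s1 s1)).
  have d1 (u v : P) : is_derive u v (fun u : P => u.1 - T) v.1.
    by have := is_deriveB (is_derive_fst u v) (is_derive_cst T u v); rewrite subr0.
  have dbe (u v : P) : is_derive u v be (tau * v.1) by exact: is_deriveZ.
  have dE (u v : P) : is_derive u v E (2 * be u * v.1 * E u).
    have := is_derive_comp1 (is_derive_expR _) (is_deriveZ tau (is_deriveM (d1 u v) (d1 u v))).
    move=> H; apply: (is_derive_eq H).
    by rewrite /E /be /GRing.scale /= !fctE /GRing.scale /=; ring.
  have E0 u : 0 <= E u by rewrite ltW // expR_gt0.
  have dd (h : P -> R) (u v : P) : smooth_on A h -> A u -> is_derive u v h ('D_v h u).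
    by move=> sh Au; apply: derivableP; exact: (smooth_on_derivable sh Au).
  pose fI i (u : P) := E u * ('D_e2 (q i) u * p i u - 'D_e2 (p i) u * q i u
    + be u * (p i u * p i u + q i u * q i u)).
  pose fJ j (u : P) := E u * (w j u * w j u).
  pose rI i (u : P) := E u * ('D_e1 (q i) u * p i u - 'D_e1 (p i) u * q i u).
  have sfI i : smooth_on A (fI i).
    exact: (sM _ _ sE (smooth_onD oA (smooth_onB oA
      (sM _ _ (smooth_on_derive e2 (sq i)) (sp i)) (sM _ _ (smooth_on_derive e2 (sp i)) (sq i)))
      (sM _ _ sbe (smooth_onD oA (sM _ _ (sp i) (sp i)) (sM _ _ (sq i) (sq i)))))).
  have sfJ j : smooth_on A (fJ j) by exact: (sM _ _ sE (sM _ _ (sw j) (sw j))).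
  have srI i : smooth_on A (rI i).
    exact: (sM _ _ sE (smooth_onB oA
      (sM _ _ (smooth_on_derive e1 (sq i)) (sp i)) (sM _ _ (smooth_on_derive e1 (sp i)) (sq i)))).
  pose kap (u : P) := \sum_i fI i u - \sum_j fJ j u.
  pose r (u : P) := \sum_i rI i u.
  have sfIs := smooth_on_sum (index_enum I) oA (fun i (_ : true) => sfI i).
  have sfJs := smooth_on_sum (index_enum J) oA (fun i (_ : true) => sfJ i).
  have sk : smooth_on A kap by exact: (smooth_onB oA sfIs sfJs).
  have sr : smooth_on A r by exact: (smooth_on_sum (index_enum I) oA (fun i (_ : true) => srI i)).
  have EA u : E u = E (u.1, 0) by [].
  have := @intg_param_mono R kap r T0 t0 t1 L t01 t1T L0 sk sr.
  have -> : intg 0 L (fun x => kap (t0, x)) = 0.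
    rewrite (@eq_intg _ _ _ _ (fun=> 0)) ?intg_cst ?mul0r ?ltW // => x _.
    have [z1 z2] := z0 x; rewrite /kap !big1 ?subrr // => [j _|i _].
      by rewrite /fJ z2 !mulr0.
    by rewrite /fI; have [-> ->] := z1 i; rewrite !(mulr0, subr0, addr0).
  have -> : intg 0 L (fun x => kap (t1, x))
      = E (t1, 0) * (intg 0 L (l t1) - tau * intg 0 L (m t1) - intg 0 L (W t1)).
    have ctm : cont_on 0 L (fun x => tau * m t1 x).
      exact: (cont_onM (@cont_on_cst R 0 L tau) cm).
    have clm : cont_on 0 L (fun x => l t1 x - tau * m t1 x).
      by move=> x xL; exact: (continuousB (cl x xL) (ctm x xL)).
    have clmW : cont_on 0 L (fun x => l t1 x - tau * m t1 x - W t1 x).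
      by move=> x xL; exact: (continuousB (clm x xL) (cW x xL)).
    rewrite -(intgZ tau cm) -(intgB cl ctm) -(intgB clm cW) -(intgZ _ clmW).
    apply: eq_intg => x _; rewrite /kap /fI /fJ -!mulr_sumr EA /= -mulrBr.
    have -> : be (t1, x) = - tau by rewrite /be /T /=; ring.
    by rewrite big_split /= -mulr_sumr mulNr.
  rewrite pmulr_rge0 ?expR_gt0 // => H; suff H' : 0 <= intg 0 L (l t1)
      - tau * intg 0 L (m t1) - intg 0 L (W t1) by move: H'; lra.
  apply: H.
    move=> t tT; rewrite /r; apply: eq_bigr => i _.
    have per (h : P -> R) : (forall t x, h (t, x + L) = h (t, x)) ->
        h (t, L) = h (t, 0) /\ 'D_e1 h (t, L) = 'D_e1 h (t, 0).
      move=> hper; split; first by rewrite -(hper t 0) add0r.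
      pose idl : {linear P -> P} := idfun.
      have := @derive_affine R P P h idl (0, L) (t, 0) e1.
      have -> : idl (t, 0) + (0, L) = (t, L) :> P.
        by congr (_, _); rewrite /= ?addr0 ?add0r.
      have -> : (fun y => h (idl y + (0, L))) = h.
        apply/funext => -[s y]; rewrite -(hper s y); congr h.
        by congr (_, _); rewrite /= ?addr0.
      by move=> ->.
    rewrite /rI [E (t, L)]EA [E (t, 0)]EA /=.
    have [-> ->] := per _ (pper i); have [-> ->] := per _ (qper i).
    by [].
  move=> t x tt xL; have Au : A (t, x) by case/andP: tt => _ /le_lt_trans; apply.
  set u : P := (t, x).
  have Dk : 'D_e1 kap u = \sum_i 'D_e1 (fI i) u - \sum_j 'D_e1 (fJ j) u.
    rewrite -(derive_sum_smooth e1 (index_enum I) oA Au sfI).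
    rewrite -(derive_sum_smooth e1 (index_enum J) oA Au sfJ).
    have := deriveB (smooth_on_derivable sfIs Au) (smooth_on_derivable sfJs Au).
    by apply.
  rewrite Dk -subr_ge0 addrAC (derive_sum_smooth e2 (index_enum I) oA Au srI).
  rewrite -sumrB.
  have F1 i : E u * (tau * (p i u * p i u + q i u * q i u)
      - (('D_e1 (p i) u - 'D_e2 (q i) u) ^+ 2 + ('D_e1 (q i) u + 'D_e2 (p i) u) ^+ 2) / 2)
      <= 'D_e1 (fI i) u - 'D_e2 (rI i) u.
    have dE0 : is_derive u e2 E 0.
      by apply: (is_derive_eq (dE u e2)); rewrite /= mulr0 mul0r.
    have dE1 : is_derive u e1 E (2 * be u * E u).
      by apply: (is_derive_eq (dE u e1)); rewrite /= mulr1.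
    have db1 : is_derive u e1 be tau.
      by apply: (is_derive_eq (dbe u e1)); rewrite /= mulr1.
    rewrite /fI (derive_elliptic_energy dE1 db1 (dd _ u e1 (sp i) Au) (dd _ u e1 (sq i) Au)
      (dd _ u e1 (smooth_on_derive e2 (sp i)) Au) (dd _ u e1 (smooth_on_derive e2 (sq i)) Au)).
    rewrite /rI (derive_divergence dE0 (dd _ u e2 (sp i) Au) (dd _ u e2 (sq i) Au)
      (dd _ u e2 (smooth_on_derive e1 (sp i)) Au) (dd _ u e2 (smooth_on_derive e1 (sq i)) Au)).
    rewrite (Schwarz e2 e1 oA (sp i) Au) (Schwarz e2 e1 oA (sq i) Au).
    exact: carleman_elliptic.
  have F2 j : E u * ((- (2 * be u) - 1) * (w j u * w j u) - ('D_e1 (w j) u) ^+ 2)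
      <= - 'D_e1 (fJ j) u.
    have dE1 : is_derive u e1 E (2 * be u * E u).
      by apply: (is_derive_eq (dE u e1)); rewrite /= mulr1.
    rewrite /fJ (derive_weighted_square dE1 (dd _ u e1 (sw j) Au)).
    exact: carleman_transport.
  rewrite -[- \sum_(j : J) _]sumrN.
  apply: (le_trans _ (lerD (ler_sum _ (fun i _ => F1 i)) (ler_sum _ (fun j _ => F2 j)))).
  rewrite -!mulr_sumr -mulrDr mulr_ge0 //.
  have [G1 G2] := HK t x tt xL.
  rewrite -/u in G1 G2.
  set c := K * S u in G1 G2.
  set Mu := \sum_i (p i u * p i u + q i u * q i u).
  set Wu := \sum_j w j u * w j u.
  have cE : c = K * (Mu + Wu) by [].
  have M0 : 0 <= Mu by apply: sumr_ge0 => i _; rewrite addr_ge0 // -expr2 sqr_ge0.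
  have W0 : 0 <= Wu by apply: sumr_ge0 => j _; rewrite -expr2 sqr_ge0.
  have c0 : 0 <= c by rewrite cE mulr_ge0 // addr_ge0.
  have Sc (U : finType) : #|U|%:R * c = \sum_(i : U) c.
    by rewrite sumr_const mulr_natl.
  have H1 : tau * Mu - #|I|%:R * c <= \sum_i (tau * (p i u * p i u + q i u * q i u)
      - (('D_e1 (p i) u - 'D_e2 (q i) u) ^+ 2 + ('D_e1 (q i) u + 'D_e2 (p i) u) ^+ 2) / 2).
    rewrite sumrB -mulr_sumr lerB // Sc.
    apply: ler_sum => i _; apply: le_trans (G1 i).
    by rewrite ler_pdivrMr // ler_peMr ?ler1n // addr_ge0 // sqr_ge0.
  have beu : be u <= - tau.
    by rewrite /be /T /u /=; case/andP: tt => _ tt1; nra.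
  have H2 : (2 * tau - 1) * Wu - #|J|%:R * c <=
      \sum_j ((- (2 * be u) - 1) * (w j u * w j u) - ('D_e1 (w j) u) ^+ 2).
    rewrite mulr_sumr Sc -sumrB.
    apply: ler_sum => j _; apply: lerB; last exact: G2.
    by apply: ler_wpM2r; [rewrite -expr2 sqr_ge0|lra].
  apply: (le_trans _ (lerD H1 H2)).
  have h1 : 0 <= (tau - tau0) * Mu by rewrite mulr_ge0 // subr_ge0.
  have h2 : 0 <= (tau - tau0) * Wu by rewrite mulr_ge0 // subr_ge0.
  have h3 : 0 <= (tau - 1) * Wu by rewrite mulr_ge0 // subr_ge0.
  rewrite (_ : _ + _ = (tau - tau0) * Mu + (tau - tau0) * Wu + (tau - 1) * Wu + Mu + Wu).
    by rewrite !addr_ge0.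
  by rewrite cE /tau0; ring.
have m0 : forall x, 0 <= x <= L -> m t1 x = 0.
  apply: intg_eq0 => //.
    by move=> x _; apply: sumr_ge0 => i _; rewrite addr_ge0 // -expr2 sqr_ge0.
  rewrite leNgt; apply/negP => mpos.
  pose tau := Num.max tau0 ((intg 0 L (l t1) + 1) / intg 0 L (m t1)).
  have W0 : 0 <= intg 0 L (W t1).
    by apply: Rintegral_ge0 => x _; apply: sumr_ge0 => j _; rewrite -expr2 sqr_ge0.
  have := key tau; rewrite le_max lexx => /(_ isT).
  have : (intg 0 L (l t1) + 1) / intg 0 L (m t1) <= tau by rewrite le_max lexx orbT.
  by rewrite ler_pdivrMr // => h1 h2; move: (le_trans h1 (le_trans (ler_wpDr W0 (lexx _)) h2)); lra.
have pq0 x : 0 <= x <= L -> forall i, p i (t1, x) = 0 /\ q i (t1, x) = 0.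
  move=> xL i; have := m0 x xL.
  move=> /psumr_eq0P => /(_ _ i isT) H.
  have : p i (t1, x) * p i (t1, x) + q i (t1, x) * q i (t1, x) = 0.
    by apply: H => k _; rewrite addr_ge0 // -expr2 sqr_ge0.
  move/eqP; rewrite paddr_eq0 -?expr2 ?sqr_ge0 // !sqrf_eq0.
  by move=> /andP[/eqP -> /eqP ->].
have W0 : forall x, 0 <= x <= L -> W t1 x = 0.
  apply: intg_eq0 => //.
    by move=> x _; apply: sumr_ge0 => j _; rewrite -expr2 sqr_ge0.
  have := key _ (lexx tau0).
  rewrite (@eq_intg _ _ _ (m t1) (fun=> 0)) //.
  rewrite (@eq_intg _ _ _ (l t1) (fun=> 0)); last first.
    move=> x xL; apply: big1 => i _.
    by have [-> ->] := pq0 x xL i; rewrite !mulr0 subrr.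
  by rewrite (intg_cst 0 (ltW L0)) !mul0r mulr0 add0r.
move=> x xL; split; first exact: pq0.
move=> j; have := W0 x xL.
move=> /psumr_eq0P => /(_ _ j isT) H.
have : w j (t1, x) * w j (t1, x) = 0 by apply: H => k _; rewrite -expr2 sqr_ge0.
by move/eqP; rewrite mulf_eq0 orbb => /eqP.
Qed.

End Carleman.

Section Disc.
Context {R : realType}.
Local Notation P := (R * R)%type.

Definition sqdist (z0 z : P) : R := (z.1 - z0.1) ^+ 2 + (z.2 - z0.2) ^+ 2.
Definition disc (z0 : P) (r : R) : set P := [set z | sqdist z0 z < r ^+ 2].

Lemma sqdist_ge0 z0 z : 0 <= sqdist z0 z.
Proof. by rewrite addr_ge0 // sqr_ge0. Qed.

Lemma smooth_sqdist z0 (A : set P) : open A -> smooth_on A (sqdist z0).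
Proof.
move=> oA.
have s1 := smooth_onB oA (smooth_fst A) (smooth_on_cst A z0.1).
have s2 := smooth_onB oA (smooth_snd A) (smooth_on_cst A z0.2).
exact: (smooth_onD oA (smooth_onM oA s1 s1) (smooth_onM oA s2 s2)).
Qed.

Lemma disc_open z0 r : open (disc z0 r).
Proof.
rewrite (_ : disc z0 r = sqdist z0 @^-1` [set t | t < r ^+ 2]) //.
apply: open_comp; last exact: open_lt.
by move=> z _; exact: (smooth_on_cont (smooth_sqdist z0 openT)).
Qed.

Lemma disc_center z0 r : 0 < r -> disc z0 r z0.
Proof. by move=> r0; rewrite /disc /= /sqdist !subrr expr0n addr0 exprn_gt0. Qed.

Lemma disc_sub z0 r1 r2 : 0 <= r1 -> r1 <= r2 -> disc z0 r1 `<=` disc z0 r2.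
Proof.
move=> r10 r12 z /= /lt_le_trans; apply.
by rewrite ler_sqr ?nnegrE // (le_trans r10).
Qed.

Lemma polar_angle (a b : R) : a ^+ 2 + b ^+ 2 = 1 ->
  exists2 x, 0 <= x <= pi *+ 2 & cos x = a /\ sin x = b.
Proof.
move=> ab; have ha : -1 <= a <= 1.
  have : a ^+ 2 <= 1 by rewrite -ab lerDl sqr_ge0.
  by move=> a1; apply/andP; split; nra.
have aI : a \in `[-1, 1] by rewrite in_itv.
have p0 := @pi_ge0 R.
have := acos_ge0 ha; have := acos_lepi ha; have ca := acosK aI.
have sa := sin_acos ha.
have bE : Num.sqrt (1 - a ^+ 2) = `|b|.
  by rewrite -ab addrC addKr sqrtr_sqr.
move=> h1 h2; have [b0|b0] := leP 0 b.
  exists (acos a); first by rewrite h2 (le_trans h1) // mulr2n lerDl.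
  by rewrite ca sa bE ger0_norm.
exists (pi *+ 2 - acos a).
  by rewrite subr_ge0 gerBl h2 (le_trans h1) // mulr2n lerDl.
rewrite addrC cosD2pi sinD2pi cosN sinN ca sa bE ltr0_norm ?opprK //.
Qed.

(** In the coordinates [z = z0 + exp (t + i x)] the Cauchy-Riemann operator stays
    elliptic up to a factor, the radial derivative becomes [d/dt], and a small
    circle around [z0] becomes the line [t = t0] on which everything vanishes:
    [strip_unique_continuation] applies, with period [2 pi] in [x]. *)
Lemma disc_unique_continuation (I J : finType) (p q : I -> P -> R) (w : J -> P -> R)
    (Kf : P -> R) (z0 : P) (r0 r : R) : 0 < r0 -> 0 < r ->
  let D := disc z0 r in
  (forall i, smooth_on D (p i)) -> (forall i, smooth_on D (q i)) ->
  (forall j, smooth_on D (w j)) ->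
  (forall z, D z -> {for z, continuous Kf}) ->
  let vanish z := (forall i, p i z = 0 /\ q i z = 0) /\ forall j, w j z = 0 in
  (forall z, disc z0 r0 z -> vanish z) ->
  let S z := \sum_i (p i z * p i z + q i z * q i z) + \sum_j w j z * w j z in
  (forall z, D z ->
     (forall i, ('D_e1 (p i) z - 'D_e2 (q i) z) ^+ 2
         + ('D_e1 (q i) z + 'D_e2 (p i) z) ^+ 2 <= Kf z * S z) /\
     forall j, ('D_(z - z0) (w j) z) ^+ 2 <= Kf z * S z) ->
  forall z, D z -> vanish z.
Proof.
move=> r00 rr0 D sp sq sw cK vanish V0 S HK z Dz.
have [/V0//|zr0] := ltP (sqdist z0 z) (r0 ^+ 2).
have d0 : 0 < sqdist z0 z by rewrite (lt_le_trans _ zr0) // exprn_gt0.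
set rho := Num.sqrt (sqdist z0 z).
have rho0 : 0 < rho by rewrite sqrtr_gt0.
have rho2 : rho ^+ 2 = sqdist z0 z by rewrite sqr_sqrtr // sqdist_ge0.
have [x xI [cx sx]] : exists2 x : R, 0 <= x <= pi *+ 2 &
    cos x = (z.1 - z0.1) / rho /\ sin x = (z.2 - z0.2) / rho.
  apply: polar_angle; rewrite !exprMn -mulrDl exprVn rho2.
  by rewrite -/(sqdist z0 z) divff // gt_eqF.
have [t1 et1] := expR_total rho0.
have [T0 eT0] := expR_total rr0.
pose t0 := ln (r0 / 2).
have et0 : expR t0 = r0 / 2 by rewrite lnK // posrE divr_gt0.
have rhor : rho < r by rewrite -(@ltr_pXn2r _ 2) ?nnegrE ?ltW // rho2.
have r0rho : r0 <= rho by rewrite -ler_sqr ?nnegrE ?(ltW r00) ?(ltW rho0) // rho2.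
have t01 : t0 < t1 by rewrite -ltr_expR et0 et1; lra.
have t1T : t1 < T0 by rewrite -ltr_expR et1 eT0.
pose A := [set u : P | u.1 < T0].
have oA : open A.
  rewrite (_ : A = fst @^-1` [set t | t < T0]) //.
  by apply: open_comp; [move=> u _; exact: cvg_fst|exact: open_lt].
pose gam (u : P) : P := (z0.1 + expR u.1 * cos u.2, z0.2 + expR u.1 * sin u.2).
have dgam u : sqdist z0 (gam u) = (expR u.1) ^+ 2.
  rewrite /sqdist /gam /= [_ + _ - _]addrC addKr [X in _ + X ^+ 2]addrC addKr.
  by rewrite !exprMn -mulrDr cos2Dsin2 mulr1.
have gamD u : A u -> D (gam u).
  move=> Au; rewrite /D /disc /= dgam -eT0 ltr_pXn2r ?nnegrE ?ltW ?expR_gt0 //.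
  by rewrite ltr_expR.
have sexp : smooth_on A (fun u => expR u.1).
  exact: (smooth_on_comp1 oA smooth_expR (smooth_fst A)).
have scos : smooth_on A (fun u => cos u.2).
  exact: (smooth_on_comp1 oA smooth_cos (smooth_snd A)).
have ssin : smooth_on A (fun u => sin u.2).
  exact: (smooth_on_comp1 oA smooth_sin (smooth_snd A)).
have sg1 : smooth_on A (fun u => (gam u).1).
  exact: (smooth_onD oA (smooth_on_cst A z0.1) (smooth_onM oA sexp scos)).
have sg2 : smooth_on A (fun u => (gam u).2).
  exact: (smooth_onD oA (smooth_on_cst A z0.2) (smooth_onM oA sexp ssin)).
have oD : open D := @disc_open z0 r.
have scomp (f : P -> R) : smooth_on D f -> smooth_on A (f \o gam).
  by move=> sf; exact: (smooth_on_comp2 oA oD gamD sg1 sg2 sf).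
have dexp (u v : P) : is_derive u v (fun u : P => expR u.1) (expR u.1 * v.1).
  exact: (is_derive_comp1 (is_derive_expR _) (is_derive_fst u v)).
have dcos (u v : P) : is_derive u v (fun u : P => cos u.2) (- sin u.2 * v.2).
  exact: (is_derive_comp1 (is_derive_cos _) (is_derive_snd u v)).
have dsin (u v : P) : is_derive u v (fun u : P => sin u.2) (cos u.2 * v.2).
  exact: (is_derive_comp1 (is_derive_sin _) (is_derive_snd u v)).
have dg1 (u v : P) : is_derive u v (fun u => (gam u).1)
    (expR u.1 * cos u.2 * v.1 - expR u.1 * sin u.2 * v.2).
  have H := is_deriveD (is_derive_cst z0.1 u v) (is_deriveM (dexp u v) (dcos u v)).
  by apply: (is_derive_eq H); rewrite /GRing.scale /=; ring.
have dg2 (u v : P) : is_derive u v (fun u => (gam u).2)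
    (expR u.1 * sin u.2 * v.1 + expR u.1 * cos u.2 * v.2).
  have H := is_deriveD (is_derive_cst z0.2 u v) (is_deriveM (dexp u v) (dsin u v)).
  by apply: (is_derive_eq H); rewrite /GRing.scale /=; ring.
have Dcomp (f : P -> R) (u : P) : smooth_on D f -> A u ->
    let X := expR u.1 * cos u.2 in let Y := expR u.1 * sin u.2 in
    'D_e1 (f \o gam) u = X * 'D_e1 f (gam u) + Y * 'D_e2 f (gam u) /\
    'D_e2 (f \o gam) u = - Y * 'D_e1 f (gam u) + X * 'D_e2 f (gam u).
  move=> sf Au X Y; have df := smooth_differentiable oD sf (gamD u Au).
  have [d11 E11] := dg1 u e1; have [d12 E12] := dg1 u e2.
  have [d21 E21] := dg2 u e1; have [d22 E22] := dg2 u e2.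
  have [_ ->] := derive_comp2 df d11 d21; have [_ ->] := derive_comp2 df d12 d22.
  rewrite E11 E12 E21 E22 /= -/X -/Y.
  by rewrite !mulr1 !mulr0 !subr0 !addr0 !add0r ?sub0r.
have gz : gam (t1, x) = z.
  rewrite /gam /= et1 cx sx !(mulrC rho) !divfK ?gt_eqF //.
  by rewrite ![_ + (_ - _)]addrC !subrK -surjective_pairing.
have L0 : (0 : R) < pi *+ 2 by rewrite mulrn_wgt0 // pi_gt0.
have tT t : t0 <= t <= t1 -> t < T0 by case/andP => _ /le_lt_trans; apply.
have [K K0 HKf] : exists2 K, 0 <= K & forall t x, t0 <= t <= t1 -> 0 <= x <= pi *+ 2 ->
    Kf (gam (t, x)) * (expR t) ^+ 2 <= K /\ Kf (gam (t, x)) <= K.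
  have cpt : compact (`[t0, t1] `*` `[0, pi *+ 2] : set P).
    by apply: compact_setX; exact: segment_compact.
  pose h (u : P) := (Kf (gam u) * Kf (gam u) + 1) * (expR u.1 * expR u.1 + 1).
  have cont : {within (`[t0, t1] `*` `[0, pi *+ 2] : set P), continuous h}.
    apply: continuous_in_subspaceT => u; rewrite inE /= => -[].
    rewrite !in_itv /= => /tT Au _.
    have ce := smooth_on_cont sexp Au.
    have cg : {for u, continuous gam}.
      exact: (cvg_pair (smooth_on_cont sg1 Au) (smooth_on_cont sg2 Au)).
    have ck : {for u, continuous (fun u => Kf (gam u))}.
      exact: (continuous_at_comp cg (cK _ (gamD u Au))).
    have c1 : {for u, continuous (fun _ : P => 1 : R)} by exact: cvg_cst.
    exact: (continuousM (continuousD (continuousM ck ck) c1)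
      (continuousD (continuousM ce ce) c1)).
  have [M [Mr HM]] := compact_bounded (continuous_compact cont cpt).
  exists (`|M| + 1); first by rewrite addr_ge0.
  move=> t y tI yI.
  have hK : h (t, y) <= `|M| + 1.
    apply: le_trans (ler_norm _) _; apply: (HM (`|M| + 1)).
      by rewrite (le_lt_trans (ler_norm M)) // ltrDl.
    by exists (t, y) => //; split; rewrite /= in_itv.
  move: hK; rewrite /h /=; set k := Kf _; set s := expR t.
  have := sqr_ge0 (k - 1); have := sqr_ge0 k; have := sqr_ge0 s.
  rewrite !expr2 => s0 k0 k1 hK; split; apply: le_trans hK; first nra.
  by nra.
have := @strip_unique_continuation R I J (fun i => p i \o gam) (fun i => q i \o gam)
  (fun j => w j \o gam) T0 t0 t1 K (pi *+ 2) t01 t1T L0 K0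
  (fun i => scomp _ (sp i)) (fun i => scomp _ (sq i)) (fun j => scomp _ (sw j)).
have per t y : gam (t, y + pi *+ 2) = gam (t, y).
  by rewrite /gam /= cosD2pi sinD2pi.
move=> H; rewrite -gz; apply: (H _ _ _ _ x xI) => {H}.
- by move=> i t y /=; rewrite per.
- by move=> i t y /=; rewrite per.
- move=> y; apply: V0; rewrite /disc /= dgam /= et0.
  by rewrite ltr_pXn2r ?nnegrE ?ltW ?divr_gt0 //; lra.
move=> t y tI yI; have Au : A (t, y) by exact: tT.
have [H1 H2] := HK _ (gamD _ Au).
have S0 : 0 <= S (gam (t, y)).
  by rewrite addr_ge0 //; apply: sumr_ge0 => k _; rewrite ?addr_ge0 // -expr2 sqr_ge0.
have cs1 := cos2Dsin2 y.
have fin c : c <= Kf (gam (t, y)) * S (gam (t, y)) -> expR t ^+ 2 * c <= K * S (gam (t, y)).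
  move=> cK'; apply: (@le_trans _ _ (expR t ^+ 2 * (Kf (gam (t, y)) * S (gam (t, y))))).
    by rewrite ler_wpM2l // sqr_ge0.
  by rewrite mulrA ler_wpM2r // mulrC; have [] := HKf t y tI yI.
split=> [i|j].
  have [-> ->] := Dcomp _ _ (sp i) Au; have [-> ->] := Dcomp _ _ (sq i) Au.
  apply: le_trans (fin _ (H1 i)); rewrite /=.
  set a := 'D_e1 (p i) _; set b := 'D_e2 (p i) _; set c := 'D_e1 (q i) _; set d := 'D_e2 (q i) _.
  rewrite [X in X <= _](_ : _ = expR t ^+ 2 * (((a - d) ^+ 2 + (c + b) ^+ 2) * (cos y ^+ 2 + sin y ^+ 2))).
    by rewrite cs1 mulr1.
  by ring.
have [-> _] := Dcomp _ _ (sw j) Au.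
have E : gam (t, y) - z0 = (expR t * cos y, expR t * sin y).
  by congr (_, _); rewrite /= addrC addKr.
have H3 := H2 j; rewrite E in H3.
rewrite (differentiable_dir _ (smooth_differentiable oD (sw j) (gamD _ Au))) /= in H3.
apply: le_trans H3 _; rewrite ler_wpM2r //.
by have [] := HKf t y tI yI.
Qed.
End Disc.

(** * Linear differential equations depending on parameters *)

Section Primitive.
Context {R : realType}.
Implicit Types (f F : R -> R).

Lemma is_derive_cont F (x df : R) : is_derive x (1 : R) F df -> {for x, continuous F}.
Proof. by case=> dF _; apply/differentiable_continuous/derivable1_diffP. Qed.

Lemma exists_primitive f : continuous f ->
  exists F, F 0 = 0 /\ forall x, is_derive x (1 : R) F (f x).
Proof.
move=> cf; have cfab a b : cont_on a b f by move=> x _; exact: cf.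
pose F x := intg (- (`|x| + 1)) x f - intg (- (`|x| + 1)) 0 f.
have FE b x : b <= - (`|x| + 1) -> F x = intg b x f - intg b 0 f.
  move=> bx; have n0 : 0 <= `|x| by [].
  have nx : - `|x| <= x by rewrite lerNl -normrN ler_norm.
  have h1 : - (`|x| + 1) <= x by apply: le_trans nx; rewrite lerN2 lerDl.
  have h2 : - (`|x| + 1) <= 0 by rewrite oppr_le0 addr_ge0.
  rewrite (intg_split bx h1 (cfab _ _)) (intg_split bx h2 (cfab _ _)).
  by rewrite /F; ring.
exists F; split; first by rewrite /F subrr.
move=> x; pose b := - (`|x| + 2).
have bx : b < x.
  have nx : - `|x| <= x by rewrite lerNl -normrN ler_norm.
  by apply: lt_le_trans nx; rewrite ltrN2 ltrDl.
have x1 : x < x + 1 by rewrite ltrDl.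
have := @continuous_FTC1_closed R f b x (x + 1) x1 (cont_on_integrable (cfab _ _)) bx (cf x).
case=> dG EG.
have H : is_derive x (1 : R) (fun y => intg b y f - intg b 0 f) (f x).
  have H1 : is_derive x (1 : R) (fun y => intg b y f) (f x).
    by apply: DeriveDef; [exact: dG|rewrite -EG derive1E].
  exact: (is_derive_eq (is_deriveB H1 (is_derive_cst (intg b 0 f) x 1)) (subr0 _)).
apply: near_eq_is_derive H.
near=> y; rewrite (FE b) //.
have xy : `|x - y| < 1 by near: y; exact: nbhsx_ballx.
rewrite /b lerN2 (_ : 2 = 1 + 1 :> R) // addrA lerD2r.
rewrite -(subrKC x y) (le_trans (ler_normD _ _)) // lerD2l distrC ltW //.
Unshelve. all: by end_near. Qed.

Lemma mono0 (g dg : R -> R) (s : R) : 0 <= s ->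
  (forall x, 0 <= x <= s -> is_derive x (1 : R) g (dg x) /\ 0 <= dg x) ->
  g 0 <= g s.
Proof.
move=> s0 H; have [] := @MVT_segment R g dg 0 s s0.
- by move=> x /subset_itv_oo_cc; rewrite in_itv /= => /H[].
- apply: continuous_in_subspaceT => x; rewrite inE /= in_itv /= => /H[dgx _].
  exact: is_derive_cont dgx.
- by move=> c; rewrite in_itv /= => /H[_ dg0] E; rewrite -subr_ge0 E mulr_ge0 // subr0.
Qed.

Lemma is_derive_reflect F (x df : R) : is_derive (- x) (1 : R) F df ->
  is_derive x (1 : R) (fun s => F (- s)) (- df).
Proof.
move=> H; have dN := is_deriveN (is_derive_id x (1 : R)).
exact: (is_derive_eq (@is_derive1_comp R F _ x df (-1) H dN) (mulrN1 _)).
Qed.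

Lemma norm_le_exp F (dF : R -> R) (c L a : R) : 0 <= c -> 0 <= L -> F 0 = 0 ->
  (forall x, `|x| <= a -> is_derive x (1 : R) F (dF x) /\
      `|dF x| <= c * L * expR (L * `|x|)) ->
  forall x, `|x| <= a -> `|F x| <= c * expR (L * `|x|).
Proof.
move=> c0 L0; suff H (G dG : R -> R) : G 0 = 0 -> (forall x : R, `|x| <= a -> is_derive x (1 : R) G (dG x) /\
      `|dG x| <= c * L * expR (L * `|x|)) ->
    forall x : R, 0 <= x -> `|x| <= a -> `|G x| <= c * expR (L * `|x|).
  move=> F0 HF x xa; have [x0|x0] := leP 0 x; first exact: H F0 HF x x0 xa.
  have := H (fun s => F (- s)) (fun s => - dF (- s)).
  have HR (s : R) : `|s| <= a -> is_derive s (1 : R) (fun s => F (- s)) (- dF (- s)) /\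
      `|- dF (- s)| <= c * L * expR (L * `|s|).
    move=> sa; have sa' : `|- s| <= a by rewrite normrN.
    have [d1] := HF (- s) sa'; rewrite normrN => d2; split.
      exact: (is_derive_reflect d1).
    by rewrite normrN.
  rewrite oppr0 => /(_ F0 HR (- x)); rewrite opprK !normrN oppr_ge0 (ltW x0).
  exact.
move=> G0 HG x x0 xa; rewrite (ger0_norm x0).
have dE y : is_derive y (1 : R) (fun y => c * expR (L * y)) (c * L * expR (L * y)).
  have H := is_derive_comp1 (is_derive_expR (L * y)) (is_deriveZ L (is_derive_id y (1 : R))).
  by apply: (is_derive_eq (is_deriveZ c H)); rewrite /GRing.scale /=; ring.
have bnd y : 0 <= y <= x -> is_derive y (1 : R) G (dG y) /\
    - (c * L * expR (L * y)) <= dG y <= c * L * expR (L * y).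
  move=> /andP[y0 yx]; have [|d1 d2] := HG y.
    by rewrite ger0_norm // (le_trans yx) // (le_trans (ler_norm x)).
  by split=> //; rewrite -ler_norml -{2}(ger0_norm y0).
have e0 : 0 <= c * expR (L * 0) by rewrite mulr_ge0 // expR_ge0.
rewrite ler_norml; apply/andP; split.
  rewrite -subr_ge0 opprK; apply: (le_trans _ (@mono0 (fun y => G y + c * expR (L * y))
    (fun y => dG y + c * L * expR (L * y)) x x0 _)); first by rewrite G0 add0r.
  move=> y /bnd[d1 /andP[d2 _]]; split; first exact: is_deriveD.
  by rewrite -(opprK (c * L * _)) subr_ge0.
rewrite -subr_ge0; apply: (le_trans _ (@mono0 (fun y => c * expR (L * y) - G y)
  (fun y => c * L * expR (L * y) - dG y) x x0 _)); first by rewrite G0 subr0.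
move=> y /bnd[d1 /andP[_ d2]]; split; first exact: is_deriveB.
by rewrite subr_ge0.
Qed.

Lemma norm_le_lin F (dF : R -> R) (c a : R) : F 0 = 0 ->
  (forall x, `|x| <= a -> is_derive x (1 : R) F (dF x) /\ `|dF x| <= c) ->
  forall x, `|x| <= a -> `|F x| <= c * `|x|.
Proof.
move=> F0 H x xa; have [s sx|s sx] := @mvt_dir R R F 0 1 x.
  rewrite addr0 [_ *: 1]mulr1; have [|[]] // := H s.
  exact: le_trans xa.
rewrite !addr0 ![_ *: (1 : R)]mulr1 F0 subr0 => ->.
have [|[_ ->] d2] := H s; first exact: le_trans xa.
by rewrite normrM mulrC ler_wpM2r.
Qed.

Lemma continuous_bounded f (a : R) : continuous f ->
  exists2 K, 0 <= K & forall s, `|s| <= a -> `|f s| <= K.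
Proof.
move=> cf.
have cont : {within (`[- a, a] : set R), continuous f}.
  by apply: continuous_subspaceT => x; exact: cf.
have [M [Mr HM]] := compact_bounded (continuous_compact cont (@segment_compact R (- a) a)).
exists (`|M| + 1); first by rewrite addr_ge0.
move=> s sa; apply: (HM (`|M| + 1)).
  by rewrite (le_lt_trans (ler_norm M)) // ltrDl.
by exists s => //=; rewrite in_itv /= -ler_norml.
Qed.

End Primitive.

Lemma is_derive_sum_fin {R : realType} {V : normedModType R} (I : Type) (r : seq I)
    (F : I -> V -> R) (dF : I -> R) (x v : V) :
  (forall i, is_derive x v (F i) (dF i)) ->
  is_derive x v (fun y => \sum_(i <- r) F i y) (\sum_(i <- r) dF i).
Proof.
move=> H; elim: r => [|i r IH].
  rewrite big_nil (_ : (fun=> _) = fun=> 0); first exact: is_derive_cst.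
  by apply/funext => y; rewrite big_nil.
rewrite big_cons (_ : (fun y => _) = F i + (fun y => \sum_(i <- r) F i y)).
  exact: is_deriveD.
by apply/funext => y; rewrite big_cons.
Qed.

Section Picard.
Context {R : realType} {I : finType}.
Variables (M : I -> I -> R -> R) (c : I -> R).
Hypothesis cM : forall j i, continuous (M j i).

Definition solves (y : I -> R -> R) :=
  (forall i, y i 0 = c i) /\
  forall i s, is_derive s (1 : R) (y i) (\sum_j y j s * M j i s).

Lemma coef_bounded (a : R) :
  exists2 K, 0 <= K & forall j i s, `|s| <= a -> `|M j i s| <= K.
Proof.
have H (ji : I * I) : exists K, 0 <= K /\ forall s, `|s| <= a -> `|M ji.1 ji.2 s| <= K.
  by have [K K0 HK] := continuous_bounded a (@cM ji.1 ji.2); exists K.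
have [K HK] := choice H.
exists (\sum_ji K ji); first by apply: sumr_ge0 => ji _; case: (HK ji).
move=> j i s sa; apply: le_trans ((HK (j, i)).2 s sa) _.
by rewrite (bigD1 (j, i)) //= lerDl sumr_ge0 // => k _; case: (HK k).
Qed.

(** Picard iteration.  The equation is linear, hence the iterates converge on
    every bounded interval, at the rate of the exponential series. *)
Lemma solution_exists : exists y, solves y.
Proof.
have prim (f : R -> R) : exists F, continuous f -> F 0 = 0 /\
    forall x, is_derive x (1 : R) F (f x).
  have [cf|ncf] := pselect (continuous f); last by exists f => /ncf.
  by have [F HF] := exists_primitive cf; exists F.
have [Prim HPrim] := choice prim.
pose u := fix u (m : nat) : I -> R -> R := match m with
  | 0%N => fun i _ => c i
  | m.+1 => fun i => Prim (fun s => \sum_j u m j s * M j i s) end.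
have cRHS (y : I -> R -> R) i : (forall j, continuous (y j)) ->
    continuous (fun s => \sum_j y j s * M j i s).
  move=> cy s; elim: (index_enum I) => [|j r IH].
    rewrite (_ : (fun s0 => _) = fun=> 0); first exact: cvg_cst.
    by apply/funext => s0; rewrite big_nil.
  rewrite (_ : (fun s0 => _) =
      fun s0 => y j s0 * M j i s0 + \sum_(k <- r) y k s0 * M k i s0).
    exact: (continuousD (continuousM (cy j s) (@cM j i s)) IH).
  by apply/funext => s0; rewrite big_cons.
have cu m j : continuous (u m j).
  elim: m j => [|m IH] j s; first exact: cvg_cst.
  have [_ /(_ s)] := HPrim _ (cRHS (u m) j IH); exact: is_derive_cont.
have du m i : u m.+1 i 0 = 0 /\
    forall s, is_derive s (1 : R) (u m.+1 i) (\sum_j u m j s * M j i s).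
  by exact: (HPrim _ (cRHS (u m) i (cu m))).
pose C := \sum_i `|c i|.
have C0 : 0 <= C by apply: sumr_ge0.
have sumle (K D : R) (f g : I -> R) : 0 <= K -> 0 <= D -> (forall j, `|f j| <= D) ->
    (forall j, `|g j| <= K) -> `|\sum_j f j * g j| <= #|I|%:R * (D * K).
  move=> K0 D0 fD gK; rewrite mulr_natl -sumr_const.
  apply: le_trans (ler_norm_sum _ _ _) _; apply: ler_sum => j _.
  by rewrite normrM ler_pM.
have bnd (a : R) : exists2 D, 0 <= D & forall m i s, `|s| <= a -> `|u m i s| <= D * 2^-1 ^+ m.
  have [K K0 HK] := coef_bounded a.
  pose L := 2 * (#|I|%:R * K); have L0 : 0 <= L by rewrite mulr_ge0 // mulr_ge0.
  have H m i s : `|s| <= a -> `|u m i s| <= C * 2^-1 ^+ m * expR (L * `|s|).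
    elim: m i s => [|m IH] i s sa.
      rewrite expr0 mulr1 /= (@le_trans _ _ C) //.
        by rewrite /C (bigD1 i) //= lerDl sumr_ge0.
      rewrite ler_peMr // -expR0 ler_expR mulr_ge0 //.
    have [u0 dus] := du m i.
    apply: (@norm_le_exp R (u m.+1 i) _ (C * 2^-1 ^+ m.+1) L a _ L0 u0 _ s sa).
      by rewrite mulr_ge0 // exprn_ge0 // invr_ge0.
    move=> t ta; split; first exact: dus.
    have Dp : 0 <= C * 2^-1 ^+ m * expR (L * `|t|).
      by rewrite !mulr_ge0 ?expR_ge0 // exprn_ge0 // invr_ge0.
    apply: le_trans (sumle _ _ _ _ K0 Dp (fun j => IH j t ta) (fun j => HK j i t ta)) _.
    by rewrite /L exprS le_eqVlt; apply/orP; left; apply/eqP; field.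
  exists (C * expR (L * a)); first by rewrite mulr_ge0 // expR_ge0.
  move=> m i s sa; apply: le_trans (H m i s sa) _.
  rewrite mulrAC ler_wpM2r ?exprn_ge0 ?invr_ge0 // ler_wpM2l // ler_expR.
  exact: ler_wpM2l.
pose S m i s := \sum_(0 <= k < m) u k i s.
have SS (a D : R) i s m k : (forall m i s, `|s| <= a -> `|u m i s| <= D * 2^-1 ^+ m) ->
    0 <= D -> `|s| <= a -> (m <= k)%N -> `|S k i s - S m i s| <= D * 2 * 2^-1 ^+ m.
  move=> HD D0 sa mk.
  suff H : `|S k i s - S m i s| <= D * 2 * (2^-1 ^+ m - 2^-1 ^+ k).
    apply: le_trans H _; rewrite ler_wpM2l ?mulr_ge0 // gerBl exprn_ge0 ?invr_ge0 //.
  rewrite -(subnKC mk); elim: (k - m)%N => [|d IH].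
    by rewrite addn0 !subrr normr0 mulr0.
  rewrite addnS /S big_nat_recr //= -/(S _ i s) addrAC.
  apply: le_trans (ler_normD _ _) _.
  apply: le_trans (lerD IH (HD (m + d)%N i s sa)) _.
  by rewrite exprS le_eqVlt; apply/orP; left; apply/eqP; field.
have h1 : `|2^-1 : R| < 1 by rewrite ger0_norm ?invr_ge0 // invf_lt1 // ltr1n.
have p2 (e D : R) : 0 < e -> 0 <= D -> exists N, forall m, (N <= m)%N -> D * 2 * 2^-1 ^+ m < e.
  move=> e0 D0; have /cvgr0_norm_lt/(_ e e0)[N _ HN] := cvg_geometric (D * 2) h1.
  by exists N => m Nm; apply: le_lt_trans (HN m Nm); exact: ler_norm.
have [y Hy] : exists y : I -> R -> R, forall (a D : R) i s m,
    (forall m i s, `|s| <= a -> `|u m i s| <= D * 2^-1 ^+ m) ->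
    0 <= D -> `|s| <= a -> `|y i s - S m i s| <= D * 2 * 2^-1 ^+ m.
  have ex (is' : I * R) : exists l : R, S n is'.1 is'.2 @[n --> \oo] --> l.
    case: is' => i s /=; have [D D0 HD] := bnd `|s|.
    suff : cvgn (series (fun k => u k i s)) by move=> /cvg_ex.
    apply: (@normed_cvg R R).
    apply: (@series_le_cvg R _ (geometric D 2^-1)) => //=.
    - by move=> n; rewrite /geometric /= mulr_ge0 // exprn_ge0 // invr_ge0.
    - by move=> n; exact: HD.
    - exact: is_cvg_geometric_series.
  have [y0 Hy0] := choice ex.
  exists (fun i s => y0 (i, s)) => a D i s m HD D0 sa.
  have c1 : (S n i s - S m i s) @[n --> \oo] --> y0 (i, s) - S m i s.
    by apply: cvgB; [exact: (Hy0 (i, s))|exact: cvg_cst].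
  have c2 : `|S n i s - S m i s| @[n --> \oo] --> `|y0 (i, s) - S m i s|.
    by apply: cvg_norm c1.
  rewrite -(cvg_lim (@Rhausdorff R) c2); apply: limr_le; first exact: cvgP c2.
  exists m => // k /= mk.
  exact: SS HD D0 sa mk.
have cy j : continuous (y j).
  move=> s; pose a := `|s| + 1.
  have [D D0 HD] := bnd a.
  have cS m : {for s, continuous (S m j)}.
    rewrite /S; elim: m => [|m IH].
      rewrite (_ : (fun s0 => _) = fun=> 0); first exact: cvg_cst.
      by apply/funext => s0; rewrite big_geq.
    rewrite (_ : (fun s0 => _) = fun s0 => \sum_(0 <= k < m) u k j s0 + u m j s0).
      exact: (continuousD IH (cu m j s)).
    by apply/funext => s0; rewrite big_nat_recr.
  apply/cvgrPdist_lt => e e0; have e3 : 0 < e / 3 by rewrite divr_gt0.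
  have [m /(_ m (leqnn m)) Hm] := p2 _ _ e3 D0.
  have /cvgrPdist_lt/(_ _ e3) cSm := cS m.
  have n1 : \forall x \near s, `|s - x| < 1.
    by apply/nbhs_ballP; exists 1 => //= x; rewrite -ball_normE.
  near=> x.
  have xa : `|x| <= a.
    have : `|s - x| < 1 by near: x.
    move=> sx; rewrite /a -(subKr s x) (le_trans (ler_normB _ _)) // lerD2l ltW //.
  have h2 := Hy a D j x m (fun m i s => HD m i s) D0 xa.
  have sa : `|s| <= a by rewrite lerDl.
  have h3 := Hy a D j s m (fun m i s => HD m i s) D0 sa.
  have h4 : `|S m j s - S m j x| < e / 3 by near: x.
  rewrite (_ : y j s - y j x = (y j s - S m j s) + (S m j s - S m j x) + (S m j x - y j x)); last by ring.
  have h5 : `|S m j x - y j x| < e / 3 by rewrite distrC (le_lt_trans h2).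
  apply: le_lt_trans (ler_normD _ _) _; rewrite (_ : e = e / 3 + e / 3 + e / 3); last by field.
  apply: ltrD => //; apply: le_lt_trans (ler_normD _ _) _; apply: ltrD => //.
  exact: le_lt_trans Hm.
pose h i s := c i + Prim (fun s => \sum_j y j s * M j i s) s.
have Hh i : h i 0 = c i /\ forall s, is_derive s (1 : R) (h i) (\sum_j y j s * M j i s).
  have [P0 dP] := HPrim _ (cRHS y i cy); split; first by rewrite /h P0 addr0.
  move=> s; have := is_deriveD (is_derive_cst (c i) s (1 : R)) (dP s).
  by rewrite add0r.
suff hy i s : h i s = y i s.
  exists y; split=> [i|i s]; first by rewrite -hy; case: (Hh i).
  by have [_ /(_ s)] := Hh i; congr (is_derive _ _ _ _); apply/funext => x; exact: hy.
pose a := `|s|; have sa : `|s| <= a by [].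
have [D D0 HD] := bnd a; have [K K0 HK] := coef_bounded a.
have a0 : 0 <= a by rewrite /a.
have dS m x : is_derive x (1 : R) (S m.+1 i) (\sum_j S m j x * M j i x).
  rewrite /S; elim: m => [|m IH].
    rewrite (_ : (fun s0 => _) = fun=> c i); last first.
      by apply/funext => s0; rewrite big_nat1.
    rewrite big1; first exact: is_derive_cst.
    by move=> j _; rewrite big_geq // mul0r.
  rewrite (_ : (fun s0 => _) = (fun s0 => \sum_(0 <= k < m.+1) u k i s0) + u m.+1 i); last first.
    by apply/funext => s0; rewrite big_nat_recr.
  apply: (is_derive_eq (is_deriveD IH ((du m i).2 x))).
  by rewrite -big_split /=; apply: eq_bigr => j _; rewrite big_nat_recr //= mulrDl.
have S0 m : S m.+1 i 0 = c i.
  rewrite /S big_nat_recl //= big1_seq ?addr0 // => k _.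
  by case: (du k i).
pose B := #|I|%:R * K * a; have B0 : 0 <= B by rewrite !mulr_ge0.
have hS m : `|h i s - S m.+1 i s| <= B * (D * 2 * 2^-1 ^+ m).
  pose b : R := D * 2 * 2^-1 ^+ m.
  have b0 : 0 <= b by rewrite /b !mulr_ge0 // exprn_ge0 // invr_ge0.
  have := @norm_le_lin R (fun x => h i x - S m.+1 i x)
    (fun x => \sum_j (y j x - S m j x) * M j i x) (#|I|%:R * (b * K)) a.
  have [h0 dh] := Hh i; rewrite h0 S0 subrr => /(_ erefl) H.
  have := H _ s sa; rewrite -/a (_ : _ * a = B * b); last by rewrite /B; ring.
  apply=> x xa; split.
    apply: (is_derive_eq (is_deriveB (dh x) (dS m x))).
    by rewrite -sumrB; apply: eq_bigr => j _; rewrite mulrBl.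
  apply: sumle => // j; last exact: HK.
  exact: (Hy a D j x m (fun m i s => HD m i s) D0 xa).
apply/eqP; rewrite -subr_eq0 -normr_eq0; apply/negPn/negP => nz.
have e0 : 0 < `|h i s - y i s| by rewrite lt_neqAle eq_sym nz /=.
set e := `|_| in e0.
have e2' : 0 < e / 2 by rewrite divr_gt0.
have [N1 H1] := p2 (e / 2) (B * D) e2' (mulr_ge0 B0 D0).
have [N2 H2] := p2 (e / 2) D e2' D0.
have f1 := hS (maxn N1 N2).
have f2 := Hy a D i s (maxn N1 N2).+1 (fun m i s => HD m i s) D0 sa.
have g1 := H1 _ (leq_maxl N1 N2).
have g2 := H2 _ (leqW (leq_maxr N1 N2)).
suff : e < e by rewrite ltxx.
rewrite {1}/e (_ : h i s - y i s = (h i s - S (maxn N1 N2).+1 i s)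
   - (y i s - S (maxn N1 N2).+1 i s)); last by ring.
apply: le_lt_trans (ler_normB _ _) _; rewrite [X in _ < X]splitr; apply: ltrD.
  by apply: le_lt_trans f1 _; rewrite !mulrA in g1 *.
exact: le_lt_trans f2 _.
Unshelve. all: by end_near. Qed.
End Picard.

Section Gronwall.
Context {R : realType} {I : finType}.
Variables (N : I -> I -> R -> R) (K e a : R).
Hypothesis K0 : 0 <= K.

Let n : R := #|I|%:R.
Let B : R := 2 * n * K + 1.

Lemma gronwall_rhs (x r : I -> R) (M : I -> I -> R) :
  (forall j i, `|M j i| <= K) -> (forall i, `|r i| <= e) ->
  \sum_i 2 * x i * (\sum_j x j * M j i + r i) <= B * (\sum_i x i ^+ 2) + n * e ^+ 2.
Proof.
move=> MK re; set E := \sum_i x i ^+ 2.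
have Sc (c : R) : \sum_(i : I) c = n * c by rewrite sumr_const -mulr_natl.
have H i : 2 * x i * (\sum_j x j * M j i + r i) <=
    n * K * x i ^+ 2 + K * E + x i ^+ 2 + e ^+ 2.
  rewrite mulrDr -!addrA addrA; apply: lerD.
    rewrite mulr_sumr -mulrA -Sc /E mulr_sumr -big_split /=; apply: ler_sum => j _.
    have h1 := MK j i; rewrite ler_norml in h1; case/andP: h1 => h1 h2.
    have := sqr_ge0 (x i + x j); have := sqr_ge0 (x i - x j); rewrite !expr2; nra.
  have h1 := re i; rewrite ler_norml in h1; case/andP: h1 => h1 h2.
  by have := sqr_ge0 (x i - r i); rewrite !expr2; nra.
apply: le_trans (ler_sum _ (fun i _ => H i)) _.
rewrite !big_split /= !Sc -mulr_sumr -/E le_eqVlt; apply/orP; left; apply/eqP.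
by rewrite /B; ring.
Qed.

(** The sum of squares [E] satisfies [E' <= B E + n e^2], so that
    [n e^2 s - exp (- B s) E] is nondecreasing. *)
Lemma gronwall_pos (d r : I -> R -> R) : (forall i, d i 0 = 0) ->
  (forall i s, `|s| <= a -> is_derive s (1 : R) (d i) (\sum_j d j s * N j i s + r i s)) ->
  (forall j i s, `|s| <= a -> `|N j i s| <= K) ->
  (forall i s, `|s| <= a -> `|r i s| <= e) ->
  forall s, 0 <= s -> `|s| <= a -> \sum_i d i s ^+ 2 <= expR (B * a) * (n * a) * e ^+ 2.
Proof.
move=> d0 dd NK re s s0 sa.
have n0 : 0 <= n by [].
have B0 : 0 <= B by rewrite addr_ge0 // !mulr_ge0.
pose E s := \sum_i d i s ^+ 2.
pose E' s := \sum_i 2 * d i s * (\sum_j d j s * N j i s + r i s).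
have dE x : `|x| <= a -> is_derive x (1 : R) E (E' x).
  move=> xa; apply: is_derive_sum_fin => i.
  have H := is_deriveM (dd i x xa) (dd i x xa).
  rewrite (_ : (fun y => d i y ^+ 2) = d i * d i); last by apply/funext => y; rewrite expr2.
  by apply: (is_derive_eq H); rewrite /GRing.scale /=; ring.
have dexp x : is_derive x (1 : R) (fun x => expR (- B * x)) (- B * expR (- B * x)).
  have H := is_derive_comp1 (is_derive_expR (- B * x)) (is_deriveZ (- B) (is_derive_id x (1 : R))).
  by apply: (is_derive_eq H); rewrite /GRing.scale /=; ring.
have := @mono0 R (fun x => n * e ^+ 2 * x - expR (- B * x) * E x)
  (fun x => n * e ^+ 2 - expR (- B * x) * (E' x - B * E x)) s s0.
have E00 : E 0 = 0 by rewrite /E big1 // => i _; rewrite d0 expr0n.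
rewrite E00 !mulr0 subrr => H; have {H} : 0 <= n * e ^+ 2 * s - expR (- B * s) * E s.
  apply: H => x /andP[x0 xs].
  have xa : `|x| <= a by rewrite ger0_norm // (le_trans xs) // (le_trans (ler_norm s)).
  split.
    have H1 := is_deriveM (dexp x) (dE x xa).
    have H2 := is_deriveZ (n * e ^+ 2) (is_derive_id x (1 : R)).
    by apply: (is_derive_eq (is_deriveB H2 H1)); rewrite /GRing.scale /=; ring.
  have h := gronwall_rhs (fun i => d i x) (fun j i => NK j i x xa) (fun i => re i x xa).
  have {}h : E' x - B * E x <= n * e ^+ 2 by rewrite lerBlDl.
  have ep : 0 < expR (- B * x) by exact: expR_gt0.
  have e1 : expR (- B * x) <= 1.
    by rewrite -expR0 ler_expR mulNr oppr_le0 mulr_ge0.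
  have ne : 0 <= n * e ^+ 2 by rewrite mulr_ge0 // sqr_ge0.
  rewrite subr_ge0; apply: (@le_trans _ _ (expR (- B * x) * (n * e ^+ 2))).
    by rewrite ler_wpM2l // ltW.
  by rewrite ler_piMl.
rewrite subr_ge0 => H.
have -> : \sum_i d i s ^+ 2 = expR (B * s) * (expR (- B * s) * E s).
  by rewrite mulrA -expRD mulNr subrr expR0 mul1r.
have sa' : s <= a by rewrite (le_trans (ler_norm s)).
rewrite -mulrA; apply: ler_pM; rewrite ?expR_ge0 //.
- by rewrite mulr_ge0 ?expR_ge0 // sumr_ge0 // => i _; rewrite sqr_ge0.
- by rewrite ler_expR ler_wpM2l.
- apply: le_trans H _; rewrite mulrAC ler_wpM2r ?sqr_ge0 //.
  exact: ler_wpM2l.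
Qed.

End Gronwall.

Lemma gronwall {R : realType} {I : finType} (K a : R) : 0 <= K -> 0 <= a ->
  exists2 C, 0 <= C & forall (N : I -> I -> R -> R) (d r : I -> R -> R) (e : R),
  0 <= e -> (forall i, d i 0 = 0) ->
  (forall i s, `|s| <= a -> is_derive s (1 : R) (d i) (\sum_j d j s * N j i s + r i s)) ->
  (forall j i s, `|s| <= a -> `|N j i s| <= K) ->
  (forall i s, `|s| <= a -> `|r i s| <= e) ->
  forall i s, `|s| <= a -> `|d i s| <= C * e.
Proof.
move=> K0 a0; pose D : R := expR ((2 * #|I|%:R * K + 1) * a) * (#|I|%:R * a).
have D0 : 0 <= D by rewrite mulr_ge0 ?expR_ge0 // mulr_ge0.
exists (Num.sqrt D); first exact: sqrtr_ge0.
move=> N d r e e0 d0 dd NK re i s sa.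
suff H : \sum_i d i s ^+ 2 <= D * e ^+ 2.
  have h : d i s ^+ 2 <= D * e ^+ 2.
    apply: le_trans H; rewrite (bigD1 i) //= lerDl sumr_ge0 // => j _.
    exact: sqr_ge0.
  rewrite -ler_sqr ?nnegrE ?mulr_ge0 ?sqrtr_ge0 //.
  by rewrite real_normK ?num_real // exprMn sqr_sqrtr.
have [s0|s0] := leP 0 s.
  have H := gronwall_pos K0 d0 dd NK re s0 sa.
  exact: H.
have sa' : `|- s| <= a by rewrite normrN.
have s0' : 0 <= - s by rewrite oppr_ge0 ltW.
have := @gronwall_pos R I (fun j i s => - N j i (- s)) K e a K0
  (fun i s => d i (- s)) (fun i s => - r i (- s)) _ _ _ _ (- s) s0' sa'.
rewrite opprK; apply.
- by move=> k; rewrite oppr0.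
- move=> k t ta; have ta' : `|- t| <= a by rewrite normrN.
  apply: (is_derive_eq (is_derive_reflect (dd k (- t) ta'))).
  by rewrite opprD -sumrN; congr (_ + _); apply: eq_bigr => j _; rewrite mulrN.
- by move=> j k t ta; rewrite normrN; apply: NK; rewrite normrN.
- by move=> k t ta; rewrite normrN; apply: re; rewrite normrN.
Qed.

Section Families.
Context {R : realType} {V : normedModType R}.
Implicit Types (g : R -> V -> R) (U : set V).

(** Families of functions of [p], jointly continuous in [(s, p)] together with
    their iterated derivatives in [p] up to order [k]. *)
Definition jcont U g := forall s p, U p -> {for (s, p), continuous (fun q => g q.1 q.2)}.

Fixpoint FC k U g : Prop :=
  match k with
  | 0%N => jcont U g
  | k'.+1 => jcont U g /\ forall v, (forall s p, U p -> derivable (g s) p v) /\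
               FC k' U (fun s => 'D_v (g s))
  end.

Lemma FC_jcont k U g : FC k U g -> jcont U g.
Proof. by case: k => [//|k] []. Qed.

Lemma FCS k U g : FC k.+1 U g -> FC k U g.
Proof.
elim: k g => [|k IH] g; first by case.
by move=> [h1 h2]; split=> // v; have [h3 h4] := h2 v; split=> //; exact: IH.
Qed.

Lemma FC_Ck k U g s : FC k U g -> Ck k U (g s).
Proof.
have cs h p : jcont U h -> U p -> {for p, continuous (h s)}.
  move=> jh Up; apply: (@continuous_at_comp _ _ _ (fun q => (s, q)) (fun q => h q.1 q.2)).
    exact: (cvg_pair (@cvg_cst _ s _ (nbhs p) _) (@cvg_id _ (nbhs p))).
  exact: jh.
elim: k g => [|k IH] g /=; first by move=> jg p; exact: cs.
move=> [jg H]; split=> [p Up|v]; last exact: (IH _ (H v).2).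
split; first exact: cs.
by move=> v; have [+ _] := H v; apply.
Qed.

Lemma jcont_s U g p : jcont U g -> U p -> continuous (g ^~ p).
Proof.
move=> jg Up s; apply: (@continuous_at_comp _ _ _ (fun s => (s, p)) (fun q => g q.1 q.2)).
  exact: (cvg_pair (@cvg_id _ (nbhs s)) (@cvg_cst _ p _ (nbhs s) _)).
exact: jg.
Qed.

(** Joint continuity is uniform in [s] on a compact interval. *)
Lemma tube U g p (a e : R) : jcont U g -> U p -> 0 < e ->
  \forall q \near p, forall s, `|s| <= a -> `|g s q - g s p| < e.
Proof.
move=> jg Up e0; have e2' : 0 < e / 2 by rewrite divr_gt0.
have /compact_near_coveringP cpt := @segment_compact R (- a) a.
have := cpt V (nbhs p) (fun q s => `|g s q - g s p| < e) _.
move=> H; have {H} : \forall q \near p, `[- a, a] `<=` (fun s => `|g s q - g s p| < e).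
  apply: H => s sI.
  have /cvgrPdist_lt/(_ _ e2') H1 := jg s p Up.
  have /cvgrPdist_lt/(_ _ e2') H2 := @jcont_s U g p jg Up s.
  have {H1} [[A1 A2] /= [A1s A2p] HA] := H1.
  near=> t q => /=.
  have h1 : `|g s p - g t q| < e / 2.
    by apply: (HA (t, q)); split => /=; [near: t|near: q].
  have h2 : `|g s p - g t p| < e / 2 by near: t.
  rewrite (_ : g t q - g t p = (g s p - g t p) - (g s p - g t q)); last by ring.
  by rewrite (le_lt_trans (ler_normB _ _)) // (splitr e) ltrD.
apply: filterS => q Hq s sa; apply: Hq.
by rewrite /= in_itv /= -ler_norml.
Unshelve. all: by end_near. Qed.

End Families.

Section ParamODE.
Context {R : realType} {V : normedModType R}.
Variable U : set V.
Hypothesis oU : open U.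

Definition psolves (I : finType) (M : I -> I -> R -> V -> R) (c : I -> R)
    (y : I -> R -> V -> R) :=
  forall p, U p -> solves (fun j i s => M j i s p) c (fun i s => y i s p).

Lemma psolution_exists (I : finType) (M : I -> I -> R -> V -> R) c :
  (forall j i, jcont U (M j i)) -> exists y, psolves M c y.
Proof.
move=> jM.
have H (p : V) : exists y : I -> R -> R, U p -> solves (fun j i s => M j i s p) c y.
  have [Up|nUp] := pselect (U p); last by exists (fun i s => 0).
  have [|y Hy] := @solution_exists R I (fun j i s => M j i s p) c.
    by move=> j i; exact: jcont_s (jM j i) Up.
  by exists y.
have [y Hy] := choice H.
by exists (fun i s p => y p i s) => p Up; exact: Hy.
Qed.

(** The difference of the solutions at two parameters solves the equation with a
    small right-hand side; Gronwall's inequality bounds it. *)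
Lemma psolves_jcont (I : finType) (M : I -> I -> R -> V -> R) c y :
  (forall j i, jcont U (M j i)) -> psolves M c y -> forall i, jcont U (y i).
Proof.
move=> jM Hy i s p Up; pose a := `|s| + 1.
have a0 : 0 <= a by rewrite addr_ge0.
have [y0 dy] := Hy p Up.
have [K K0 HK] := coef_bounded (fun j i => @jcont_s _ _ _ _ _ (jM j i) Up) a.
have cyp j : continuous (fun s => y j s p).
  by move=> t; exact: is_derive_cont (dy j t).
have [L L0 HL] : exists2 L, 0 <= L & forall j t, `|t| <= a -> `|y j t p| <= L.
  have [L L0 HL] := coef_bounded (M := fun j _ s => y j s p) (fun j _ => @cyp j) a.
  by exists L => // j t ta; exact: (HL j i t ta).
have K10 : 0 <= K + 1 by rewrite addr_ge0.
have [C C0 HC] := @gronwall R I (K + 1) a K10 a0.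
have n0 : 0 <= #|I|%:R * L by rewrite mulr_ge0.
apply/cvgrPdist_lt => e e0.
have e2' : 0 < e / 2 by rewrite divr_gt0.
pose eta := Num.min 1 (e / 2 / (C * (#|I|%:R * L) + 1)).
have D0 : 0 < C * (#|I|%:R * L) + 1 by rewrite ltr_wpDl // mulr_ge0.
have eta0 : 0 < eta by rewrite lt_min ltr01 /= divr_gt0.
have nM : \forall q \near p, forall ji : I * I, forall t, `|t| <= a ->
    `|M ji.1 ji.2 t q - M ji.1 ji.2 t p| < eta.
  by apply: filter_forall => ji; exact: tube (jM _ _) Up eta0.
have nU : \forall q \near p, U q by exact: open_near.
have nq : \forall q \near p, forall t, `|t| <= a -> `|y i t q - y i t p| < e / 2.
  near=> q => t ta.
  have Uq : U q by near: q.
  have Mq : forall ji : I * I, forall t, `|t| <= a ->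
    `|M ji.1 ji.2 t q - M ji.1 ji.2 t p| < eta by near: q.
  have [z0 dz] := Hy q Uq.
  have := HC (fun j i s => M j i s q) (fun j s => y j s q - y j s p)
    (fun i s => \sum_j y j s p * (M j i s q - M j i s p)) (#|I|%:R * L * eta).
  move=> H; apply: (@le_lt_trans _ _ (C * (#|I|%:R * L * eta))); last first.
    apply: (@le_lt_trans _ _ (C * (#|I|%:R * L) * (e / 2 / (C * (#|I|%:R * L) + 1)))).
      rewrite mulrA ler_wpM2l ?mulr_ge0 // ?L0 //.
      by rewrite ge_min lexx orbT.
    set X := C * _ in D0 *; rewrite [X * _]mulrA ltr_pdivrMr // [X * _]mulrC.
    by rewrite ltr_pM2l // ltrDl.
  apply: H => //.
  - by rewrite mulr_ge0 // ltW.
  - by move=> j; rewrite y0 z0 subrr.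
  - move=> k x xa; apply: (is_derive_eq (is_deriveB (dz k x) (dy k x))).
    by rewrite -sumrB -big_split /=; apply: eq_bigr => j _; ring.
  - move=> j k x xa; rewrite -(subrK (M j k x p) (M j k x q)) addrC.
    rewrite (le_trans (ler_normD _ _)) // lerD ?HK //.
    have /ltW := Mq (j, k) x xa; move=> /le_trans; apply.
    by rewrite ge_min lexx.
  - move=> k x xa; apply: le_trans (ler_norm_sum _ _ _) _.
    rewrite -mulrA mulr_natl -sumr_const; apply: ler_sum => j _.
    by rewrite normrM ler_pM // ?HL // ltW // (Mq (j, k)).
have /cvgrPdist_lt/(_ _ e2') ns := cyp i s.
have n1 : \forall x \near s, `|s - x| < 1.
  by apply/nbhs_ballP; exists 1 => //= x; rewrite -ball_normE.
exists ([set t | `|y i s p - y i t p| < e / 2 /\ `|s - t| < 1],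
        [set q | forall t, `|t| <= a -> `|y i t q - y i t p| < e / 2]).
  by split => //=; exact: filterI.
move=> [t q] /= [[h1 h2] h3].
have ta : `|t| <= a.
  rewrite /a -(subKr s t) (le_trans (ler_normB _ _)) // lerD2l ltW //.
rewrite (_ : y i s p - y i t q = (y i s p - y i t p) - (y i t q - y i t p)); last by ring.
by rewrite (le_lt_trans (ler_normB _ _)) // (splitr e) ltrD // h3.
Unshelve. all: by end_near. Qed.

Lemma is_derive_eps (f : V -> R) (p v : V) (d : R) :
  (forall e : R, 0 < e -> \forall h \near (0 : R), `|f (h *: v + p) - f p - h * d| <= e * `|h|) ->
  is_derive p v f d.
Proof.
move=> H.
have L : (fun h => h^-1 *: ((f \o shift p) (h *: v) - f p)) @ (0 : R)^' --> d.
  apply/cvgrPdist_le => e e0.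
  have H' : \forall h \near (0 : R)^', `|f (h *: v + p) - f p - h * d| <= e * `|h|.
    by rewrite near_withinE; apply: filterS (H e e0).
  near=> h.
  have h0 : h != 0 by near: h; exact: nbhs_dnbhs_neq.
  have hn : 0 < `|h| by rewrite normr_gt0.
  rewrite -(ler_pM2r hn) -normrM /= /GRing.scale /= mulrBl mulrAC mulVf // mul1r.
  rewrite distrC [d * h]mulrC.
  by near: h.
by apply: DeriveDef; [apply/cvg_ex; exists d|exact: (cvg_lim (@Rhausdorff R) L)].
Unshelve. all: by end_near. Qed.

Lemma solves_unique (I : finType) (M : I -> I -> R -> R) (c : I -> R) (y z : I -> R -> R)
    (a : R) : (forall j i, continuous (M j i)) ->
  (forall i, y i 0 = c i) -> (forall i, z i 0 = c i) ->
  (forall i s, `|s| <= a -> is_derive s (1 : R) (y i) (\sum_j y j s * M j i s)) ->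
  (forall i s, `|s| <= a -> is_derive s (1 : R) (z i) (\sum_j z j s * M j i s)) ->
  forall i s, `|s| <= a -> y i s = z i s.
Proof.
move=> cM y0 z0 dy dz i s sa; have a0 : 0 <= a by exact: le_trans sa.
have [K K0 HK] := coef_bounded cM a.
have [C C0 HC] := @gronwall R I K a K0 a0.
have := HC M (fun i s => y i s - z i s) (fun i s => 0) 0.
move=> H; have {H} : `|y i s - z i s| <= C * 0.
  apply: H => //.
  - by move=> k; rewrite y0 z0 subrr.
  - move=> k x xa; apply: (is_derive_eq (is_deriveB (dy k x xa) (dz k x xa))).
    by rewrite -sumrB addr0; apply: eq_bigr => j _; rewrite mulrBl.
  - by move=> k x _; rewrite normr0.
by rewrite mulr0 normr_le0 subr_eq0 => /eqP.
Qed.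

Lemma FC_ext k g h : (forall s p, U p -> g s p = h s p) -> FC k U g -> FC k U h.
Proof.
have jc (g1 h1 : R -> V -> R) : (forall s p, U p -> g1 s p = h1 s p) ->
    jcont U g1 -> jcont U h1.
  move=> gh jg s p Up.
  have n1 : \forall q \near (s, p), (fun q => g1 q.1 q.2) q = (fun q => h1 q.1 q.2) q.
    exists (setT, U) => /=; first by split; [exact: filterT|exact: open_near].
    by move=> [t q] /= [_ Uq]; exact: gh.
  have H : (fun q => h1 q.1 q.2) @ (s, p) --> g1 s p.
    by apply: cvg_trans (jg s p Up); apply: near_eq_cvg; apply: filterS n1.
  by rewrite (gh s p Up) in H.
elim: k g h => [|k IH] g h gh /=; first exact: jc.
move=> [jg H]; split; first exact: jc gh jg.
have ngh s p : U p -> \forall q \near p, g s q = h s q.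
  by move=> Up; apply: filterS (open_near oU Up) => q; exact: gh.
move=> v; have [d1 d2] := H v; split.
  by move=> s p Up; exact: (near_eq_derivable (ngh s p Up) (d1 s p Up)).
by apply: IH d2 => s p Up; exact: (near_eq_derive _ (ngh s p Up)).
Qed.

Lemma FC_cst k (c : R) : FC k U (fun _ _ => c).
Proof.
have jc (d : R) : jcont U (fun _ _ => d) by move=> s p _; exact: cvg_cst.
elim: k c => [|k IH] c; first exact: jc.
split=> [|v]; first exact: jc.
split; first by move=> s p _; exact: derivable_cst.
apply: (@FC_ext k (fun _ _ => 0) _ _ (IH 0)) => s p _.
by rewrite (derive_cst c p v).
Qed.

(** Differentiating the equation in [p] gives again a linear equation, for the
    pair of the solution and its derivative; this is the induction step for
    higher regularity. *)
Lemma psolves_FC k (I : finType) (M : I -> I -> R -> V -> R) c y :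
  (forall j i, FC k U (M j i)) -> psolves M c y -> forall i, FC k U (y i).
Proof.
elim: k I M c y => [|k IH] I M c y FM Hy; first exact: psolves_jcont FM Hy.
have jM j i : jcont U (M j i) by exact: (FC_jcont (FM j i)).
move=> i; split; first exact: (psolves_jcont jM Hy).
move=> v.
pose M' (j i : I + I) : R -> V -> R := match j, i with
  | inl j, inl i => M j i
  | inl j, inr i => fun s => 'D_v (M j i s)
  | inr j, inr i => M j i
  | inr j, inl i => fun _ _ => 0 end.
pose c' (i : I + I) : R := match i with inl i => c i | inr _ => 0 end.
have FM' j i' : FC k U (M' j i').
  case: j i' => [j|j] [i'|i'] /=.
  - exact: FCS.
  - by have [_ /(_ v)[]] := FM j i'.
  - exact: FC_cst.
  - exact: FCS.
have [Y HY] := psolution_exists c' (fun j i => FC_jcont (FM' j i)).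
have FY := IH _ _ _ _ FM' HY.
suff D s p : U p -> is_derive p v (y i s) (Y (inr i) s p).
  split; first by move=> s p Up; case: (D s p Up).
  apply: (@FC_ext k (Y (inr i)) _ _ (FY (inr i))) => s p Up.
  by case: (D s p Up).
move=> Up; pose a := `|s|; have sa : `|s| <= a by [].
have a0 : 0 <= a by rewrite /a.
have [y0 dy] := Hy p Up; have [Y0 dY] := HY p Up.
have cMp j l := @jcont_s _ _ _ _ _ (jM j l) Up.
have Yl j t : `|t| <= a -> Y (inl j) t p = y j t p.
  move=> ta; apply: (@solves_unique I (fun j i s => M j i s p) c
    (fun j t => Y (inl j) t p) (fun j t => y j t p) a cMp _ y0 _ (fun l x _ => dy l x) j t ta).
  - by move=> l; exact: (Y0 (inl l)).
  - move=> l x _; apply: (is_derive_eq (dY (inl l) x)).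
    rewrite big_sumType /= [X in _ + X]big1 ?addr0 // => m _.
    by rewrite mulr0.

have [K K0 HK] := coef_bounded cMp a.
have [L L0 HL] : exists2 L, 0 <= L & forall j t, `|t| <= a -> `|Y j t p| <= L.
  have cY j : continuous (fun t => Y j t p) by move=> t; exact: is_derive_cont (dY j t).
  have [L L0 HL] := coef_bounded (M := fun j _ s => Y j s p) (fun j _ => @cY j) a.
  by exists L => // j t ta; exact: (HL j j t ta).
have K10 : 0 <= K + 1 by rewrite addr_ge0.
have [C C0 HC] := @gronwall R I (K + 1) a K10 a0.
apply: is_derive_eps => e e0.
pose B := C * (#|I|%:R * (2 * L)); have B0 : 0 <= B by rewrite !mulr_ge0.
have [eta eta0 [eta1 etae]] : exists2 eta : R, 0 < eta & eta <= 1 /\ B * eta <= e.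
  have D0 : 0 < B + 1 by rewrite ltr_wpDl.
  exists (Num.min 1 (e / (B + 1))); first by rewrite lt_min ltr01 /= divr_gt0.
  split; first by rewrite ge_min lexx.
  apply: (@le_trans _ _ (B * (e / (B + 1)))).
    by rewrite ler_wpM2l // ge_min lexx orbT.
  by rewrite mulrA ler_pdivrMr // [B * e]mulrC ler_wpM2l ?(ltW e0) // lerDl.
have nM : \forall q \near p, [/\ U q, forall ji : I * I, forall t, `|t| <= a ->
    `|M ji.1 ji.2 t q - M ji.1 ji.2 t p| < eta &
    forall ji : I * I, forall t, `|t| <= a ->
    `|'D_v (M ji.1 ji.2 t) q - 'D_v (M ji.1 ji.2 t) p| < eta].
  have n1 : \forall q \near p, forall ji : I * I, forall t, `|t| <= a ->
      `|M ji.1 ji.2 t q - M ji.1 ji.2 t p| < eta.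
    by apply: filter_forall => ji; exact: tube (jM _ _) Up eta0.
  have n2 : \forall q \near p, forall ji : I * I, forall t, `|t| <= a ->
      `|'D_v (M ji.1 ji.2 t) q - 'D_v (M ji.1 ji.2 t) p| < eta.
    apply: filter_forall => ji; have [_ /(_ v)[_ /FC_jcont H]] := FM ji.1 ji.2.
    exact: tube H Up eta0.
  by apply: filterS (filterI (open_near oU Up) (filterI n1 n2)) => q [? []].
have {nM} [r /= r0 Hr] := (nbhs_ballP _ _).1 nM.
have v1 : 0 < `|v| + 1 by rewrite ltr_wpDl.
have rv0 : 0 < r / (`|v| + 1) by rewrite divr_gt0.
apply/nbhs_ballP; exists (r / (`|v| + 1)) => //= h; rewrite -ball_normE /= sub0r normrN => hr.
have Hball x : `|x| <= `|h| -> ball p r (x *: v + p).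
  move=> xh; rewrite -ball_normE /= opprD addrCA subrr addr0 normrN normrZ.
  apply: (@le_lt_trans _ _ (`|h| * (`|v| + 1))).
    by rewrite ler_pM // lerDl.
  by rewrite -ltr_pdivlMr.
set q := h *: v + p.
have [Uq Mq _] : [/\ U q, forall ji : I * I, forall t, `|t| <= a ->
    `|M ji.1 ji.2 t q - M ji.1 ji.2 t p| < eta & True].
  by have [h1 h2 _] := Hr q (Hball h (lexx _)).
have Tq j l t : `|t| <= a -> `|M j l t q - M j l t p - h * 'D_v (M j l t) p| <= `|h| * eta.
  move=> ta; have [|x xh ->] := @mvt_dir R V (M j l t) p v h.
    move=> x xh; have [Ux _ _] := Hr _ (Hball x xh).
    by have [_ /(_ v)[H _]] := FM j l; exact: H.
  rewrite -mulrBr normrM ler_wpM2l // ltW //.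
  by have [_ _ H] := Hr _ (Hball x xh); exact: (H (j, l)).
have [q0 dq] := Hy q Uq.
have := HC (fun j i s => M j i s q)
  (fun j t => y j t q - y j t p - h * Y (inr j) t p)
  (fun i t => \sum_j (y j t p * (M j i t q - M j i t p - h * 'D_v (M j i t) p)
      + h * Y (inr j) t p * (M j i t q - M j i t p))) (#|I|%:R * (2 * L) * (eta * `|h|)).
move=> H; apply: (@le_trans _ _ (C * (#|I|%:R * (2 * L) * (eta * `|h|)))); last first.
  by rewrite (_ : C * _ = B * eta * `|h|); [rewrite ler_wpM2r|rewrite /B; ring].
apply: H => //.
- by rewrite mulr_ge0 // ?mulr_ge0 // ltW.
- by move=> j; rewrite y0 q0 (Y0 (inr j)) /= mulr0 subrr subr0.
- move=> l x xa.
  apply: (is_derive_eq (is_deriveB (is_deriveB (dq l x) (dy l x)) (is_deriveZ h (dY (inr l) x)))).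
  rewrite big_sumType /= /GRing.scale /= mulrDr !mulr_sumr -!sumrB opprD -!sumrN.
  rewrite -!big_split /=.
  by apply: eq_bigr => j _; rewrite Yl //; ring.
- move=> j l x xa; rewrite -(subrK (M j l x p) (M j l x q)) addrC.
  rewrite (le_trans (ler_normD _ _)) // lerD ?HK //.
  by have /ltW := Mq (j, l) x xa; move=> /le_trans; apply.
- move=> l x xa; apply: le_trans (ler_norm_sum _ _ _) _.
  rewrite -mulrA mulr_natl -sumr_const; apply: ler_sum => j _.
  apply: le_trans (ler_normD _ _) _.
  rewrite (_ : 2 * L * _ = L * (`|h| * eta) + `|h| * L * eta); last by ring.
  apply: lerD.
    by rewrite normrM ler_pM // ?Tq // -Yl // HL.
  rewrite !normrM ler_pM ?mulr_ge0 // ?ler_wpM2l ?HL // ltW //.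
  exact: (Mq (j, l)).
Qed.

End ParamODE.

(** * The operators d/dz and d/dzbar on matrix-valued functions *)

Section Wirtinger.
Context {R : realType} {n : nat}.
Local Notation P := (R * R)%type.
Local Notation M := 'M[R[i]]_n.
Implicit Types (F G : P -> M) (z : P).

Definition ii : R[i] := 0 +i* 1.

Lemma ii2 : ii * ii = -1.
Proof. by apply: complex_ext; rewrite /= ?mulr0 ?mul0r ?mulr1 ?sub0r ?addr0 ?oppr0. Qed.

Lemma conj_ii : Num.conj ii = - ii.
Proof. by apply: complex_ext; rewrite /= ?oppr0. Qed.

Lemma two_neq0 : (2 : R[i]) != 0. Proof. by rewrite pnatr_eq0. Qed.

Lemma conj_half : Num.conj (2^-1 : R[i]) = 2^-1.
Proof. by rewrite rmorphV ?unitfE ?two_neq0 // rmorph_nat. Qed.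

Definition pz F z : M := 2^-1 *: (mderive e1 F z - ii *: mderive e2 F z).
Definition pzb F z : M := 2^-1 *: (mderive e1 F z + ii *: mderive e2 F z).

Lemma dzE (f : Cplane R -> M) w : dz f w = pz (fun p => f (of_plane p)) (to_plane w).
Proof. by apply/matrixP => i j; rewrite !mxE. Qed.

Lemma dzbarE (f : Cplane R -> M) w : dzbar f w = pzb (fun p => f (of_plane p)) (to_plane w).
Proof. by apply/matrixP => i j; rewrite !mxE. Qed.

Lemma pz_near F G z : (\forall y \near z, F y = G y) -> pz F z = pz G z.
Proof. by move=> H; rewrite /pz (mderive_near e1 H) (mderive_near e2 H). Qed.

Lemma pzb_near F G z : (\forall y \near z, F y = G y) -> pzb F z = pzb G z.
Proof. by move=> H; rewrite /pzb (mderive_near e1 H) (mderive_near e2 H). Qed.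

Definition cpx (p : P) : R[i] := p.1 +i* p.2.

Lemma mderive_dir F z (v : P) : (forall i j, differentiable (fun y => Re (F y i j)) z
    /\ differentiable (fun y => Im (F y i j)) z) ->
  mderive v F z = cpx v *: pz F z + Num.conj (cpx v) *: pzb F z.
Proof.
move=> dF; apply/matrixP => i j; rewrite !mxE.
have [d1 d2] := dF i j; rewrite /cderive (differentiable_dir v d1) (differentiable_dir v d2).
move: ('D_e1 _ z) ('D_e2 _ z) ('D_e1 _ z) ('D_e2 _ z) => a b c d.
have h2 : 2^-1 = (2^-1 : R)%:C :> R[i] by rewrite rmorphV ?unitfE ?pnatr_eq0 // rmorph_nat.
by rewrite h2; apply: complex_ext; rewrite /cpx /ii /=; field.
Qed.

Section At.
Variables (A : set P) (z : P).
Hypotheses (oA : open A) (Az : A z).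

Lemma smooth_mx_differentiable F : smooth_mx_on A F -> forall i j,
  differentiable (fun y => Re (F y i j)) z /\ differentiable (fun y => Im (F y i j)) z.
Proof.
move=> sF i j; have [s1 s2] := sF i j.
by split; [exact: (smooth_differentiable oA s1)|exact: (smooth_differentiable oA s2)].
Qed.

Lemma pzD F G : smooth_mx_on A F -> smooth_mx_on A G ->
  pz (fun y => F y + G y) z = pz F z + pz G z.
Proof.
move=> sF sG; rewrite /pz !(mderiveD Az) // -scalerDr; congr (_ *: _).
by rewrite scalerDr opprD addrACA.
Qed.

Lemma pzbD F G : smooth_mx_on A F -> smooth_mx_on A G ->
  pzb (fun y => F y + G y) z = pzb F z + pzb G z.
Proof.
move=> sF sG; rewrite /pzb !(mderiveD Az) // -scalerDr; congr (_ *: _).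
by rewrite scalerDr addrACA.
Qed.

Lemma pzB F G : smooth_mx_on A F -> smooth_mx_on A G ->
  pz (fun y => F y - G y) z = pz F z - pz G z.
Proof.
move=> sF sG; rewrite /pz !(mderiveB oA Az) // -scalerBr; congr (_ *: _).
by rewrite scalerBr !opprD !opprK addrACA.
Qed.

Lemma pzbB F G : smooth_mx_on A F -> smooth_mx_on A G ->
  pzb (fun y => F y - G y) z = pzb F z - pzb G z.
Proof.
move=> sF sG; rewrite /pzb !(mderiveB oA Az) // -scalerBr; congr (_ *: _).
by rewrite scalerBr opprD addrACA.
Qed.

Lemma pzM F G : smooth_mx_on A F -> smooth_mx_on A G ->
  pz (fun y => F y *m G y) z = pz F z *m G z + F z *m pz G z.
Proof.
move=> sF sG; rewrite /pz !(mderiveM oA Az) // -scalemxAl -scalemxAr -scalerDr.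
congr (_ *: _); rewrite mulmxBl mulmxBr -scalemxAl -scalemxAr scalerDr opprD.
by rewrite addrACA.
Qed.

Lemma pzbM F G : smooth_mx_on A F -> smooth_mx_on A G ->
  pzb (fun y => F y *m G y) z = pzb F z *m G z + F z *m pzb G z.
Proof.
move=> sF sG; rewrite /pzb !(mderiveM oA Az) // -scalemxAl -scalemxAr -scalerDr.
congr (_ *: _); rewrite mulmxDl mulmxDr -scalemxAl -scalemxAr scalerDr.
by rewrite addrACA.
Qed.

Lemma pz_adj F : smooth_mx_on A F -> pz (fun y => adjm (F y)) z = adjm (pzb F z).
Proof.
move=> sF; rewrite /pz /pzb !(mderive_adj Az) // adjmZ adjmD adjmZ.
by rewrite conj_half conj_ii scaleNr.
Qed.

Lemma pzb_adj F : smooth_mx_on A F -> pzb (fun y => adjm (F y)) z = adjm (pz F z).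
Proof.
move=> sF; rewrite /pz /pzb !(mderive_adj Az) // adjmZ adjmD adjmN adjmZ.
by rewrite conj_half conj_ii scaleNr opprK.
Qed.

Lemma pzZ c F : smooth_mx_on A F -> pz (fun y => c *: F y) z = c *: pz F z.
Proof.
move=> sF; rewrite /pz !(mderiveZ Az) // [RHS]scalerA [c * _]mulrC -[RHS]scalerA.
by congr (_ *: _); rewrite scalerBr !scalerA [ii * c]mulrC.
Qed.

Lemma pzbZ c F : smooth_mx_on A F -> pzb (fun y => c *: F y) z = c *: pzb F z.
Proof.
move=> sF; rewrite /pzb !(mderiveZ Az) // [RHS]scalerA [c * _]mulrC -[RHS]scalerA.
by congr (_ *: _); rewrite scalerDr !scalerA [ii * c]mulrC.
Qed.

Lemma pz_sum I (r : seq I) (F : I -> P -> M) : (forall i, smooth_mx_on A (F i)) ->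
  pz (fun y => \sum_(i <- r) F i y) z = \sum_(i <- r) pz (F i) z.
Proof.
move=> sF; rewrite /pz !(mderive_sum oA Az) // -scaler_sumr; congr (_ *: _).
by rewrite scaler_sumr sumrB.
Qed.

Lemma pzb_sum I (r : seq I) (F : I -> P -> M) : (forall i, smooth_mx_on A (F i)) ->
  pzb (fun y => \sum_(i <- r) F i y) z = \sum_(i <- r) pzb (F i) z.
Proof.
move=> sF; rewrite /pzb !(mderive_sum oA Az) // -scaler_sumr; congr (_ *: _).
by rewrite scaler_sumr big_split.
Qed.

End At.

Lemma smooth_pz A F : open A -> smooth_mx_on A F -> smooth_mx_on A (pz F).
Proof.
move=> oA sF; apply: (smooth_mx_onZ 2^-1 oA).
apply: (smooth_mx_onB oA (smooth_mx_on_mderive e1 oA sF)).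
exact: (smooth_mx_onZ ii oA (smooth_mx_on_mderive e2 oA sF)).
Qed.

Lemma smooth_pzb A F : open A -> smooth_mx_on A F -> smooth_mx_on A (pzb F).
Proof.
move=> oA sF; apply: (smooth_mx_onZ 2^-1 oA).
apply: (smooth_mx_onD oA (smooth_mx_on_mderive e1 oA sF)).
exact: (smooth_mx_onZ ii oA (smooth_mx_on_mderive e2 oA sF)).
Qed.

Lemma pz_pzb_sym A F z : open A -> A z -> smooth_mx_on A F -> pz (pzb F) z = pzb (pz F) z.
Proof.
move=> oA Az sF.
have s1 := smooth_mx_on_mderive e1 oA sF; have s2 := smooth_mx_on_mderive e2 oA sF.
have s2' := smooth_mx_onZ ii oA s2.
rewrite [LHS]/pz [RHS]/pzb /pz /pzb.
have d12 v : mderive v (fun y => 2^-1 *: (mderive e1 F y + ii *: mderive e2 F y)) z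
    = 2^-1 *: (mderive v (mderive e1 F) z + ii *: mderive v (mderive e2 F) z).
  by rewrite (mderiveZ Az v 2^-1 (smooth_mx_onD oA s1 s2')) (mderiveD Az v s1 s2') (mderiveZ Az v ii s2).
have d12' v : mderive v (fun y => 2^-1 *: (mderive e1 F y - ii *: mderive e2 F y)) z
    = 2^-1 *: (mderive v (mderive e1 F) z - ii *: mderive v (mderive e2 F) z).
  by rewrite (mderiveZ Az v 2^-1 (smooth_mx_onB oA s1 s2')) (mderiveB oA Az v s1 s2') (mderiveZ Az v ii s2).
rewrite !d12 !d12' (mderive_sym oA Az e2 e1 sF).
move: (mderive e1 (mderive e1 F) z) (mderive e1 (mderive e2 F) z) => X Y.
move: (mderive e2 (mderive e2 F) z) => Z.
by apply/matrixP => i j; rewrite !mxE; ring.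
Qed.

Lemma pz_cst (c : M) z : pz (fun=> c) z = 0.
Proof. by rewrite /pz !mderive_cst scaler0 subr0 scaler0. Qed.

Lemma pzb_cst (c : M) z : pzb (fun=> c) z = 0.
Proof. by rewrite /pzb !mderive_cst scaler0 addr0 scaler0. Qed.

End Wirtinger.

(** * Radial parallel transport of truncated loops *)

Section FamiliesClosure.
Context {R : realType} {V : normedModType R}.
Variable U : set V.
Hypothesis oU : open U.
Implicit Types (g h : R -> V -> R).

Lemma FCD k g h : FC k U g -> FC k U h -> FC k U (fun s p => g s p + h s p).
Proof.
have jc g1 h1 : jcont U g1 -> jcont U h1 -> jcont U (fun s p => g1 s p + h1 s p).
  by move=> jg jh s p Up; exact: (continuousD (jg s p Up) (jh s p Up)).
elim: k g h => [|k IH] g h /=; first exact: jc.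
move=> [jg Hg] [jh Hh]; split; first exact: jc.
move=> v; have [dg Fg] := Hg v; have [dh Fh] := Hh v; split.
  by move=> s p Up; exact: (derivableD (dg s p Up) (dh s p Up)).
apply: (FC_ext oU _ (IH _ _ Fg Fh)) => s p Up.
by rewrite -(deriveD (dg s p Up) (dh s p Up)).
Qed.

Lemma FCM k g h : FC k U g -> FC k U h -> FC k U (fun s p => g s p * h s p).
Proof.
have jc g1 h1 : jcont U g1 -> jcont U h1 -> jcont U (fun s p => g1 s p * h1 s p).
  by move=> jg jh s p Up; exact: (continuousM (jg s p Up) (jh s p Up)).
elim: k g h => [|k IH] g h; first exact: jc.
move=> FCg FCh; have [jg Hg] := FCg; have [jh Hh] := FCh; split; first exact: jc.
move=> v; have [dg Fg] := Hg v; have [dh Fh] := Hh v; split.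
  by move=> s p Up; exact: (derivableM (dg s p Up) (dh s p Up)).
apply: (FC_ext oU _ (FCD (IH _ _ (FCS FCg) Fh) (IH _ _ (FCS FCh) Fg))) => s p Up.
by have /= -> := deriveM (dg s p Up) (dh s p Up).
Qed.

Definition cFC k (g : R -> V -> R[i]) :=
  FC k U (fun s p => Re (g s p)) /\ FC k U (fun s p => Im (g s p)).

Lemma cFC_ext k (g h : R -> V -> R[i]) : (forall s p, g s p = h s p) -> cFC k g -> cFC k h.
Proof.
by move=> gh [h1 h2]; split; [apply: (FC_ext oU _ h1)|apply: (FC_ext oU _ h2)] => s p _; rewrite gh.
Qed.

Lemma cFC_cst k (c : R[i]) : cFC k (fun _ _ => c).
Proof. by split; exact: FC_cst. Qed.

Lemma cFCM k (g h : R -> V -> R[i]) : cFC k g -> cFC k h -> cFC k (fun s p => g s p * h s p).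
Proof.
move=> [g1 g2] [h1 h2]; split.
  apply: (FC_ext oU _ (FCD (FCM g1 h1) (FCM (FC_cst oU k (-1)) (FCM g2 h2)))) => s p _.
  by rewrite ReM mulN1r.
apply: (FC_ext oU _ (FCD (FCM g1 h2) (FCM g2 h1))) => s p _.
by rewrite ImM.
Qed.

Lemma cFCD k (g h : R -> V -> R[i]) : cFC k g -> cFC k h -> cFC k (fun s p => g s p + h s p).
Proof.
move=> [g1 g2] [h1 h2]; split.
  by apply: (FC_ext oU _ (FCD g1 h1)) => s p _; rewrite ReD.
by apply: (FC_ext oU _ (FCD g2 h2)) => s p _; rewrite ImD.
Qed.

Lemma cFC_sum k (I : Type) (r : seq I) (g : I -> R -> V -> R[i]) :
  (forall i, cFC k (g i)) -> cFC k (fun s p => \sum_(i <- r) g i s p).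
Proof.
move=> H; elim: r => [|i r IH].
  by apply: (cFC_ext _ (cFC_cst k 0)) => s p; rewrite big_nil.
by apply: (cFC_ext _ (cFCD (H i) IH)) => s p; rewrite big_cons.
Qed.

End FamiliesClosure.

Section Transport.
Context {R : realType} {n : nat}.
Local Notation P := (R * R)%type.
Local Notation M := 'M[R[i]]_n.
Variables (z0 : P) (r : R) (d : nat).
Hypothesis r0 : 0 < r.
Local Notation D2 := (disc z0 (2 * r)).
Local Notation U := (disc (0 : P) r).

(** Truncation to [-3/2, 3/2]: with it the coefficients of the transport
    equation are defined for every [s], while nothing changes near [0, 1]. *)
Definition clamp (s : R) : R := (`|s + 3 / 2| - `|s - 3 / 2|) / 2.

Lemma clamp_id s : `|s| <= 3 / 2 -> clamp s = s.
Proof.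
rewrite ler_norml => /andP[h1 h2]; rewrite /clamp ger0_norm; last by lra.
by rewrite ler0_norm; [field|lra].
Qed.

Lemma clamp_le s : `|clamp s| <= 3 / 2.
Proof.
rewrite ler_norml /clamp; have [h1|h1] := leP 0 (s + 3 / 2); have [h2|h2] := leP 0 (s - 3 / 2).
- by rewrite !ger0_norm //; apply/andP; split; lra.
- by rewrite ger0_norm // ltr0_norm //; apply/andP; split; lra.
- by rewrite ltr0_norm // ger0_norm //; apply/andP; split; lra.
- by rewrite !ltr0_norm //; apply/andP; split; lra.
Qed.

Lemma clamp_continuous : continuous clamp.
Proof.
have c1 (a : R) : continuous (fun s : R => `|s + a|).
  move=> s; apply: (@continuous_at_comp _ _ _ (fun s => s + a) (fun x => `|x|)).
    by apply: cvgD; [exact: cvg_id|exact: cvg_cst].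
  exact: norm_continuous.
have ch (s : R) : {for s, continuous (fun _ : R => 2^-1 : R)} by exact: cvg_cst.
by move=> s; exact: (continuousM (continuousB (c1 (3 / 2) s) (c1 (- (3 / 2)) s)) (ch s)).
Qed.

Lemma sqdist_scale (k : R) (p : P) : sqdist z0 (k *: p + z0) = k ^+ 2 * sqdist 0 p.
Proof. by rewrite /sqdist /= /GRing.scale /=; ring. Qed.

Lemma ray_in_disc (s : R) p : U p -> `|s| <= 3 / 2 -> D2 (s *: p + z0).
Proof.
move=> Up s32; rewrite /disc /= sqdist_scale.
have s2 : s ^+ 2 <= 9 / 4.
  by move: s32; rewrite ler_norml => /andP[h1 h2]; rewrite expr2; nra.
have p0 := sqdist_ge0 0 p; rewrite /disc /= in Up.
apply: (@le_lt_trans _ _ (9 / 4 * sqdist 0 p)); first by rewrite ler_wpM2r.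
by rewrite exprMn; have := exprn_gt0 2 r0; move: (r ^+ 2) (sqdist 0 p) Up p0 => a b; lra.
Qed.

Lemma FC_ray k (g : P -> R) : smooth_on D2 g -> FC k U (fun s p => g (clamp s *: p + z0)).
Proof.
have jc h : smooth_on D2 h -> jcont U (fun s p => h (clamp s *: p + z0)).
  move=> sh s p Up.
  apply: (@continuous_at_comp _ _ _ (fun q : R * P => clamp q.1 *: q.2 + z0) h); last first.
    exact: (smooth_on_cont sh (ray_in_disc Up (clamp_le s))).
  have c1 : {for (s, p), continuous (fun q : R * P => clamp q.1)}.
    by apply: (@continuous_at_comp _ _ _ fst clamp); [exact: cvg_fst|exact: clamp_continuous].
  apply: cvgD; last exact: cvg_cst.
  by apply: cvgZ; [exact: c1|exact: cvg_snd].
have cL (c : R) : continuous (GRing.scale c : {linear P -> P}).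
  exact: scaler_continuous.
elim: k g => [|k IH] g sg; first exact: jc.
split; first exact: jc.
move=> v; split.
  move=> s p Up.
  apply/(derivable_affine g (GRing.scale (clamp s) : {linear P -> P}) z0 p v).
  exact: (smooth_on_derivable sg (ray_in_disc Up (clamp_le s))).
have FD := IH _ (smooth_on_derive v sg).
have Fc : FC k U (fun s _ => clamp s).
  have jcl : jcont U (fun s (_ : P) => clamp s).
    move=> s p _; apply: (@continuous_at_comp _ _ _ fst clamp); first exact: cvg_fst.
    exact: clamp_continuous.
  case: {IH FD} k => [//|k]; split => // w; split.
    by move=> s p _; exact: derivable_cst.
  apply: (FC_ext (@disc_open _ _ _) _ (FC_cst (@disc_open _ _ _) k 0)) => s p _.
  by rewrite derive_cst.
apply: (FC_ext (@disc_open _ _ _) _ (FCM (@disc_open _ _ _) Fc FD)) => s p Up.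
transitivity ('D_(clamp s *: v) g (clamp s *: p + z0)); last first.
  by rewrite (derive_affine g (GRing.scale (clamp s) : {linear P -> P})).
have dg := smooth_differentiable (@disc_open _ _ _) sg (ray_in_disc Up (clamp_le s)).
rewrite (differentiable_dir v dg) (differentiable_dir (clamp s *: v) dg).
by rewrite mulrDr !mulrA.
Qed.

Definition nxt (X : nat -> M) k : M := if (k < d)%N then X k.+1 else 0.
Definition prv (X : nat -> M) k : M := if k is k'.+1 then X k' else 0.

(** The connection of the truncated system, applied to a tangent vector:
    [a] and [b] stand for the values of [A dz] and [B dzbar]. *)
Definition transp (a b : M) (X : nat -> M) k : M :=
  (X k - nxt X k) *m a + (X k - prv X k) *m b.

Lemma transp_sum (J : finType) (a b : M) (c : J -> R[i]) (X : J -> nat -> M) k :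
  transp a b (fun k => \sum_j c j *: X j k) k = \sum_j c j *: transp a b (X j) k.
Proof.
have E1 : nxt (fun k => \sum_j c j *: X j k) k = \sum_j c j *: nxt (X j) k.
  by rewrite /nxt; case: ifP => // _; rewrite big1 // => j _; rewrite scaler0.
have E2 : prv (fun k => \sum_j c j *: X j k) k = \sum_j c j *: prv (X j) k.
  by case: k {E1} => //=; rewrite big1 // => j _; rewrite scaler0.
rewrite /transp E1 E2 -!sumrB !mulmx_suml -big_split /=; apply: eq_bigr => j _.
by rewrite -!scalerBr -!scalemxAl scalerDr.
Qed.

Lemma eq_transp a b (X Y : nat -> M) k : (forall k, (k <= d)%N -> X k = Y k) ->
  (k <= d)%N -> transp a b X k = transp a b Y k.
Proof.
move=> XY kd; rewrite /transp /nxt XY //.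
have -> : prv X k = prv Y k by case: k kd => //= k kd; rewrite XY // ltnW.
by case: ifP => // kd'; rewrite XY.
Qed.

Local Notation I := (bool * 'I_d.+1 * ('I_n * 'I_n))%type.

Definition cmp (b : bool) (x : R[i]) : R := if b then Im x else Re x.

Definition bas (J : I) (k : nat) : M :=
  if k == J.1.2 :> nat then (if J.1.1 then ii else 1) *: delta_mx J.2.1 J.2.2 else 0.

Definition mkX (y : I -> R) (k : nat) : M := \sum_J (y J)%:C *: bas J k.

Lemma cmpD b x y : cmp b (x + y) = cmp b x + cmp b y.
Proof. by case: b; rewrite /= ?ReD ?ImD. Qed.

Lemma cmp0 b : cmp b 0 = 0. Proof. by case: b. Qed.

Lemma cmp_sum b (J : finType) (F : J -> R[i]) : cmp b (\sum_j F j) = \sum_j cmp b (F j).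
Proof. exact: (big_morph _ (cmpD b) (cmp0 b)). Qed.

Lemma cmpZ b (t : R) x : cmp b (t%:C * x) = t * cmp b x.
Proof. by case: x => u v; case: b; rewrite /= ?mul0r ?subr0 ?addr0. Qed.

Lemma cmp_ext (x y : R[i]) : (forall b, cmp b x = cmp b y) -> x = y.
Proof. by move=> H; apply: complex_ext; [exact: (H false)|exact: (H true)]. Qed.

Lemma bas_entry (J : I) (k : 'I_d.+1) b i j : cmp b (bas J k i j) = (J == (b, k, (i, j)))%:R.
Proof.
case: J => [[b' k'] [i' j']]; rewrite /bas /= !xpair_eqE.
have [kk|kk] := eqVneq (k : nat) k'; last first.
  rewrite mxE cmp0; have -> : (k' == k) = false.
    by apply/negP => /eqP E; move: kk; rewrite E eqxx.
  by rewrite andbF.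
have -> : k' = k by apply/val_inj.
rewrite eqxx andbT !mxE (eq_sym i) (eq_sym j).
by case: (i' == i); case: (j' == j); case: b; case: b'; rewrite /= ?mulr0n ?mulr1n ?mulr0 ?mulr1 ?subr0 ?addr0 ?mul0r ?add0r.
Qed.

Lemma mkX_entry y (k : 'I_d.+1) b i j : cmp b (mkX y k i j) = y (b, k, (i, j)).
Proof.
rewrite /mkX summxE cmp_sum (bigD1 (b, k, (i, j))) //= big1 ?addr0.
  by rewrite mxE cmpZ bas_entry eqxx mulr1.
by move=> J JE; rewrite mxE cmpZ bas_entry (negbTE JE) mulr0.
Qed.

End Transport.

Section TransportSolution.
Context {R : realType} {n : nat}.
Local Notation P := (R * R)%type.
Local Notation M := 'M[R[i]]_n.
Variables (z0 : P) (r : R) (d : nat) (A B : P -> M).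
Hypothesis r0 : 0 < r.
Local Notation D2 := (disc z0 (2 * r)).
Local Notation U := (disc (0 : P) r).
Hypotheses (sA : smooth_mx_on D2 A) (sB : smooth_mx_on D2 B).
Local Notation I := (bool * 'I_d.+1 * ('I_n * 'I_n))%type.

Let oU : open U := @disc_open _ _ _.

Lemma FC_p {V : normedModType R} (O : set V) (oO : open O) k (g : V -> R) :
  smooth_on O g -> FC k O (fun _ p => g p).
Proof.
have jc h : smooth_on O h -> jcont O (fun _ p => h p).
  move=> sh s p Op; apply: (@continuous_at_comp _ _ _ snd h); first exact: cvg_snd.
  exact: (smooth_on_cont sh Op).
elim: k g => [|k IH] g sg; first exact: jc.
split; first exact: jc.
move=> v; split; last exact: (IH _ (smooth_on_derive v sg)).
by move=> s p Op; exact: (smooth_on_derivable sg Op).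
Qed.

Definition adz p z : M := cpx p *: A z.
Definition bdzb p z : M := Num.conj (cpx p) *: B z.

Let coef (J K : I) (s : R) (p : P) : R :=
  cmp K.1.1 (transp d (adz p (clamp s *: p + z0)) (bdzb p (clamp s *: p + z0))
    (bas J) K.1.2 K.2.1 K.2.2).

Let FC_coef J K k : FC k U (coef J K).
Proof.
suff : cFC U k (fun s p => transp d (adz p (clamp s *: p + z0)) (bdzb p (clamp s *: p + z0))
    (bas J) K.1.2 K.2.1 K.2.2).
  by rewrite /coef; case: K => [[[] ?] ?] [].
have Fc : cFC U k (fun _ p => cpx p).
  by split; apply: FC_p => //; [exact: smooth_fst|exact: smooth_snd].
have FcJ : cFC U k (fun _ p => Num.conj (cpx p)).
  split; first by apply: FC_p => //; exact: smooth_fst.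
  apply: FC_p => //; exact: (smooth_onN oU (smooth_snd U)).
have FA i j : cFC U k (fun s p => A (clamp s *: p + z0) i j).
  by have [s1 s2] := sA i j; split; [exact: (FC_ray r0 k s1)|exact: (FC_ray r0 k s2)].
have FB i j : cFC U k (fun s p => B (clamp s *: p + z0) i j).
  by have [s1 s2] := sB i j; split; [exact: (FC_ray r0 k s1)|exact: (FC_ray r0 k s2)].
pose X1 := (bas J K.1.2 - nxt d (bas J) K.1.2 : M).
pose X2 := (bas J K.1.2 - prv (bas J) K.1.2 : M).
have H1 := cFC_sum oU (index_enum 'I_n) (fun l => cFCM oU (cFC_cst oU k (X1 K.2.1 l)) (cFCM oU Fc (FA l K.2.2))).
have H2 := cFC_sum oU (index_enum 'I_n) (fun l => cFCM oU (cFC_cst oU k (X2 K.2.1 l)) (cFCM oU FcJ (FB l K.2.2))).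
apply: (cFC_ext oU _ (cFCD oU H1 H2)) => s p.
rewrite /transp [RHS]mxE; congr (_ + _); rewrite mxE; apply: eq_bigr => l _;
  by congr (_ * _); rewrite [RHS]mxE.
Qed.

Let coefE (y : I -> R) s p (k : 'I_d.+1) b i j :
  \sum_J y J * coef J (b, k, (i, j)) s p =
  cmp b (transp d (adz p (clamp s *: p + z0)) (bdzb p (clamp s *: p + z0)) (mkX y) k i j).
Proof.
rewrite /mkX transp_sum summxE cmp_sum; apply: eq_bigr => J _.
by rewrite [X in cmp b X]mxE cmpZ.
Qed.

Lemma transport_exists (c : nat -> M) : exists X : R -> P -> nat -> M,
  [/\ forall p (k : 'I_d.+1), U p -> X 0 p k = c k,
      forall p s (k : 'I_d.+1) b i j, U p -> `|s| <= 3 / 2 ->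
        is_derive s (1 : R) (fun s => cmp b (X s p k i j))
          (cmp b (transp d (adz p (s *: p + z0)) (bdzb p (s *: p + z0)) (X s p) k i j)),
      forall s k, smooth_mx_on U (fun p => X s p k)
    & forall p (Y : R -> nat -> M), U p -> (forall k : 'I_d.+1, Y 0 k = c k) ->
        (forall s (k : 'I_d.+1) b i j, `|s| <= 1 ->
          is_derive s (1 : R) (fun s => cmp b (Y s k i j))
            (cmp b (transp d (adz p (s *: p + z0)) (bdzb p (s *: p + z0)) (Y s) k i j))) ->
        forall s (k : 'I_d.+1), `|s| <= 1 -> Y s k = X s p k].
Proof.
pose c' (K : I) := cmp K.1.1 (c K.1.2 K.2.1 K.2.2).
have [y Hy] := psolution_exists c' (fun J K => FC_coef J K 0%N).
have Fy k : forall K, FC k U (y K) by exact: (psolves_FC oU (fun J K => FC_coef J K k) Hy).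
exists (fun s p k => mkX (fun K => y K s p) k); split.
- move=> p k Up; have [y0 _] := Hy p Up.
  by apply/matrixP => i j; apply: cmp_ext => b; rewrite mkX_entry y0.
- move=> p s k b i j Up s32; have [_ dy] := Hy p Up.
  have := dy (b, k, (i, j)) s; rewrite coefE clamp_id //.
  congr (is_derive _ _ _ _); apply/funext => t; by rewrite mkX_entry.
- move=> s k i j.
  have sy J : csmooth_on U (fun p => (y J s p)%:C).
    by split; [apply/smooth_onP => l; exact: (FC_Ck s (Fy l J))|exact: smooth_on_cst].
  apply: (csmooth_on_ext oU _ (csmooth_on_sum (index_enum _) oU (fun J (_ : true) =>
    csmooth_onM oU (sy J) (csmooth_on_cst U (bas J k i j))))) => p _.
  by rewrite /mkX summxE; apply: eq_bigr => J _; rewrite mxE.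
- move=> p Y Up Y0 dY s k s1.
  have [y0 dy] := Hy p Up.
  apply/matrixP => i j; apply: cmp_ext => b; rewrite mkX_entry.
  pose z (K : I) (t : R) := cmp K.1.1 (Y t K.1.2 K.2.1 K.2.2).
  have zE t (l : nat) : (l <= d)%N -> Y t l = mkX (fun K => z K t) l.
    move=> ld; apply/matrixP => i' j'; apply: cmp_ext => b'.
    by rewrite -[l]/(nat_of_ord (Ordinal (ld : (l < d.+1)%N))) mkX_entry.
  have := @solves_unique R I (fun J K s => coef J K s p) c' z (fun K s => y K s p) 1.
  move=> H; apply: (H _ _ y0 _ _ (b, k, (i, j)) s s1) => {H}.
  + by move=> J K; exact: (jcont_s (FC_jcont (FC_coef J K 0%N)) Up).
  + by move=> K; rewrite /z Y0.
  + move=> [[b' k'] [i' j']] t t1.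
    have t32 : `|t| <= 3 / 2 by apply: le_trans t1 _; lra.
    have := dY t k' b' i' j' t1; rewrite (eq_transp _ _ (zE t)); last by rewrite -ltnS.
    by rewrite coefE clamp_id.
Qed.

Lemma transp_scale (t : R) a b (X : nat -> M) k :
  transp d (t%:C *: a) (t%:C *: b) X k = t%:C *: transp d a b X k.
Proof. by rewrite /transp -!scalemxAr -scalerDr. Qed.

Lemma cpxZ (t : R) p : cpx (t *: p) = t%:C * cpx p.
Proof. by apply: complex_ext; rewrite /= ?mul0r ?subr0 ?addr0. Qed.

Lemma conj_real (t : R) : Num.conj (t%:C : R[i]) = t%:C.
Proof. by apply: complex_ext; rewrite /= ?oppr0. Qed.

Lemma adz_scale (t : R) p z : adz (t *: p) z = t%:C *: adz p z.
Proof. by rewrite /adz cpxZ scalerA. Qed.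

Lemma bdzb_scale (t : R) p z : bdzb (t *: p) z = t%:C *: bdzb p z.
Proof.
rewrite /bdzb cpxZ scalerA; congr (_ *: _).
by rewrite -[in RHS](conj_real t) -rmorphM.
Qed.

(** The value at parameter 1, as a function of the end point, satisfies the
    transport equation in the radial direction: along a ray it is the solution
    itself, by uniqueness. *)
Lemma radial_transport (c : nat -> M) : exists v : nat -> P -> M,
  [/\ forall k, smooth_mx_on (disc z0 r) (v k),
      forall z (k : 'I_d.+1), disc z0 r z ->
        mderive (z - z0) (v k) z = transp d (adz (z - z0) z) (bdzb (z - z0) z) (v^~ z) k
    & forall (C : nat -> P -> M) r1, 0 < r1 -> r1 <= r -> (forall k : 'I_d.+1, C k z0 = c k) ->
        (forall k : 'I_d.+1, smooth_mx_on (disc z0 r1) (C k)) ->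
        (forall z (k : 'I_d.+1) p, disc z0 r1 z ->
          mderive p (C k) z = transp d (adz p z) (bdzb p z) (C^~ z) k) ->
        forall z (k : 'I_d.+1), disc z0 r1 z -> v k z = C k z].
Proof.
have [X [X0 dX sX uX]] := transport_exists c.
have tr z : sqdist 0 (z - z0) = sqdist z0 z.
  by rewrite /sqdist /= !subr0.
have trU r1 z : disc z0 r1 z -> disc 0 r1 (z - z0) by rewrite /disc /= tr.
have cmp_derive b (F : P -> M) z p i j :
    cmp b (mderive p F z i j) = 'D_p (fun y => cmp b (F y i j)) z.
  by rewrite mxE; case: b.
pose v k z := X 1 (z - z0) k.
have sv k : smooth_mx_on (disc z0 r) (v k).
  pose idl : {linear P -> P} := idfun.
  have cid : continuous idl by move=> y; exact: cvg_id.
  move=> i j; have [s1 s2] := sX 1 k i j.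
  by split; [apply: (smooth_on_affine (L := idl) cid _ s1)|apply: (smooth_on_affine (L := idl) cid _ s2)];
    move=> z Dz; exact: trU.
exists v; split=> //.
- move=> z k Dz; set p := z - z0; have Up : U p by exact: trU.
  have scal (s : R) : `|s| <= 3 / 2 -> U (s *: p) -> X 1 (s *: p) k = X s p k.
    move=> s32 Usp.
    have h1 : `|1 : R| <= 1 by rewrite normr1.
    have := uX (s *: p) (fun t => X (s * t) p) Usp _ _ 1 k h1.
    rewrite mulr1 => H; apply/esym; apply: H => {k} [k|t k b i j t1].
      by rewrite mulr0 X0.
    have st : `|s * t| <= 3 / 2.
      by rewrite normrM; apply: le_trans s32; rewrite ler_piMr.
    have Hs := is_deriveZ s (is_derive_id t (1 : R)).
    have := is_derive_comp1 (dX p (s * t) k b i j Up st) Hs.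
    congr (is_derive _ _ _ _).
    rewrite scalerA (mulrC t) adz_scale bdzb_scale transp_scale [X in _ = cmp b X]mxE cmpZ [LHS]mulrC.
    by have -> : s%:A = s :> R by rewrite /GRing.scale /= mulr1.
  apply/matrixP => i j; apply: cmp_ext => b; rewrite cmp_derive.
  have h1 : `|1 : R| <= 3 / 2 by rewrite normr1; lra.
  have H1 := dX p 1 k b i j Up h1.
  have zE : 1 *: p + z0 = z by rewrite scale1r /p subrK.
  rewrite zE in H1.
  have H2 : is_derive (0 : R) (1 : R) (fun h => cmp b (X (h + 1) p k i j))
      (cmp b (transp d (adz p z) (bdzb p z) (X 1 p) k i j)).
    have H3 := is_deriveD (is_derive_id (0 : R) (1 : R)) (is_derive_cst (1 : R) (0 : R) (1 : R)).
    have H1' : is_derive (0 + 1 : R) (1 : R) (fun s => cmp b (X s p k i j))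
        (cmp b (transp d (adz p z) (bdzb p z) (X 1 p) k i j)) by rewrite add0r.
    have := @is_derive_comp1 R R (fun s => cmp b (X s p k i j)) (fun h => h + 1) 0 1 _ _ H1' H3.
    by rewrite addr0 mulr1.
  have df : derivable (fun y => cmp b (v k y i j)) z p.
    have [s1 s2] := sv k i j.
    by case: b {H1 H2}; [exact: (smooth_on_derivable s2 Dz)|exact: (smooth_on_derivable s1 Dz)].
  have := @is_derive_line R P (fun y => cmp b (v k y i j)) z p 0.
  rewrite scale0r add0r => /(_ df) H4.
  have nU : \forall h \near (0 : R), U ((h + 1) *: p) /\ `|h + 1| <= 3 / 2.
    have ch : {for (0 : R), continuous (fun h : R => (h + 1) *: p)}.
      apply: cvgZ; last exact: cvg_cst.
      by apply: cvgD; [exact: cvg_id|exact: cvg_cst].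
    have U1 : U ((0 + 1) *: p) by rewrite add0r scale1r.
    have n1 : \forall h \near (0 : R), `|h| < 2^-1.
      by apply/nbhs_ballP; exists 2^-1 => //= h; rewrite -ball_normE /= sub0r normrN.
    have n2 : \forall h \near (0 : R), U ((h + 1) *: p).
      by apply: (ch U); exact: (open_near oU U1).
    near=> h; split; first by near: h.
    have h2 : `|h| < 2^-1 by near: h.
    by move: h2; rewrite ler_norml ltr_norml => /andP[h2 h3]; apply/andP; split; lra.
  have near0 : \forall h \near (0 : R), cmp b (X (h + 1) p k i j) = cmp b (v k (h *: p + z) i j).
    apply: filterS nU => h [Uh h32]; rewrite -scal //; congr (cmp b (X 1 _ k i j)).
    by rewrite /p scalerDl scale1r addrA.
  have H5 := near_eq_is_derive near0 H2.
  by case: H4 => _ <-; case: H5.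
- move=> C r1 r10 r1r C0 sC dC z k Dz.
  have Dzr : disc z0 r z by exact: (disc_sub (ltW r10) r1r).
  have Up := trU _ _ Dzr.
  have h1 : `|1 : R| <= 1 by rewrite normr1.
  have := uX (z - z0) (fun t k => C k (t *: (z - z0) + z0)) Up _ _ 1 k h1.
  rewrite scale1r subrK => H; apply/esym; apply: H => {k} [k|t k b i j t1].
    by rewrite scale0r add0r.
  set y := t *: (z - z0) + z0.
  have Dy : disc z0 r1 y.
    rewrite /disc /= /y sqdist_scale tr; apply: le_lt_trans Dz.
    rewrite ler_piMl ?sqdist_ge0 //.
    by move: t1; rewrite ler_norml => /andP[t1 t2]; rewrite expr2; nra.
  have df : derivable (fun y => cmp b (C k y i j)) y (z - z0).
    have [s1 s2] := sC k i j.
    by case: b; [exact: (smooth_on_derivable s2 Dy)|exact: (smooth_on_derivable s1 Dy)].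
  have := is_derive_line df.
  by rewrite -cmp_derive dC.
Unshelve. all: by end_near. Qed.

End TransportSolution.

(** * Unique continuation along a disc *)

Section SquareNorm.
Context {R : realType} {n : nat}.
Local Notation M := 'M[R[i]]_n.

Implicit Types X Y : M.

Definition sqc (x : R[i]) : R := Re x * Re x + Im x * Im x.
Definition nsq (X : M) : R := \sum_i \sum_j sqc (X i j).

Lemma sqc_ge0 x : 0 <= sqc x.
Proof. by rewrite addr_ge0 // -expr2 sqr_ge0. Qed.

Lemma sqc_eq0 x : sqc x = 0 -> x = 0.
Proof.
move=> /eqP; rewrite paddr_eq0 -?expr2 ?sqr_ge0 // !expf_eq0 /= => /andP[/eqP h1 /eqP h2].
exact: complex_ext.
Qed.

Lemma sqcM x y : sqc (x * y) = sqc x * sqc y.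
Proof. by rewrite /sqc ReM ImM; ring. Qed.

Lemma sqcN x : sqc (- x) = sqc x.
Proof. by rewrite /sqc ReN ImN; ring. Qed.

Lemma sqcD x y : sqc (x + y) <= 2 * (sqc x + sqc y).
Proof.
rewrite /sqc ReD ImD; have := sqr_ge0 (Re x - Re y); have := sqr_ge0 (Im x - Im y).
by rewrite !expr2; nra.
Qed.

Lemma sqc_sum (F : 'I_n -> R[i]) : sqc (\sum_k F k) <= n%:R * \sum_k sqc (F k).
Proof.
have real (f : 'I_n -> R) : (\sum_k f k) * (\sum_k f k) <= n%:R * \sum_k f k * f k.
  have S2 : \sum_k \sum_l (f k * f k + f l * f l) = 2 * (n%:R * \sum_k f k * f k).
    transitivity (\sum_k (n%:R * (f k * f k) + \sum_l f l * f l)).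
      by apply: eq_bigr => k _; rewrite big_split /= sumr_const card_ord mulr_natl.
    by rewrite big_split /= -mulr_sumr sumr_const card_ord -[_ *+ n]mulr_natl; ring.
  rewrite -(ler_pM2l (ltr0Sn R 1)) -S2 mulr_suml mulr_sumr; apply: ler_sum => k _.
  rewrite mulr_sumr mulr_sumr; apply: ler_sum => l _.
  by have := sqr_ge0 (f k - f l); rewrite expr2; nra.
rewrite {1}/sqc Re_sum Im_sum.
apply: le_trans (lerD (real _) (real _)) _.
by rewrite -mulrDr -big_split.
Qed.

Lemma nsq_ge0 X : 0 <= nsq X.
Proof. by rewrite sumr_ge0 // => i _; rewrite sumr_ge0 // => j _; exact: sqc_ge0. Qed.

Lemma entry_le_nsq X i j : sqc (X i j) <= nsq X.
Proof.
rewrite /nsq (bigD1 i) //= (bigD1 j) //= -addrA lerDl addr_ge0 // sumr_ge0 // => k _.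
  exact: sqc_ge0.
by rewrite sumr_ge0 // => l _; exact: sqc_ge0.
Qed.

Lemma nsq0 : nsq (0 : M) = 0.
Proof. by rewrite /nsq big1 // => i _; rewrite big1 // => j _; rewrite mxE /sqc /= mul0r addr0. Qed.

Lemma nsqN X : nsq (- X) = nsq X.
Proof. by apply: eq_bigr => i _; apply: eq_bigr => j _; rewrite mxE sqcN. Qed.

Lemma nsqB_le X Y : nsq (X - Y) <= 2 * (nsq X + nsq Y).
Proof.
rewrite -[nsq Y]nsqN -big_split mulr_sumr; apply: ler_sum => i _.
rewrite -big_split mulr_sumr; apply: ler_sum => j _.
by rewrite [X in sqc X]mxE; exact: sqcD.
Qed.

Lemma nsqZ c X : nsq (c *: X) = sqc c * nsq X.
Proof.
by rewrite mulr_sumr; apply: eq_bigr => i _; rewrite mulr_sumr; apply: eq_bigr => j _; rewrite mxE sqcM.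
Qed.

Lemma sqc_mul_le X Y i j : sqc ((X *m Y) i j) <= n%:R * (nsq X * nsq Y).
Proof.
rewrite mxE; apply: le_trans (sqc_sum _) _; apply: ler_wpM2l => //.
apply: (@le_trans _ _ (\sum_k sqc (X i k) * nsq Y)).
  apply: ler_sum => k _; rewrite sqcM; apply: ler_wpM2l; first exact: sqc_ge0.
  exact: entry_le_nsq.
rewrite -mulr_suml; apply: ler_wpM2r; first exact: nsq_ge0.
rewrite [X in _ <= X](bigD1 i) //= lerDl sumr_ge0 // => k _.
by rewrite sumr_ge0 // => l _; exact: sqc_ge0.
Qed.

Lemma nsq_continuous {V : normedModType R} (A : set V) (F : V -> M) x : open A -> A x ->
  smooth_mx_on A F -> {for x, continuous (fun y => nsq (F y))}.
Proof.
move=> oA Ax sF; apply: (@smooth_on_cont _ _ A); last by [].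
apply: (smooth_on_sum _ oA) => i _; apply: (smooth_on_sum _ oA) => j _.
have [s1 s2] := sF i j.
exact: (smooth_onD oA (smooth_onM oA s1 s1) (smooth_onM oA s2 s2)).
Qed.

End SquareNorm.

Section MatrixContinuation.
Context {R : realType} {n m : nat}.
Local Notation P := (R * R)%type.
Local Notation M := 'M[R[i]]_n.

Lemma pzb_sqc (F : P -> M) z i j :
  ('D_e1 (fun y => Re (F y i j)) z - 'D_e2 (fun y => Im (F y i j)) z) ^+ 2
  + ('D_e1 (fun y => Im (F y i j)) z + 'D_e2 (fun y => Re (F y i j)) z) ^+ 2
  = 4 * sqc (pzb F z i j).
Proof.
have -> : pzb F z i j = 2^-1%:C * ((cderive e1 (fun y => F y i j) z) + ii * cderive e2 (fun y => F y i j) z).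
  by rewrite !mxE; congr (_ * _); rewrite rmorphV ?unitfE ?pnatr_eq0 // rmorph_nat.
rewrite sqcM /cderive.
move: ('D_e1 (fun y => Re (F y i j)) z) ('D_e2 (fun y => Re (F y i j)) z) => x1 x2.
move: ('D_e1 (fun y => Im (F y i j)) z) ('D_e2 (fun y => Im (F y i j)) z) => y1 y2.
by rewrite /sqc /ii /=; field.
Qed.

Lemma pz_sqc (F : P -> M) z i j :
  ('D_e1 (fun y => Re (F y i j)) z + 'D_e2 (fun y => Im (F y i j)) z) ^+ 2
  + ('D_e1 (fun y => Im (F y i j)) z - 'D_e2 (fun y => Re (F y i j)) z) ^+ 2
  = 4 * sqc (pz F z i j).
Proof.
have -> : pz F z i j = 2^-1%:C * ((cderive e1 (fun y => F y i j) z) - ii * cderive e2 (fun y => F y i j) z).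
  by rewrite !mxE; congr (_ * _); rewrite rmorphV ?unitfE ?pnatr_eq0 // rmorph_nat.
rewrite sqcM /cderive.
move: ('D_e1 (fun y => Re (F y i j)) z) ('D_e2 (fun y => Re (F y i j)) z) => x1 x2.
move: ('D_e1 (fun y => Im (F y i j)) z) ('D_e2 (fun y => Im (F y i j)) z) => y1 y2.
by rewrite /sqc /ii /=; field.
Qed.

(** [disc_unique_continuation] for matrices: [a] is almost holomorphic, [b]
    almost antiholomorphic, the [w k] are almost constant along the rays. *)
Lemma mx_unique_continuation (a b : P -> M) (w : 'I_m -> P -> M) (Kf : P -> R)
    (z0 : P) (r0 r : R) : 0 < r0 -> 0 < r ->
  let D := disc z0 r in
  smooth_mx_on D a -> smooth_mx_on D b -> (forall k, smooth_mx_on D (w k)) ->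
  (forall z, D z -> {for z, continuous Kf}) ->
  let vanish z := [/\ a z = 0, b z = 0 & forall k, w k z = 0] in
  (forall z, disc z0 r0 z -> vanish z) ->
  let S z := nsq (a z) + nsq (b z) + \sum_k nsq (w k z) in
  (forall z, D z -> forall i j,
     [/\ 4 * sqc (pzb a z i j) <= Kf z * S z, 4 * sqc (pz b z i j) <= Kf z * S z
       & forall k, sqc (mderive (z - z0) (w k) z i j) <= Kf z * S z]) ->
  forall z, D z -> vanish z.
Proof.
move=> r00 rr D sa sb sw cK vanish V0 S HK z Dz.
have oD : open D by exact: disc_open.
pose I := (bool * ('I_n * 'I_n))%type; pose J := ('I_m * (bool * ('I_n * 'I_n)))%type.
pose p (i : I) (z : P) := if i.1 then Re (b z i.2.1 i.2.2) else Re (a z i.2.1 i.2.2).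
pose q (i : I) (z : P) := if i.1 then - Im (b z i.2.1 i.2.2) else Im (a z i.2.1 i.2.2).
pose u (j : J) (z : P) := cmp j.2.1 (w j.1 z j.2.2.1 j.2.2.2).
have SE y : \sum_i (p i y * p i y + q i y * q i y) + \sum_j u j y * u j y = S y.
  rewrite /S; congr (_ + _).
    rewrite -(pair_bigA _ (fun c ij => p (c, ij) y * p (c, ij) y + q (c, ij) y * q (c, ij) y)) /=.
    rewrite big_bool /= [LHS]addrC; congr (_ + _); rewrite /nsq pair_bigA /=.
      by [].
    by apply: eq_bigr => ij _; rewrite /p /q /sqc /=; ring.
  rewrite -(pair_bigA _ (fun k c => u (k, c) y * u (k, c) y)) /=; apply: eq_bigr => k _.
  rewrite -(pair_bigA _ (fun c ij => u (k, (c, ij)) y * u (k, (c, ij)) y)) /=.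
  rewrite big_bool /= addrC -big_split /nsq pair_bigA /=.
  by apply: eq_bigr => ij _.
have sp i : smooth_on D (p i).
  by case: i => [[] [i j]]; [exact: (sb i j).1|exact: (sa i j).1].
have sq i : smooth_on D (q i).
  by case: i => [[] [i j]]; [exact: (smooth_onN oD (sb i j).2)|exact: (sa i j).2].
have su j : smooth_on D (u j).
  by case: j => [k [[] [i j]]]; [exact: (sw k i j).2|exact: (sw k i j).1].
have := @disc_unique_continuation R I J p q u Kf z0 r0 r r00 rr sp sq su cK _ _ z Dz.
move=> H; have {H} [] := H.
- move=> y /V0[ya yb yw]; split.
    by move=> [[] [i j]]; rewrite /p /q /= ?ya ?yb mxE /= ?oppr0.
  by move=> [k [c [i j]]]; rewrite /u /= yw mxE cmp0.
- move=> y Dy; rewrite SE; split.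
    move=> [[] [i j]]; have [h1 h2 _] := HK y Dy i j; last first.
      by move: h1; rewrite -(pzb_sqc a y i j).
    rewrite /p /q /=.
    have dN v : 'D_v (fun y => - Im (b y i j)) y = - 'D_v (fun y => Im (b y i j)) y.
      exact: (deriveN (smooth_on_derivable (sb i j).2 Dy)).
    rewrite !dN opprK; move: h2; rewrite -(pz_sqc b y i j); apply: le_trans.
    move: ('D_e1 _ y) ('D_e2 _ y) ('D_e1 _ y) ('D_e2 _ y) => x1 x2 x3 x4.
    by rewrite le_eqVlt; apply/orP; left; apply/eqP; ring.
  move=> [k [c [i j]]]; have [_ _ /(_ k)] := HK y Dy i j; apply: le_trans.
  rewrite /u [X in sqc X]mxE /cderive /sqc /=.
  by case: c; rewrite /= expr2 ?lerDl ?lerDr -expr2 sqr_ge0.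
- move=> H1 H2; split.
  + apply/matrixP => i j; rewrite mxE; have [h1 h2] := H1 (false, (i, j)).
    exact: complex_ext.
  + apply/matrixP => i j; rewrite mxE; have [h1 /eqP h2] := H1 (true, (i, j)).
    by apply: complex_ext; rewrite // -[LHS]opprK; move: h2; rewrite /q /= => /eqP ->; rewrite oppr0.
  + move=> k; apply/matrixP => i j; rewrite mxE; apply: cmp_ext => c; rewrite cmp0.
    exact: (H2 (k, (c, (i, j)))).
Qed.

End MatrixContinuation.

(** * Extension of polynomial solutions over a disc *)

Section Extension.
Context {R : realType} {n : nat}.
Local Notation P := (R * R)%type.
Local Notation M := 'M[R[i]]_n.
Implicit Types (A B : P -> M) (C : nat -> P -> M) (O : set P).

(** The equations of the coefficients of a polynomial extended solution
    [sum_k lambda^k C_k] of degree [d]; [A] and [B] are the components of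
    [phi^-1 dphi / 2].  The equation of [C_(-1)] is the condition [psol_low],
    and that of [C_(d+1)] gives [psol_high]. *)
Record psol (d : nat) O A B C : Prop := PSol {
  psol_smooth : forall k, smooth_mx_on O (C k);
  psol_pz : forall k z, O z -> pz (C k) z = (C k z - C k.+1 z) *m A z;
  psol_pzb : forall k z, O z -> pzb (C k) z = (C k z - prv (C^~ z) k) *m B z;
  psol_deg : forall k z, (d < k)%N -> O z -> C k z = 0;
  psol_low : forall z, O z -> C 0%N z *m A z = 0
}.

Lemma psol_high d O A B C z : open O -> psol d O A B C -> O z -> C d z *m B z = 0.
Proof.
move=> oO [_ _ Cb Cd _] Oz.
have n0 : \forall y \near z, C d.+1 y = (fun=> 0) y.
  by apply: filterS (open_near oO Oz) => y; apply: Cd.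
have := Cb d.+1 z Oz; rewrite (pzb_near n0) pzb_cst Cd //= sub0r mulNmx.
by move/eqP; rewrite eq_sym oppr_eq0 => /eqP.
Qed.

Lemma mderive_transp d O A B C z p k : open O -> psol d O A B C -> O z -> (k <= d)%N ->
  mderive p (C k) z = transp d (adz A p z) (bdzb B p z) (C^~ z) k.
Proof.
move=> oO sC Oz kd; have [sm Cz Cb Cd _] := sC.
rewrite (mderive_dir p (smooth_mx_differentiable oO Oz (sm k))) Cz // Cb //.
have nE : nxt d (C^~ z) k = C k.+1 z by rewrite /nxt; case: ltnP => // dk; rewrite Cd.
by rewrite /transp nE /adz /bdzb -!scalemxAr.
Qed.

(** The failure of the truncated system to be flat is concentrated in its
    first and last components. *)
Lemma curvature O A B (V Vn Vp E F Ep Fn : P -> M) z : open O -> O z ->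
  smooth_mx_on O A -> smooth_mx_on O B ->
  smooth_mx_on O V -> smooth_mx_on O Vn -> smooth_mx_on O Vp ->
  (forall z, O z -> pzb A z = A z *m B z - B z *m A z) ->
  (forall z, O z -> pz B z = B z *m A z - A z *m B z) ->
  (forall z, O z -> E z = pz V z - (V z - Vn z) *m A z) ->
  (forall z, O z -> F z = pzb V z - (V z - Vp z) *m B z) ->
  pz Vp z = Ep z + (Vp z - V z) *m A z ->
  pzb Vn z = Fn z + (Vn z - V z) *m B z ->
  pzb E z - pz F z = (E z - Ep z) *m B z - (F z - Fn z) *m A z.
Proof.
move=> oO Oz sA sB sV sVn sVp fA fB eE eF eEp eFn.
have nE : \forall y \near z, E y = pz V y - (V y - Vn y) *m A y.
  by apply: filterS (open_near oO Oz) => y; exact: eE.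
have nF : \forall y \near z, F y = pzb V y - (V y - Vp y) *m B y.
  by apply: filterS (open_near oO Oz) => y; exact: eF.
have s1 := smooth_mx_onB oO sV sVn; have s2 := smooth_mx_onB oO sV sVp.
rewrite (pzb_near nE) (pz_near nF).
rewrite (pzbB oO Oz (smooth_pz oO sV) (smooth_mx_onM oO s1 sA)).
rewrite (pzB oO Oz (smooth_pzb oO sV) (smooth_mx_onM oO s2 sB)).
rewrite (pz_pzb_sym oO Oz sV) (pzbM oO Oz s1 sA) (pzM oO Oz s2 sB).
rewrite (pzbB oO Oz sV sVn) (pzB oO Oz sV sVp) fA // fB // eEp eFn.
have -> : pz V z = E z + (V z - Vn z) *m A z by rewrite eE // subrK.
have -> : pzb V z = F z + (V z - Vp z) *m B z by rewrite eF // subrK.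
move: (pzb (pz V) z) (E z) (F z) (Ep z) (Fn z) => W e f ep fn.
move: (V z) (Vn z) (Vp z) (A z) (B z) => v vn vp a b.
rewrite !(mulmxDl, mulmxDr, mulNmx, mulmxN, opprD, opprK, mulmxA).
move: (e *m b) (ep *m b) (f *m a) (fn *m a) => x1 x2 x3 x4.
move: (v *m a *m b) (vn *m a *m b) (vp *m a *m b) => x5 x6 x7.
move: (v *m b *m a) (vn *m b *m a) (vp *m b *m a) => x8 x9 x10.
by apply/matrixP => i j; rewrite !mxE; ring.
Qed.

Variables (z0 : P) (r : R) (d : nat) (A B : P -> M).
Hypothesis rr : 0 < r.
Local Notation D2 := (disc z0 (2 * r)).
Local Notation D := (disc z0 r).
Hypotheses (sA2 : smooth_mx_on D2 A) (sB2 : smooth_mx_on D2 B).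
Hypothesis fA : forall z, D z -> pzb A z = A z *m B z - B z *m A z.
Hypothesis fB : forall z, D z -> pz B z = B z *m A z - A z *m B z.

Let oD : open D := @disc_open _ _ _.
Let zet (z : P) : R[i] := cpx (z - z0).

Let sqc_zet z : sqc (zet z) = sqdist z0 z.
Proof. by rewrite /sqc /zet /sqdist /= !expr2. Qed.

Let smooth_zet : csmooth_on D zet.
Proof.
split.
  exact: (smooth_onB oD (smooth_fst D) (smooth_on_cst D z0.1)).
exact: (smooth_onB oD (smooth_snd D) (smooth_on_cst D z0.2)).
Qed.

(** The coordinate [zet] is holomorphic: it is a constant for [pzb], and its
    conjugate is one for [pz]. *)
Let dzet v z : cderive v zet z = cpx v.
Proof.
rewrite /cderive /zet /cpx; apply: complex_ext => /=.
  have H := is_deriveB (is_derive_fst z v) (is_derive_cst z0.1 z v).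
  by have [_ ->] := H; rewrite subr0.
have H := is_deriveB (is_derive_snd z v) (is_derive_cst z0.2 z v).
by have [_ ->] := H; rewrite subr0.
Qed.

Let dzetJ v z : D z -> cderive v (fun y => Num.conj (zet y)) z = Num.conj (cpx v).
Proof. by move=> Dz; rewrite (cderiveJ Dz v smooth_zet) dzet. Qed.

Let cpx_e1 : cpx (e1 : P) = 1. Proof. by []. Qed.
Let cpx_e2 : cpx (e2 : P) = ii. Proof. by []. Qed.

Let pz_zetJ (F : P -> M) z : D z -> smooth_mx_on D F ->
  pz (fun y => - (Num.conj (zet y) *: F y)) z = - (Num.conj (zet z) *: pz F z).
Proof.
move=> Dz sF; have sJ := csmooth_onJ oD smooth_zet.
have s1 := smooth_mx_onZf oD sJ sF.
have -> : (fun y => - (Num.conj (zet y) *: F y)) = (fun y => (-1) *: (Num.conj (zet y) *: F y)).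
  by apply/funext => y; rewrite scaleN1r.
rewrite (pzZ Dz (-1) s1) scaleN1r /pz; congr (- _).
rewrite !(mderiveZf Dz _ sJ sF) !dzetJ // cpx_e1 cpx_e2 rmorph1 conj_ii.
move: (F z) (mderive e1 F z) (mderive e2 F z) (Num.conj (zet z)) => f x y c.
have i2 := @ii2 R; apply/matrixP => i j; rewrite !mxE; by ring: i2.
Qed.

Let pzb_zet (F : P -> M) z : D z -> smooth_mx_on D F ->
  pzb (fun y => zet y *: F y) z = zet z *: pzb F z.
Proof.
move=> Dz sF; rewrite /pzb !(mderiveZf Dz _ smooth_zet sF) !dzet cpx_e1 cpx_e2.
move: (F z) (mderive e1 F z) (mderive e2 F z) (zet z) => f x y c.
have i2 := @ii2 R; apply/matrixP => i j; rewrite !mxE; by ring: i2.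
Qed.

(** The candidate [X] is the radial transport of [C z0].  Its errors in the two
    equations of [psol], multiplied by [zet] and its conjugate, are [w] and
    [- w]; besides, [a = X 0 *m A] and [b = X d *m B] have to vanish.  The
    functions [a], [b], [w] satisfy a closed linear system: [pzb a] and [pz b]
    are combinations of [a], [b] and [w], and so is the radial derivative of
    [w].  They vanish on the small disc, where [X] is the given solution, hence
    on the large one by [mx_unique_continuation]. *)
Lemma psol_extend C r0 : 0 < r0 -> r0 <= r -> psol d (disc z0 r0) A B C ->
  exists2 C', psol d D A B C' & forall k z, disc z0 r0 z -> C' k z = C k z.
Proof.
move=> r00 r0r sC.
have le8 (x y t : R) : 0 <= x -> 0 <= y -> 0 <= t ->
    2 * (2 * (2 * (2 * t + y))) <= 8 * (1 + x + 4 * t + y) by move=> *; lra.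
have sub0 : disc z0 r0 `<=` D by exact: disc_sub (ltW r00) r0r.
have o0 : open (disc z0 r0) by exact: disc_open.
have sD2 : D `<=` D2 by apply: disc_sub (ltW rr) _; lra.
have sA := smooth_mx_on_sub sD2 sA2; have sB := smooth_mx_on_sub sD2 sB2.
have [v [sv dv uv]] := radial_transport d rr sA2 sB2 (fun k => C k z0).
pose X k z := if (k <= d)%N then v k z else 0 : M.
have sX k : smooth_mx_on D (X k).
  by rewrite /X; case: leqP => _; [exact: sv|exact: smooth_mx_on_cst].
have XC k z : disc z0 r0 z -> X k z = C k z.
  move=> Dz; rewrite /X; case: leqP => kd; last by rewrite (psol_deg sC).
  apply: (uv C r0 r00 r0r _ _ _ z (Ordinal (kd : (k < d.+1)%N)) Dz) => //.
    by move=> l; exact: (psol_smooth sC).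
  move=> y l p Dy; apply: (mderive_transp p o0 sC Dy); exact: (ltn_ord l).
pose Xp k z := prv (X^~ z) k.
have sXp k : smooth_mx_on D (Xp k).
  by case: k => [|k]; [exact: smooth_mx_on_cst|exact: sX].
pose E k z := pz (X k) z - (X k z - X k.+1 z) *m A z.
pose F k z := pzb (X k) z - (X k z - Xp k z) *m B z.
pose Ep k z := if k is k'.+1 then E k' z else X 0%N z *m A z.
have sE k : smooth_mx_on D (E k).
  exact: (smooth_mx_onB oD (smooth_pz oD (sX k)) (smooth_mx_onM oD (smooth_mx_onB oD (sX k) (sX k.+1)) sA)).
have sF k : smooth_mx_on D (F k).
  exact: (smooth_mx_onB oD (smooth_pzb oD (sX k)) (smooth_mx_onM oD (smooth_mx_onB oD (sX k) (sXp k)) sB)).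
pose a z := X 0%N z *m A z; pose b z := X d z *m B z.
have sa : smooth_mx_on D a by exact: (smooth_mx_onM oD (sX 0%N) sA).
have sb : smooth_mx_on D b by exact: (smooth_mx_onM oD (sX d) sB).
have Xd k z : (d < k)%N -> X k z = 0 by move=> dk; rewrite /X leqNgt dk.
have pzXd k z : (d < k)%N -> pz (X k) z = 0 /\ pzb (X k) z = 0.
  move=> dk; have -> : X k = fun=> 0 by apply/funext => y; exact: Xd.
  by rewrite pz_cst pzb_cst.
have Fd z : F d.+1 z = b z.
  by rewrite /F (pzXd d.+1 z (ltnSn d)).2 Xd //= !sub0r mulNmx opprK.
(* The radial equation: the two errors E and F cancel along the rays. *)
have EF z k : D z -> (k <= d)%N -> zet z *: E k z = - (Num.conj (zet z) *: F k z).
  move=> Dz kd.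
  have := dv z (Ordinal (kd : (k < d.+1)%N)) Dz.
  rewrite /= (eq_transp _ _ (Y := X^~ z)) //; last by move=> l ld; rewrite /X ld.
  have -> : v k = X k by apply/funext => y; rewrite /X kd.
  rewrite (mderive_dir _ (smooth_mx_differentiable oD Dz (sX k))).
  rewrite /transp /adz /bdzb -!scalemxAr -/(zet z).
  have -> : nxt d (X^~ z) k = X k.+1 z by rewrite /nxt; case: ltnP => // dk; rewrite Xd.
  move=> H; apply/eqP; rewrite -addr_eq0 /E /F !scalerBr addrACA H -opprD subrr //.
(* Along the rays w changes only by the curvature, as zeta E = - conj(zeta) F
   turns the radial derivative of w into the commutator term. *)
pose w k z := zet z *: E k z.
have sw k : smooth_mx_on D (w k) by exact: (smooth_mx_onZf oD smooth_zet (sE k)).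
have pzb_a z : D z -> pzb a z = F 0%N z *m A z + a z *m B z.
  move=> Dz; rewrite (pzbM oD Dz (sX 0%N) sA) fA //.
  have -> : pzb (X 0%N) z = F 0%N z + X 0%N z *m B z by rewrite /F /Xp /= subr0 subrK.
  by rewrite mulmxDl mulmxBr !mulmxA /a -addrA; congr (_ + _); rewrite addrCA subrr addr0.
have pz_b z : D z -> pz b z = E d z *m B z + b z *m A z.
  move=> Dz; rewrite (pzM oD Dz (sX d) sB) fB //.
  have -> : pz (X d) z = E d z + X d z *m A z by rewrite /E (Xd d.+1) // subr0 subrK.
  by rewrite mulmxDl mulmxBr !mulmxA /b -addrA; congr (_ + _); rewrite addrCA subrr addr0.
have curv k z : D z -> pzb (E k) z - pz (F k) z =
    (E k z - Ep k z) *m B z - (F k z - F k.+1 z) *m A z.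
  move=> Dz; apply: (curvature oD Dz sA sB (sX k) (sX k.+1) (sXp k) fA fB (E := E k) (F := F k)) => //.
  - case: k => [|k]; last by rewrite /Ep /E /Xp /= subrK.
    have -> : Xp 0%N = fun=> 0 by [].
    by rewrite pz_cst /Ep sub0r mulNmx subrr.
  - by rewrite /F /Xp /= subrK.
have dw k z : D z -> (k <= d)%N -> mderive (z - z0) (w k) z =
    (zet z * Num.conj (zet z)) *: ((E k z - Ep k z) *m B z - (F k z - F k.+1 z) *m A z).
  move=> Dz kd; rewrite (mderive_dir _ (smooth_mx_differentiable oD Dz (sw k))) -/(zet z).
  have nw : \forall y \near z, w k y = - (Num.conj (zet y) *: F k y).
    by apply: filterS (open_near oD Dz) => y Dy; exact: EF.
  have h1 : pz (w k) z = - (Num.conj (zet z) *: pz (F k) z).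
    by rewrite (pz_near nw) (pz_zetJ Dz (sF k)).
  rewrite h1 (pzb_zet Dz (sE k)) -(curv k z Dz).
  move: (pz (F k) z) (pzb (E k) z) (zet z) (Num.conj (zet z)) => x y c cj.
  by rewrite scalerN !scalerA [cj * c]mulrC scalerBr addrC.
have vanish0 z : disc z0 r0 z -> [/\ a z = 0, b z = 0, F 0%N z = 0, E d z = 0 & forall k, w k z = 0].
  move=> Dz; have E0 k : E k z = 0.
    have nX : \forall y \near z, X k y = C k y.
      by apply: filterS (open_near o0 Dz) => y; exact: XC.
    by rewrite /E (pz_near nX) (psol_pz sC) // !XC // subrr.
  split=> //.
  - by rewrite /a XC // (psol_low sC).
  - by rewrite /b XC // (psol_high o0 sC).
  - have nX : \forall y \near z, X 0%N y = C 0%N y.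
      by apply: filterS (open_near o0 Dz) => y; exact: XC.
    by rewrite /F /Xp /= (pzb_near nX) (psol_pzb sC) // !XC //= subrr.
  - by move=> k; rewrite /w E0 scaler0.
(* Recovering E and F from w divides by zeta.  Everything vanishes within r0
   of z0, and outside of that disc the square of 1/zeta is at most m. *)
pose m z : R := 2 / (sqdist z0 z + r0 ^+ 2).
have r02 : 0 < r0 ^+ 2 by exact: exprn_gt0.
have mden z : 0 < sqdist z0 z + r0 ^+ 2 by rewrite ltr_wpDl // sqdist_ge0.
have m0 z : 0 <= m z by rewrite divr_ge0 // ltW.
pose N z : R := n%:R * (nsq (A z) + nsq (B z)).
pose Kf z : R := 8 * (1 + m z + 4 * sqdist z0 z + sqdist z0 z ^+ 2) * N z.
have cKf z : D z -> {for z, continuous Kf}.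
  move=> Dz.
  have cs : {for z, continuous (sqdist z0)} by exact: (smooth_on_cont (smooth_sqdist z0 oD) Dz).
  have cc (c : R) : {for z, continuous (fun _ : P => c)} by exact: cvg_cst.
  have cm : {for z, continuous m}.
    apply: (continuousM (cc 2)); apply: continuousV; first by rewrite gt_eqF.
    exact: (continuousD cs (cc _)).
  have cN : {for z, continuous N}.
    apply: (continuousM (cc _)); apply: continuousD.
      exact: (nsq_continuous oD Dz sA).
    exact: (nsq_continuous oD Dz sB).
  apply: (continuousM _ cN); apply: (continuousM (cc 8)).
  apply: continuousD; last exact: (continuousM cs cs).
  exact: (continuousD (continuousD (cc 1) cm) (continuousM (cc 4) cs)).
pose S z := nsq (a z) + nsq (b z) + \sum_(k < d.+1) nsq (w k z).
have key z : D z -> forall i j,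
     [/\ 4 * sqc (pzb a z i j) <= Kf z * S z, 4 * sqc (pz b z i j) <= Kf z * S z
       & forall k : 'I_d.+1, sqc (mderive (z - z0) (w k) z i j) <= Kf z * S z].
  move=> Dz i j; set s := sqdist z0 z.
  have s0 : 0 <= s by exact: sqdist_ge0.
  have na0 := nsq_ge0 (a z); have nb0 := nsq_ge0 (b z).
  have nw0 : 0 <= \sum_(k < d.+1) nsq (w k z).
    by apply: sumr_ge0 => k _; exact: nsq_ge0.
  have S0 : 0 <= S z by rewrite !addr_ge0.
  have aS : nsq (a z) <= S z by rewrite /S -addrA lerDl addr_ge0.
  have bS : nsq (b z) <= S z by rewrite /S -addrA addrCA lerDl addr_ge0.
  have wS k : (k <= d)%N -> nsq (w k z) <= S z.
    move=> kd; rewrite /S (bigD1 (Ordinal (kd : (k < d.+1)%N))) //= addrCA lerDl.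
    by rewrite !addr_ge0 // sumr_ge0 // => l _; exact: nsq_ge0.
  have wE k : nsq (w k z) = s * nsq (E k z) by rewrite nsqZ sqc_zet.
  have wF k : (k <= d)%N -> nsq (w k z) = s * nsq (F k z).
    by move=> kd; rewrite /w EF // nsqN nsqZ /sqc ReJ ImJ mulrNN -/(sqc _) sqc_zet.
  have mS (Y : M) : s * nsq Y <= S z -> (disc z0 r0 z -> Y = 0) -> nsq Y <= m z * S z.
    move=> sY Y0; have [D0|] := ltP s (r0 ^+ 2).
      by rewrite Y0 // nsq0 mulr_ge0.
    move=> sr; apply: (@le_trans _ _ (m z * (s * nsq Y))); last exact: ler_wpM2l.
    rewrite mulrA ler_peMl ?nsq_ge0 // /m -/s mulrAC ler_pdivlMr ?mden //.
    by rewrite mul1r; lra.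
  have mF : nsq (F 0%N z) <= m z * S z.
    by apply: mS => [|/vanish0[]//]; rewrite -wF // wS.
  have mE : nsq (E d z) <= m z * S z.
    by apply: mS => [|/vanish0[]//]; rewrite -wE // wS.
  have A0 := nsq_ge0 (A z); have B0 := nsq_ge0 (B z).
  have two (T Y : M) (x y : R) : nsq T <= x -> nsq Y <= y -> 0 <= x -> 0 <= y ->
      sqc ((T *m A z + Y *m B z) i j) <= 2 * (x + y) * N z.
    move=> Xx Yy x0 y0; rewrite mxE; apply: le_trans (sqcD _ _) _.
    rewrite -mulrA ler_pM2l // /N.
    apply: le_trans (lerD (sqc_mul_le _ _ _ _) (sqc_mul_le _ _ _ _)) _.
    rewrite -mulrDr mulrCA ler_wpM2l //.
    have h1 := ler_wpM2r A0 Xx; have h2 := ler_wpM2r B0 Yy.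
    have h3 := mulr_ge0 x0 B0; have h4 := mulr_ge0 y0 A0; nra.
  have N0 : 0 <= N z by rewrite mulr_ge0 // addr_ge0.
  have mz0 := m0 z.
  have fin (c x : R) : x <= c * S z * N z ->
      c <= 8 * (1 + m z + 4 * s + s ^+ 2) -> x <= Kf z * S z.
    move=> h1 h2; apply: le_trans h1 _; rewrite /Kf -/s mulrAC.
    by apply: ler_wpM2r => //; apply: ler_wpM2r.
  have s20 : 0 <= s ^+ 2 by exact: sqr_ge0.
  split.
  - rewrite pzb_a //; apply: (fin (8 * (m z + 1))); last by lra.
    have h := two _ _ _ _ mF aS (mulr_ge0 mz0 S0) S0.
    apply: le_trans (ler_wpM2l _ h) _ => //.
    by rewrite le_eqVlt; apply/orP; left; apply/eqP; ring.
  - rewrite pz_b // addrC; apply: (fin (8 * (1 + m z))); last by lra.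
    have h := two _ _ _ _ bS mE S0 (mulr_ge0 mz0 S0).
    apply: le_trans (ler_wpM2l _ h) _ => //.
    by rewrite le_eqVlt; apply/orP; left; apply/eqP; ring.
  - move=> k; have kd : (k <= d)%N by rewrite -ltnS.
    rewrite (dw k z Dz kd) addrC scalerDr -mulNmx !scalemxAl.
    have ss : sqc (zet z * Num.conj (zet z)) = s ^+ 2.
      by rewrite sqcM sqc_zet /sqc ReJ ImJ mulrNN -/(sqc _) sqc_zet expr2.
    have nEp : s ^+ 2 * nsq (Ep k z) <= (s + s ^+ 2) * S z.
      case: (nat_of_ord k) kd => [|l] ld /=.
        by apply: ler_pM => //; rewrite lerDr.
      rewrite expr2 -mulrA -wE; apply: ler_pM => //; first exact: nsq_ge0.
        by rewrite lerDl -expr2.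
      by apply: wS; exact: ltnW.
    have nFn : s ^+ 2 * nsq (F k.+1 z) <= (s + s ^+ 2) * S z.
      have [kd'|kd'] := ltnP k d.
        rewrite expr2 -mulrA -wF //; apply: ler_pM => //; first exact: nsq_ge0.
          by rewrite lerDl -expr2.
        exact: wS.
      have -> : nat_of_ord k = d by apply/eqP; rewrite eqn_leq kd kd'.
      by rewrite Fd; apply: ler_pM => //; rewrite lerDr.
    have nE : s ^+ 2 * nsq (E k z) <= s * S z.
      by rewrite expr2 -mulrA -wE; apply: ler_wpM2l => //; exact: wS.
    have nF : s ^+ 2 * nsq (F k z) <= s * S z.
      by rewrite expr2 -mulrA -wF //; apply: ler_wpM2l => //; exact: wS.
    pose c := 2 * (2 * s + s ^+ 2) * S z.
    have c0 : 0 <= c by rewrite !mulr_ge0 // addr_ge0 // mulr_ge0.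
    have h1 : nsq ((zet z * Num.conj (zet z)) *: - (F k z - F k.+1 z)) <= c.
      rewrite nsqZ ss nsqN; apply: le_trans (ler_wpM2l s20 (nsqB_le _ _)) _.
      rewrite mulrCA mulrDr; apply: le_trans (ler_wpM2l (ler0n R 2) (lerD nF nFn)) _.
      by rewrite le_eqVlt; apply/orP; left; apply/eqP; rewrite /c; ring.
    have h2 : nsq ((zet z * Num.conj (zet z)) *: (E k z - Ep k z)) <= c.
      rewrite nsqZ ss; apply: le_trans (ler_wpM2l s20 (nsqB_le _ _)) _.
      rewrite mulrCA mulrDr; apply: le_trans (ler_wpM2l (ler0n R 2) (lerD nE nEp)) _.
      by rewrite le_eqVlt; apply/orP; left; apply/eqP; rewrite /c; ring.
    apply: (fin _ _ _ (le8 _ _ _ mz0 s20 s0)).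
    apply: le_trans (two _ _ _ _ h1 h2 c0 c0) _.
    by rewrite le_eqVlt; apply/orP; left; apply/eqP; rewrite /c; ring.
have V := mx_unique_continuation r00 rr sa sb (fun k : 'I_d.+1 => sw k) cKf _ key.
have {V}V z : D z -> [/\ a z = 0, b z = 0 & forall k : 'I_d.+1, w k z = 0].
  by apply: V => y /vanish0[h1 h2 _ _ h3]; split.
have EF0 z k : D z -> (k <= d)%N -> E k z = 0 /\ F k z = 0.
  move=> Dz kd; have [D0|nD0] := pselect (disc z0 r0 z).
    have nX l : \forall y \near z, X l y = C l y.
      by apply: filterS (open_near o0 D0) => y; exact: XC.
    rewrite /E /F (pz_near (nX k)) (pzb_near (nX k)) (psol_pz sC) // (psol_pzb sC) //.
    rewrite !XC // subrr; split=> //; rewrite /Xp.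
    by case: (k) => [|l] /=; rewrite ?XC // subrr.
  have zn : zet z != 0.
    apply/eqP => z00; apply: nD0; rewrite /disc /= -sqc_zet z00.
    by rewrite /sqc /= !mul0r addr0.
  have [_ _ /(_ (Ordinal (kd : (k < d.+1)%N))) /= wk] := V z Dz.
  have := EF z k Dz kd; rewrite -/(w k z) wk => /eqP.
  rewrite eq_sym oppr_eq0 scaler_eq0 conjC_eq0 (negbTE zn) /= => /eqP ->.
  by move: wk => /eqP; rewrite /w scaler_eq0 (negbTE zn) /= => /eqP ->.
exists X => //; split=> //.
- move=> k z Dz; have [kd|dk] := leqP k d.
    by have [/eqP + _] := EF0 z k Dz kd; rewrite subr_eq0 => /eqP.
  by rewrite (pzXd k z dk).1 !Xd ?subrr ?mul0mx // (leq_trans dk).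
- move=> k z Dz; have [kd|dk] := leqP k d.
    by have [_ /eqP +] := EF0 z k Dz kd; rewrite subr_eq0 => /eqP.
  rewrite (pzXd k z dk).2 Xd //.
  case: k dk => [//|k] /=; rewrite ltnS leq_eqVlt => /predU1P[<-|dk].
    by have [_ bz _] := V z Dz; rewrite sub0r mulNmx -/(b z) bz oppr0.
  by rewrite Xd // subrr mul0mx.
- by move=> k z dk _; exact: Xd.
- by move=> z Dz; have [] := V z Dz.
Qed.

End Extension.

(** The function [u = G *m C 0] solves [pzb u = u *m B], so that unique
    continuation applies, with no component transported along the rays. *)
Lemma lowest_vanish {R : realType} {n : nat} (z0 : R * R) (r r0 : R) (d : nat)
    (A B : R * R -> 'M[R[i]]_n) C (G : 'M[R[i]]_n) :
  0 < r0 -> 0 < r -> smooth_mx_on (disc z0 r) B -> psol d (disc z0 r) A B C ->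
  (forall z, disc z0 r0 z -> G *m C 0%N z = 0) ->
  forall z, disc z0 r z -> G *m C 0%N z = 0.
Proof.
move=> r00 rr sB sC G0 z Dz; set D := disc z0 r in sB sC Dz *.
have oD : open D by exact: disc_open.
have sG := smooth_mx_on_cst D G.
have s0 := psol_smooth sC 0%N.
have sa := smooth_mx_onM oD sG s0.
have := @mx_unique_continuation R n 0 (fun y => G *m C 0%N y) (fun=> 0) (fun _ _ => 0)
  (fun y => 4 * (n%:R * nsq (B y))) z0 r0 r r00 rr sa (smooth_mx_on_cst D 0)
  (fun k => smooth_mx_on_cst D 0).
move=> H; have {H} [] // := H _ _ _ z Dz.
- move=> y Dy; apply: (@continuousM _ _ (fun=> 4)); first exact: cvg_cst.
  apply: (@continuousM _ _ (fun=> n%:R)); first exact: cvg_cst.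
  exact: (nsq_continuous oD Dy sB).
- by move=> y Dy; split=> //; exact: G0.
move=> y Dy i j.
have S0 : 0 <= nsq (G *m C 0%N y) + nsq (0 : 'M[R[i]]_n) + \sum_(k < 0) nsq (0 : 'M[R[i]]_n).
  by rewrite !addr_ge0 ?nsq_ge0 // sumr_ge0 // => k _; exact: nsq_ge0.
have K0 : 0 <= 4 * (n%:R * nsq (B y)) by rewrite !mulr_ge0 // nsq_ge0.
split; last by case.
  rewrite (pzbM oD Dy sG s0) pzb_cst mul0mx add0r (psol_pzb sC) //= subr0 mulmxA.
  rewrite big_ord0 addr0 nsq0 addr0 -!mulrA ler_pM2l //.
  by apply: le_trans (sqc_mul_le _ _ _ _) _; rewrite [nsq (B y) * _]mulrC.
by rewrite pz_cst mxE /sqc /= mul0r addr0 mulr0 mulr_ge0.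
Qed.

(** * Complex differentiability and real differentiability *)

Import ComplexField.Normc.

Section Bridge.
Context {R : realType}.
Local Notation P := (R * R)%type.
Local Notation K := (Cplane R).
Implicit Types (w h : K) (p q : P) (f : K -> K).

Lemma normCE (x : R[i]) : `|x| = (normc x)%:C.
Proof. by []. Qed.

Lemma normc_ge0 (x : R[i]) : 0 <= normc x.
Proof. by case: x => a b; exact: sqrtr_ge0. Qed.

Lemma normc_sqr (x : R[i]) : normc x ^+ 2 = sqc x.
Proof. by case: x => a b; rewrite /= sqr_sqrtr ?addr_ge0 ?sqr_ge0 // /sqc /= !expr2. Qed.

Lemma normRe_le (x : R[i]) : `|Re x| <= normc x.
Proof.
rewrite -ler_sqr ?nnegrE ?normc_ge0 // normc_sqr real_normK ?num_real // /sqc.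
by rewrite -!expr2 lerDl sqr_ge0.
Qed.

Lemma normIm_le (x : R[i]) : `|Im x| <= normc x.
Proof.
rewrite -ler_sqr ?nnegrE ?normc_ge0 // normc_sqr real_normK ?num_real // /sqc.
by rewrite -!expr2 lerDr sqr_ge0.
Qed.

Lemma normc_real (t : R) : normc t%:C = `|t|.
Proof. by rewrite /= expr0n addr0 sqrtr_sqr. Qed.

Lemma normc_ii : normc (ii : R[i]) = 1.
Proof. by rewrite /= expr0n expr1n add0r sqrtr1. Qed.

Lemma normc_le (x : R[i]) : normc x <= `|Re x| + `|Im x|.
Proof.
have -> : x = (Re x)%:C + ii * (Im x)%:C.
  by apply: complex_ext; rewrite /= ?mul0r ?mul1r ?subr0 ?addr0 ?add0r ?mulr0 ?oppr0 ?addr0.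
apply: le_trans (le_normcD _ _) _.
by rewrite normcM normc_ii mul1r !normc_real /= !(mul0r,mul1r,mulr0,subr0,addr0,add0r).
Qed.

Lemma normc_cpx_le p : normc (cpx p) <= 2 * `|p|.
Proof.
apply: le_trans (normc_le _) _; rewrite /= mulr2n mulrDl mul1r lerD //.
  exact: norm1_le.
exact: norm2_le.
Qed.

Lemma norm_le_cpx p : `|p| <= normc (cpx p).
Proof. by rewrite prod_normE ge_max (normRe_le (cpx p)) (normIm_le (cpx p)). Qed.

Lemma cpxB p q : cpx (p - q) = cpx p - cpx q. Proof. by []. Qed.
Lemma cpxD p q : cpx (p + q) = cpx p + cpx q. Proof. by []. Qed.
Lemma to_planeK w : cpx (to_plane w) = w. Proof. by case: w. Qed.
Lemma cpxK p : to_plane (cpx p) = p. Proof. by case: p. Qed.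

(** Neighbourhoods in the complex plane, with radii in the real field. *)
Lemma nearC (w : K) (Q : K -> Prop) :
  (\forall x \near w, Q x) <-> exists2 d : R, 0 < d & forall x, normc (x - w) < d -> Q x.
Proof.
split=> [/nbhs_ballP[e /= e0 H]|[d d0 H]].
  move: e0; rewrite ltcE /= => /andP[/eqP e2 e1].
  exists (Re e) => // x xd; apply: H; rewrite -ball_normE /= distrC normCE ltcE /= e2 eqxx.
  exact: xd.
apply/nbhs_ballP; exists (d%:C); first by rewrite /= ltcR.
by move=> x; rewrite -ball_normE /= distrC normCE ltcR; exact: H.
Qed.

Lemma cpx_continuous : continuous (cpx : P -> K).
Proof.
move=> p Q /nearC[d d0 H]; apply/nbhs_ballP; exists (d / 2) => /=; first by rewrite divr_gt0.
move=> q; rewrite -ball_normE /= => pq; apply: H; rewrite -cpxB.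
by apply: le_lt_trans (normc_cpx_le _) _; rewrite mulrC -ltr_pdivlMr // distrC.
Qed.

Lemma to_plane_continuous : continuous (to_plane : K -> P).
Proof.
move=> w Q /nbhs_ballP[d /= d0 H]; apply/nearC; exists d => // x xw; apply: H.
rewrite -ball_normE /= distrC; apply: le_lt_trans xw.
by apply: le_trans (norm_le_cpx _) _; rewrite cpxB !to_planeK.
Qed.

(** This form of complex differentiability compares directly with
    differentiability in the real plane. *)
Lemma is_deriveCP f w (l : R[i]) : is_derive w (1 : K) f l <->
  forall e : R, 0 < e -> exists2 d : R, 0 < d & forall x, normc (x - w) < d ->
    normc (f x - f w - (x - w) * l) <= e * normc (x - w).
Proof.
split=> [[df dfl] e e0|H].
  have L : (fun h : K => h^-1 *: (f (h *: (1 : K) + w) - f w)) @ (0 : K)^' --> (l : K).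
    by move: df; rewrite -dfl /derivable; exact.
  have eC : 0 < e%:C :> R[i] by rewrite ltcR.
  move/cvgrPdist_lt/(_ _ eC) : L; rewrite near_withinE => /nearC[d d0 {}H].
  exists d => // x xd; have [->|xw] := eqVneq x w.
    by rewrite !subrr mul0r subr0 normc0 mulr0.
  have h0 : x - w != 0 by rewrite subr_eq0.
  have := H (x - w); rewrite subr0 => /(_ xd h0).
  rewrite [_ *: 1]mulr1 subrK normCE ltcR => {}H.
  have -> : f x - f w - (x - w) * l = (x - w) * - (l - (x - w)^-1 * (f x - f w)).
    by rewrite opprB mulrBr mulrA divff // mul1r.
  rewrite normcM normcN mulrC ler_wpM2r ?normc_ge0 //.
  exact: ltW.
have L : (fun h : K => h^-1 *: (f (h *: (1 : K) + w) - f w)) @ (0 : K)^' --> (l : K).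
  apply/cvgrPdist_le => e; rewrite ltcE /= => /andP[/eqP e2 e1].
  have [d d0 {}H] := H _ e1.
  rewrite near_withinE; apply/nearC; exists d => // h hd h0; rewrite subr0 in hd.
  have := H (h + w); rewrite addrK => /(_ hd) {}H.
  rewrite [_ *: 1]mulr1 normCE lecE /= e2 eqxx /=.
  have nh : 0 < normc h.
    rewrite lt_def normc_ge0 andbT; apply/eqP => /eq0_normc hh.
    by move: h0; rewrite hh eqxx.
  rewrite -(ler_pM2r nh); apply: le_trans H; rewrite -normcM.
  have -> : (l - h^-1 *: (f (h + w) - f w)) * h = - (f (h + w) - f w - h * l).
    by rewrite /GRing.scale /= mulrBl [h^-1 * _ * h]mulrAC mulVf // mul1r [l * h]mulrC [RHS]opprB.
  by rewrite normcN.
by apply: DeriveDef; [apply/cvg_ex; exists l|exact: (cvg_lim (@norm_hausdorff _ _) L)].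
Qed.

(** The real differential is multiplication by the complex derivative; this
    contains the Cauchy-Riemann equations. *)
Lemma complex_differentiable f p (l : R[i]) : is_derive (cpx p : K) (1 : K) f l ->
  [/\ differentiable (fun q => Re (f (cpx q))) p, differentiable (fun q => Im (f (cpx q))) p
    & forall v, cderive v (fun q => f (cpx q)) p = cpx v * l].
Proof.
move=> /is_deriveCP H.
have near_le (e : R) : 0 < e -> \forall h \near (0 : P),
    normc (f (cpx (h + p)) - f (cpx p) - cpx h * l) <= e * `|h|.
  move=> e0; have e2 : 0 < e / 2 by rewrite divr_gt0.
  have [d d0 {}H] := H _ e2.
  have nh : \forall h \near (0 : P), normc (cpx h) < d.
    apply/nbhs_ballP; exists (d / 2) => /=; first by rewrite divr_gt0.
    move=> h; rewrite -ball_normE /= sub0r normrN => hd.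
    by apply: le_lt_trans (normc_cpx_le _) _; rewrite mulrC -ltr_pdivlMr.
  apply: filterS nh => h hd; have := H (cpx (h + p)); rewrite cpxD addrK => /(_ hd) h1.
  apply: le_trans h1 _; apply: le_trans (ler_wpM2l (ltW e2) (normc_cpx_le h)) _.
  by rewrite mulrA divfK.
have [d1 E1] : differentiable (fun q => Re (f (cpx q))) p /\
    'd (fun q => Re (f (cpx q))) p = lin2 (Re l) (- Im l) :> (P -> R).
  apply: differentiableI; first exact: lin2_continuous.
  move=> e /near_le; apply: filterS => h; apply: le_trans.
  apply: le_trans (normRe_le _); rewrite !ReD !ReN ReM /lin2 le_eqVlt; apply/orP; left; apply/eqP.
  by congr (`|_|); rewrite /cpx /= /lin2; ring.
have [d2 E2] : differentiable (fun q => Im (f (cpx q))) p /\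
    'd (fun q => Im (f (cpx q))) p = lin2 (Im l) (Re l) :> (P -> R).
  apply: differentiableI; first exact: lin2_continuous.
  move=> e /near_le; apply: filterS => h; apply: le_trans.
  apply: le_trans (normIm_le _); rewrite !ImD !ImN ImM /lin2 le_eqVlt; apply/orP; left; apply/eqP.
  by congr (`|_|); rewrite /cpx /= /lin2; ring.
split=> // v; rewrite /cderive !deriveE // E1 E2; apply: complex_ext.
  by rewrite ReM /lin2 /=; ring.
by rewrite ImM /lin2 /=; ring.
Qed.

End Bridge.

(** * Goursat's theorem on rectangles *)

Section Goursat.
Context {R : realType}.
Local Notation P := (R * R)%type.
Implicit Types (f g : P -> R) (p q : P).

Definition rect (x0 x1 y0 y1 : R) : set P :=
  [set p | x0 <= p.1 <= x1 /\ y0 <= p.2 <= y1].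

(** The integral of the form [f dx + g dy] over the boundary of a rectangle,
    counterclockwise. *)
Definition rint f g (x0 x1 y0 y1 : R) : R :=
  intg x0 x1 (fun x => f (x, y0) - f (x, y1)) +
  intg y0 y1 (fun y => g (x1, y) - g (x0, y)).

Lemma continuous_section1 f (t x : R) :
  {for (x, t), continuous f} -> {for x, continuous (fun y => f (y, t))}.
Proof.
move=> ch; apply: (@continuous_at_comp _ _ _ (fun y => (y, t)) f) => //.
exact: (cvg_pair (@cvg_id _ (nbhs x)) (@cvg_cst _ t _ (nbhs x) _)).
Qed.

Definition cont_rect f x0 x1 y0 y1 :=
  forall p, rect x0 x1 y0 y1 p -> {for p, continuous f}.

Definition boundary (x0 x1 y0 y1 : R) : set P :=
  [set p | rect x0 x1 y0 y1 p /\ ((p.1 = x0 \/ p.1 = x1) \/ (p.2 = y0 \/ p.2 = y1))].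

Definition cont_bd f x0 x1 y0 y1 :=
  forall p, boundary x0 x1 y0 y1 p -> {for p, continuous f}.

Section Boundary.
Variables (f : P -> R) (x0 x1 y0 y1 : R).
Hypotheses (x01 : x0 <= x1) (y01 : y0 <= y1) (cf : cont_bd f x0 x1 y0 y1).

Lemma cont_bd_x : cont_on x0 x1 (fun x => f (x, y0)) /\ cont_on x0 x1 (fun x => f (x, y1)).
Proof.
split=> x xI; apply: continuous_section1; apply: cf; (split; [split|right]) => //=.
- by rewrite lexx.
- by left.
- by rewrite lexx andbT.
- by right.
Qed.

Lemma cont_bd_y : cont_on y0 y1 (fun y => f (x0, y)) /\ cont_on y0 y1 (fun y => f (x1, y)).
Proof.
split=> y yI; apply: continuous_section; apply: cf; (split; [split|left]) => //=.
- by rewrite lexx.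
- by left.
- by rewrite lexx andbT.
- by right.
Qed.

End Boundary.

Lemma boundaryI x0 x1 y0 y1 : x0 <= x1 -> y0 <= y1 ->
  (forall x, x0 <= x <= x1 -> boundary x0 x1 y0 y1 (x, y0) /\ boundary x0 x1 y0 y1 (x, y1)) /\
  (forall y, y0 <= y <= y1 -> boundary x0 x1 y0 y1 (x0, y) /\ boundary x0 x1 y0 y1 (x1, y)).
Proof.
move=> x01 y01; split=> t tI; split; split=> /=.
- by split; rewrite //= lexx.
- by right; left.
- by split; rewrite //= lexx andbT.
- by right; right.
- by split; rewrite //= lexx.
- by left; left.
- by split; rewrite //= lexx andbT.
- by left; right.
Qed.

Lemma cont_rect_bd f x0 x1 y0 y1 : cont_rect f x0 x1 y0 y1 -> cont_bd f x0 x1 y0 y1.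
Proof. by move=> cf p [/cf]. Qed.

Section Edges.
Variables (f : P -> R) (x0 x1 y0 y1 : R).
Hypotheses (cf : cont_rect f x0 x1 y0 y1).

Lemma cont_edge_x y : y0 <= y <= y1 -> cont_on x0 x1 (fun x => f (x, y)).
Proof. by move=> yI x xI; apply: continuous_section1; apply: cf. Qed.

Lemma cont_edge_y x : x0 <= x <= x1 -> cont_on y0 y1 (fun y => f (x, y)).
Proof. by move=> xI y yI; apply: continuous_section; apply: cf. Qed.

End Edges.

Lemma cont_onB (a b : R) (u v : R -> R) : cont_on a b u -> cont_on a b v ->
  cont_on a b (fun x => u x - v x).
Proof. by move=> cu cv x xI; exact: (continuousB (cu x xI) (cv x xI)). Qed.

Lemma rint_splitx f g x0 x x1 y0 y1 : x0 <= x -> x <= x1 -> y0 <= y1 ->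
  cont_rect f x0 x1 y0 y1 -> cont_rect g x0 x1 y0 y1 ->
  rint f g x0 x1 y0 y1 = rint f g x0 x y0 y1 + rint f g x x1 y0 y1.
Proof.
move=> h1 h2 h3 cf cg; rewrite /rint.
have yl : y0 <= y0 <= y1 by rewrite lexx.
have yr : y0 <= y1 <= y1 by rewrite lexx andbT.
have xl : x0 <= x0 <= x1 by rewrite lexx (le_trans h1).
have xr : x0 <= x1 <= x1 by rewrite lexx (le_trans h1).
have xm : x0 <= x <= x1 by rewrite h1.
rewrite (intg_split h1 h2 (cont_onB (cont_edge_x cf yl) (cont_edge_x cf yr))).
have c0 := cont_edge_y cg xl; have c1 := cont_edge_y cg xr; have cm := cont_edge_y cg xm.
rewrite addrACA; congr (_ + _).
rewrite -(intgD (cont_onB cm c0) (cont_onB c1 cm)).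
by apply: eq_intg => y _; rewrite [RHS]addrC addrA subrK.
Qed.

Lemma rint_splity f g x0 x1 y0 y y1 : y0 <= y -> y <= y1 -> x0 <= x1 ->
  cont_rect f x0 x1 y0 y1 -> cont_rect g x0 x1 y0 y1 ->
  rint f g x0 x1 y0 y1 = rint f g x0 x1 y0 y + rint f g x0 x1 y y1.
Proof.
move=> h1 h2 h3 cf cg; rewrite /rint.
have xl : x0 <= x0 <= x1 by rewrite lexx.
have xr : x0 <= x1 <= x1 by rewrite lexx andbT.
have yl : y0 <= y0 <= y1 by rewrite lexx (le_trans h1).
have yr : y0 <= y1 <= y1 by rewrite lexx (le_trans h1).
have ym : y0 <= y <= y1 by rewrite h1.
rewrite (intg_split h1 h2 (cont_onB (cont_edge_y cg xr) (cont_edge_y cg xl))).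
have c0 := cont_edge_x cf yl; have c1 := cont_edge_x cf yr; have cm := cont_edge_x cf ym.
rewrite addrACA; congr (_ + _).
rewrite -(intgD (cont_onB c0 cm) (cont_onB cm c1)).
by apply: eq_intg => x _; rewrite addrA subrK.
Qed.

Lemma cont_rect_sub f x0 x1 y0 y1 a0 a1 b0 b1 : x0 <= a0 -> a1 <= x1 -> y0 <= b0 -> b1 <= y1 ->
  cont_rect f x0 x1 y0 y1 -> cont_rect f a0 a1 b0 b1.
Proof.
move=> h1 h2 h3 h4 cf p [/andP[p1 p2] /andP[p3 p4]]; apply: cf.
by split; rewrite ?(le_trans h1 p1) ?(le_trans p2 h2) ?(le_trans h3 p3) ?(le_trans p4 h4).
Qed.

(** An affine form with symmetric derivative integrates to zero. *)
Lemma rint_affine_bound f g (a b u v m f0 fx fy g0 gy : R) p :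
  0 <= u -> 0 <= v ->
  cont_bd f a (a + u) b (b + v) -> cont_bd g a (a + u) b (b + v) ->
  (forall q, boundary a (a + u) b (b + v) q ->
    `|f q - (f0 + fx * (q.1 - p.1) + fy * (q.2 - p.2))| <= m /\
    `|g q - (g0 + fy * (q.1 - p.1) + gy * (q.2 - p.2))| <= m) ->
  `|rint f g a (a + u) b (b + v)| <= 2 * m * (u + v).
Proof.
move=> u0 v0 cf cg H.
have au : a <= a + u by rewrite lerDl.
have bv : b <= b + v by rewrite lerDl.
have [ex ey] := boundaryI au bv.
have [cf0 cf1] := cont_bd_x bv cf; have [cg0 cg1] := cont_bd_y au cg.
have c1 := cont_onB cf0 cf1; have c2 := cont_onB cg1 cg0.
have i1 : `|intg a (a + u) (fun x => (f (x, b) - f (x, b + v)) + fy * v)| <= 2 * m * u.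
  have -> : 2 * m * u = 2 * m * (a + u - a) by rewrite [a + u]addrC addrK.
  apply: (norm_intg_le au (cont_onD c1 (@cont_on_cst R a (a + u) (fy * v)))) => x xI.
  have [h1 _] := H _ (ex x xI).1; have [h2 _] := H _ (ex x xI).2.
  have -> : f (x, b) - f (x, b + v) + fy * v =
    (f (x, b) - (f0 + fx * (x - p.1) + fy * (b - p.2))) -
    (f (x, b + v) - (f0 + fx * (x - p.1) + fy * (b + v - p.2))) by ring.
  by rewrite mulr2n mulrDl mul1r (le_trans (ler_normB _ _)) // lerD.
have i2 : `|intg b (b + v) (fun y => (g (a + u, y) - g (a, y)) + - (fy * u))| <= 2 * m * v.
  have -> : 2 * m * v = 2 * m * (b + v - b) by rewrite [b + v]addrC addrK.
  apply: (norm_intg_le bv (cont_onD c2 (@cont_on_cst R b (b + v) (- (fy * u))))) => y yI.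
  have [_ h1] := H _ (ey y yI).2; have [_ h2] := H _ (ey y yI).1.
  have -> : g (a + u, y) - g (a, y) + - (fy * u) =
    (g (a + u, y) - (g0 + fy * (a + u - p.1) + gy * (y - p.2))) -
    (g (a, y) - (g0 + fy * (a - p.1) + gy * (y - p.2))) by ring.
  by rewrite mulr2n mulrDl mul1r (le_trans (ler_normB _ _)) // lerD.
have -> : rint f g a (a + u) b (b + v) =
    intg a (a + u) (fun x => (f (x, b) - f (x, b + v)) + fy * v) +
    intg b (b + v) (fun y => (g (a + u, y) - g (a, y)) + - (fy * u)).
  rewrite (intgD c1 (@cont_on_cst R _ _ _)) (intgD c2 (@cont_on_cst R _ _ _)) !intg_cst //.
  by rewrite /rint; ring.
by rewrite mulrDr (le_trans (ler_normD _ _)) // lerD.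
Qed.

(** The point is the supremum of the left end points. *)
Lemma nested_point (a : nat -> R) (w : R) : 0 <= w ->
  (forall n, a n <= a n.+1 /\ a n.+1 + w / 2 ^+ n.+1 <= a n + w / 2 ^+ n) ->
  exists x, forall n, a n <= x <= a n + w / 2 ^+ n.
Proof.
move=> w0 H.
have mono n m : a n <= a (n + m)%N /\ a (n + m)%N + w / 2 ^+ (n + m) <= a n + w / 2 ^+ n.
  elim: m => [|m [h1 h2]]; first by rewrite addn0.
  have [h3 h4] := H (n + m)%N; rewrite addnS.
  by split; [exact: le_trans h3|exact: le_trans h2].
have wn n : 0 <= w / 2 ^+ n by rewrite divr_ge0 // exprn_ge0.
have ub n m : a m <= a n + w / 2 ^+ n.
  have [nm|mn] := leqP n m.
    have [_] := mono n (m - n)%N; rewrite subnKC //; apply: le_trans.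
    by rewrite lerDl.
  have [+ _] := mono m (n - m)%N; rewrite (subnKC (ltnW mn)) => /le_trans; apply.
  by rewrite lerDl.
have hs : has_sup (range a).
  split; first by exists (a 0%N); exists 0%N.
  by exists (a 0%N + w / 2 ^+ 0) => _ [m _ <-].
exists (sup (range a)) => n; apply/andP; split.
  by apply: ub_le_sup; [case: hs|exists n].
by apply: ge_sup; [case: hs|move=> _ [m _ <-]].
Qed.

(** Goursat's argument: were the integral nonzero, one of the four quarters of
    the rectangle would carry at least a quarter of it, and so on; but near the
    common point of the nested rectangles the form is affine up to a small error
    and affine closed forms integrate to zero ([rint_affine_bound]). *)
Lemma goursat f g (x0 y0 w h : R) : 0 < w -> 0 < h ->
  (forall p, rect x0 (x0 + w) y0 (y0 + h) p ->
    [/\ differentiable f p, differentiable g p & 'D_e2 f p = 'D_e1 g p]) ->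
  rint f g x0 (x0 + w) y0 (y0 + h) = 0.
Proof.
move=> w0 h0 H; apply/eqP; apply/negPn/negP => ne0.
pose s := `|rint f g x0 (x0 + w) y0 (y0 + h)|.
have s0 : 0 < s by rewrite normr_gt0.
pose W n : R := w / 2 ^+ n; pose Hh n : R := h / 2 ^+ n.
have Wn n : 0 < W n by rewrite divr_gt0 // exprn_gt0.
have Hn n : 0 < Hh n by rewrite divr_gt0 // exprn_gt0.
have WS n : W n = W n.+1 + W n.+1 by rewrite /W exprS; field; rewrite expf_neq0.
have HS n : Hh n = Hh n.+1 + Hh n.+1 by rewrite /Hh exprS; field; rewrite expf_neq0.
have cont k : (k = f \/ k = g) -> cont_rect k x0 (x0 + w) y0 (y0 + h).
  by move=> kfg p /H[d1 d2 _]; apply: differentiable_continuous; case: kfg => ->.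
have cf := cont f (or_introl erefl); have cg := cont g (or_intror erefl).
pose inside n (q : P) := [/\ x0 <= q.1, q.1 + W n <= x0 + w, y0 <= q.2 & q.2 + Hh n <= y0 + h].
pose bad n (q : P) := inside n q /\
  s / 4 ^+ n <= `|rint f g q.1 (q.1 + W n) q.2 (q.2 + Hh n)|.
have step n q : bad n q -> exists q' : P, [/\ bad n.+1 q',
    q.1 <= q'.1 /\ q'.1 + W n.+1 <= q.1 + W n & q.2 <= q'.2 /\ q'.2 + Hh n.+1 <= q.2 + Hh n].
  move=> [[i1 i2 i3 i4] sn].
  have c1 := cont_rect_sub i1 i2 i3 i4 cf; have c2 := cont_rect_sub i1 i2 i3 i4 cg.
  have w1 := Wn n.+1; have h1 := Hn n.+1.
  have sub b c : (b = 0 \/ b = W n.+1) -> (c = 0 \/ c = Hh n.+1) ->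
      s / 4 ^+ n.+1 <= `|rint f g (q.1 + b) (q.1 + b + W n.+1) (q.2 + c) (q.2 + c + Hh n.+1)| ->
      exists q' : P, [/\ bad n.+1 q',
      q.1 <= q'.1 /\ q'.1 + W n.+1 <= q.1 + W n & q.2 <= q'.2 /\ q'.2 + Hh n.+1 <= q.2 + Hh n].
    move=> hb hc hs; have b0 : 0 <= b <= W n.+1 by case: hb => ->; rewrite ?lexx ltW.
    have c0 : 0 <= c <= Hh n.+1 by case: hc => ->; rewrite ?lexx ltW.
    case/andP: b0 => b0 b1; case/andP: c0 => c0 c3.
    have := WS n; have := HS n => eH eW.
    exists (q.1 + b, q.2 + c); split=> /=; [split=> //; split=> /=| |]; try split; lra.
  apply: contrapT => N.
  have lt b c : (b = 0 \/ b = W n.+1) -> (c = 0 \/ c = Hh n.+1) ->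
      `|rint f g (q.1 + b) (q.1 + b + W n.+1) (q.2 + c) (q.2 + c + Hh n.+1)| < s / 4 ^+ n.+1.
    by move=> hb hc; rewrite ltNge; apply/negP => /(sub _ _ hb hc)/N.
  have L0 : (0 : R) = 0 \/ (0 : R) = W n.+1 by left.
  have L1 : W n.+1 = 0 \/ W n.+1 = W n.+1 by right.
  have M0 : (0 : R) = 0 \/ (0 : R) = Hh n.+1 by left.
  have M1 : Hh n.+1 = 0 \/ Hh n.+1 = Hh n.+1 by right.
  have a1 := lt _ _ L0 M0; have a2 := lt _ _ L0 M1.
  have a3 := lt _ _ L1 M0; have a4 := lt _ _ L1 M1.
  have eW := WS n; have eH := HS n.
  rewrite !addr0 -!addrA -eW -eH in a1 a2 a3 a4.
  have xm1 : q.1 <= q.1 + W n.+1 by rewrite lerDl ltW.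
  have xm2 : q.1 + W n.+1 <= q.1 + W n by rewrite eW lerD2l lerDl ltW.
  have ym1 : q.2 <= q.2 + Hh n.+1 by rewrite lerDl ltW.
  have ym2 : q.2 + Hh n.+1 <= q.2 + Hh n by rewrite eH lerD2l lerDl ltW.
  have yy := le_trans ym1 ym2.
  have E := rint_splitx xm1 xm2 yy c1 c2.
  rewrite (rint_splity ym1 ym2 xm1 (cont_rect_sub (lexx _) xm2 (lexx _) (lexx _) c1)
    (cont_rect_sub (lexx _) xm2 (lexx _) (lexx _) c2)) in E.
  rewrite (rint_splity ym1 ym2 xm2 (cont_rect_sub xm1 (lexx _) (lexx _) (lexx _) c1)
    (cont_rect_sub xm1 (lexx _) (lexx _) (lexx _) c2)) in E.
  move: sn; rewrite E leNgt => /negP; apply.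
  have -> : s / 4 ^+ n = (s / 4 ^+ n.+1 + s / 4 ^+ n.+1) + (s / 4 ^+ n.+1 + s / 4 ^+ n.+1).
    by rewrite exprS; field; rewrite expf_neq0.
  apply: le_lt_trans (ler_normD _ _) _.
  by apply: ltrD; apply: le_lt_trans (ler_normD _ _) _; apply: ltrD.
have [next nextP] : exists F : nat -> P -> P, forall n q, bad n q -> [/\ bad n.+1 (F n q),
    q.1 <= (F n q).1 /\ (F n q).1 + W n.+1 <= q.1 + W n &
    q.2 <= (F n q).2 /\ (F n q).2 + Hh n.+1 <= q.2 + Hh n].
  have T (nq : nat * P) : exists q' : P, bad nq.1 nq.2 -> [/\ bad nq.1.+1 q',
    nq.2.1 <= q'.1 /\ q'.1 + W nq.1.+1 <= nq.2.1 + W nq.1 &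
    nq.2.2 <= q'.2 /\ q'.2 + Hh nq.1.+1 <= nq.2.2 + Hh nq.1].
    have [/step[q' Hq']|nb] := pselect (bad nq.1 nq.2); first by exists q'.
    by exists (0, 0) => /nb.
  by have [F HF] := choice T; exists (fun n q => F (n, q)) => n q; exact: (HF (n, q)).
pose Q := fix Q n : P := if n is n'.+1 then next n' (Q n') else (x0, y0).
have Qbad n : bad n (Q n).
  elim: n => [|n /nextP[]//].
  by split; [split|]; rewrite /= /W /Hh ?expr0 ?divr1.
have Qstep n := nextP n _ (Qbad n).
have [x xP] : exists x, forall n, (Q n).1 <= x <= (Q n).1 + W n.
  by apply: (nested_point (ltW w0)) => n; have [_ [] ] := Qstep n.
have [y yP] : exists y, forall n, (Q n).2 <= y <= (Q n).2 + Hh n.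
  by apply: (nested_point (ltW h0)) => n; have [_ _ [] ] := Qstep n.
pose p : P := (x, y).
have [|df dg sym] := H p.
  have := xP 0%N; have := yP 0%N; rewrite /= /W /Hh expr0 !divr1 => hy hx.
  by split.
have wh : 0 < w + h by rewrite addr_gt0.
pose eta := s / (4 * (w + h) ^+ 2).
have eta0 : 0 < eta by rewrite divr_gt0 // mulr_gt0 // exprn_gt0.
have /nbhs_ballP[d /= d0 Hd] : \forall h \near (0 : P),
    `|f (h + p) - f p - 'd f p h| <= eta * `|h| /\ `|g (h + p) - g p - 'd g p h| <= eta * `|h|.
  exact: filterI (differentiableE df eta0) (differentiableE dg eta0).
have [n nd] : exists n, (w + h) / 2 ^+ n < d.
  have [n hn] : exists n : nat, (w + h) / d < n%:R.
    exists (Num.bound ((w + h) / d)).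
    by apply: archi_boundP; rewrite divr_ge0 // ltW.
  exists n; rewrite ltr_pdivrMr ?exprn_gt0 // -ltr_pdivrMl // mulrC.
  apply: lt_trans hn _; rewrite -natrX ltr_nat.
  exact: ltn_expl.
have [[i1 i2 i3 i4] sn] := Qbad n.
have /andP[x1 x2] := xP n; have /andP[y1 y2] := yP n.
have eWH : (w + h) / 2 ^+ n = W n + Hh n by rewrite mulrDl.
have close q : rect (Q n).1 ((Q n).1 + W n) (Q n).2 ((Q n).2 + Hh n) q -> `|q - p| <= W n + Hh n.
  move=> [/andP[q1 q2] /andP[q3 q4]]; have w1 := Wn n; have h1 := Hn n.
  rewrite prod_normE ge_max /=; apply/andP; split; rewrite ler_norml; apply/andP; split; lra.
have := @rint_affine_bound f g (Q n).1 (Q n).2 (W n) (Hh n) (eta * (W n + Hh n))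
   (f p) ('D_e1 f p) ('D_e2 f p) (g p) ('D_e2 g p) p (ltW (Wn n)) (ltW (Hn n))
   (cont_rect_bd (cont_rect_sub i1 i2 i3 i4 cf)) (cont_rect_bd (cont_rect_sub i1 i2 i3 i4 cg)).
move=> B; have {}B : `|rint f g (Q n).1 ((Q n).1 + W n) (Q n).2 ((Q n).2 + Hh n)|
   <= 2 * (eta * (W n + Hh n)) * (W n + Hh n).
  apply: B => q [/close qp _].
  have ball : ball (0 : P) d (q - p).
    by rewrite -ball_normE /= sub0r normrN (le_lt_trans qp) // -eWH.
  have [+ +] := Hd _ ball; rewrite subrK -!deriveE //.
  rewrite (differentiable_dir (q - p) df) (differentiable_dir (q - p) dg) -sym => h1 h2.
  split.
    have -> : f q - (f p + 'D_e1 f p * (q.1 - p.1) + 'D_e2 f p * (q.2 - p.2)) =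
      f q - f p - ((q - p).1 * 'D_e1 f p + (q - p).2 * 'D_e2 f p) by rewrite /=; ring.
    by apply: le_trans h1 _; rewrite ler_pM2l.
  have -> : g q - (g p + 'D_e2 f p * (q.1 - p.1) + 'D_e2 g p * (q.2 - p.2)) =
    g q - g p - ((q - p).1 * 'D_e2 f p + (q - p).2 * 'D_e2 g p) by rewrite /=; ring.
  by apply: le_trans h2 _; rewrite ler_pM2l.
have := le_trans sn B; rewrite -eWH leNgt => /negP; apply.
have -> : 2 * (eta * ((w + h) / 2 ^+ n)) * ((w + h) / 2 ^+ n) = s / 4 ^+ n / 2.
  have -> : (4 : R) ^+ n = 2 ^+ n * 2 ^+ n by rewrite -exprMn -natrM.
  by rewrite /eta; field; rewrite !expf_neq0 // gt_eqF.
have s4 : 0 < s / 4 ^+ n by rewrite divr_gt0 // exprn_gt0.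
by lra.
Qed.

(** An isolated singularity at which the form stays continuous is harmless. *)
Lemma goursat_except f g (x0 x1 y0 y1 : R) (a : P) :
  x0 < a.1 -> a.1 < x1 -> y0 < a.2 -> a.2 < y1 ->
  cont_rect f x0 x1 y0 y1 -> cont_rect g x0 x1 y0 y1 ->
  (forall p, rect x0 x1 y0 y1 p -> p <> a ->
    [/\ differentiable f p, differentiable g p & 'D_e2 f p = 'D_e1 g p]) ->
  rint f g x0 x1 y0 y1 = 0.
Proof.
move=> ax0 ax1 ay0 ay1 cf cg H.
have G b0 b1 c0 c1 : x0 <= b0 -> b1 <= x1 -> y0 <= c0 -> c1 <= y1 -> b0 < b1 -> c0 < c1 ->
    ~ rect b0 b1 c0 c1 a -> rint f g b0 b1 c0 c1 = 0.
  move=> h1 h2 h3 h4 h5 h6 na.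
  have E1 : b1 = b0 + (b1 - b0) by rewrite addrC subrK.
  have E2 : c1 = c0 + (c1 - c0) by rewrite addrC subrK.
  rewrite E1 E2; apply: goursat; rewrite ?subr_gt0 // => p; rewrite -E1 -E2 => pr.
  apply: H; last by move=> pa; apply: na; rewrite -pa.
  by case: pr => /andP[p1 p2] /andP[p3 p4]; split; apply/andP; split; lra.
apply/eqP; rewrite -normr_le0; apply/ler_addgt0Pr => e e0; rewrite add0r.
have ca k : cont_rect k x0 x1 y0 y1 -> exists2 d, 0 < d &
    forall q, `|q - a| < d -> `|k q| <= `|k a| + 1.
  move=> ck; have ra : rect x0 x1 y0 y1 a by split; rewrite !ltW.
  have /cvgrPdist_lt/(_ _ ltr01)/nbhs_ballP[d /= d0 Hd] := ck a ra.
  exists d => // q qa; have := Hd q; rewrite -ball_normE /= distrC => /(_ qa) h.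
  rewrite -[k q](subrK (k a)) addrC (le_trans (ler_normD _ _)) // lerD2l distrC.
  exact: ltW.
have [d1 d10 H1] := ca f cf; have [d2 d20 H2] := ca g cg.
pose m := `|f a| + 1 + (`|g a| + 1).
have m0 : 0 < m by have := normr_ge0 (f a); have := normr_ge0 (g a); rewrite /m; lra.
have [t [t0 t1 t2 t3 t4]] : exists t, [/\ 0 < t, t < d1, t < d2, t <= e / (8 * m) &
    [/\ x0 < a.1 - t, a.1 + t < x1, y0 < a.2 - t & a.2 + t < y1]].
  have p1 : 0 < e / (8 * m) by rewrite divr_gt0 // mulr_gt0.
  pose l := [:: d1; d2; e / (8 * m); a.1 - x0; x1 - a.1; a.2 - y0; y1 - a.2].
  pose M := \big[Num.min/1]_(x <- l) x.
  have M0 : 0 < M.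
    rewrite /M !big_cons big_nil !lt_min ltr01 d10 d20 p1 !subr_gt0.
    by rewrite ax0 ax1 ay0 ay1.
  have Ml x : x \in l -> M <= x.
    rewrite /M; elim: (l) => // y k IH; rewrite inE big_cons => /predU1P[->|/IH].
      by rewrite ge_min lexx.
    by move=> h; rewrite ge_min h orbT.
  have h1 : M <= d1 by apply: Ml; rewrite !inE eqxx ?orbT.
  have h2 : M <= d2 by apply: Ml; rewrite !inE eqxx ?orbT.
  have h3 : M <= e / (8 * m) by apply: Ml; rewrite !inE eqxx ?orbT.
  have h4 : M <= a.1 - x0 by apply: Ml; rewrite !inE eqxx ?orbT.
  have h5 : M <= x1 - a.1 by apply: Ml; rewrite !inE eqxx ?orbT.
  have h6 : M <= a.2 - y0 by apply: Ml; rewrite !inE eqxx ?orbT.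
  have h7 : M <= y1 - a.2 by apply: Ml; rewrite !inE eqxx ?orbT.
  by clear Ml; exists (M / 2); split; [| | | |split]; lra.
case: t4 => t4 t5 t6 t7.
have -> : rint f g x0 x1 y0 y1 = rint f g (a.1 - t) (a.1 + t) (a.2 - t) (a.2 + t).
  rewrite (@rint_splitx f g x0 (a.1 - t) x1) ?(G x0 (a.1 - t)) //; try lra; last first.
    by move=> [/andP[_ h] _]; lra.
  rewrite add0r.
  have cf1 : cont_rect f (a.1 - t) x1 y0 y1 by apply: cont_rect_sub cf; lra.
  have cg1 : cont_rect g (a.1 - t) x1 y0 y1 by apply: cont_rect_sub cg; lra.
  rewrite (@rint_splitx f g (a.1 - t) (a.1 + t) x1) ?(G (a.1 + t) x1) //; try lra; last first.
    by move=> [/andP[h _] _]; lra.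
  rewrite addr0.
  have cf2 : cont_rect f (a.1 - t) (a.1 + t) y0 y1 by apply: cont_rect_sub cf; lra.
  have cg2 : cont_rect g (a.1 - t) (a.1 + t) y0 y1 by apply: cont_rect_sub cg; lra.
  rewrite (@rint_splity f g (a.1 - t) (a.1 + t) y0 (a.2 - t) y1) ?(G _ _ y0 (a.2 - t)) //; try lra; last first.
    by move=> [_ /andP[_ h]]; lra.
  rewrite add0r.
  have cf3 : cont_rect f (a.1 - t) (a.1 + t) (a.2 - t) y1 by apply: cont_rect_sub cf; lra.
  have cg3 : cont_rect g (a.1 - t) (a.1 + t) (a.2 - t) y1 by apply: cont_rect_sub cg; lra.
  rewrite (@rint_splity f g (a.1 - t) (a.1 + t) (a.2 - t) (a.2 + t) y1) ?(G _ _ (a.2 + t) y1) ?addr0 //; try lra.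
  by move=> [_ /andP[h _]]; lra.
have B := @rint_affine_bound f g (a.1 - t) (a.2 - t) (t + t) (t + t) m 0 0 0 0 0 0.
have E1 : a.1 - t + (t + t) = a.1 + t by ring.
have E2 : a.2 - t + (t + t) = a.2 + t by ring.
rewrite E1 E2 in B.
have cf3 : cont_rect f (a.1 - t) (a.1 + t) (a.2 - t) (a.2 + t) by apply: cont_rect_sub cf; lra.
have cg3 : cont_rect g (a.1 - t) (a.1 + t) (a.2 - t) (a.2 + t) by apply: cont_rect_sub cg; lra.
have tt : 0 <= t + t by lra.
apply: le_trans (B tt tt (cont_rect_bd cf3) (cont_rect_bd cg3) _) _.
  move=> q [[/andP[q1 q2] /andP[q3 q4]] _]; rewrite !mul0r !addr0 !subr0.
  have qa d : t < d -> `|q - a| < d.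
    move=> td; apply: le_lt_trans td; rewrite prod_normE ge_max /=.
    by apply/andP; split; rewrite ler_norml; apply/andP; split; lra.
  have := H1 q (qa _ t1); have := H2 q (qa _ t2).
  by move: (normr_ge0 (f a)) (normr_ge0 (g a)); rewrite /m; split; lra.
move: t3; rewrite ler_pdivlMr ?mulr_gt0 // => t3.
by apply: le_trans t3; rewrite le_eqVlt; apply/orP; left; apply/eqP; ring.
Qed.

End Goursat.

(** * Cauchy's formula and regularity of holomorphic functions *)

Section Cauchy.
Context {R : realType}.
Local Notation P := (R * R)%type.
Local Notation K := (Cplane R).
Implicit Types (f g : P -> K) (p q : P).

Lemma Re_continuous : continuous (@complex.Re R : K -> R).
Proof.
move=> w; apply: (@continuous_at_comp _ _ _ to_plane fst); last exact: cvg_fst.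
exact: to_plane_continuous.
Qed.

Lemma Im_continuous : continuous (@complex.Im R : K -> R).
Proof.
move=> w; apply: (@continuous_at_comp _ _ _ to_plane snd); last exact: cvg_snd.
exact: to_plane_continuous.
Qed.

Lemma ReIm_continuous f p : {for p, continuous f} ->
  {for p, continuous (fun q => Re (f q))} /\ {for p, continuous (fun q => Im (f q))}.
Proof.
move=> cf; split.
  by apply: (@continuous_at_comp _ _ _ f (@complex.Re R)) => //; exact: Re_continuous.
by apply: (@continuous_at_comp _ _ _ f (@complex.Im R)) => //; exact: Im_continuous.
Qed.

Variables (x0 y0 s : R).
Hypothesis s0 : 0 < s.
Let bd := boundary x0 (x0 + s) y0 (y0 + s).
Let RI u v := rint u v x0 (x0 + s) y0 (y0 + s).

(** The integral of [f dz] over the boundary of a square, from its real and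
    imaginary parts. *)
Definition Cint f : R[i] :=
  rint (fun p => Re (f p)) (fun p => - Im (f p)) x0 (x0 + s) y0 (y0 + s) +i*
  rint (fun p => Im (f p)) (fun p => Re (f p)) x0 (x0 + s) y0 (y0 + s).

Let ss : x0 <= x0 + s. Proof. by rewrite lerDl ltW. Qed.
Let tt : y0 <= y0 + s. Proof. by rewrite lerDl ltW. Qed.
Let bI := boundaryI ss tt.

Let RI_ext u v u' v' : (forall p, bd p -> u p = u' p /\ v p = v' p) -> RI u v = RI u' v'.
Proof.
move=> H; have [ex ey] := bI; congr (_ + _); apply: eq_intg => t tI.
  by rewrite (H _ (ex t tI).1).1 (H _ (ex t tI).2).1.
by rewrite (H _ (ey t tI).1).2 (H _ (ey t tI).2).2.
Qed.

Let RI_lin (al be : R) u v u' v' :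
  cont_bd u x0 (x0 + s) y0 (y0 + s) -> cont_bd v x0 (x0 + s) y0 (y0 + s) ->
  cont_bd u' x0 (x0 + s) y0 (y0 + s) -> cont_bd v' x0 (x0 + s) y0 (y0 + s) ->
  RI (fun p => al * u p + be * u' p) (fun p => al * v p + be * v' p) =
  al * RI u v + be * RI u' v'.
Proof.
move=> cu cv cu' cv'; rewrite /RI /rint.
have [u1 u2] := cont_bd_x tt cu; have [u3 u4] := cont_bd_x tt cu'.
have [v1 v2] := cont_bd_y ss cv; have [v3 v4] := cont_bd_y ss cv'.
have cc a b (k : R) (h : R -> R) : cont_on a b h -> cont_on a b (fun x => k * h x).
  by move=> ch; exact: (cont_onM (@cont_on_cst R a b k) ch).
rewrite !mulrDr addrACA; congr (_ + _).
  have d1 := cont_onB u1 u2; have d2 := cont_onB u3 u4.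
  rewrite -(intgZ _ d1) -(intgZ _ d2) -(intgD (cc _ _ al _ d1) (cc _ _ be _ d2)).
  by apply: eq_intg => t _; ring.
have d1 := cont_onB v2 v1; have d2 := cont_onB v4 v3.
rewrite -(intgZ _ d1) -(intgZ _ d2) -(intgD (cc _ _ al _ d1) (cc _ _ be _ d2)).
by apply: eq_intg => t _; ring.
Qed.

Definition cont_boundary f := forall p, bd p -> {for p, continuous f}.

Let cRI f : cont_boundary f ->
  [/\ cont_bd (fun p => Re (f p)) x0 (x0 + s) y0 (y0 + s),
   cont_bd (fun p => Im (f p)) x0 (x0 + s) y0 (y0 + s) &
   cont_bd (fun p => - Im (f p)) x0 (x0 + s) y0 (y0 + s)].
Proof.
move=> cf; split=> p /cf/ReIm_continuous[c1 c2] //.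
exact: (continuousN c2).
Qed.

Lemma Cint_ext f g : (forall p, bd p -> f p = g p) -> Cint f = Cint g.
Proof. by move=> H; congr (_ +i* _); apply: RI_ext => p /H ->. Qed.

Lemma CintD f g : cont_boundary f -> cont_boundary g ->
  Cint (fun p => f p + g p) = Cint f + Cint g.
Proof.
move=> /cRI[f1 f2 f3] /cRI[g1 g2 g3]; apply: complex_ext.
  rewrite ReD -[X in _ = X + _]mul1r -[X in _ = _ + X]mul1r.
  apply: etrans (RI_lin 1 1 f1 f3 g1 g3); apply: RI_ext => p _.
  by rewrite ReD ImD; split; ring.
rewrite ImD -[X in _ = X + _]mul1r -[X in _ = _ + X]mul1r.
apply: etrans (RI_lin 1 1 f2 f1 g2 g1); apply: RI_ext => p _.
by rewrite ReD ImD; split; ring.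
Qed.

Lemma CintZ c f : cont_boundary f -> Cint (fun p => c * f p) = c * Cint f.
Proof.
move=> /cRI[f1 f2 f3]; apply: complex_ext.
  rewrite ReM -mulNr.
  apply: etrans (RI_lin (Re c) (- Im c) f1 f3 f2 f1); apply: RI_ext => p _.
  by rewrite ReM ImM; split; ring.
rewrite ImM.
apply: etrans (RI_lin (Re c) (Im c) f2 f1 f1 f3); apply: RI_ext => p _.
by rewrite ReM ImM; split; ring.
Qed.

Lemma CintB f g : cont_boundary f -> cont_boundary g ->
  Cint (fun p => f p - g p) = Cint f - Cint g.
Proof.
move=> cf cg; have cN : cont_boundary (fun p => -1 * g p).
  by move=> p bp; apply: (@continuousM _ _ (fun=> -1 : K)); [exact: cvg_cst|exact: cg].
rewrite -[- Cint g]mulN1r -(CintZ (-1) cg) -(CintD cf cN).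
by apply: Cint_ext => p _; rewrite mulN1r.
Qed.

Lemma Cint_bound f m : cont_boundary f -> (forall p, bd p -> normc (f p) <= m) ->
  normc (Cint f) <= 8 * m * s.
Proof.
move=> /cRI[f1 f2 f3] H.
have B u v : cont_bd u x0 (x0 + s) y0 (y0 + s) -> cont_bd v x0 (x0 + s) y0 (y0 + s) ->
    (forall p, bd p -> `|u p| <= m /\ `|v p| <= m) -> `|RI u v| <= 4 * m * s.
  move=> cu cv uv; have -> : 4 * m * s = 2 * m * (s + s) by ring.
  apply: (@rint_affine_bound R u v x0 y0 s s m 0 0 0 0 0 0 (ltW s0) (ltW s0) cu cv) => q /uv.
  by rewrite !mul0r !addr0 !subr0.
have h1 : `|RI (fun p => Re (f p)) (fun p => - Im (f p))| <= 4 * m * s.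
  apply: B => // p /H h; rewrite normrN; split; apply: le_trans h; [exact: normRe_le|exact: normIm_le].
have h2 : `|RI (fun p => Im (f p)) (fun p => Re (f p))| <= 4 * m * s.
  apply: B => // p /H h; split; apply: le_trans h; [exact: normIm_le|exact: normRe_le].
apply: le_trans (normc_le _) _.
by apply: le_trans (lerD h1 h2) _; rewrite le_eqVlt; apply/orP; left; apply/eqP; ring.
Qed.

Definition inner (d : R) : set K :=
  [set a | x0 + d < Re a < x0 + s - d /\ y0 + d < Im a < y0 + s - d].

Lemma inner_dist d a p : 0 < d -> inner d a -> bd p -> d <= normc (cpx p - a).
Proof.
move=> d0 [/andP[a1 a2] /andP[a3 a4]] [[/andP[p1 p2] /andP[p3 p4]] [[h|h]|[h|h]]].
- have := normRe_le (cpx p - a); rewrite ReD ReN /= h; apply: le_trans.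
  by rewrite ler0_norm; lra.
- have := normRe_le (cpx p - a); rewrite ReD ReN /= h; apply: le_trans.
  by rewrite ger0_norm; lra.
- have := normIm_le (cpx p - a); rewrite ImD ImN /= h; apply: le_trans.
  by rewrite ler0_norm; lra.
- have := normIm_le (cpx p - a); rewrite ImD ImN /= h; apply: le_trans.
  by rewrite ger0_norm; lra.
Qed.

Section Kernel.
Variables (phi : P -> K) (m d : R).
Hypotheses (d0 : 0 < d) (cphi : cont_boundary phi) (phim : forall p, bd p -> normc (phi p) <= m).

Definition kern a p : K := (cpx p - a)^-1.

Lemma kern_bd a p : inner d a -> bd p -> cpx p - a != 0 /\ normc (kern a p) <= d^-1.
Proof.
move=> ia bp; have h := inner_dist d0 ia bp.
split; last by rewrite /kern normcV lef_pV2 ?posrE // (lt_le_trans d0).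
by apply/eqP => E; move: h; rewrite E normc0 leNgt d0.
Qed.

Lemma kern_cont a : inner d a -> cont_boundary (kern a).
Proof.
move=> ia p bp; have [h _] := kern_bd ia bp.
apply: (@continuousV _ _ (fun p => cpx p - a : K)) => //.
by apply: continuousB; [exact: cpx_continuous|exact: cvg_cst].
Qed.

Lemma cont_boundaryM f g : cont_boundary f -> cont_boundary g ->
  cont_boundary (fun p => f p * g p).
Proof. by move=> cf cg p bp; exact: (continuousM (cf p bp) (cg p bp)). Qed.

Lemma kern_diff a b p : inner d a -> inner d b -> bd p ->
  kern b p - kern a p = (b - a) * (kern a p * kern b p).
Proof.
move=> ia ib bp; have [ha _] := kern_bd ia bp; have [hb _] := kern_bd ib bp.
by rewrite /kern; field; rewrite ha hb.
Qed.

Lemma inner_near a : inner d a -> exists2 e, 0 < e & forall b, normc (b - a) < e -> inner d b.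
Proof.
move=> [/andP[a1 a2] /andP[a3 a4]].
pose e := Num.min (Num.min (Re a - (x0 + d)) (x0 + s - d - Re a))
                  (Num.min (Im a - (y0 + d)) (y0 + s - d - Im a)).
exists e; first by rewrite !lt_min !subr_gt0 a1 a2 a3 a4.
move=> b; rewrite !lt_min => /andP[/andP[h1 h2] /andP[h3 h4]].
have := normRe_le (b - a); have := normIm_le (b - a); rewrite !ReD !ImD !ReN !ImN !ler_norml.
by move=> /andP[h5 h6] /andP[h7 h8]; split; apply/andP; split; lra.
Qed.

Lemma quad_derive (F : K -> K) (a : K) (l : R[i]) (C e : R) : 0 <= C -> 0 < e ->
  (forall b, normc (b - a) < e -> normc (F b - F a - (b - a) * l) <= C * normc (b - a) ^+ 2) ->
  is_derive a (1 : K) F l.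
Proof.
move=> C0 e0 H; apply/is_deriveCP => h h0.
have c1 : 0 < C + 1 by lra.
exists (Num.min e (h / (C + 1))); first by rewrite lt_min e0 divr_gt0.
move=> b; rewrite lt_min => /andP[be bh].
apply: le_trans (H b be) _; rewrite expr2 mulrA ler_wpM2r ?normc_ge0 //.
move: bh; rewrite ltr_pdivlMr // => bh.
by have := normc_ge0 (b - a); nra.
Qed.

(** Derivatives are taken under the integral sign by an exact identity: with
    [p = 1 / (z - a)] and [q = 1 / (z - b)] one has [q - p = (b - a) p q], hence
    [q - p - (b - a) p^2 = (b - a)^2 p^2 q]. *)
Lemma kernel_derive1 (a : K) : inner d a ->
  is_derive a (1 : K) (fun a : K => Cint (fun p => phi p * kern a p) : K)
    (Cint (fun p => phi p * (kern a p * kern a p))).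
Proof.
move=> ia; have [e e0 He] := inner_near ia.
have m0 : 0 <= m.
  have bp : bd (x0, y0) by exact: (bI.1 x0 (introT andP (conj (lexx _) ss))).1.
  exact: le_trans (normc_ge0 _) (phim bp).
have dV0 : 0 <= d^-1 by rewrite invr_ge0 ltW.
apply: (@quad_derive _ a _ (8 * (m * (d^-1 * d^-1 * d^-1)) * s) e) => //.
  by rewrite !mulr_ge0 // ltW.
move=> b /He ib; have ka := kern_cont ia; have kb := kern_cont ib.
have k2 := cont_boundaryM ka ka; have k3 := cont_boundaryM k2 kb.
have c1 := cont_boundaryM cphi ka; have c2 := cont_boundaryM cphi kb.
have c3 := cont_boundaryM cphi k2; have c4 := cont_boundaryM cphi k3.
rewrite -(CintB c2 c1) -(CintZ (b - a) c3) -CintB; last 2 first.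
- by move=> p bp; exact: (continuousB (c2 p bp) (c1 p bp)).
- by move=> p bp; apply: (@continuousM _ _ (fun=> (b - a : K))); [exact: cvg_cst|exact: c3].
have -> : Cint (fun p => phi p * kern b p - phi p * kern a p - (b - a) * (phi p * (kern a p * kern a p)))
    = ((b - a) * (b - a)) * Cint (fun p => phi p * (kern a p * kern a p * kern b p)).
  rewrite -(CintZ _ c4); apply: Cint_ext => p bp.
  rewrite -mulrBr (kern_diff ia ib bp).
  have -> : (b - a) * (b - a) * (phi p * (kern a p * kern a p * kern b p)) =
     (b - a) * (phi p * (kern a p * ((b - a) * (kern a p * kern b p)))) by ring.
  by rewrite -[in RHS](kern_diff ia ib bp); ring.
rewrite !normcM -expr2 mulrC ler_wpM2r ?sqr_ge0 //; apply: Cint_bound => // p bp.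
have [_ ha] := kern_bd ia bp; have [_ hb] := kern_bd ib bp.
rewrite !normcM; apply: ler_pM; rewrite ?mulr_ge0 ?normc_ge0 //; first exact: phim.
by apply: ler_pM; rewrite ?mulr_ge0 ?normc_ge0 //; apply: ler_pM; rewrite ?normc_ge0.
Qed.

Lemma kernel_derive2 (a : K) : inner d a ->
  derivable (fun a : K => Cint (fun p => phi p * (kern a p * kern a p)) : K) a (1 : K).
Proof.
move=> ia; have [e e0 He] := inner_near ia.
have m0 : 0 <= m.
  have bp : bd (x0, y0) by exact: (bI.1 x0 (introT andP (conj (lexx _) ss))).1.
  exact: le_trans (normc_ge0 _) (phim bp).
have dV0 : 0 <= d^-1 by rewrite invr_ge0 ltW.
suff [] : is_derive a (1 : K) (fun a : K => Cint (fun p => phi p * (kern a p * kern a p)) : K)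
    (Cint (fun p => phi p * (2 * (kern a p * kern a p * kern a p)))) by [].
have D30 : 0 <= m * (d^-1 * d^-1 * d^-1 * (3 * d^-1)) by rewrite !mulr_ge0.
apply: (@quad_derive _ a _ (8 * (m * (d^-1 * d^-1 * d^-1 * (3 * d^-1))) * s) e) => //.
  by apply: mulr_ge0; [exact: mulr_ge0|exact: ltW].
move=> b /He ib; have ka := kern_cont ia; have kb := kern_cont ib.
have k2 := cont_boundaryM ka ka; have k2b := cont_boundaryM kb kb.
have cc (c : K) (f : P -> K) : cont_boundary f -> cont_boundary (fun p => c * f p).
  by move=> cf p bp; apply: (@continuousM _ _ (fun=> c)); [exact: cvg_cst|exact: cf].
have k3 := cc 2 _ (cont_boundaryM k2 ka).
have c1 := cont_boundaryM cphi k2; have c2 := cont_boundaryM cphi k2b.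
have c3 := cont_boundaryM cphi k3.
have k4 : cont_boundary (fun p => kern a p * kern a p * kern b p * (kern b p + 2 * kern a p)).
  apply: cont_boundaryM; first exact: (cont_boundaryM k2 kb).
  by move=> p bp; exact: (continuousD (kb p bp) (cc 2 _ ka p bp)).
have c4 := cont_boundaryM cphi k4.
rewrite -(CintB c2 c1) -(CintZ (b - a) c3) -CintB; last 2 first.
- by move=> p bp; exact: (continuousB (c2 p bp) (c1 p bp)).
- exact: cc.
have -> : Cint (fun p => phi p * (kern b p * kern b p) - phi p * (kern a p * kern a p)
      - (b - a) * (phi p * (2 * (kern a p * kern a p * kern a p))))
    = ((b - a) * (b - a)) *
      Cint (fun p => phi p * (kern a p * kern a p * kern b p * (kern b p + 2 * kern a p))).
  rewrite -(CintZ _ c4); apply: Cint_ext => p bp.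
  have E := kern_diff ia ib bp.
  have -> : phi p * (kern b p * kern b p) - phi p * (kern a p * kern a p) =
    phi p * ((kern b p - kern a p) * (kern b p + kern a p)) by ring.
  rewrite E.
  have -> : phi p * ((b - a) * (kern a p * kern b p) * (kern b p + kern a p)) -
     (b - a) * (phi p * (2 * (kern a p * kern a p * kern a p))) =
     (b - a) * (phi p * (kern a p * ((kern b p - kern a p) * (kern b p + 2 * kern a p)))) by ring.
  by rewrite E; ring.
rewrite !normcM -expr2 mulrC ler_wpM2r ?sqr_ge0 //; apply: Cint_bound => // p bp.
have [_ ha] := kern_bd ia bp; have [_ hb] := kern_bd ib bp.
rewrite normcM; apply: ler_pM; rewrite ?normc_ge0 //; first exact: phim.
rewrite normcM; apply: ler_pM; rewrite ?normc_ge0 //.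
  rewrite !normcM; apply: ler_pM; rewrite ?mulr_ge0 ?normc_ge0 //.
  by apply: ler_pM; rewrite ?normc_ge0.
apply: le_trans (le_normcD _ _) _.
have n2 : normc (2 : R[i]) = 2 by rewrite -[2 in LHS](rmorph_nat (real_complex R)) normc_real ger0_norm.
by rewrite normcM n2; lra.
Qed.

End Kernel.

(** Each of the four sides contributes positively to the imaginary part. *)
Lemma winding_neq0 d a : 0 < d -> inner d a -> Cint (kern a) != 0.
Proof.
move=> d0 ia; have [cr ci _] := cRI (kern_cont d0 ia).
suff : 0 < Im (Cint (kern a)) by move=> h; apply/eqP => E; rewrite E /= ltxx in h.
have [ex ey] := bI.
have kE p : bd p -> 0 < sqc (cpx p - a) /\
    Re (kern a p) = (p.1 - Re a) / sqc (cpx p - a) /\ Im (kern a p) = - (p.2 - Im a) / sqc (cpx p - a).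
  move=> bp; have [h _] := kern_bd d0 ia bp.
  have h0 : 0 < sqc (cpx p - a).
    rewrite lt_def sqc_ge0 andbT; apply/eqP => /sqc_eq0 E; by rewrite E eqxx in h.
  split=> //; rewrite /kern; move: h h0; case: (a) => a1 a2 _ /=.
  by rewrite /sqc /= -!expr2 => h; rewrite mulNr; split.
have [/andP[a1 a2] /andP[a3 a4]] := ia.
have [h1 h2] := cont_bd_x tt ci; have [h3 h4] := cont_bd_y ss cr.
rewrite /= /rint; apply: addr_gt0.
  apply: intg_gt0; first by rewrite ltrDl.
  - exact: (cont_onB h1 h2).
  - move=> x xI; have [q1 [_ ->]] := kE _ (ex x xI).1; have [q2 [_ ->]] := kE _ (ex x xI).2.
    rewrite /= subr_ge0; apply: (@le_trans _ _ 0).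
      by rewrite pmulr_lle0 ?invr_gt0 //; lra.
    by apply: divr_ge0; [lra|exact: ltW].
  - exists x0; first by rewrite lexx.
    have xI : x0 <= x0 <= x0 + s by rewrite lexx.
    have [q1 [_ ->]] := kE _ (ex x0 xI).1; have [q2 [_ ->]] := kE _ (ex x0 xI).2.
    rewrite /= subr_gt0; apply: (@lt_trans _ _ 0).
      by rewrite pmulr_llt0 ?invr_gt0 //; lra.
    by apply: divr_gt0; lra.
apply: intg_gt0; first by rewrite ltrDl.
- exact: (cont_onB h4 h3).
- move=> x xI; have [q1 [-> _]] := kE _ (ey x xI).1; have [q2 [-> _]] := kE _ (ey x xI).2.
  rewrite /= subr_ge0; apply: (@le_trans _ _ 0).
    by rewrite pmulr_lle0 ?invr_gt0 //; lra.
  by apply: divr_ge0; [lra|exact: ltW].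
- exists y0; first by rewrite lexx.
  have xI : y0 <= y0 <= y0 + s by rewrite lexx.
  have [q1 [-> _]] := kE _ (ey y0 xI).1; have [q2 [-> _]] := kE _ (ey y0 xI).2.
  rewrite /= subr_gt0; apply: (@lt_trans _ _ 0).
    by rewrite pmulr_llt0 ?invr_gt0 //; lra.
  by apply: divr_gt0; lra.
Qed.

End Cauchy.

Section HolomorphicRegularity.
Context {R : realType}.
Local Notation P := (R * R)%type.
Local Notation K := (Cplane R).
Variables (O : set K) (f : K -> K).
Hypotheses (oO : open O) (df : forall w, O w -> derivable f w (1 : K)).

Let derivableK_cont (h : K -> K) (w : K) : derivable h w (1 : K) -> {for w, continuous h}.
Proof. by move=> dh; apply/differentiable_continuous/derivable1_diffP. Qed.

(** The difference quotient at [a] extends continuously to [a], so Goursat's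
    theorem with an exceptional point applies to it. *)
Lemma cauchy_formula x0 y0 s d (a : K) : 0 < s -> 0 < d -> inner x0 y0 s d a ->
  (forall p, rect x0 (x0 + s) y0 (y0 + s) p -> O (cpx p)) ->
  Cint x0 y0 s (fun p => f (cpx p) * kern a p) = f a * Cint x0 y0 s (kern a).
Proof.
move=> s0 d0 ia sub.
have [/andP[a1 a2] /andP[a3 a4]] := ia.
have ar : rect x0 (x0 + s) y0 (y0 + s) (to_plane a) by split=> /=; apply/andP; split; lra.
have Oa : O a by rewrite -(to_planeK a); exact: sub.
pose l : K := 'D_1 f a.
have fa : is_derive a (1 : K) f l by apply: DeriveDef => //; exact: df.
pose g (w : K) : K := if w == a then l else (f w - f a) * (w - a)^-1.
have gder (w : K) : O w -> w != a -> derivable g w (1 : K).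
  move=> Ow wa; have n0 : w - a != 0 by rewrite subr_eq0.
  have near : \forall y \near w, (f y - f a) * (y - a)^-1 = g y.
    apply/nearC; exists (normc (w - a)) => [|y yw].
      by rewrite lt_def normc_ge0 andbT; apply: contra n0 => /eqP/eq0_normc ->.
    rewrite /g; case: eqVneq => // E; move: yw; rewrite E.
    by rewrite -(normcN (w - a)) opprB ltxx.
  apply: (near_eq_derivable near).
  apply: derivableM; first by apply: derivableB; [exact: df|exact: derivable_cst].
  have h1 : derivable (id : K -> K) w 1 by exact: derivable_id.
  have h2 : derivable (fun=> a : K) w 1 by exact: derivable_cst.
  exact: (@derivableV _ _ (fun y => y - a) w 1 n0 (derivableB h1 h2)).
have gcont (w : K) : O w -> {for w, continuous g}.
  move=> Ow; have [E|wa] := eqVneq w a; last by apply: derivableK_cont; exact: gder.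
  rewrite E => Q; rewrite {1}/g eqxx => /nearC[e e0 HQ].
  have e20 : 0 < e / 2 by rewrite divr_gt0.
  have /is_deriveCP/(_ _ e20)[k k0 Hk] := fa.
  apply/nearC; exists k => // y ya; apply: HQ; rewrite /g.
  case: eqVneq => [_|yn]; first by rewrite subrr normc0.
  have n0 : y - a != 0 by rewrite subr_eq0.
  have np : 0 < normc (y - a).
    by rewrite lt_def normc_ge0 andbT; apply: contra n0 => /eqP/eq0_normc ->.
  rewrite -(ltr_pM2r np) -normcM.
  have -> : ((f y - f a) * (y - a)^-1 - l) * (y - a) = f y - f a - (y - a) * l.
    by rewrite mulrBl mulfVK // [l * _]mulrC.
  apply: le_lt_trans (Hk y ya) _; rewrite ltr_pM2r //; lra.
have gc p : rect x0 (x0 + s) y0 (y0 + s) p -> {for p, continuous (fun p => g (cpx p))}.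
  move=> pr; apply: (@continuous_at_comp P K K cpx g); first exact: cpx_continuous.
  exact: gcont (sub p pr).
have gd p : rect x0 (x0 + s) y0 (y0 + s) p -> p <> to_plane a ->
    [/\ differentiable (fun p => Re (g (cpx p))) p, differentiable (fun p => Im (g (cpx p))) p,
      'D_e2 (fun p => Re (g (cpx p))) p = - 'D_e1 (fun p => Im (g (cpx p))) p &
      'D_e2 (fun p => Im (g (cpx p))) p = 'D_e1 (fun p => Re (g (cpx p))) p].
  move=> pr pa; have pa' : cpx p != a by apply/eqP => E; apply: pa; rewrite -E cpxK.
  have H : is_derive (cpx p : K) (1 : K) g ('D_1 g (cpx p)).
    by apply: DeriveDef => //; exact: gder (sub p pr) pa'.
  have [h1 h2 h3] := complex_differentiable H.
  have := h3 e2; have := h3 e1; rewrite [cpx e1](_ : _ = 1) // mul1r => <- E.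
  split=> //.
    by have := congr1 (@complex.Re R) E; rewrite ReM /= mul0r mul1r sub0r.
  by have := congr1 (@complex.Im R) E; rewrite ImM /= mul0r mul1r add0r.
have cR : cont_rect (fun p => Re (g (cpx p))) x0 (x0 + s) y0 (y0 + s).
  by move=> p /gc/ReIm_continuous[].
have cI : cont_rect (fun p => Im (g (cpx p))) x0 (x0 + s) y0 (y0 + s).
  by move=> p /gc/ReIm_continuous[].
have Z : Cint x0 y0 s (fun p => g (cpx p)) = 0.
  have t1 : x0 < (to_plane a).1 by rewrite /=; lra.
  have t2 : (to_plane a).1 < x0 + s by rewrite /=; lra.
  have t3 : y0 < (to_plane a).2 by rewrite /=; lra.
  have t4 : (to_plane a).2 < y0 + s by rewrite /=; lra.
  apply: complex_ext; rewrite /Cint /=.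
    apply: (goursat_except t1 t2 t3 t4 cR) => [p pr|p pr pa].
      exact: (continuousN (cI p pr)).
    have [h1 h2 h3 h4] := gd p pr pa; split; [exact: h1|exact: (differentiableN h2)|].
    rewrite h3; apply/esym; apply: (@deriveN _ _ _ (fun p => Im (g (cpx p)))).
    exact: diff_derivable.
  apply: (goursat_except t1 t2 t3 t4 cI cR) => p pr pa.
  by have [h1 h2 h3 h4] := gd p pr pa; split.
have ka := kern_cont d0 ia.
have cf : cont_boundary x0 y0 s (fun p => f (cpx p)).
  move=> p [pr _]; apply: (@continuous_at_comp P K K cpx f); first exact: cpx_continuous.
  by apply: derivableK_cont; apply: df; exact: sub.
have c1 := cont_boundaryM cf ka.
have c2 : cont_boundary x0 y0 s (fun p => f a * kern a p).
  by apply: cont_boundaryM ka => p _; exact: cvg_cst.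
apply/eqP; rewrite -subr_eq0 -(CintZ s0 _ ka) -(CintB s0 c1 c2) -Z; apply/eqP.
apply: (Cint_ext s0) => p bp; have [h _] := kern_bd d0 ia bp.
rewrite /g; case: eqVneq => [E|_]; first by rewrite E subrr eqxx in h.
by rewrite mulrBl.
Qed.

(** By Cauchy's formula, [f] is near [c] the quotient [N / J] of two integrals
    that depend on the pole; these are twice differentiable, and so is [f]. *)
Lemma derivable_derive (c : K) : O c -> derivable (fun w => 'D_1 f w : K) c (1 : K).
Proof.
move=> Oc.
have cfc := derivableK_cont (df Oc).
have [e e0 He] : exists2 e, 0 < e & forall w, normc (w - c) < e -> O w /\ normc (f w - f c) < 1.
  have nO : \forall w \near c, O w by exact: open_nbhs_nbhs.
  have n1 : \forall w \near c, normc (f w - f c) < 1.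
    by apply: (cfc [set y | normc (y - f c) < 1]); apply/nearC; exists 1.
  have /nearC[e e0 H] : \forall w \near c, O w /\ normc (f w - f c) < 1 by exact: filterI nO n1.
  by exists e.
pose s := e / 2; pose d := s / 4; pose x0 := Re c - s / 2; pose y0 := Im c - s / 2.
have s0 : 0 < s by rewrite divr_gt0.
have d0 : 0 < d by rewrite divr_gt0.
have ic : inner x0 y0 s d c.
  by split; apply/andP; rewrite /x0 /y0 /d; split; lra.
have rc p : rect x0 (x0 + s) y0 (y0 + s) p -> normc (cpx p - c) < e.
  move=> [/andP[p1 p2] /andP[p3 p4]]; apply: le_lt_trans (normc_le _) _.
  rewrite ReD ImD ReN ImN /=.
  have h1 : `|p.1 - Re c| <= s / 2 by rewrite ler_norml; apply/andP; rewrite /x0 in p1 p2; split; lra.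
  have h2 : `|p.2 - Im c| <= s / 2 by rewrite ler_norml; apply/andP; rewrite /y0 in p3 p4; split; lra.
  by apply: le_lt_trans (lerD h1 h2) _; rewrite /s; lra.
have sub p : rect x0 (x0 + s) y0 (y0 + s) p -> O (cpx p) by move=> /rc/He[].
pose m := normc (f c) + 1.
pose phi p : K := f (cpx p).
have cf : cont_boundary x0 y0 s phi.
  move=> p [pr _]; apply: (@continuous_at_comp P K K cpx f); first exact: cpx_continuous.
  by apply: derivableK_cont; apply: df; exact: sub.
have fm p : boundary x0 (x0 + s) y0 (y0 + s) p -> normc (phi p) <= m.
  move=> [/rc/He[_ h] _]; rewrite /phi -(subrK (f c) (f (cpx p))) addrC.
  by apply: le_trans (le_normcD _ _) _; rewrite lerD2l ltW.
pose one (p : P) : K := 1.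
have c1 : cont_boundary x0 y0 s one by move=> p _; exact: cvg_cst.
have m1 p : boundary x0 (x0 + s) y0 (y0 + s) p -> normc (one p) <= 1.
  by move=> _; rewrite normc1.
pose N (a : K) : K := Cint x0 y0 s (fun p => phi p * kern a p).
pose N' (a : K) : K := Cint x0 y0 s (fun p => phi p * (kern a p * kern a p)).
pose J (a : K) : K := Cint x0 y0 s (fun p => one p * kern a p).
pose J' (a : K) : K := Cint x0 y0 s (fun p => one p * (kern a p * kern a p)).
have JE a : J a = Cint x0 y0 s (kern a) by apply: Cint_ext => // p _; rewrite mul1r.
have [k k0 Hk] := inner_near ic.
have inO a : inner x0 y0 s d a -> O a.
  move=> [/andP[a1 a2] /andP[a3 a4]]; rewrite -(to_planeK a); apply: sub.
  by split=> /=; apply/andP; split; lra.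
have E a : inner x0 y0 s d a -> N a = f a * J a.
  by move=> ia; rewrite JE; exact: (cauchy_formula s0 d0 ia sub).
have dN a : inner x0 y0 s d a -> is_derive a (1 : K) N (N' a).
  by move=> ia; exact: (kernel_derive1 s0 d0 cf fm ia).
have dJ a : inner x0 y0 s d a -> is_derive a (1 : K) J (J' a).
  by move=> ia; exact: (kernel_derive1 s0 d0 c1 m1 ia).
have dN' : derivable N' c (1 : K) by exact: (kernel_derive2 s0 d0 cf fm ic).
have dJ' : derivable J' c (1 : K) by exact: (kernel_derive2 s0 d0 c1 m1 ic).
have near : \forall w \near c, (N' w - f w * J' w) * (J w)^-1 = 'D_1 f w.
  apply/nearC; exists k => // w /Hk iw.
  have nw : \forall y \near w, N y = f y * J y.
    by have [k' k'0 Hk'] := inner_near iw; apply/nearC; exists k' => // y /Hk'; exact: E.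
  have fw : is_derive w (1 : K) f ('D_1 f w) := DeriveDef (df (inO w iw)) erefl.
  have [_ h1] := is_deriveM fw (dJ w iw).
  have h2 := near_eq_derive (1 : K) nw.
  have [_ h3] := dN w iw.
  rewrite h3 in h2; rewrite h2.
  have -> : 'D_1 (fun y => f y * J y) w = f w * J' w + J w * 'D_1 f w by exact: h1.
  have Jn : J w != 0 by rewrite JE; exact: (winding_neq0 s0 d0 iw).
  move: (f w * J' w) (J w) ('D_1 f w) Jn => x y z yn.
  by rewrite addrAC subrr add0r mulrAC divff // mul1r.
apply: (near_eq_derivable near).
have Jn : J c != 0 by rewrite JE; exact: (winding_neq0 s0 d0 ic).
have [dJc _] := dJ c ic.
exact: (derivableM (derivableB dN' (derivableM (df Oc) dJ')) (derivableV Jn dJc)).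
Qed.

End HolomorphicRegularity.

(** A directional derivative of [Re (c f)] is [Re (c' f')], so smoothness to
    order [k + 1] follows from that of the holomorphic function [f'] to order
    [k]. *)
Lemma holomorphic_smooth {R : realType} (O : set (Cplane R)) (f : Cplane R -> Cplane R) :
  open O -> (forall w, O w -> derivable f w (1 : Cplane R)) ->
  csmooth_on [set p : R * R | O (cpx p)] (fun p => f (cpx p)).
Proof.
move=> oO df; set OP := [set p : R * R | O (cpx p)].
have main k : forall (f : Cplane R -> Cplane R) (c : R[i]),
    (forall w, O w -> derivable f w (1 : Cplane R)) ->
    Ck k OP (fun p => Re (c * f (cpx p))).
  elim: k => [|k IH] {df}f c df.
    move=> p Op.
    have cf : {for p, continuous (fun p => c * f (cpx p) : Cplane R)}.
      apply: (@continuousM _ _ (fun=> c : Cplane R)); first exact: cvg_cst.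
      apply: (@continuous_at_comp (R * R)%type (Cplane R) (Cplane R) cpx f); first exact: cpx_continuous.
      by apply/differentiable_continuous/derivable1_diffP; exact: df.
    by have [] := ReIm_continuous cf.
  have dif p : OP p -> forall v, differentiable (fun p => Re (c * f (cpx p))) p /\
      'D_v (fun p => Re (c * f (cpx p))) p = Re ((c * cpx v) * 'D_1 f (cpx p)).
    move=> Op v.
    have H : is_derive (cpx p : Cplane R) (1 : Cplane R) (fun w => c * f w : Cplane R) (c * 'D_1 f (cpx p)).
      have h := is_deriveZ c (DeriveDef (df _ Op) erefl).
      exact: h.
    have [h1 h2 h3] := complex_differentiable H; split=> //.
    by have := congr1 (@complex.Re R) (h3 v); rewrite /= => ->; congr Re; rewrite mulrCA mulrA.
  split=> [p Op|v].
    split; first by apply: differentiable_continuous; exact: (dif p Op 0).1.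
    by move=> v; apply: diff_derivable; exact: (dif p Op v).1.
  apply: (Ck_ext _ _ (IH (fun w => 'D_1 f w) (c * cpx v) _)).
  - exact: (open_comp (fun p _ => @cpx_continuous R p) oO).
  - by move=> p Op; rewrite (dif p Op v).2.
  - by move=> w Ow; exact: (derivable_derive oO df Ow).
split; apply/smooth_onP => k.
  apply: (Ck_ext _ _ (main k f 1 df)); last by move=> p _; rewrite mul1r.
  exact: (open_comp (fun p _ => @cpx_continuous R p) oO).
apply: (Ck_ext _ _ (main k f (- ii) df)).
  exact: (open_comp (fun p _ => @cpx_continuous R p) oO).
by move=> p _; rewrite ReM /=; ring.
Qed.

(** * Polynomial loops of unitary matrices *)

Section PolyLoops.
Context {R : realType} {n : nat}.
Local Notation M := 'M[R[i]]_n.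
Implicit Types (C D : nat -> M) (l : R[i]).

Definition ev d C l : M := \sum_(k < d.+1) l ^+ k *: C k.

Lemma circle_conj l : circle l -> l * Num.conj l = 1.
Proof. by rewrite /circle /= -normCK => ->; rewrite expr1n. Qed.

Lemma circle_neq0 l : circle l -> l != 0.
Proof. by move=> /circle_conj E; apply/eqP => l0; move/eqP: E; rewrite l0 mul0r eq_sym oner_eq0. Qed.

Lemma circle_inv l : circle l -> l^-1 = Num.conj l.
Proof. by move=> cl; rewrite -[LHS]mulr1 -(circle_conj cl) mulKf // circle_neq0. Qed.

Lemma circle1 : @circle R 1.
Proof. by rewrite /circle /= normr1. Qed.

(** The points come from the rational parametrization of the circle. *)
Lemma circle_points N : exists2 s : seq R[i], uniq s & size s = N /\ forall l, l \in s -> circle l.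
Proof.
pose pt (k : nat) : R[i] := (1 + k%:R * ii) / (1 - k%:R * ii).
have conjk (k : nat) : Num.conj (k%:R : R[i]) = k%:R by rewrite rmorph_nat.
have sq (k : nat) : (1 + k%:R * ii : R[i]) != 0 /\ (1 - k%:R * ii : R[i]) != 0.
  have E : (1 + k%:R * ii) * (1 - k%:R * ii) = (1 + k ^ 2)%:R :> R[i].
    have i2 := @ii2 R; rewrite natrD natrX; ring: i2.
  have : (1 + k ^ 2)%:R != 0 :> R[i] by rewrite pnatr_eq0.
  by rewrite -E mulf_eq0 negb_or => /andP[].
exists [seq pt k | k <- iota 0 N]; last first.
  split; first by rewrite size_map size_iota.
  move=> l /mapP[k _ ->]; have [h1 h2] := sq k.
  have cj : Num.conj (1 - k%:R * ii) = 1 + k%:R * ii :> R[i].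
    by rewrite rmorphB rmorph1 rmorphM /= conjk conj_ii mulrN opprK.
  rewrite /circle /= /pt normrM normfV.
  by rewrite -cj norm_conjC divff // normr_eq0.
rewrite map_inj_uniq ?iota_uniq // => k m E.
have [h1 h2] := sq k; have [h3 h4] := sq m.
move/eqP: E; rewrite /pt eqr_div // => /eqP E.
have : 2 * ii * (k%:R - m%:R) = 0 :> R[i].
  rewrite -[RHS](subrr ((1 + m%:R * ii) * (1 - k%:R * ii))) -{1}E; ring.
have ii0 : ii != 0 :> R[i].
  by apply/eqP => i0; have := @ii2 R; rewrite i0 mul0r => /eqP; rewrite eq_sym oppr_eq0 oner_eq0.
have t0 : 2 * ii != 0 :> R[i] by rewrite mulf_neq0 // two_neq0.
by move/eqP; rewrite mulf_eq0 (negbTE t0) /= subr_eq0 eqr_nat => /eqP.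
Qed.

Lemma poly_circle0 (p : {poly R[i]}) : (forall l, circle l -> p.[l] = 0) -> p = 0.
Proof.
move=> H; apply/eqP; apply/negPn/negP => p0.
have [s us [sz sc]] := circle_points (size p).
have := max_poly_roots p0 _ us; rewrite sz ltnn => F; suff : false by [].
by apply: F; apply/allP => l /sc/H/eqP.
Qed.

Local Notation MP := 'M[{poly R[i]}]_n.

Definition pm d C : MP := \matrix_(i, j) \poly_(k < d.+1) C k i j.
Definition coefm (X : MP) k : M := map_mx (fun p : {poly R[i]} => p`_k) X.
Definition evp (X : MP) l : M := map_mx (horner_eval l) X.

Lemma evpM (X Y : MP) l : evp (X *m Y) l = evp X l *m evp Y l.
Proof. exact: map_mxM. Qed.

Lemma evp_pm d C l : evp (pm d C) l = ev d C l.
Proof.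
apply/matrixP => i j; rewrite !mxE /horner_eval horner_poly summxE.
by apply: eq_bigr => k _; rewrite mxE mulrC.
Qed.

Lemma evp_scalar (p : {poly R[i]}) l : evp p%:M l = p.[l]%:M.
Proof. by rewrite /evp map_scalar_mx. Qed.

(** The circle is infinite. *)
Lemma evp_inj (X Y : MP) : (forall l, circle l -> evp X l = evp Y l) -> X = Y.
Proof.
move=> H; apply/matrixP => i j; apply/eqP; rewrite -subr_eq0; apply/eqP.
apply: poly_circle0 => l cl; have /matrixP/(_ i j) := H l cl.
by rewrite !mxE /horner_eval => E; rewrite hornerD hornerN E subrr.
Qed.

Lemma coefm_pm d C k : (k <= d)%N -> coefm (pm d C) k = C k.
Proof. by move=> kd; apply/matrixP => i j; rewrite !mxE coef_poly ltnS kd. Qed.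

Lemma coefm_pm0 d C k : (d < k)%N -> coefm (pm d C) k = 0.
Proof. by move=> dk; apply/matrixP => i j; rewrite !mxE coef_poly ltnS leqNgt dk. Qed.

Lemma pm_coefm d (X : MP) : (forall m, (d < m)%N -> coefm X m = 0) -> pm d (coefm X) = X.
Proof.
move=> H; apply/matrixP => i j; rewrite !mxE; apply/polyP => k; rewrite coef_poly ltnS.
case: leqP => kd; first by rewrite mxE.
by have /matrixP/(_ i j) := H k kd; rewrite !mxE => ->.
Qed.

Lemma coefmM (X Y : MP) k :
  coefm (X *m Y) k = \sum_(m < k.+1) coefm X m *m coefm Y (k - m).
Proof.
apply/matrixP => i j; rewrite !mxE summxE coef_sum.
under eq_bigr do rewrite coefM.
rewrite exchange_big; apply: eq_bigr => m _; rewrite mxE.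
by apply: eq_bigr => l _; rewrite !mxE.
Qed.

Lemma coefm_Xn d k (Y : MP) : coefm ('X^d%:M *m Y) k = if (k < d)%N then 0 else coefm Y (k - d).
Proof.
apply/matrixP => i j; rewrite mul_scalar_mx !mxE coefXnM.
by case: ifP => _; rewrite mxE.
Qed.

Lemma ev_inj d C D : (forall l, circle l -> ev d C l = ev d D l) ->
  forall k, (k <= d)%N -> C k = D k.
Proof.
move=> H k kd; rewrite -(coefm_pm C kd) -(coefm_pm D kd); congr coefm.
by apply: evp_inj => l cl; rewrite !evp_pm H.
Qed.

(** On the circle, the adjoint of a polynomial loop is again polynomial up to
    a power of the parameter. *)
Definition revm d C k : M := if (k <= d)%N then adjm (C (d - k)%N) else 0.

Lemma ev_rev d C l : circle l -> ev d (revm d C) l = l ^+ d *: adjm (ev d C l).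
Proof.
move=> cl; rewrite /ev adjm_sum scaler_sumr (reindex_inj rev_ord_inj) /=.
apply: eq_bigr => k _; have kd : (k <= d)%N by rewrite -ltnS.
rewrite /revm subSS leq_subr (subKn kd) adjmZ scalerA; congr (_ *: _).
have -> : l ^+ d = l ^+ (d - k) * l ^+ k by rewrite -exprD subnK.
have -> : Num.conj (l ^+ k) = Num.conj l ^+ k by exact: rmorphXn.
by rewrite -mulrA -exprMn (circle_conj cl) expr1n mulr1.
Qed.

Definition normed d C :=
  (forall l, circle l -> ev d C l *m adjm (ev d C l) = 1%:M) /\ ev d C 1 = 1%:M.

Lemma normed_l d C l : normed d C -> circle l -> adjm (ev d C l) *m ev d C l = 1%:M.
Proof. by move=> [H _] /H/mulmx1C. Qed.

Lemma normed_pm d C : normed d C -> pm d (revm d C) *m pm d C = 'X^d%:M.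
Proof.
move=> nC; apply: evp_inj => l cl; rewrite evpM !evp_pm ev_rev // -scalemxAl normed_l //.
by rewrite evp_scalar hornerXn scalemx1.
Qed.

Lemma ev_shift d C l : l != 0 -> C d.+1 = 0 ->
  \sum_(k < d.+1) l ^+ k *: C k.+1 = l^-1 *: (ev d C l - C 0%N).
Proof.
move=> l0 Cd; apply: (scalerI l0); rewrite scalerA divff // scale1r /ev scaler_sumr.
rewrite [X in _ = X - _]big_ord_recl expr0 scale1r addrC addKr big_ord_recr /=.
rewrite Cd !scaler0 addr0.
by apply: eq_bigr => k _; rewrite scalerA -exprS.
Qed.

Lemma normed_pmr d C : normed d C -> pm d C *m pm d (revm d C) = 'X^d%:M.
Proof.
move=> nC; have [n1 _] := nC; apply: evp_inj => l cl.
rewrite evpM 2!evp_pm (ev_rev d C cl) -scalemxAr n1 //.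
by rewrite evp_scalar hornerXn scalemx1.
Qed.

Lemma normed_coef d C : normed d C -> \sum_(k < d.+1) C k *m adjm (C k) = 1%:M.
Proof.
move=> nC; have := congr1 (fun X => coefm X d) (normed_pmr nC).
rewrite coefmM => E.
have -> : 1%:M = coefm 'X^d%:M d.
  apply/matrixP => i j; rewrite !mxE; case: (i == j); rewrite /= ?mulr1n ?mulr0n ?coef0 //.
  by rewrite coefXn eqxx.
rewrite -E; apply: eq_bigr => k _.
have kd : (k <= d)%N by rewrite -ltnS.
by rewrite (coefm_pm _ kd) (coefm_pm _ (leq_subr _ _)) /revm leq_subr subKn.
Qed.

(** Splitting off the projection [pi] moves the norm of the coefficients down
    by one power of the parameter. *)
Definition bshift (pi : M) C k : M := (1%:M - pi) *m C k + pi *m C k.+1.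

Definition weight d C : R := \sum_(k < d.+1) k%:R * nsq (C k).

Lemma nsqE (X : M) : (nsq X)%:C = \tr (X *m adjm X).
Proof.
rewrite /nsq /mxtrace rmorph_sum; apply: eq_bigr => i _; rewrite rmorph_sum mxE.
apply: eq_bigr => j _; rewrite mxE; apply: complex_ext; rewrite ?ReM ?ImM ?ReJ ?ImJ /= /sqc; ring.
Qed.

Section Projection.
Variable pi : M.
Hypotheses (pi2 : pi *m pi = pi) (pia : adjm pi = pi).

Let piC : (1%:M - pi) *m pi = 0. Proof. by rewrite mulmxBl mul1mx pi2 subrr. Qed.
Let piC' : pi *m (1%:M - pi) = 0. Proof. by rewrite mulmxBr mulmx1 pi2 subrr. Qed.
Let adjmC : adjm (1%:M - pi) = 1%:M - pi. Proof. by rewrite adjmD adjmN adjm1 pia. Qed.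

Lemma nsq_projD X Y : nsq ((1%:M - pi) *m X + pi *m Y) = nsq X - nsq (pi *m X) + nsq (pi *m Y).
Proof.
have E (a b : R) : a%:C = b%:C -> a = b by move=> /(congr1 (@complex.Re R)).
apply: E; rewrite rmorphD rmorphB /= !nsqE.
have qq : (1%:M - pi) *m (1%:M - pi) = 1%:M - pi by rewrite mulmxBl mul1mx piC' subr0.
have qtr Z : \tr ((1%:M - pi) *m Z) = \tr Z - \tr (pi *m Z).
  by rewrite mulmxBl mul1mx raddfB.
have cyc (U V W T : M) : \tr (U *m V *m (W *m T)) = \tr (T *m U *m (V *m W)).
  by rewrite mulmxA mxtrace_mulC !mulmxA.
move: (1%:M - pi) adjmC piC piC' qq qtr => q qa qp pq qq qtr.
rewrite adjmD !adjmM qa pia mulmxDl !mulmxDr !mxtraceD.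
rewrite (cyc q X _ q) (cyc q X _ pi) (cyc pi Y _ q) (cyc pi X _ pi).
by rewrite qp pq qq pi2 !mul0mx !mxtrace0 addr0 add0r qtr.
Qed.

Lemma bshift_ev d C l : l != 0 -> pi *m C 0%N = 0 -> C d.+1 = 0 ->
  ev d (bshift pi C) l = ((1%:M - pi) + l^-1 *: pi) *m ev d C l.
Proof.
move=> l0 C0 Cd; transitivity ((1%:M - pi) *m ev d C l + pi *m \sum_(k < d.+1) l ^+ k *: C k.+1).
  rewrite /ev !mulmx_sumr -big_split; apply: eq_bigr => k _.
  by rewrite /bshift scalerDr !scalemxAr.
by rewrite ev_shift // -scalemxAr mulmxBr C0 subr0 [RHS]mulmxDl -[X in _ = _ + X]scalemxAl.
Qed.

Lemma bshift_normed d C : normed d C -> pi *m C 0%N = 0 -> C d.+1 = 0 ->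
  normed d (bshift pi C).
Proof.
move=> [n1 n2] C0 Cd; split=> [l cl|]; last first.
  by rewrite bshift_ev ?oner_neq0 // invr1 scale1r subrK mul1mx n2.
rewrite bshift_ev ?circle_neq0 // adjmM mulmxA -[_ *m ev d C l *m _]mulmxA n1 // mulmx1.
rewrite adjmD adjmC adjmZ pia (circle_inv cl) conjCK.
have qq : (1%:M - pi) *m (1%:M - pi) = 1%:M - pi by rewrite mulmxBl mul1mx piC' subr0.
have q1 : 1%:M - pi + pi = 1%:M by rewrite subrK.
move: (1%:M - pi) piC piC' qq q1 => q qp pq qq q1.
rewrite mulmxDl !mulmxDr -!scalemxAl -!scalemxAr qp pq qq !scaler0 addr0 add0r pi2.
by rewrite scalerA mulrC (circle_conj cl) scale1r.
Qed.

(** The projected parts of the coefficients, whose total square norm is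
    [tr pi = 1], each move down by one degree. *)
Lemma bshift_weight d C : normed d C -> pi *m C 0%N = 0 -> C d.+1 = 0 -> \tr pi = 1 ->
  weight d (bshift pi C) = weight d C - 1.
Proof.
move=> nC C0 Cd tr1.
have S1 : \sum_(k < d.+1) nsq (pi *m C k) = 1.
  have E (a b : R) : a%:C = b%:C -> a = b by move=> /(congr1 (@complex.Re R)).
  have c1 : 1%:C = \tr pi :> R[i] by rewrite tr1.
  apply: E; rewrite rmorph_sum /= c1 -[pi in RHS]mulmx1 -(normed_coef nC) mulmx_sumr raddf_sum.
  apply: eq_bigr => k _; rewrite nsqE adjmM pia mulmxA mxtrace_mulC !mulmxA pi2.
  by rewrite -mulmxA.
have S2 : \sum_(k < d.+1) k%:R * nsq (pi *m C k.+1) = \sum_(k < d.+1) k%:R * nsq (pi *m C k) - 1.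
  rewrite -[X in _ = _ - X]S1 -sumrB [RHS]big_ord_recl [LHS]big_ord_recr /= Cd mulmx0 nsq0 mulr0 addr0.
  rewrite C0 nsq0 mulr0 subr0 add0r; apply: eq_bigr => k _.
  by rewrite /bump /= add1n -[k.+1%:R]natr1 mulrDl mul1r addrK.
rewrite /weight; under eq_bigr do rewrite nsq_projD mulrDr mulrBr.
by rewrite big_split sumrB /= S2 addrA subrK.
Qed.

End Projection.

(** The projection is the one on the line of a nonzero row [g] of [G], namely
    the matrix [g^* g / |g|^2]; what [G] annihilates, [g] annihilates. *)
Lemma row_projection (G : M) : G != 0 -> exists pi : M,
  [/\ pi *m pi = pi, adjm pi = pi, \tr pi = 1 & forall X : M, G *m X = 0 -> pi *m X = 0].
Proof.
move=> G0; have [i [j Gij]] : exists i j, G i j != 0.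
  apply: contrapT => H; move/eqP: G0; apply; apply/matrixP => i j; rewrite mxE.
  by apply/eqP; apply/negPn/negP => Gij; apply: H; exists i, j.
pose c := \sum_k G i k * Num.conj (G i k).
have c0 : c != 0.
  rewrite psumr_eq0; last by move=> k _; rewrite -normCK exprn_ge0.
  apply/negP => /allP/(_ j (mem_index_enum j)); rewrite /= -normCK sqrf_eq0 normr_eq0.
  by rewrite (negbTE Gij).
have cr : Num.conj c = c.
  by rewrite rmorph_sum; apply: eq_bigr => k _; rewrite rmorphM /= conjCK mulrC.
exists (\matrix_(a, b) (c^-1 * (Num.conj (G i a) * G i b))); split.
- apply/matrixP => a b; rewrite !mxE.
  transitivity (c^-1 * c^-1 * (Num.conj (G i a) * G i b) * c).
    by rewrite mulr_sumr; apply: eq_bigr => k _; rewrite !mxE; ring.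
  by rewrite mulrAC -[c^-1 * c^-1 * c]mulrA mulVf // mulr1.
- have crV : Num.conj c^-1 = c^-1.
    by apply: (mulfI c0); rewrite -{1}cr -rmorphM divff // rmorph1.
  have cjE (x y : R[i]) : Num.conj (c^-1 * (Num.conj x * y)) = c^-1 * (Num.conj y * x).
    by rewrite -[in RHS]crV -[x in RHS]conjCK -!rmorphM [y * _]mulrC.
  by apply/matrixP => a b; rewrite !mxE cjE.
- rewrite /mxtrace; under eq_bigr do rewrite mxE [Num.conj _ * _]mulrC.
  by rewrite -mulr_sumr mulVf.
- move=> X GX; apply/matrixP => a b; rewrite !mxE.
  have /matrixP/(_ i b) := GX; rewrite !mxE => E.
  transitivity (c^-1 * Num.conj (G i a) * \sum_k G i k * X k b); last by rewrite E mulr0.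
  by rewrite mulr_sumr; apply: eq_bigr => k _; rewrite !mxE; ring.
Qed.

End PolyLoops.

(** * Uniqueness and normalization on a disc *)

Section DiscSolutions.
Context {R : realType} {n : nat}.
Local Notation P := (R * R)%type.
Local Notation M := 'M[R[i]]_n.
Implicit Types (A B : P -> M) (C D : nat -> P -> M) (O : set P).

Lemma psol_sub d O W A B C : W `<=` O -> psol d O A B C -> psol d W A B C.
Proof.
move=> OO [s1 s2 s3 s4 s5]; split=> //.
- by move=> k; exact: (smooth_mx_on_sub OO (s1 k)).
- by move=> k z /OO; exact: s2.
- by move=> k z /OO; exact: s3.
- by move=> k z dk /OO; exact: s4.
- by move=> z /OO; exact: s5.
Qed.

Lemma psol_local d O A B C :
  (forall z, O z -> exists2 W, W z & psol d W A B C) -> psol d O A B C.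
Proof.
move=> H; split.
- by move=> k; apply: smooth_mx_on_local => z /H[W Oz [s _ _ _ _]]; exists W.
- by move=> k z /H[W Oz [_ s _ _ _]]; exact: s.
- by move=> k z /H[W Oz [_ _ s _ _]]; exact: s.
- by move=> k z dk /H[W Oz [_ _ _ s _]]; exact: s.
- by move=> z /H[W Oz [_ _ _ _ s]]; exact: s.
Qed.

Lemma psol_ext d O A B A' B' C C' : open O -> (forall z, O z -> A z = A' z) ->
  (forall z, O z -> B z = B' z) -> (forall k z, O z -> C k z = C' k z) ->
  psol d O A B C -> psol d O A' B' C'.
Proof.
move=> oO AA BB CC [s1 s2 s3 s4 s5].
have nC k z : O z -> \forall y \near z, C' k y = C k y.
  by move=> Oz; apply: filterS (open_near oO Oz) => y Oy; rewrite CC.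
split.
- by move=> k; exact: (smooth_mx_on_ext oO (CC k) (s1 k)).
- by move=> k z Oz; rewrite (pz_near (nC k z Oz)) s2 // AA // !CC.
- move=> k z Oz; rewrite (pzb_near (nC k z Oz)) s3 // BB // CC //.
  by case: k => [|k] //=; rewrite CC.
- by move=> k z dk Oz; rewrite -CC // s4.
- by move=> z Oz; rewrite -CC // -AA // s5.
Qed.

(** The mean value theorem along the radius. *)
Lemma const_on_disc z0 (r : R) (F : P -> M) : smooth_mx_on (disc z0 r) F ->
  (forall z, disc z0 r z -> pz F z = 0 /\ pzb F z = 0) ->
  forall z, disc z0 r z -> F z = F z0.
Proof.
move=> sF dF z Dz; apply/matrixP => i j; apply: cmp_ext => b.
have oD : open (disc z0 r) by exact: disc_open.
have [s1 s2] := sF i j.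
have inD (s : R) : `|s| <= 1 -> disc z0 r (s *: (z - z0) + z0).
  move=> s1'; rewrite /disc /= sqdist_scale; apply: le_lt_trans Dz.
  have -> : sqdist 0 (z - z0) = sqdist z0 z by rewrite /sqdist /= !subr0.
  rewrite ler_piMl ?sqdist_ge0 //.
  by move: s1'; rewrite ler_norml => /andP[t1 t2]; rewrite expr2; nra.
have [|s] := @mvt_dir R P (fun y => cmp b (F y i j)) z0 (z - z0) 1.
  move=> s; rewrite normr1 => /inD Dy.
  by case: b; [exact: (smooth_on_derivable s2 Dy)|exact: (smooth_on_derivable s1 Dy)].
rewrite normr1 scale1r subrK mul1r => /inD Dy.
have -> : 'D_(z - z0) (fun y => cmp b (F y i j)) (s *: (z - z0) + z0) =
    cmp b (mderive (z - z0) F (s *: (z - z0) + z0) i j) by rewrite mxE; case: (b).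
rewrite (mderive_dir _ (smooth_mx_differentiable oD Dy sF)).
have [-> ->] := dF _ Dy.
by rewrite !scaler0 addr0 mxE cmp0 => /eqP; rewrite subr_eq0 => /eqP.
Qed.

Section Ev.
Variables (d : nat) (O : set P) (A B : P -> M).
Hypotheses (oO : open O) (AB : forall z, O z -> adjm (A z) = - B z).

Lemma smooth_ev C l : (forall k, smooth_mx_on O (C k)) -> smooth_mx_on O (fun z => ev d (C^~ z) l).
Proof.
move=> sC; apply: (smooth_mx_on_sum _ oO) => k _; exact: (smooth_mx_onZ _ oO (sC k)).
Qed.

Lemma ev_derive C l z : l != 0 -> psol d O A B C -> O z ->
  pz (fun z => ev d (C^~ z) l) z = (1 - l^-1) *: (ev d (C^~ z) l *m A z) /\
  pzb (fun z => ev d (C^~ z) l) z = (1 - l) *: (ev d (C^~ z) l *m B z).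
Proof.
move=> l0 sC Oz; have [s1 s2 s3 s4 s5] := sC.
have sZ (k : 'I_d.+1) : smooth_mx_on O (fun z => l ^+ k *: C k z) by exact: (smooth_mx_onZ _ oO (s1 k)).
split.
  rewrite (pz_sum oO Oz _ sZ).
  have -> : \sum_(k < d.+1) pz (fun z => l ^+ k *: C k z) z =
      (ev d (C^~ z) l - \sum_(k < d.+1) l ^+ k *: C k.+1 z) *m A z.
    rewrite -sumrB mulmx_suml; apply: eq_bigr => k _.
    by rewrite (pzZ Oz _ (s1 k)) s2 // -scalerBr scalemxAl.
  have -> : \sum_(k < d.+1) l ^+ k *: C k.+1 z = l^-1 *: (ev d (C^~ z) l - C 0%N z).
    by apply: (ev_shift (C := C^~ z) l0); exact: s4.
  rewrite scalerBr opprB addrA mulmxBl mulmxDl -!scalemxAl s5 // scaler0.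
  by rewrite addr0 scalerBl scale1r.
rewrite (pzb_sum oO Oz _ sZ).
have -> : \sum_(k < d.+1) pzb (fun z => l ^+ k *: C k z) z =
    (ev d (C^~ z) l - \sum_(k < d.+1) l ^+ k *: prv (C^~ z) k) *m B z.
  rewrite -sumrB mulmx_suml; apply: eq_bigr => k _.
  by rewrite (pzbZ Oz _ (s1 k)) s3 // -scalerBr scalemxAl.
have -> : \sum_(k < d.+1) l ^+ k *: prv (C^~ z) k = l *: (ev d (C^~ z) l - l ^+ d *: C d z).
  rewrite /ev big_ord_recl /= scaler0 add0r [X in X - _]big_ord_recr /= addrK scaler_sumr.
  by apply: eq_bigr => k _; rewrite scalerA -exprS.
rewrite scalerBr opprB addrA mulmxBl mulmxDl -!scalemxAl (psol_high oO sC Oz) !scaler0.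
by rewrite addr0 scalerBl scale1r.
Qed.

(** As [A^* = - B] and [lambda^-1] is the conjugate of [lambda], the equations
    of the two factors cancel. *)
Lemma quotient_derive C D l z : circle l -> psol d O A B C -> psol d O A B D -> O z ->
  let Q z := ev d (C^~ z) l *m adjm (ev d (D^~ z) l) in
  pz Q z = 0 /\ pzb Q z = 0.
Proof.
move=> cl sC sD Oz Q.
have l0 := circle_neq0 cl.
have sc := smooth_ev l (psol_smooth sC); have sd := smooth_ev l (psol_smooth sD).
have sa := smooth_mx_on_adj oO sd.
have [c1 c2] := ev_derive l0 sC Oz; have [d1 d2] := ev_derive l0 sD Oz.
have BA : adjm (B z) = - A z by rewrite -[B z]opprK -AB // adjmN adjmK.
have cl1 : Num.conj (1 - l) = 1 - l^-1 by rewrite rmorphB rmorph1 (circle_inv cl).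
have cl2 : Num.conj (1 - l^-1) = 1 - l.
  by rewrite rmorphB rmorph1 /= (circle_inv cl) conjCK.
split.
  rewrite (pzM oO Oz sc sa) (pz_adj Oz sd) c1 d2 adjmZ adjmM BA cl1.
  by rewrite -scalemxAl -scalemxAr mulNmx mulmxN scalerN mulmxA subrr.
rewrite (pzbM oO Oz sc sa) (pzb_adj Oz sd) c2 d1 adjmZ adjmM AB // cl2.
by rewrite -scalemxAl -scalemxAr mulNmx mulmxN scalerN mulmxA subrr.
Qed.

End Ev.

Section OnDisc.
Variables (d : nat) (z0 : P) (r : R) (A B : P -> M).
Hypotheses (rr : 0 < r) (AB : forall z, disc z0 r z -> adjm (A z) = - B z).
Local Notation DD := (disc z0 r).
Let oD : open DD := @disc_open _ _ _.

Lemma quotient_const C D l z : circle l -> psol d DD A B C -> psol d DD A B D -> DD z ->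
  ev d (C^~ z) l *m adjm (ev d (D^~ z) l) = ev d (C^~ z0) l *m adjm (ev d (D^~ z0) l).
Proof.
move=> cl sC sD Dz.
have sc := smooth_ev d oD l (psol_smooth sC); have sd := smooth_ev d oD l (psol_smooth sD).
have sQ := smooth_mx_onM oD sc (smooth_mx_on_adj oD sd).
apply: (const_on_disc sQ) => // y Dy.
exact: (quotient_derive oD AB cl sC sD Dy).
Qed.

Lemma normed_propagate C : psol d DD A B C -> normed d (C^~ z0) ->
  forall z, DD z -> normed d (C^~ z).
Proof.
move=> sC [n1 n2] z Dz; split=> [l cl|].
  by rewrite (quotient_const cl sC sC Dz) n1.
have s1 := smooth_ev d oD 1 (psol_smooth sC).
rewrite -n2; apply: (const_on_disc s1) => // y Dy.
have [-> ->] := ev_derive oD (oner_neq0 _) sC Dy.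
by rewrite invr1 subrr !scale0r.
Qed.

(** The normalization of type one of Segal and Uhlenbeck. *)
Definition type_one C := forall G : M, (forall z, DD z -> G *m C 0%N z = 0) -> G = 0.

(** The quotient of the two loops is a Laurent polynomial [gamma] in lambda with
    constant coefficients.  Since [D = gamma C] has no negative powers and no
    constant matrix annihilates [C 0], [gamma] has no negative powers either.
    The same applies to the inverse of [gamma], which is its adjoint; hence
    [gamma] is constant in lambda, and it is 1 at [lambda = 1]. *)
Lemma type_one_unique C D : psol d DD A B C -> psol d DD A B D ->
  (forall z, DD z -> normed d (C^~ z)) -> (forall z, DD z -> normed d (D^~ z)) ->
  type_one C -> type_one D -> forall k z, DD z -> C k z = D k z.
Proof.
move=> sC sD nC nD tC tD.
have Dz0 : DD z0 by exact: disc_center.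
(* H is lambda^d times the quotient of the two loops, hence constant in z; the
   identity H C = lambda^d D has no terms of degree below d, and reading its
   coefficients upwards, each coefficient of H below d annihilates C 0. *)
have low C1 C2 : psol d DD A B C1 -> psol d DD A B C2 ->
    (forall z, DD z -> normed d (C1^~ z)) -> (forall z, DD z -> normed d (C2^~ z)) ->
    type_one C1 ->
    forall m, (m < d)%N -> coefm (pm d (C2^~ z0) *m pm d (revm d (C1^~ z0))) m = 0.
  move=> s1 s2 n1 n2 t1; set H := _ *m _.
  have HE z : DD z -> H *m pm d (C1^~ z) = 'X^d%:M *m pm d (C2^~ z).
    move=> Dz; have -> : H = pm d (C2^~ z) *m pm d (revm d (C1^~ z)).
      apply: evp_inj => l cl; rewrite 2!evpM 4!evp_pm 2!(@ev_rev R n d _ l cl) -2!scalemxAr.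
      by rewrite (quotient_const cl s2 s1 Dz).
    by rewrite -mulmxA (normed_pm (n1 z Dz)) scalar_mxC.
  elim/ltn_ind => m IH md; apply: t1 => z Dz.
  have : coefm (H *m pm d (C1^~ z)) m = 0 by rewrite HE // coefm_Xn md.
  rewrite coefmM (bigD1 ord_max) //= subnn (coefm_pm _ (leq0n d)) big1 ?addr0 // => k km.
  have km' : (k < m)%N.
    by rewrite ltn_neqAle -ltnS ltn_ord andbT; apply: contra km => /eqP E; apply/eqP/val_inj.
  by rewrite IH ?mul0mx // (ltn_trans km').
set H := pm d (D^~ z0) *m pm d (revm d (C^~ z0)).
have Hlow := low C D sC sD nC nD tC.
have Hbig m : (d + d < m)%N -> coefm H m = 0.
  move=> m2; rewrite coefmM big1 // => k _; have [kd|dk] := leqP k d; last by rewrite (coefm_pm0 _ dk) mul0mx.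
  have dm : (d < m - k)%N by rewrite ltn_subRL (leq_ltn_trans _ m2) // leq_add2r.
  by rewrite [X in _ *m X](coefm_pm0 _ dm) mulmx0.
have evH l : evp H l = ev (d + d) (coefm H) l by rewrite -{1}(pm_coefm Hbig) evp_pm.
set H' := pm d (C^~ z0) *m pm d (revm d (D^~ z0)).
have H'E : H' = pm (d + d) (revm (d + d) (coefm H)).
  apply: evp_inj => l cl; rewrite evp_pm ev_rev // -evH.
  rewrite 2!evpM 4!evp_pm 2!(@ev_rev R n d _ l cl) -2!scalemxAr adjmZ adjmM adjmK scalerA.
  have -> : Num.conj (l ^+ d) = Num.conj l ^+ d by exact: rmorphXn.
  by rewrite exprD -mulrA -exprMn (circle_conj cl) expr1n mulr1.
have H0 m : m != d -> coefm H m = 0.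
  rewrite neq_ltn => /orP[/Hlow//|dm].
  have [m2|/Hbig//] := leqP m (d + d).
  have mm : (d + d - m < d)%N by rewrite ltn_subLR // ltn_add2r.
  have := low D C sD sC nD nC tD _ mm.
  rewrite -/H' H'E coefm_pm ?leq_subr // /revm leq_subr subKn // => E.
  by rewrite -[LHS]adjmK E adjm0.
have Hd l : evp H l = l ^+ d *: coefm H d.
  have dd : (d < (d + d).+1)%N by rewrite ltnS leq_addr.
  rewrite evH /ev (bigD1 (Ordinal dd)) //= big1 ?addr0 // => k kd.
  by rewrite H0 ?scaler0 //; apply: contra kd => /eqP E; apply/eqP/val_inj.
have [_ c1] := nC z0 Dz0; have [_ d1] := nD z0 Dz0.
have K1 : coefm H d = 1%:M.
  have := Hd 1; rewrite expr1n scale1r => <-.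
  rewrite evpM !evp_pm ev_rev; last exact: circle1.
  by rewrite expr1n scale1r c1 d1 adjm1 mulmx1.
move=> k z Dz; have [kd|dk] := leqP k d; last by rewrite (psol_deg sC) // (psol_deg sD).
apply: (@ev_inj R n d (C^~ z) (D^~ z) _ k kd) => l cl.
have l0 : l ^+ d != 0 by rewrite expf_neq0 // circle_neq0.
have E : ev d (D^~ z) l *m adjm (ev d (C^~ z) l) = 1%:M.
  rewrite (quotient_const cl sD sC Dz); apply: (scalerI l0).
  rewrite scalemxAr -ev_rev // -!evp_pm -evpM -/H Hd K1 //.
by rewrite -[LHS]mul1mx -E -mulmxA (normed_l (nC z Dz) cl) mulmx1.
Qed.

(** As long as the lowest coefficient is annihilated, a line can be split off;
    this decreases the weight, so it ends. *)
Lemma type_one_exists C : psol d DD A B C -> (forall z, DD z -> normed d (C^~ z)) ->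
  exists D, [/\ psol d DD A B D, forall z, DD z -> normed d (D^~ z) & type_one D].
Proof.
have Dz0 : DD z0 by exact: disc_center.
have w0 (E : nat -> M) : 0 <= weight d E.
  by apply: sumr_ge0 => k _; rewrite mulr_ge0 // (@nsq_ge0 R n).
have main : forall (N : nat) C, weight d (C^~ z0) < N%:R -> psol d DD A B C ->
    (forall z, DD z -> normed d (C^~ z)) ->
    exists D, [/\ psol d DD A B D, forall z, DD z -> normed d (D^~ z) & type_one D].
  elim=> [|N IH] {}C wN sC nC; first by have := w0 (C^~ z0); rewrite leNgt wN.
  have [t1|nt] := pselect (type_one C); first by exists C.
  have [G [GC Gn]] : exists G : M, (forall z, DD z -> G *m C 0%N z = 0) /\ G != 0.
    apply: contrapT => H; apply: nt; rewrite /type_one => G GC; apply/eqP/negPn/negP => Gn.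
    by apply: H; exists G.
  have [pi [pi2 pia tr1 piX]] := row_projection Gn.
  have C0 z : DD z -> pi *m C 0%N z = 0 by move=> Dz; apply: piX; exact: GC.
  have [s1 s2 s3 s4 s5] := sC.
  have Cd z : DD z -> C d.+1 z = 0 by exact: s4.
  have sL (X : M) k : smooth_mx_on DD (fun z => X *m C k z).
    exact: (smooth_mx_onM oD (smooth_mx_on_cst DD X) (s1 k)).
  have pzL (X : M) k z : DD z -> pz (fun z => X *m C k z) z = X *m ((C k z - C k.+1 z) *m A z).
    by move=> Dz; rewrite (pzM oD Dz (smooth_mx_on_cst DD X) (s1 k)) pz_cst mul0mx add0r s2.
  have pzbL (X : M) k z : DD z -> pzb (fun z => X *m C k z) z = X *m ((C k z - prv (C^~ z) k) *m B z).
    by move=> Dz; rewrite (pzbM oD Dz (smooth_mx_on_cst DD X) (s1 k)) pzb_cst mul0mx add0r s3.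
  have C1 z : DD z -> pi *m C 1%N z *m A z = 0.
    move=> Dz; have n0 : \forall y \near z, pi *m C 0%N y = (fun=> 0) y.
      by apply: filterS (open_near oD Dz) => y; exact: C0.
    have := pzL pi 0%N z Dz; rewrite (pz_near n0) pz_cst mulmxA mulmxBr C0 // sub0r mulNmx.
    by move/eqP; rewrite eq_sym oppr_eq0 => /eqP.
  pose D k z := bshift pi (C^~ z) k.
  have sD : psol d DD A B D.
    split.
    - by move=> k; exact: (smooth_mx_onD oD (sL _ k) (sL _ k.+1)).
    - move=> k z Dz; rewrite (pzD Dz (sL _ k) (sL _ k.+1)) !pzL // /D /bshift.
      by rewrite !mulmxA -mulmxDl !mulmxBr opprD [X in _ = X *m _]addrACA.
    - move=> k z Dz; rewrite (pzbD Dz (sL _ k) (sL _ k.+1)) !pzbL // /D /bshift.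
      rewrite !mulmxA -mulmxDl !mulmxBr /=; congr (_ *m _).
      case: k => [|k] /=; first by rewrite mulmx0 !subr0 C0 // subr0.
      by rewrite opprD addrACA.
    - by move=> k z dk Dz; rewrite /D /bshift !s4 // ?mulmx0 ?addr0 // (ltn_trans dk).
    - move=> z Dz; rewrite /D /bshift mulmxDl C1 // addr0 -mulmxA s5 //.
      by rewrite mulmx0.
  have nD z : DD z -> normed d (D^~ z).
    by move=> Dz; exact: (bshift_normed pi2 pia (nC z Dz) (C0 z Dz) (Cd z Dz)).
  apply: (IH D) => //.
  rewrite [weight _ _](bshift_weight pi2 pia (nC z0 Dz0) (C0 z0 Dz0) (Cd z0 Dz0) tr1).
  by rewrite ltrBlDr -natr1 in wN *.
move=> sC nC; apply: (main (Num.bound (weight d (C^~ z0))) C) => //.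
exact: archi_boundP.
Qed.

End OnDisc.
End DiscSolutions.

(** * Holomorphic changes of variable *)

Section PlanePullback.
Context {R : realType} {n : nat}.
Local Notation P := (R * R)%type.
Local Notation K := (Cplane R).
Local Notation M := 'M[R[i]]_n.
Variables (O : set K) (tau : K -> K) (Op : set P).
Hypotheses (oO : open O) (oOp : open Op) (dtau : forall w, O w -> derivable tau w (1 : K)).
Let OP : set P := [set p | O (cpx p)].
Let Th (p : P) : P := to_plane (tau (cpx p)).
Hypothesis OPO : forall p, OP p -> Op (Th p).

Let oOP : open OP.
Proof. exact: (open_comp (fun p _ => @cpx_continuous R p) oO). Qed.

Definition ctau (p : P) : R[i] := 'D_1 tau (cpx p).

Lemma smooth_pull (F : P -> M) : smooth_mx_on Op F -> smooth_mx_on OP (fun p => F (Th p)).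
Proof.
move=> sF i j; have [s1 s2] := sF i j; have [t1 t2] := holomorphic_smooth oO dtau.
by split; [exact: (smooth_on_comp2 oOP oOp OPO t1 t2 s1)|exact: (smooth_on_comp2 oOP oOp OPO t1 t2 s2)].
Qed.

Lemma mderive_pull (F : P -> M) p v : smooth_mx_on Op F -> OP p ->
  mderive v (fun q => F (Th q)) p =
  (cpx v * ctau p) *: pz F (Th p) + Num.conj (cpx v * ctau p) *: pzb F (Th p).
Proof.
move=> sF Op'; have OT := OPO Op'.
have H : is_derive (cpx p : K) (1 : K) tau (ctau p) := DeriveDef (dtau Op') erefl.
have [d1 d2 dv] := complex_differentiable H.
have h1 : derivable (fun y => (Th y).1) p v by exact: diff_derivable.
have h2 : derivable (fun y => (Th y).2) p v by exact: diff_derivable.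
have E := dv v.
have dif := smooth_mx_differentiable oOp OT sF.
have := mderive_dir (to_plane (cpx v * ctau p)) dif; rewrite to_planeK => <-.
apply/matrixP => i j; rewrite !mxE; have [f1 f2] := dif i j.
have E1 : 'D_v (fun y => (Th y).1) p = Re (cpx v * ctau p) := congr1 (@complex.Re R) E.
have E2 : 'D_v (fun y => (Th y).2) p = Im (cpx v * ctau p) := congr1 (@complex.Im R) E.
apply: complex_ext; rewrite /cderive.
  have [_ c1] := derive_comp2 f1 h1 h2.
  by rewrite E1 E2 in c1; rewrite (differentiable_dir _ f1); exact: c1.
have [_ c1] := derive_comp2 f2 h1 h2.
by rewrite E1 E2 in c1; rewrite (differentiable_dir _ f2); exact: c1.
Qed.

Lemma pz_pull (F : P -> M) p : smooth_mx_on Op F -> OP p ->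
  pz (fun q => F (Th q)) p = ctau p *: pz F (Th p) /\
  pzb (fun q => F (Th q)) p = Num.conj (ctau p) *: pzb F (Th p).
Proof.
move=> sF Op'; rewrite [pz (fun q => _) _]/pz [pzb (fun q => _) _]/pzb.
rewrite !(mderive_pull _ sF Op') [cpx e1](_ : _ = 1) // [cpx e2](_ : _ = ii) // mul1r.
have -> : Num.conj (ii * ctau p) = - (ii * Num.conj (ctau p)).
  by rewrite -mulNr -conj_ii; exact: rmorphM.
move: (pz F (Th p)) (pzb F (Th p)) (ctau p) (Num.conj (ctau p)) => X Y t t'.
by have i2 := @ii2 R; split; apply/matrixP => i j; rewrite !mxE; field: i2.
Qed.

Lemma psol_pull d (A B : P -> M) C : psol d Op A B C ->
  psol d OP (fun p => ctau p *: A (Th p)) (fun p => Num.conj (ctau p) *: B (Th p))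
    (fun k p => C k (Th p)).
Proof.
move=> [s1 s2 s3 s4 s5]; split.
- by move=> k; exact: smooth_pull.
- by move=> k p Op'; rewrite (pz_pull (s1 k) Op').1 s2 ?scalemxAr //; exact: OPO.
- move=> k p Op'; rewrite (pz_pull (s1 k) Op').2 s3 ?scalemxAr; last exact: OPO.
  by case: k.
- by move=> k p dk Op'; rewrite s4 //; exact: OPO.
- by move=> p Op'; rewrite -scalemxAr s5 ?scaler0 //; exact: OPO.
Qed.

(** The derivative of a holomorphic function is holomorphic. *)
Lemma smooth_ctau : csmooth_on OP ctau.
Proof. exact: (holomorphic_smooth oO (fun w Ow => derivable_derive oO dtau Ow)). Qed.

Lemma pzb_ctau (F : P -> M) p : smooth_mx_on OP F -> OP p ->
  pzb (fun q => ctau q *: F q) p = ctau p *: pzb F p /\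
  pz (fun q => Num.conj (ctau q) *: F q) p = Num.conj (ctau p) *: pz F p.
Proof.
move=> sF Op'; have sc := smooth_ctau; have scJ := csmooth_onJ oOP sc.
pose t2 := 'D_1 (fun w => 'D_1 tau w : K) (cpx p).
have H : is_derive (cpx p : K) (1 : K) (fun w => 'D_1 tau w : K) t2 :=
  DeriveDef (derivable_derive oO dtau Op') erefl.
have [_ _ dv] := complex_differentiable H.
have dc v : cderive v ctau p = cpx v * t2 by exact: dv.
have dcJ v : cderive v (fun q => Num.conj (ctau q)) p = Num.conj (cpx v * t2).
  by rewrite (cderiveJ Op' v sc) dc.
have i2 := @ii2 R.
have alg (X Y Z : M) (t u : R[i]) :
    2^-1 *: ((1 * u) *: X + t *: Y + ii *: ((ii * u) *: X + t *: Z)) = t *: (2^-1 *: (Y + ii *: Z)).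
  by apply/matrixP => i j; rewrite !mxE; ring: i2.
have algJ (X Y Z : M) (t u : R[i]) :
    2^-1 *: ((1 * u) *: X + t *: Y - ii *: ((- (ii * u)) *: X + t *: Z)) = t *: (2^-1 *: (Y - ii *: Z)).
  by apply/matrixP => i j; rewrite !mxE; ring: i2.
have c1 : Num.conj (cpx (e1 : P) * t2) = 1 * Num.conj t2 by rewrite [cpx e1](_ : _ = 1) // !mul1r.
have c2 : Num.conj (cpx (e2 : P) * t2) = - (ii * Num.conj t2).
  by rewrite -mulNr -conj_ii; exact: rmorphM.
split.
  rewrite [LHS]/pzb (mderiveZf Op' e1 sc sF) (mderiveZf Op' e2 sc sF) (dc e1) (dc e2).
  exact: alg.
rewrite [LHS]/pz (mderiveZf Op' e1 scJ sF) (mderiveZf Op' e2 scJ sF) (dcJ e1) (dcJ e2) c1 c2.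
exact: algJ.
Qed.

End PlanePullback.

(** * Solutions on a Riemann surface *)

Section ChartFacts.
Context {R : realType} {M : topologicalType}.
Local Notation P := (R * R)%type.
Implicit Types (c : chart R M) (U V : set M).

Definition CU c U : set P := [set p | (chart_coord c @` (chart_dom c `&` U)) (of_plane p)].

Lemma CU_coord c U x : chart_dom c x -> U x -> CU c U (to_plane (chart_coord c x)).
Proof. by move=> cx Ux; exists x => //; rewrite -[RHS]/(cpx _) to_planeK. Qed.

Lemma CU_param c U p : CU c U p -> let x := chart_param c (of_plane p) in
  [/\ chart_dom c x, U x & chart_coord c x = of_plane p].
Proof. by move=> [x [cx Ux] <-] /=; rewrite chart_coordK. Qed.

Lemma param_continuous c U p : CU c U p ->
  {for (of_plane p), continuous (chart_param c : Cplane R -> M)}.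
Proof.
move=> [x [cx _] xp]; have := @chart_param_continuous _ _ c.
rewrite (continuous_open_subspace _ (@chart_codom_open _ _ c)) => H; apply: H.
by rewrite inE; exists x.
Qed.

Lemma coord_continuous c x : chart_dom c x -> {for x, continuous (chart_coord c)}.
Proof.
move=> cx; have := @chart_coord_continuous _ _ c.
by rewrite (continuous_open_subspace _ (@chart_dom_open _ _ c)) => H; apply: H; rewrite inE.
Qed.

Lemma CU_openC c U : open U -> open (chart_coord c @` (chart_dom c `&` U)).
Proof.
move=> oU; rewrite openE => w [x [cx Ux] xw].
have pw : CU c U (to_plane w) by exists x => //; rewrite xw -[RHS]/(cpx _) to_planeK.
have cp := param_continuous pw; rewrite -[of_plane _]/(cpx _) to_planeK in cp.
have n1 : \forall y \near w, U (chart_param c y).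
  apply: (cp U); rewrite -xw chart_coordK //; exact: open_nbhs_nbhs.
have n2 : \forall y \near w, (chart_coord c @` chart_dom c) y.
  by apply: open_nbhs_nbhs; split; [exact: chart_codom_open|exists x].
rewrite /interior; apply: filterS (filterI n1 n2) => y [Uy [z cz zy]].
by exists z => //; split=> //; rewrite -(chart_coordK cz) zy.
Qed.

Lemma CU_open c U : open U -> open (CU c U).
Proof.
by move=> oU; apply: (open_comp (fun p _ => @cpx_continuous R p)); exact: CU_openC.
Qed.

Lemma CU_sub c U V : U `<=` V -> CU c U `<=` CU c V.
Proof. by move=> UV p [x [cx Ux] xp]; exists x => //; split=> //; exact: UV. Qed.

End ChartFacts.

Section SurfaceSolutions.
Context {R : realType} {n : nat}.
Local Notation P := (R * R)%type.
Local Notation K := (Cplane R).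
Local Notation Mx := 'M[R[i]]_n.

Definition loc {S : topologicalType} (c : chart R S) (F : S -> Mx) (p : P) : Mx :=
  F (chart_param c (of_plane p)).
Definition Ac {S : topologicalType} (c : chart R S) (phi : S -> Mx) (p : P) : Mx :=
  Az (phi \o chart_param c) (of_plane p).
Definition Bc {S : topologicalType} (c : chart R S) (phi : S -> Mx) (p : P) : Mx :=
  Azbar (phi \o chart_param c) (of_plane p).

Lemma AcE {S : topologicalType} (c : chart R S) phi p :
  Ac c phi p = 2^-1 *: (invmx (loc c phi p) *m pz (loc c phi) p).
Proof. by rewrite /Ac /Az dzE -[to_plane _]/(to_plane (cpx p)) cpxK. Qed.

Lemma BcE {S : topologicalType} (c : chart R S) phi p :
  Bc c phi p = 2^-1 *: (invmx (loc c phi p) *m pzb (loc c phi) p).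
Proof. by rewrite /Bc /Azbar dzbarE -[to_plane _]/(to_plane (cpx p)) cpxK. Qed.

Definition wsol (S : riemannSurface R) d (U : set S) (phi : S -> Mx) (C : nat -> S -> Mx) :=
  (forall c, atlas c -> psol d (CU c U) (Ac c phi) (Bc c phi) (fun k => loc c (C k))) /\
  forall x, U x -> normed d (C^~ x).

(** All notions are local, so that one chart on each side suffices; in these
    charts the map is [tau]. *)
Section TwoCharts.
Variables (N M : topologicalType) (c : chart R N) (e : chart R M) (f : N -> M).
Variables (V : set N) (U : set M) (phi : M -> Mx).
Hypotheses (oV : open V) (oU : open U) (Vc : V `<=` chart_dom c).
Hypotheses (fV : forall x, V x -> U (f x) /\ chart_dom e (f x)).
Let tau : K -> K := chart_coord e \o f \o chart_param c.
Hypothesis dtau : forall x, V x -> derivable tau (chart_coord c x) (1 : K).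

Let O : set K := chart_coord c @` (chart_dom c `&` V).
Let oO : open O := @CU_openC _ _ c V oV.
Let oOp : open (CU e U) := @CU_open _ _ e U oU.
Let dO w : O w -> derivable tau w (1 : K).
Proof. by move=> [x [_ Vx] <-]; exact: dtau. Qed.

Let OPO p : O (cpx p) -> CU e U (to_plane (tau (cpx p))).
Proof.
move=> Op; have [cx Vx _] := CU_param (Op : CU c V p); have [Ufx efx] := fV Vx.
exact: CU_coord.
Qed.

Let locE (F : M -> Mx) p : CU c V p -> loc e F (to_plane (tau (cpx p))) = loc c (F \o f) p.
Proof.
move=> Op; have [cx Vx _] := CU_param Op; have [Ufx efx] := fV Vx.
by rewrite /loc -[of_plane (to_plane _)]/(cpx _) to_planeK /tau /= chart_coordK.
Qed.

Let oCV : open (CU c V) := @CU_open _ _ c V oV.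

Lemma chart_smooth_pull (F : M -> Mx) : smooth_mx_on (CU e U) (loc e F) ->
  smooth_mx_on (CU c V) (loc c (F \o f)).
Proof.
move=> sF; apply: (smooth_mx_on_ext oCV _ (smooth_pull oO oOp dO OPO sF)) => p Op.
exact: locE.
Qed.

Hypothesis sphi : smooth_mx_on (CU e U) (loc e phi).

Let near_loc (F : M -> Mx) p : CU c V p ->
  \forall q \near p, loc c (F \o f) q = loc e F (to_plane (tau (cpx q))).
Proof. by move=> Op; apply: filterS (open_near oCV Op) => q Oq; rewrite locE. Qed.

Lemma Ac_pull p : CU c V p ->
  Ac c (phi \o f) p = ctau tau p *: Ac e phi (to_plane (tau (cpx p))) /\
  Bc c (phi \o f) p = Num.conj (ctau tau p) *: Bc e phi (to_plane (tau (cpx p))).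
Proof.
move=> Op; have [h1 h2] := pz_pull oOp dO OPO sphi Op.
have alg (I X : Mx) (t : R[i]) : 2^-1 *: (I *m (t *: X)) = t *: (2^-1 *: (I *m X)).
  by rewrite -scalemxAr !scalerA mulrC.
split.
  by rewrite 2!AcE (pz_near (near_loc phi Op)) h1 -(locE phi Op); exact: alg.
by rewrite 2!BcE (pzb_near (near_loc phi Op)) h2 -(locE phi Op); exact: alg.
Qed.

Lemma chart_psol_pull d C : psol d (CU e U) (Ac e phi) (Bc e phi) (fun k => loc e (C k)) ->
  psol d (CU c V) (Ac c (phi \o f)) (Bc c (phi \o f)) (fun k => loc c (C k \o f)).
Proof.
move=> sC; apply: (psol_ext oCV _ _ _ (psol_pull oO oOp dO OPO sC)).
- by move=> p Op; rewrite (Ac_pull Op).1.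
- by move=> p Op; rewrite (Ac_pull Op).2.
- by move=> k p Op; exact: locE.
Qed.

Lemma chart_harmonic_pull : smooth_mx_on (CU e U) (Ac e phi) -> smooth_mx_on (CU e U) (Bc e phi) ->
  (forall p, CU e U p -> pzb (Ac e phi) p + pz (Bc e phi) p = 0) ->
  forall p, CU c V p -> pzb (Ac c (phi \o f)) p + pz (Bc c (phi \o f)) p = 0.
Proof.
move=> sA sB H p Op.
have nA : \forall q \near p, Ac c (phi \o f) q = ctau tau q *: Ac e phi (to_plane (tau (cpx q))).
  by apply: filterS (open_near oCV Op) => q Oq; rewrite (Ac_pull Oq).1.
have nB : \forall q \near p, Bc c (phi \o f) q =
    Num.conj (ctau tau q) *: Bc e phi (to_plane (tau (cpx q))).
  by apply: filterS (open_near oCV Op) => q Oq; rewrite (Ac_pull Oq).2.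
have s1 := smooth_pull oO oOp dO OPO sA; have s2 := smooth_pull oO oOp dO OPO sB.
rewrite (pzb_near nA) (pz_near nB).
rewrite (pzb_ctau oO dO s1 Op).1 (pzb_ctau oO dO s2 Op).2.
rewrite (pz_pull oOp dO OPO sA Op).2 (pz_pull oOp dO OPO sB Op).1.
have alg (X Y : Mx) (t u : R[i]) : X + Y = 0 -> t *: (u *: X) + u *: (t *: Y) = 0.
  by move=> XY; rewrite !scalerA [u * t]mulrC -scalerDr XY scaler0.
by apply: alg; apply: H; exact: OPO.
Qed.

End TwoCharts.
End SurfaceSolutions.

(** * Harmonic maps in a chart *)

Section Harmonic.
Context {R : realType} {n : nat}.
Local Notation P := (R * R)%type.
Local Notation Mx := 'M[R[i]]_n.

Lemma unitarymx_adjm (F : Mx) : F \is unitarymx <-> F *m adjm F = 1%:M.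
Proof. by rewrite adjmE; split=> [/unitarymxP|H]; [|apply/unitarymxP]. Qed.

Lemma unitarymx_invmx (F : Mx) : F *m adjm F = 1%:M -> invmx F = adjm F.
Proof.
move=> H; have uF : F \in unitmx by case/mulmx1_unit: H.
by rewrite -[RHS]mul1mx -(mulVmx uF) -mulmxA H mulmx1.
Qed.

Lemma flat_alg (F A B Z W : Mx) : adjm F *m F = 1%:M ->
  2 *: ((2 *: (F *m A)) *m B + F *m W) = 2 *: ((2 *: (F *m B)) *m A + F *m Z) -> Z + W = 0 ->
  Z = A *m B - B *m A /\ W = B *m A - A *m B.
Proof.
move=> FF /(scalerI two_neq0) E /eqP; rewrite addr_eq0 => /eqP ZW.
have := congr1 (fun X => adjm F *m X) E.
rewrite /= !mulmxDr -!scalemxAl -!scalemxAr !mulmxA FF !mul1mx ZW.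
move: (A *m B) (B *m A) => X Y E2.
have WE : W = Y - X.
  apply: (scalerI two_neq0); apply/eqP; rewrite -subr_eq0; apply/eqP.
  have -> : 2 *: W - 2 *: (Y - X) = (2 *: X + W) - (2 *: Y - W).
    by apply/matrixP => i j; rewrite !mxE; ring.
  by rewrite E2 subrr.
by rewrite WE opprB.
Qed.

Section InChart.
Variables (S : topologicalType) (c : chart R S) (O : set P) (phi : S -> Mx).
Hypotheses (oO : open O) (sphi : smooth_mx_on O (loc c phi)).
Hypothesis uphi : forall p, O p -> loc c phi p *m adjm (loc c phi p) = 1%:M.

Let f := loc c phi.
Let sa := smooth_mx_on_adj oO sphi.

Let AE p : O p -> Ac c phi p = 2^-1 *: (adjm (f p) *m pz f p).
Proof. by move=> Op; rewrite AcE unitarymx_invmx ?uphi. Qed.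

Let BE p : O p -> Bc c phi p = 2^-1 *: (adjm (f p) *m pzb f p).
Proof. by move=> Op; rewrite BcE unitarymx_invmx ?uphi. Qed.

Lemma smooth_Ac : smooth_mx_on O (Ac c phi).
Proof.
apply: (smooth_mx_on_ext oO _ (smooth_mx_onZ 2^-1 oO (smooth_mx_onM oO sa (smooth_pz oO sphi)))).
by move=> p Op; rewrite AE.
Qed.

Lemma smooth_Bc : smooth_mx_on O (Bc c phi).
Proof.
apply: (smooth_mx_on_ext oO _ (smooth_mx_onZ 2^-1 oO (smooth_mx_onM oO sa (smooth_pzb oO sphi)))).
by move=> p Op; rewrite BE.
Qed.

Let phiV p : O p -> adjm (f p) *m f p = 1%:M.
Proof. by move=> /uphi/mulmx1C. Qed.

Lemma adjm_Ac p : O p -> adjm (Ac c phi p) = - Bc c phi p.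
Proof.
move=> Op; rewrite AE // BE // adjmZ conj_half adjmM adjmK -scalerN; congr (_ *: _).
have n1 : \forall q \near p, adjm (f q) *m f q = (fun=> 1%:M) q.
  by apply: filterS (open_near oO Op) => q; exact: phiV.
have := pzb_near n1; rewrite pzb_cst (pzbM oO Op sa sphi) (pzb_adj Op sphi).
by move/eqP; rewrite addr_eq0 => /eqP.
Qed.

Let pzE p : O p -> pz f p = 2 *: (f p *m Ac c phi p) /\ pzb f p = 2 *: (f p *m Bc c phi p).
Proof.
move=> Op; have alg (F X : Mx) : F *m adjm F = 1%:M -> X = 2 *: (F *m (2^-1 *: (adjm F *m X))).
  by move=> FF; rewrite -scalemxAr mulmxA FF mul1mx scalerA divff ?two_neq0 // scale1r.
by rewrite (AE Op) (BE Op); split; apply: alg; exact: uphi.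
Qed.

(** Equality of the mixed derivatives of [phi] computes the difference of the
    two left-hand sides, and harmonicity says that their sum is zero. *)
Lemma harmonic_flat : (forall p, O p -> pzb (Ac c phi) p + pz (Bc c phi) p = 0) ->
  forall p, O p ->
  pzb (Ac c phi) p = Ac c phi p *m Bc c phi p - Bc c phi p *m Ac c phi p /\
  pz (Bc c phi) p = Bc c phi p *m Ac c phi p - Ac c phi p *m Bc c phi p.
Proof.
move=> H p Op; have Hp := H p Op.
have n1 : \forall q \near p, pz f q = 2 *: (f q *m Ac c phi q).
  by apply: filterS (open_near oO Op) => q Oq; rewrite (pzE Oq).1.
have n2 : \forall q \near p, pzb f q = 2 *: (f q *m Bc c phi q).
  by apply: filterS (open_near oO Op) => q Oq; rewrite (pzE Oq).2.
have sA := smooth_Ac; have sB := smooth_Bc.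
have h1 : pz (fun q => 2 *: (f q *m Bc c phi q)) p = 2 *: (pz f p *m Bc c phi p + f p *m pz (Bc c phi) p).
  exact: (etrans (pzZ Op 2 (smooth_mx_onM oO sphi sB))
    (congr1 (fun X => 2 *: X) (pzM oO Op sphi sB))).
have h2 : pzb (fun q => 2 *: (f q *m Ac c phi q)) p = 2 *: (pzb f p *m Ac c phi p + f p *m pzb (Ac c phi) p).
  exact: (etrans (pzbZ Op 2 (smooth_mx_onM oO sphi sA))
    (congr1 (fun X => 2 *: X) (pzbM oO Op sphi sA))).
have E : pz (pzb f) p = pzb (pz f) p := pz_pzb_sym oO Op sphi.
rewrite (pz_near n2) (pzb_near n1) h1 h2 (pzE Op).1 (pzE Op).2 in E.
exact: (flat_alg (phiV Op) E Hp).
Qed.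

End InChart.
End Harmonic.

(** * Transfer of solutions along holomorphic maps *)

Section Transfer.
Context {R : realType} {n : nat}.
Local Notation P := (R * R)%type.
Local Notation K := (Cplane R).
Local Notation Mx := 'M[R[i]]_n.

Lemma harmonic_chart {M : riemannSurface R} (U : set M) (phi : M -> Mx) c :
  open U -> harmonic_on U phi -> atlas c ->
  [/\ smooth_mx_on (CU c U) (loc c phi),
      forall p, CU c U p -> loc c phi p *m adjm (loc c phi p) = 1%:M &
      forall p, CU c U p -> pzb (Ac c phi) p + pz (Bc c phi) p = 0].
Proof.
move=> oU [h1 h2 h3] ac; split; first exact: h2.
  by move=> p /CU_param[_ Ux _]; apply/unitarymx_adjm; exact: h1.
move=> p /CU_param[cx Ux E]; have := h3 c _ ac cx Ux.
by rewrite dzbarE dzE E -[to_plane _]/(to_plane (cpx p)) cpxK.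
Qed.

Definition holo_at {N M : riemannSurface R} (f : N -> M) (x : N) :=
  {for x, continuous f} /\
  forall (c : chart R N) (e : chart R M), atlas c -> atlas e -> chart_dom c x -> chart_dom e (f x) ->
    derivable (chart_coord e \o f \o chart_param c : K -> K) (chart_coord c x) (1 : K).

Section Pull.
Variables (N M : riemannSurface R) (f : N -> M) (V : set N) (U : set M).
Hypotheses (oV : open V) (oU : open U) (fV : forall x, V x -> U (f x)).
Hypothesis hf : forall x, V x -> holo_at f x.

Let small (c : chart R N) (e : chart R M) : set N := [set y | [/\ V y, chart_dom c y & chart_dom e (f y)]].

Let small_open (c : chart R N) (e : chart R M) : open (small c e).
Proof.
rewrite openE => x [Vx cx ex]; rewrite /interior.
have n1 : \forall y \near x, V y by exact: open_nbhs_nbhs.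
have n2 : \forall y \near x, chart_dom c y.
  by apply: open_nbhs_nbhs; split=> //; exact: chart_dom_open.
have n3 : \forall y \near x, chart_dom e (f y).
  apply: ((hf Vx).1 (chart_dom e)); apply: open_nbhs_nbhs; split=> //; exact: chart_dom_open.
by apply: filterS (filterI n1 (filterI n2 n3)) => y [? [? ?]].
Qed.

Let smallP (c : chart R N) p : atlas c -> CU c V p -> exists2 e, atlas e &
  [/\ CU c (small c e) p, (forall x, small c e x -> U (f x) /\ chart_dom e (f x)),
   small c e `<=` chart_dom c &
   (forall x, small c e x -> derivable (chart_coord e \o f \o chart_param c : K -> K) (chart_coord c x) (1 : K))].
Proof.
move=> ac /CU_param[cx Vx E].
have [e ae ex] := atlas_cover (f (chart_param c (of_plane p))).
exists e => //; split.
- by exists (chart_param c (of_plane p)).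
- by move=> x [Vx' _ ?]; split=> //; exact: fV.
- by move=> x [].
- by move=> x [Vx' cx' ex']; exact: (hf Vx').2.
Qed.

Lemma smooth_map_pull (F : M -> Mx) : smooth_map_on U F -> smooth_map_on V (F \o f).
Proof.
move=> sF c ac; apply: smooth_mx_on_local => p Cp.
have [e ae [Cs Us sc ds]] := smallP ac Cp.
exists (CU c (small c e)) => //.
exact: (chart_smooth_pull (small_open c e) oU Us ds (sF e ae)).
Qed.

Lemma wsol_pull d (phi : M -> Mx) C : smooth_map_on U phi -> wsol d U phi C ->
  wsol d V (phi \o f) (fun k => C k \o f).
Proof.
move=> sphi [sC nC]; split; last by move=> x Vx; exact: nC (fV Vx).
move=> c ac; apply: psol_local => p Cp.
have [e ae [Cs Us sc ds]] := smallP ac Cp.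
exists (CU c (small c e)) => //.
exact: (chart_psol_pull (small_open c e) oU Us ds (sphi e ae) (sC e ae)).
Qed.

(** The factor [tau'] is holomorphic, so that both terms of the harmonic map
    equation are multiplied by [|tau'|^2]. *)
Lemma harmonic_pull (phi : M -> Mx) : harmonic_on U phi -> harmonic_on V (phi \o f).
Proof.
move=> hphi; have [u1 s1 _] := hphi; split.
- by move=> x Vx; exact: u1 (fV Vx).
- exact: smooth_map_pull.
move=> c x ac cx Vx.
have Cp : CU c V (to_plane (chart_coord c x)) by exact: CU_coord.
have [e ae [Cs Us sc ds]] := smallP ac Cp.
have [h1 h2 h3] := harmonic_chart oU hphi ae.
have oCU := @CU_open _ _ e U oU.
have := chart_harmonic_pull (small_open c e) oU Us ds h1 (smooth_Ac oCU h1 h2) (smooth_Bc oCU h1 h2) h3 Cs.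
by rewrite -dzbarE -dzE.
Qed.

End Pull.

(** The changes of charts are holomorphic: this is the pullback along the
    identity. *)
Lemma wsol_chart {M : riemannSurface R} d (U : set M) (phi : M -> Mx) C e :
  open U -> U `<=` chart_dom e -> atlas e -> smooth_map_on U phi ->
  psol d (CU e U) (Ac e phi) (Bc e phi) (fun k => loc e (C k)) ->
  (forall x, U x -> normed d (C^~ x)) -> wsol d U phi C.
Proof.
move=> oU Ue ae sphi sC nC; split=> // c ac; apply: psol_local => p Cp.
have [cx Ux E] := CU_param Cp.
pose V := U `&` chart_dom c.
have oV : open V by apply: openI => //; exact: chart_dom_open.
exists (CU c V); first by exists (chart_param c (of_plane p)).
apply: (@chart_psol_pull R n M M c e (fun y => y) V U phi oV oU _ _ (sphi e ae) d C sC).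
- by move=> x [Ux' _]; split=> //; exact: Ue.
- by move=> x [Ux' cx']; exact: (atlas_holomorphic ac ae cx' (Ue _ Ux')).
Qed.

End Transfer.

(** * Finite uniton number and polynomial solutions *)

Section Conversion.
Context {R : realType} {n : nat} {M : riemannSurface R}.
Local Notation P := (R * R)%type.
Local Notation K := (Cplane R).
Local Notation Mx := 'M[R[i]]_n.
Implicit Types (U : set M) (phi : M -> Mx).

(** The differential equations hold for each lambda on the circle; they are
    identities between polynomials in lambda. *)
Lemma psol_of_ev d (O : set P) (A B : P -> Mx) (D : nat -> P -> Mx) : open O ->
  (forall k, smooth_mx_on O (D k)) -> (forall k z, (d < k)%N -> O z -> D k z = 0) ->
  (forall l z, circle l -> O z ->
     pz (fun y => ev d (D^~ y) l) z = (1 - l^-1) *: (ev d (D^~ z) l *m A z) /\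
     pzb (fun y => ev d (D^~ y) l) z = (1 - l) *: (ev d (D^~ z) l *m B z)) ->
  psol d O A B D.
Proof.
move=> oO sD Dd H.
have sZ l (k : 'I_d.+1) : smooth_mx_on O (fun z => l ^+ k *: D k z) by exact: (smooth_mx_onZ _ oO (sD k)).
have Dnear k z : (d < k)%N -> O z -> \forall y \near z, D k y = (fun=> 0) y.
  by move=> dk Oz; apply: filterS (open_near oO Oz) => y; exact: Dd.
have evM (X : Mx) l z : \sum_(k < d.+1) l ^+ k *: (D k z *m X) = ev d (D^~ z) l *m X.
  by rewrite /ev mulmx_suml; apply: eq_bigr => k _; rewrite scalemxAl.
have pzS l z : O z -> pz (fun y => ev d (D^~ y) l) z = \sum_(k < d.+1) l ^+ k *: pz (D k) z.
  move=> Oz; rewrite (pz_sum oO Oz _ (sZ l)); apply: eq_bigr => k _.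
  exact: (pzZ Oz _ (sD k)).
have pzbS l z : O z -> pzb (fun y => ev d (D^~ y) l) z = \sum_(k < d.+1) l ^+ k *: pzb (D k) z.
  move=> Oz; rewrite (pzb_sum oO Oz _ (sZ l)); apply: eq_bigr => k _.
  exact: (pzbZ Oz _ (sD k)).
(* Multiplied by lambda, the identity on the circle is one between polynomials,
   whose coefficients can be compared. *)
have hz z : O z -> forall k, (k <= d.+1)%N ->
    D k z *m A z + (if k is k'.+1 then pz (D k') z - D k' z *m A z else 0) = 0.
  move=> Oz k kd.
  apply: (@ev_inj R n d.+1 (fun k => D k z *m A z +
     (if k is k'.+1 then pz (D k') z - D k' z *m A z else 0)) (fun=> 0) _ k kd) => l cl.
  have l0 := circle_neq0 cl; have [E _] := H l z cl Oz.
  rewrite [RHS]/ev big1 => [|m _]; last by rewrite scaler0.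
  rewrite /ev; under eq_bigr do rewrite scalerDr.
  rewrite big_split /= big_ord_recr /= (Dd d.+1) // mul0mx scaler0 addr0 evM.
  rewrite big_ord_recl /= scaler0 add0r.
  have -> : \sum_(i < d.+1) l ^+ bump 0 i *: (pz (D i) z - D i z *m A z) =
      l *: (pz (fun y => ev d (D^~ y) l) z - ev d (D^~ z) l *m A z).
    rewrite pzS // -evM -sumrB scaler_sumr; apply: eq_bigr => m _.
    by rewrite -scalerBr scalerA -exprS.
  rewrite E scalerBl scale1r addrAC subrr add0r scalerN scalerA divff // scale1r.
  by rewrite subrr.
have hzb z : O z -> forall k, (k <= d.+1)%N ->
    (pzb (D k) z - D k z *m B z) + prv (D^~ z) k *m B z = 0.
  move=> Oz k kd.
  apply: (@ev_inj R n d.+1 (fun k => (pzb (D k) z - D k z *m B z) + prv (D^~ z) k *m B z)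
     (fun=> 0) _ k kd) => l cl.
  have [_ E] := H l z cl Oz.
  rewrite [RHS]/ev big1 => [|m _]; last by rewrite scaler0.
  rewrite /ev; under eq_bigr do rewrite scalerDr.
  rewrite big_split /= big_ord_recr /= (Dd d.+1) // mul0mx (pzb_near (Dnear d.+1 z (ltnSn d) Oz)).
  rewrite pzb_cst subrr scaler0 addr0.
  have -> : \sum_(i < d.+1) l ^+ i *: (pzb (D i) z - D i z *m B z) =
      pzb (fun y => ev d (D^~ y) l) z - ev d (D^~ z) l *m B z.
    by rewrite pzbS // -evM -sumrB; apply: eq_bigr => m _; rewrite scalerBr.
  rewrite big_ord_recl /= mul0mx scaler0 add0r.
  have -> : \sum_(i < d.+1) l ^+ bump 0 i *: (D i z *m B z) = l *: (ev d (D^~ z) l *m B z).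
    by rewrite -evM scaler_sumr; apply: eq_bigr => m _; rewrite scalerA -exprS.
  by rewrite E scalerBl scale1r addrAC subrK subrr.
split=> //.
- move=> k z Oz; have [kd|dk] := leqP k d.
    have /= := hz z Oz k.+1 kd; rewrite addrCA -mulmxBl => /eqP.
    rewrite addr_eq0 => /eqP ->; by rewrite -mulNmx opprB.
  by rewrite (pz_near (Dnear k z dk Oz)) pz_cst (Dd k z dk Oz) (Dd k.+1 z (ltnW dk) Oz) subrr mul0mx.
- move=> k z Oz; have [kd|dk] := leqP k d.+1.
    have := hzb z Oz k kd; rewrite -addrA -mulNmx -mulmxDl => /eqP.
    by rewrite addr_eq0 => /eqP ->; rewrite -mulNmx opprD opprK.
  rewrite (pzb_near (Dnear k z (ltnW dk) Oz)) pzb_cst (Dd k) //; last exact: ltnW.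
  by case: k dk => [//|k dk] /=; rewrite Dd // subrr mul0mx.
- by move=> z Oz; have /= := hz z Oz 0%N (leq0n _); rewrite addr0.
Qed.

Lemma finite_uniton_wsol U phi : open U -> finite_uniton_number_on U phi ->
  exists d C, wsol d U phi C.
Proof.
move=> oU [hphi [Phi [u1 u2 u3 u4] [r [s [C [sC PhiE]]]]]].
pose d := (r + s)%N; pose D k x := if (k <= d)%N then C (k%:Z - r%:Z) x else 0 : Mx.
have evD l x : circle l -> U x -> ev d (D^~ x) l = l ^+ r *: Phi l x.
  move=> cl Ux; rewrite PhiE // scaler_sumr; apply: eq_bigr => k _.
  have kd : (k <= d)%N by rewrite -ltnS.
  rewrite /D kd scalerA -[l ^+ r]/(l ^ r%:Z) -expfzDr ?circle_neq0 //.
  by have -> : r%:Z + (k%:Z - r%:Z) = k%:Z by rewrite addrC subrK.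
exists d, D; split; last first.
  move=> x Ux; split=> [l cl|]; last by rewrite evD ?u3 // ?expr1n ?scale1r //; exact: circle1.
  rewrite evD // adjmZ -scalemxAl -scalemxAr scalerA.
  have -> : Num.conj (l ^+ r) = Num.conj l ^+ r by exact: rmorphXn.
  rewrite -exprMn circle_conj // expr1n scale1r.
  by apply/unitarymx_adjm; exact: u1.
move=> c ac; have oO := @CU_open _ _ c U oU.
apply: psol_of_ev => //.
- move=> k; rewrite /D; case: (leqP k d) => kd; last exact: smooth_mx_on_cst.
  apply: (sC (k%:Z - r%:Z) _ c ac); apply/andP; split.
    by rewrite lerBrDr addNr.
  by rewrite lerBlDr -PoszD lez_nat addnC.
- by move=> k z dk Oz; rewrite /loc /D leqNgt dk.
move=> l z cl Oz; have [cx Ux E] := CU_param Oz.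
have [e1 e2] := u4 c l _ ac cl cx Ux; rewrite E in e1 e2.
have pE : to_plane (of_plane z) = z := cpxK z.
rewrite dzE pE in e1; rewrite dzbarE pE in e2.
have uF : Phi l (chart_param c (of_plane z)) *m adjm (Phi l (chart_param c (of_plane z))) = 1%:M.
  by apply/unitarymx_adjm; exact: u1.
have nQ : \forall y \near z, ev d (fun k => loc c (D k) y) l = l ^+ r *: loc c (Phi l) y.
  by apply: filterS (open_near oO Oz) => y /CU_param[_ Uy _]; exact: evD.
have sloc : smooth_mx_on (CU c U) (loc c (Phi l)).
  have sE : smooth_mx_on (CU c U) (fun y => l ^- r *: ev d (fun k => loc c (D k) y) l).
    apply: (smooth_mx_onZ _ oO); apply: (smooth_mx_on_sum _ oO) => k _.
    apply: (smooth_mx_onZ _ oO); rewrite /D; have kd : (k <= d)%N by rewrite -ltnS.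
    rewrite kd; apply: (sC (k%:Z - r%:Z) _ c ac); apply/andP; split.
      by rewrite lerBrDr addNr.
    by rewrite lerBlDr -PoszD lez_nat addnC.
  apply: (smooth_mx_on_ext oO _ sE) => y /CU_param[_ Uy _].
  rewrite [ev _ _ _](evD l _ cl Uy) scalerA mulVf ?scale1r //.
  by rewrite expf_neq0 // circle_neq0.
have ev1 : ev d (fun k => loc c (D k) z) l = l ^+ r *: Phi l (chart_param c (of_plane z)) by exact: evD.
have Fz : pz (loc c (Phi l)) z = (1 - l^-1) *: (Phi l (chart_param c (of_plane z)) *m Ac c phi z).
  rewrite -[pz _ _]mul1mx -uF -mulmxA scalemxAr; congr (_ *m _).
  by rewrite -(unitarymx_invmx uF); exact: e1.
have Fzb : pzb (loc c (Phi l)) z = (1 - l) *: (Phi l (chart_param c (of_plane z)) *m Bc c phi z).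
  rewrite -[pzb _ _]mul1mx -uF -mulmxA scalemxAr; congr (_ *m _).
  by rewrite -(unitarymx_invmx uF); exact: e2.
have alg (t u : R[i]) (F X : Mx) : t *: (u *: (F *m X)) = u *: (t *: F *m X).
  by rewrite -scalemxAl !scalerA mulrC.
rewrite (pz_near nQ) (pzb_near nQ) (pzZ Oz _ sloc) (pzbZ Oz _ sloc) Fz Fzb ev1.
by split; exact: alg.
Qed.

Fact snd_linear : linear (snd : R * P -> P). Proof. by []. Qed.
Fact fst_linear : linear (fst : R * P -> R). Proof. by []. Qed.
HB.instance Definition _ := GRing.isLinear.Build R (R * P)%type P _ (snd : R * P -> P) snd_linear.
HB.instance Definition _ := GRing.isLinear.Build R (R * P)%type R _ (fst : R * P -> R) fst_linear.

Lemma wsol_finite_uniton d U phi C : open U -> harmonic_on U phi -> wsol d U phi C ->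
  finite_uniton_number_on U phi.
Proof.
move=> oU hphi [sC nC]; split=> //.
exists (fun l x => ev d (C^~ x) l); last first.
  exists 0%N, d, (fun k x => C `|k|%N x); split.
    by move=> k _ c ac; exact: (psol_smooth (sC c ac)).
  move=> l x cl Ux; rewrite /ev add0n; apply: eq_bigr => k _.
  by rewrite subr0.
split.
- by move=> l x cl Ux; apply/unitarymx_adjm; exact: (nC x Ux).1.
- move=> c ac; have oO := @CU_open _ _ c U oU.
  set A2 := [set q : R * P | _].
  have csnd : continuous (snd : R * P -> P) by move=> q; exact: cvg_snd.
  have oA2 : open A2 by exact: (open_comp (fun q _ => csnd q) oO).
  have cs : csmooth_on A2 (fun q : R * P => cos q.1 +i* sin q.1).
    split.
      have := @smooth_on_affine R (R * P)%type R A2 setT (@cos R) (fst : R * P -> R) 0.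
      move=> H; apply: (smooth_on_ext oA2 _ (H _ _ (@smooth_cos R))) => //.
      + by move=> q _; rewrite addr0.
      + by move=> q; exact: cvg_fst.
    have := @smooth_on_affine R (R * P)%type R A2 setT (@sin R) (fst : R * P -> R) 0.
    move=> H; apply: (smooth_on_ext oA2 _ (H _ _ (@smooth_sin R))) => //.
    + by move=> q _; rewrite addr0.
    + by move=> q; exact: cvg_fst.
  have csX k : csmooth_on A2 (fun q : R * P => (cos q.1 +i* sin q.1) ^+ k).
    elim: k => [|k IH]; first exact: csmooth_on_cst.
    by apply: (csmooth_on_ext oA2 _ (csmooth_onM oA2 cs IH)) => q _; rewrite exprS.
  apply: (smooth_mx_on_sum _ oA2) => k _.
  apply: (smooth_mx_onZf oA2 (csX k)) => i j.
  have [s1 s2] := psol_smooth (sC c ac) k i j.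
  have A2O q : A2 q -> CU c U (q.2 + 0) by rewrite addr0.
  split.
    apply: (smooth_on_ext oA2 _ (@smooth_on_affine R (R * P)%type P A2 _ _ (snd : R * P -> P) 0 csnd A2O s1)).
    by move=> q _; rewrite addr0.
  apply: (smooth_on_ext oA2 _ (@smooth_on_affine R (R * P)%type P A2 _ _ (snd : R * P -> P) 0 csnd A2O s2)).
  by move=> q _; rewrite addr0.
- by move=> x Ux; exact: (nC x Ux).2.
- move=> c l x ac cl cx Ux F f w.
  have Oz : CU c U (to_plane w) by exact: CU_coord.
  have oO := @CU_open _ _ c U oU.
  have [E1 E2] := ev_derive oO (circle_neq0 cl) (sC c ac) Oz.
  have wE : of_plane (to_plane w) = w by exact: to_planeK.
  have Fw : F w *m adjm (F w) = 1%:M.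
    by apply: (nC _ _).1 => //; rewrite /w chart_coordK.
  have FV := mulmx1C Fw.
  rewrite unitarymx_invmx // dzE dzbarE.
  have Ew : ev d (fun k => loc c (C k) (to_plane w)) l = F w by rewrite /loc wE.
  rewrite Ew in E1 E2.
  split.
    rewrite [pz _ _]E1 -scalemxAr mulmxA FV mul1mx /Ac wE //.
  by rewrite [pzb _ _]E2 -scalemxAr mulmxA FV mul1mx /Bc wE.
Qed.

End Conversion.

(** * From an open set to the whole surface *)

Lemma near_continuous_comp {T U : topologicalType} (f : T -> U) x (Q : set U) :
  {for x, continuous f} -> nbhs (f x) Q -> \forall y \near x, Q (f y).
Proof. by move=> cf; exact: cf. Qed.

Section DiscGeometry.
Context {R : realType}.
Local Notation P := (R * R)%type.

Lemma near_disc (Q : P -> Prop) z : (\forall p \near z, Q p) ->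
  exists2 r, 0 < r & forall p, disc z r p -> Q p.
Proof.
move=> /nbhs_ballP[e /= e0 H].
exists e => // y; rewrite /disc /= => ye; apply: H; rewrite -ball_normE /= distrC.
have lt (a b : R) : a ^+ 2 + b ^+ 2 < e ^+ 2 -> `|a| < e.
  move=> h; rewrite -(@ltr_pXn2r _ 2) ?nnegrE ?(ltW e0) // real_normK ?num_real //.
  by apply: le_lt_trans h; rewrite lerDl sqr_ge0.
rewrite prod_normE gt_max (lt _ _ ye) /=.
by rewrite /sqdist addrC in ye; exact: lt ye.
Qed.

Lemma open_disc (O : set P) z : open O -> O z -> exists2 r, 0 < r & disc z r `<=` O.
Proof. by move=> oO Oz; exact: (near_disc (open_near oO Oz)). Qed.

Lemma sqdist_sym (x y : P) : sqdist x y = sqdist y x.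
Proof. by rewrite /sqdist; ring. Qed.

Lemma sqdist_triangle (x y z : P) : sqdist x z <= 2 * (sqdist x y + sqdist y z).
Proof.
rewrite /sqdist; have := sqr_ge0 (x.1 - y.1 + (z.1 - y.1)); have := sqr_ge0 (x.2 - y.2 + (z.2 - y.2)).
rewrite !expr2; nra.
Qed.

End DiscGeometry.

Section Globalization.
Context {R : realType} {n : nat} {M : riemannSurface R}.
Local Notation P := (R * R)%type.
Local Notation K := (Cplane R).
Local Notation Mx := 'M[R[i]]_n.
Variable phi : M -> Mx.
Hypothesis hphi : harmonic_on [set: M] phi.
Implicit Types (U : set M) (e : chart R M).

Let coordP e (x : M) : P := to_plane (chart_coord e x).

Let coordP_cont e x : chart_dom e x -> {for x, continuous (coordP e)}.
Proof.
move=> ex; apply: (@continuous_at_comp _ _ _ (chart_coord e) to_plane); first exact: coord_continuous.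
exact: to_plane_continuous.
Qed.

Let paramP_cont e (U : set M) p : CU e U p -> {for p, continuous (fun p => chart_param e (of_plane p))}.
Proof.
move=> Cp; apply: (@continuous_at_comp P K M cpx (chart_param e)); first exact: cpx_continuous.
exact: (param_continuous Cp).
Qed.

Let coordK e x : chart_dom e x -> chart_param e (of_plane (coordP e x)) = x.
Proof. by move=> ex; rewrite -[of_plane _]/(cpx _) to_planeK chart_coordK. Qed.

Let paramK e U p : CU e U p -> coordP e (chart_param e (of_plane p)) = p.
Proof. by move=> /CU_param[_ _ E]; rewrite /coordP E; exact: cpxK. Qed.

Let chart_facts e : atlas e ->
  [/\ smooth_mx_on (CU e setT) (loc e phi), smooth_mx_on (CU e setT) (Ac e phi),
      smooth_mx_on (CU e setT) (Bc e phi),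
      (forall p, CU e setT p -> adjm (Ac e phi p) = - Bc e phi p) &
      forall p, CU e setT p ->
       pzb (Ac e phi) p = Ac e phi p *m Bc e phi p - Bc e phi p *m Ac e phi p /\
       pz (Bc e phi) p = Bc e phi p *m Ac e phi p - Ac e phi p *m Bc e phi p].
Proof.
move=> ae; have oU := @CU_open _ _ e _ openT.
have [h1 h2 h3] := harmonic_chart openT hphi ae; split=> //.
- exact: smooth_Ac oU h1 h2.
- exact: smooth_Bc oU h1 h2.
- exact: adjm_Ac oU h1 h2.
- exact: harmonic_flat oU h1 h2 h3.
Qed.

Lemma wsol_sub d U V C : V `<=` U -> wsol d U phi C -> wsol d V phi C.
Proof.
move=> VU [s1 s2]; split; last by move=> x /VU; exact: s2.
by move=> c /s1; apply: psol_sub; exact: CU_sub.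
Qed.

Let smooth_phi U : smooth_map_on U phi.
Proof.
move=> c ac; have [_ h _] := hphi; apply: (smooth_mx_on_sub _ (h c ac)).
exact: (CU_sub (@subsetT _ U)).
Qed.

Let nbhd e z r : set M := [set x | chart_dom e x /\ disc z r (coordP e x)].

Let nbhd_open e z r : open (nbhd e z r).
Proof.
rewrite openE => x [ex Dx]; rewrite /interior.
have n1 : \forall y \near x, chart_dom e y.
  by apply: open_nbhs_nbhs; split=> //; exact: chart_dom_open.
have n2 : \forall y \near x, disc z r (coordP e y).
  exact: (near_continuous_comp (coordP_cont ex) (open_near (@disc_open _ z r) Dx)).
exact: filterI n1 n2.
Qed.

Let CU_nbhd e z r : disc z r `<=` CU e setT -> CU e (nbhd e z r) = disc z r.
Proof.
move=> sub; apply/seteqP; split=> p.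
  by move=> Cp; have [_ [_ +] _] := CU_param Cp; rewrite (paramK Cp).
move=> Dp; have Cp := sub p Dp; have [ex _ E] := CU_param Cp.
by exists (chart_param e (of_plane p)) => //; split=> //; split=> //; rewrite (paramK Cp).
Qed.

Lemma disc_wsol d e z r C : atlas e -> disc z r `<=` CU e setT ->
  psol d (disc z r) (Ac e phi) (Bc e phi) C -> (forall p, disc z r p -> normed d (C^~ p)) ->
  wsol d (nbhd e z r) phi (fun k x => C k (coordP e x)).
Proof.
move=> ae sub sC nC; apply: (@wsol_chart _ _ _ _ _ _ _ e) => //.
- by move=> x [].
- rewrite (CU_nbhd sub); apply: (psol_ext (@disc_open _ _ _) _ _ _ sC) => // k p Dp.
  by rewrite /loc (paramK (sub p Dp)).
- by move=> x [_ Dx]; exact: nC.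
Qed.

Definition solvable d : set M := [set x | exists U C, [/\ open U, U x & wsol d U phi C]].

Lemma solvable_open d : open (solvable d).
Proof.
rewrite openE => x [U [C [oU Ux sC]]]; rewrite /interior.
have nU : \forall y \near x, U y by exact: open_nbhs_nbhs.
by apply: filterS nU => y Uy; exists U, C.
Qed.

(* A solution near a point y close to x extends to a disc around y that
   contains x. *)
Lemma solvable_closed d : closed (solvable d).
Proof.
move=> x clx; have [e ae ex] := atlas_cover x.
have [_ sA sB AB flat] := chart_facts ae.
have Cx : CU e setT (coordP e x) by exact: CU_coord.
have [q q0 Dq] := open_disc (@CU_open _ _ e _ openT) Cx.
set w := coordP e x in Dq.
have q8 : 0 < q / 8 by rewrite divr_gt0.
have [y [[U [C [oU Uy [sC nC]]]] [ey Dy]]] : solvable d `&` nbhd e w (q / 8) !=set0.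
  apply: clx; apply: open_nbhs_nbhs; split; first exact: nbhd_open.
  by split=> //; exact: disc_center.
set z := coordP e y in Dy; pose r := q / 4.
have r0 : 0 < r by rewrite divr_gt0.
have q20 := exprn_gt0 2 q0.
have D2 : disc z (2 * r) `<=` CU e setT.
  move=> p Dp; apply: Dq; rewrite /disc /=.
  apply: le_lt_trans (sqdist_triangle w z p) _.
  move: Dy Dp; rewrite /disc /= !exprMn !exprVn; move: (sqdist w z) (sqdist z p) => a b.
  by rewrite /r ?exprMn ?exprVn; lra.
have Dr : disc z r `<=` CU e setT.
  by move=> p Dp; apply: D2; apply: (disc_sub _ _ Dp); [exact: ltW|lra].
have Dx : disc z r w.
  rewrite /disc /= sqdist_sym; move: Dy; rewrite /disc /= /r !exprMn !exprVn; lra.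
have Cy : CU e U z by exact: CU_coord.
have [r1 r10 Dr1] := open_disc (@CU_open _ _ e _ oU) Cy.
pose r2 := Num.min r1 r.
have r20 : 0 < r2 by rewrite lt_min r10.
have r2r : r2 <= r by rewrite ge_min lexx orbT.
have sub2 : disc z r2 `<=` CU e U.
  by move=> p Dp; apply: Dr1; apply: (disc_sub _ _ Dp); [exact: ltW|rewrite ge_min lexx].
have sC2 := psol_sub sub2 (sC e ae).
have [D sD DC] := psol_extend r0 (smooth_mx_on_sub D2 sA) (smooth_mx_on_sub D2 sB)
  (fun p Dp => (flat p (Dr p Dp)).1) (fun p Dp => (flat p (Dr p Dp)).2) r20 r2r sC2.
have nD : normed d (D^~ z).
  have -> : D^~ z = C^~ y.
    apply/funext => k; rewrite (DC k z (disc_center z r20)).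
    exact: (congr1 (C k) (coordK ey)).
  exact: nC.
have nDz := normed_propagate (fun p Dp => AB p (Dr p Dp)) sD nD.
exists (nbhd e z r), (fun k x => D k (coordP e x)); split=> //.
exact: disc_wsol.
Qed.

Definition type_one_at (C : nat -> M -> Mx) (y : M) :=
  forall G : Mx, (\forall y' \near y, G *m C 0%N y' = 0) -> G = 0.

(** The normalization is made on a disc.  It persists at the points of the disc
    of half the radius: if [G] annihilates the lowest coefficient near such a
    point, then by [lowest_vanish] also near the centre, and then on the whole
    disc. *)
Lemma solvable_type_one d x : solvable d x -> exists U C,
  [/\ open U, U x, wsol d U phi C & forall y, U y -> type_one_at C y].
Proof.
move=> [U [C [oU Ux [sC nC]]]]; have [e ae ex] := atlas_cover x.
have [_ sA sB AB flat] := chart_facts ae.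
have Cx : CU e U (coordP e x) by exact: CU_coord.
have [r r0 Dr] := open_disc (@CU_open _ _ e _ oU) Cx.
set z := coordP e x in Dr.
have DT : disc z r `<=` CU e setT.
  by move=> p /Dr; apply: CU_sub; exact: subsetT.
have sCz := psol_sub Dr (sC e ae).
have nCz p : disc z r p -> normed d (fun k => loc e (C k) p).
  by move=> /Dr Cp; have [_ Up _] := CU_param Cp; exact: nC.
have [D [sD nD tD]] := type_one_exists r0 sCz nCz.
have sW := disc_wsol ae DT sD nD.
have r2 : 0 < r / 2 by rewrite divr_gt0.
have r2r : r / 2 <= r by lra.
have sub2 := disc_sub (ltW r2) r2r (z0 := z).
exists (nbhd e z (r / 2)), (fun k y => D k (coordP e y)); split=> //.
- by split=> //; exact: disc_center.
- by apply: wsol_sub sW => y [ey /sub2].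
move=> y [ey Dy] G GD; apply: tD.
set z1 := coordP e y in Dy.
have sD1 : disc z1 (r / 2) `<=` disc z r.
  move=> p Dp; rewrite /disc /=; apply: le_lt_trans (sqdist_triangle z z1 p) _.
  move: Dy Dp; rewrite /disc /= !exprMn !exprVn; move: (sqdist z z1) (sqdist z1 p) (r ^+ 2) => a b c.
  by lra.
have Cz1 : CU e setT z1 by exact: CU_coord.
have sBr := smooth_mx_on_sub DT sB.
have nG : \forall p \near z1, disc z1 (r / 2) p /\ G *m D 0%N p = 0.
  have n1 : \forall p \near z1, disc z1 (r / 2) p.
    exact: (open_near (@disc_open _ z1 (r / 2)) (disc_center z1 r2)).
  have n2 : \forall p \near z1, G *m D 0%N (coordP e (chart_param e (of_plane p))) = 0.
    apply: (near_continuous_comp (Q := [set y | G *m D 0%N (coordP e y) = 0]) (paramP_cont Cz1)).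
    have -> : chart_param e (of_plane z1) = y by exact: coordK ey.
    exact: GD.
  apply: filterS (filterI n1 n2) => p [Dp]; rewrite (paramK (DT p (sD1 p Dp))).
  by [].
have [rho rho0 Hrho] : exists2 rho, 0 < rho & forall p, disc z1 rho p -> G *m D 0%N p = 0.
  by have [rho rho0 Hr] := near_disc nG; exists rho => // p /Hr[].
have V1 := lowest_vanish rho0 r2 (smooth_mx_on_sub sD1 sBr) (psol_sub sD1 sD) Hrho.
have z1z : disc z1 (r / 2) z by rewrite /disc /= sqdist_sym.
have [rho' rho'0 Hr'] := open_disc (@disc_open _ z1 (r / 2)) z1z.
by apply: (lowest_vanish rho'0 r0 sBr sD) => p /Hr'; exact: V1.
Qed.

Lemma wsol_unique d U U' C C' y : open U -> open U' -> U y -> U' y ->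
  wsol d U phi C -> wsol d U' phi C' -> type_one_at C y -> type_one_at C' y -> forall k, C k y = C' k y.
Proof.
move=> oU oU' Uy Uy' [sC nC] [sC' nC'] tC tC' k.
have [e ae ey] := atlas_cover y.
have [_ sA sB AB flat] := chart_facts ae.
have Cy : CU e (U `&` U') (coordP e y) by exact: CU_coord.
have [r r0 Dr] := open_disc (@CU_open _ _ e _ (openI oU oU')) Cy.
set z := coordP e y in Dr.
have DT : disc z r `<=` CU e setT by move=> p /Dr; apply: CU_sub; exact: subsetT.
have D1 : disc z r `<=` CU e U by move=> p /Dr; apply: CU_sub => ? [].
have D2 : disc z r `<=` CU e U' by move=> p /Dr; apply: CU_sub => ? [].
have tE (E : nat -> M -> Mx) : type_one_at E y -> type_one z r (fun k => loc e (E k)).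
  move=> tE G GE; apply: tE.
  have := nbhd_open e z r => oN.
  have nN : \forall y' \near y, nbhd e z r y'.
    by apply: open_nbhs_nbhs; split=> //; split=> //; exact: disc_center.
  apply: filterS nN => y' [ey' Dy']; rewrite -[RHS](GE _ Dy').
  exact: (congr1 (fun x => G *m E 0%N x) (esym (coordK ey'))).
have nE (E : nat -> M -> Mx) W : disc z r `<=` CU e W -> (forall x, W x -> normed d (E^~ x)) ->
    forall p, disc z r p -> normed d (fun k => loc e (E k) p).
  by move=> DW nE p /DW Cp; have [_ Wp _] := CU_param Cp; exact: nE.
have := type_one_unique r0 (fun p Dp => AB p (DT p Dp)) (psol_sub D1 (sC e ae))
  (psol_sub D2 (sC' e ae)) (nE _ _ D1 nC) (nE _ _ D2 nC') (tE _ tC) (tE _ tC') k (disc_center z r0).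
by move=> H; apply: etrans (etrans H _); [exact: (congr1 (C k) (esym (coordK ey)))|exact: (congr1 (C' k) (coordK ey))].
Qed.

(** The set of points near which a solution of degree [d] exists is open, closed
    and nonempty.  The normalized local solutions agree where they meet, so
    taking at each point the value of one of them gives a global solution. *)
Lemma wsol_global d : solvable d !=set0 -> exists C, wsol d setT phi C.
Proof.
move=> ne.
have all x : solvable d x.
  have E : solvable d = [set: M].
    apply: surface_connected => //.
      by exists (solvable d); [exact: solvable_open|rewrite setTI].
    by exists (solvable d); [exact: solvable_closed|rewrite setTI].
  by rewrite E.
have ch x : exists UC : set M * (nat -> M -> Mx),
    [/\ open UC.1, UC.1 x, wsol d UC.1 phi UC.2 & forall y, UC.1 y -> type_one_at UC.2 y].
  by have [U [C H]] := solvable_type_one (all x); exists (U, C).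
have [F HF] := choice ch.
pose C k y := (F y).2 k y.
exists C; split; last first.
  by move=> x _; have [_ Ux [_ nC] _] := HF x; exact: nC.
move=> c ac; apply: psol_local => p Cp.
have [cx _ E] := CU_param Cp; set x := chart_param c (of_plane p) in cx E.
have [oU Ux sC tC] := HF x.
exists (CU c (F x).1); first by exists x.
have [psC _] := sC.
apply: (psol_ext (@CU_open _ _ c _ oU) _ _ _ (psC c ac)) => // k q Cq.
have [cy Uy _] := CU_param Cq; rewrite /loc /C; set y := chart_param c (of_plane q) in cy Uy *.
have [oU' Uy' sC' tC'] := HF y.
exact: (wsol_unique oU oU' Uy Uy' sC sC' (tC y Uy) (tC' y Uy')).
Qed.

Lemma finite_uniton_global U : open U -> U !=set0 -> finite_uniton_number_on U phi ->
  finite_uniton_number_on [set: M] phi.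
Proof.
move=> oU [x Ux] /(finite_uniton_wsol oU)[d [C sC]].
have [|D sD] := @wsol_global d; first by exists x, U, C.
exact: (wsol_finite_uniton openT hphi sD).
Qed.

End Globalization.

(** * Coverings *)

Section Coverings.
Context {R : realType}.
Local Notation P := (R * R)%type.
Local Notation K := (Cplane R).

(** With [y = sig x - sig v] and [u = x - v], differentiability of [tau] gives
    [u = l y + o(y)], hence [y = O(u)] and then [y = u / l + o(u)]. *)
Lemma inverse_derive (sig tau : K -> K) (v : K) (l : R[i]) : {for v, continuous sig} ->
  (\forall x \near v, tau (sig x) = x) -> is_derive (sig v) (1 : K) tau l -> l != 0 ->
  derivable sig v (1 : K).
Proof.
move=> cs inv /is_deriveCP H l0.
have nl : 0 < normc l by rewrite lt_def normc_ge0 andbT; apply: contra l0 => /eqP/eq0_normc ->.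
suff [] : is_derive v (1 : K) sig l^-1 by [].
apply/is_deriveCP => e e0.
pose h := Num.min (normc l / 2) (e * normc l ^+ 2 / 2).
have h0 : 0 < h by rewrite lt_min !divr_gt0 // mulr_gt0 // exprn_gt0.
have [d d0 Hd] := H h h0.
have n1 : \forall x \near v, normc (sig x - sig v) < d.
  by apply: (near_continuous_comp (Q := [set y | normc (y - sig v) < d]) cs); apply/nearC; exists d.
have iv : tau (sig v) = v := nbhs_singleton inv.
have [d' d'0 Hd'] : exists2 d', 0 < d' & forall x, normc (x - v) < d' ->
    tau (sig x) = x /\ normc (sig x - sig v) < d.
  by apply/nearC; exact: filterI inv n1.
exists d' => // x /Hd'[ix xd]; have := Hd _ xd; rewrite ix iv.
set y := sig x - sig v; set u := x - v => yu.
have h1 : h <= normc l / 2 by rewrite ge_min lexx.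
have h2 : h <= e * normc l ^+ 2 / 2 by rewrite ge_min lexx orbT.
have ny := normc_ge0 y; have nu := normc_ge0 u.
have yle : normc y * normc l <= 2 * normc u.
  have : normc (y * l) <= normc u + normc (u - y * l).
    have Eyl : y * l = u + - (u - y * l) by rewrite opprB addrC subrK.
    by rewrite {1}Eyl; apply: le_trans (le_normcD _ _) _; rewrite normcN.
  rewrite normcM => h3; have h4 : h * normc y <= normc l / 2 * normc y by rewrite ler_wpM2r.
  have h5 : normc l / 2 * normc y = normc y * normc l / 2 by ring.
  by lra.
have E : (y - u * l^-1) * l = - (u - y * l).
  by rewrite mulrBl mulfVK // [RHS]opprB.
rewrite -(ler_pM2r nl) -normcM E normcN; apply: le_trans yu _.
have F := ler_pM (ltW h0) (mulr_ge0 ny (ltW nl)) h2 yle.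
rewrite -(ler_pM2r nl) -[h * _ * _]mulrA; apply: le_trans F _.
by rewrite le_eqVlt; apply/orP; left; apply/eqP; rewrite expr2; field.
Qed.

(** If the derivative vanished everywhere, [tau] would take the same value at
    both ends of a horizontal segment. *)
Lemma derive_neq0 (O : set K) (tau : K -> K) w : open O -> O w ->
  (forall x, O x -> derivable tau x (1 : K)) ->
  (forall x y, O x -> O y -> tau x = tau y -> x = y) -> exists2 x, O x & 'D_1 tau x != 0.
Proof.
move=> oO Ow dtau inj; apply: contrapT => N.
have z x : O x -> 'D_1 tau x = 0.
  by move=> Ox; apply/eqP/negPn/negP => nz; apply: N; exists x.
pose p := to_plane w.
have oOP : open [set q : P | O (cpx q)] by exact: (open_comp (fun q _ => @cpx_continuous R q) oO).
have Op : O (cpx p) by rewrite to_planeK.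
have [r r0 Dr] := open_disc oOP Op.
pose t := r / 2; have t0 : 0 < t by rewrite divr_gt0.
have inD (s : R) : `|s| <= `|t| -> O (cpx (s *: e1 + p)).
  move=> st; apply: Dr; rewrite /disc /= sqdist_scale /sqdist /e1 /= !subr0 expr0n /= addr0 expr1n mulr1.
  have : s ^+ 2 <= t ^+ 2 by rewrite -(@real_normK _ s) ?num_real // -(@real_normK _ t) ?num_real // ler_sqr ?nnegrE.
  by move=> h; apply: le_lt_trans h _; rewrite /t exprMn exprVn; have := exprn_gt0 2 r0; lra.
have dif q : O (cpx q) -> [/\ differentiable (fun q => Re (tau (cpx q))) q,
    differentiable (fun q => Im (tau (cpx q))) q &
    'D_e1 (fun q => Re (tau (cpx q))) q = 0 /\ 'D_e1 (fun q => Im (tau (cpx q))) q = 0].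
  move=> Oq; have H : is_derive (cpx q : K) (1 : K) tau ('D_1 tau (cpx q)) := DeriveDef (dtau _ Oq) erefl.
  have [h1 h2 h3] := complex_differentiable H; split=> //.
  have := h3 e1; rewrite z // mulr0 => E.
  by split; [exact: (congr1 (@complex.Re R) E)|exact: (congr1 (@complex.Im R) E)].
have [|s1 /inD Os1] := @mvt_dir R P (fun q => Re (tau (cpx q))) p e1 t.
  by move=> s /inD/dif[h1 _ _]; exact: diff_derivable.
have [_ _ [-> _]] := dif _ Os1; rewrite mulr0 => /eqP; rewrite subr_eq0 => /eqP E1.
have [|s2 /inD Os2] := @mvt_dir R P (fun q => Im (tau (cpx q))) p e1 t.
  by move=> s /inD/dif[_ h1 _]; exact: diff_derivable.
have [_ _ [_ ->]] := dif _ Os2; rewrite mulr0 => /eqP; rewrite subr_eq0 => /eqP E2.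
have tt : `|t| <= `|t| by [].
have := inj _ _ (inD t tt) Op (complex_ext E1 E2) => /(congr1 (@complex.Re R)) /=.
rewrite /GRing.scale /= mulr1 => /eqP; rewrite -subr_eq0 addrK => /eqP t00.
by rewrite t00 ltxx in t0.
Qed.

Variables (n : nat) (M Mt : riemannSurface R).
Local Notation Mx := 'M[R[i]]_n.
Variables (phi : M -> Mx) (Pi : Mt -> M).
Hypothesis hphi : harmonic_on [set: M] phi.
Hypotheses (Pi_covering : covering_map Pi) (Pi_holomorphic : holomorphic_map Pi).

Let Pi_holo x : holo_at Pi x.
Proof.
have [cPi hPi] := Pi_holomorphic; split; first exact: cPi.
by move=> c e ac ae cx ex; exact: hPi.
Qed.

Lemma finite_uniton_pull : finite_uniton_number_on [set: M] phi ->
  finite_uniton_number_on [set: Mt] (phi \o Pi).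
Proof.
move=> /(finite_uniton_wsol openT)[d [C sC]].
have [_ sphi _] := hphi.
have fV (x : Mt) : [set: Mt] x -> [set: M] (Pi x) by [].
have hf (x : Mt) : [set: Mt] x -> holo_at Pi x by move=> _; exact: Pi_holo.
apply: (wsol_finite_uniton openT (harmonic_pull openT openT fV hf hphi)).
exact: (wsol_pull openT openT fV hf sphi sC).
Qed.

(** A solution upstairs is pulled back by a local section of the covering,
    near a point where the covering is biholomorphic. *)
Lemma finite_uniton_push : finite_uniton_number_on [set: Mt] (phi \o Pi) ->
  exists U : set M, [/\ open U, U !=set0 & finite_uniton_number_on U phi].
Proof.
move=> fPi; have [hPi _] := fPi; have [d [C [sC nC]]] := finite_uniton_wsol openT fPi.
have [cPi sPi evPi] := Pi_covering.
have [b _] := surface_nonempty M.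
have [V [oV Vb [sheets [oS _ PV secS]]]] := evPi b.
have [x0 Pix0] := sPi b.
have [S Ss Sx0] : exists2 S, sheets S & S x0.
  have : (Pi @^-1` V) x0 by rewrite /= Pix0.
  by rewrite PV => -[S ? ?]; exists S.
have [s [cs sV sK]] := secS S Ss.
have [c ac cx0] := atlas_cover x0; have [e ae eb] := atlas_cover b.
pose tau : K -> K := chart_coord e \o Pi \o chart_param c.
pose W : set Mt := [set y | [/\ S y, chart_dom c y, V (Pi y) & chart_dom e (Pi y)]].
have oW : open W.
  rewrite openE => y [Sy cy Vy ey]; rewrite /interior.
  have n1 : \forall y' \near y, S y' by apply: open_nbhs_nbhs; split=> //; exact: oS.
  have n2 : \forall y' \near y, chart_dom c y'.
    by apply: open_nbhs_nbhs; split=> //; exact: chart_dom_open.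
  have n3 : \forall y' \near y, V (Pi y').
    by apply: (near_continuous_comp (cPi y)); exact: open_nbhs_nbhs.
  have n4 : \forall y' \near y, chart_dom e (Pi y').
    by apply: (near_continuous_comp (cPi y)); apply: open_nbhs_nbhs; split=> //; exact: chart_dom_open.
  by apply: filterS (filterI (filterI n1 n2) (filterI n3 n4)) => y' [[? ?] [? ?]].
have Wx0 : W x0 by rewrite /W /= Pix0.
pose O : set K := chart_coord c @` (chart_dom c `&` W).
have oO : open O := @CU_openC _ _ c W oW.
have dtau w : O w -> derivable tau w (1 : K).
  by move=> [y [cy [_ _ _ ey]] <-]; exact: (Pi_holomorphic.2 c e ac ae y cy ey).
have tauE y : chart_dom c y -> tau (chart_coord c y) = chart_coord e (Pi y).
  by move=> cy; rewrite /tau /= chart_coordK.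
have inj w w' : O w -> O w' -> tau w = tau w' -> w = w'.
  move=> [y [cy [Sy _ Vy ey]] <-] [y' [cy' [Sy' _ Vy' ey']] <-].
  rewrite !tauE // => E; congr (chart_coord c _).
  rewrite -(sK y Sy) -(sK y' Sy'); congr s.
  by rewrite -(chart_coordK ey) -(chart_coordK ey') E.
have Ox0 : O (chart_coord c x0) by exists x0.
have [w1 Ow1 dw1] := derive_neq0 oO Ox0 dtau inj.
have [y1 [cy1 Wy1] yw1] := Ow1.
have scont y : V y -> {for y, continuous s}.
  by move=> Vy; move: cs; rewrite (continuous_open_subspace _ oV) => H; apply: H; rewrite inE.
(* the part of V over which the derivative of the projection does not vanish *)
pose U : set M := [set y | [/\ V y, W (s y) & 'D_1 tau (chart_coord c (s y)) != 0]].
have oU : open U.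
  rewrite openE => y [Vy Wy dy]; rewrite /interior.
  have n1 : \forall y' \near y, V y' by exact: open_nbhs_nbhs.
  have n2 : \forall y' \near y, W (s y').
    by apply: (near_continuous_comp (scont y Vy)); exact: open_nbhs_nbhs.
  have csy : {for y, continuous (fun y' => chart_coord c (s y'))}.
    apply: (@continuous_at_comp _ _ _ s (chart_coord c)); first exact: scont.
    by apply: coord_continuous; case: Wy.
  have Oy : O (chart_coord c (s y)) by exists (s y) => //; split=> //; case: Wy.
  have cD : {for chart_coord c (s y), continuous (fun w => 'D_1 tau w : K)}.
    by apply/differentiable_continuous/derivable1_diffP; exact: (derivable_derive oO dtau Oy).
  have cc := continuous_at_comp csy cD.
  have n3 : \forall y' \near y, 'D_1 tau (chart_coord c (s y')) != 0.
    apply: (near_continuous_comp (Q := [set w : K | w != 0]) cc).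
    apply/nearC; exists (normc ('D_1 tau (chart_coord c (s y)))).
      by rewrite lt_def normc_ge0 andbT; apply: contra dy => /eqP/eq0_normc ->.
    move=> w; apply: contraTneq => ->; rewrite sub0r normcN -leNgt.
    by rewrite /= lexx.
  by apply: filterS (filterI n1 (filterI n2 n3)) => y' [? [? ?]].
have Uy1 : U (Pi y1).
  have [Sy1 _ Vy1 _] := Wy1; have sy : s (Pi y1) = y1 := sK y1 Sy1.
  by split; [exact: Vy1|rewrite sy; exact: Wy1|rewrite sy yw1; exact: dw1].
exists U; split=> //; first by exists (Pi y1).
have sPhi : smooth_mx_on (CU c setT) (loc c (phi \o Pi)) by have [_ h _] := hPi; exact: h.
have Ue : U `<=` chart_dom e.
  by move=> y [Vy [_ _ _ +] _]; rewrite (sV y Vy).2.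
have fU y : U y -> [set: Mt] (s y) /\ chart_dom c (s y) by move=> [_ [_ ? _ _] _].
have dsig y : U y -> derivable (chart_coord c \o s \o chart_param e : K -> K) (chart_coord e y) (1 : K).
  move=> Uy; have ey := Ue y Uy; have [Vy Wy dy] := Uy; have [Ss' cs' _ _] := Wy.
  have Cy : CU e U (to_plane (chart_coord e y)) by exact: CU_coord.
  have cp : {for chart_coord e y, continuous (chart_param e : K -> M)}.
    by have := param_continuous Cy; rewrite [of_plane _](to_planeK (chart_coord e y)).
  have sE : (chart_coord c \o s \o chart_param e) (chart_coord e y) = chart_coord c (s y).
    by rewrite /= chart_coordK.
  have Oy : O (chart_coord c (s y)) by exists (s y).
  have h3 : is_derive ((chart_coord c \o s \o chart_param e) (chart_coord e y)) (1 : K) tau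
      ('D_1 tau (chart_coord c (s y))).
    by rewrite sE; exact: (DeriveDef (dtau _ Oy) erefl).
  have h1 : {for chart_coord e y, continuous (chart_coord c \o s \o chart_param e)}.
    apply: (@continuous_at_comp K Mt K (s \o chart_param e) (chart_coord c)).
      by apply: (@continuous_at_comp K M Mt (chart_param e) s) => //; rewrite chart_coordK //; exact: scont.
    by rewrite /= chart_coordK //; exact: coord_continuous.
  have h2 : \forall v \near chart_coord e y, tau ((chart_coord c \o s \o chart_param e) v) = v.
    have n1 : \forall v \near chart_coord e y, U (chart_param e v).
      by apply: (near_continuous_comp cp); rewrite chart_coordK //; exact: open_nbhs_nbhs.
    have n2 : \forall v \near chart_coord e y, (chart_coord e @` chart_dom e) v.
      by apply: open_nbhs_nbhs; split; [exact: chart_codom_open|exists y].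
    apply: filterS (filterI n1 n2) => v [Uv [y' ey' yv]] /=.
    have [Vv [_ cv _ _] _] := Uv.
    by rewrite tauE // (sV _ Vv).2 -yv chart_coordK.
  exact: (inverse_derive h1 h2 h3 dy).
have psU := chart_psol_pull oU openT fU dsig sPhi (sC c ac).
have phiE y : U y -> phi (Pi (s y)) = phi y by move=> [Vy _ _]; rewrite (sV y Vy).2.
have oCU := @CU_open _ _ e U oU.
have locE p : CU e U p -> loc e ((phi \o Pi) \o s) p = loc e phi p.
  by move=> Cp; have [_ Up _] := CU_param Cp; exact: phiE.
have near_loc p : CU e U p -> \forall q \near p, loc e ((phi \o Pi) \o s) q = loc e phi q.
  by move=> Cp; apply: filterS (open_near oCU Cp) => q; exact: locE.
have hU : harmonic_on U phi.
  have [h1 h2 h3] := hphi; split.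
  - by move=> y _; exact: h1.
  - by move=> c' ac'; apply: (smooth_mx_on_sub _ (h2 c' ac')); exact: (CU_sub (@subsetT _ U)).
  - by move=> c' y ac' cy _; exact: h3.
have [_ sphi _] := hU.
have EA p : CU e U p -> Ac e ((phi \o Pi) \o s) p = Ac e phi p.
  by move=> Cp; rewrite 2!AcE (locE p Cp) (pz_near (near_loc p Cp)).
have EB p : CU e U p -> Bc e ((phi \o Pi) \o s) p = Bc e phi p.
  by move=> Cp; rewrite 2!BcE (locE p Cp) (pzb_near (near_loc p Cp)).
have psE := psol_ext oCU EA EB (fun k p _ => erefl) psU.
have nU y : U y -> normed d (fun k => C k (s y)) by move=> _; exact: nC.
exact: (wsol_finite_uniton oU hU (wsol_chart oU Ue ae sphi psE nU)).
Qed.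

End Coverings.

Theorem corollary4p2 (R : realType) (n : nat) (M Mt : riemannSurface R)
    (phi : M -> 'M[R[i]]_n) (Pi : Mt -> M)
    (phi_harmonic : harmonic_on [set: M] phi)
    (Mt_simply_connected : simply_connected R Mt)
    (Pi_covering : covering_map Pi)
    (Pi_holomorphic : holomorphic_map Pi) :
  (finite_uniton_number_on [set: M] phi <->
     exists U : set M, [/\ open U, U !=set0 & finite_uniton_number_on U phi])
  /\
  (finite_uniton_number_on [set: M] phi <->
     finite_uniton_number_on [set: Mt] (phi \o Pi)).
Proof.
have globalize : (exists U : set M, [/\ open U, U !=set0 & finite_uniton_number_on U phi]) ->
    finite_uniton_number_on [set: M] phi.
  by move=> [U [oU ne fU]]; exact: (finite_uniton_global phi_harmonic oU ne fU).
split; split=> [f|f]; last 2 first.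
- exact: finite_uniton_pull.
- by apply: globalize; exact: (finite_uniton_push phi_harmonic Pi_covering Pi_holomorphic f).
- exists [set: M]; split=> //; first exact: openT.
  exact: surface_nonempty.
- exact: globalize.
Qed.
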